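(* Let $M^{2n}$ be a complete Kähler manifold of real dimension $2n$ satisfying, for some $\nu>2$ and some constant $C_S>0$, the Sobolev type inequality $$\left(\int_M |\phi|^{\frac{2\nu}{\nu-2}}\right)^{\frac{\nu-2}{\nu}}\leq C_S\int_M|\nabla\phi|^2$$ for every compactly supported smooth function $\phi$ on $M$. Suppose that $\|\lambda^-\|_{\nu/2}<\frac{2}{C_S}$, where $$\|\lambda^-\|_{\nu/2}:=\left(\int_M|\lambda^-|^{\frac{\nu}{2}}\right)^{\frac{2}{\nu}}.$$ Then every (real-valued) harmonic function $u$ on $M$ with $\int_M|\nabla u|^2<\infty$ is a constant function.
   Context: Manifolds are connected. For $x\in M$, $\lambda(x)$ denotes the smallest eigenvalue of the Ricci curvature tensor of $M$ at $x$ (with respect to the metric), and $\lambda^-(x)=\min\{0,\lambda(x)\}$. Integrals are with respect to the Riemannian volume. *)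

(* Defs.v *)
From mathcomp Require Import all_boot all_order all_algebra.
From mathcomp Require Import all_classical all_reals all_analysis.

Set Implicit Arguments.
Unset Strict Implicit.
Unset Printing Implicit Defensive.

Import Order.TTheory GRing.Theory Num.Theory numFieldNormedType.Exports.
Local Open Scope classical_set_scope.
Local Open Scope ring_scope.

Section Coordinates.
Variables (R : realType) (m : nat).
Implicit Types (f : 'rV[R]_m -> R) (g : 'rV[R]_m -> 'M[R]_m).

Definition partial (a : 'I_m) f : 'rV[R]_m -> R :=
  fun y => 'D_(delta_mx 0 a) f y.

(* Only meaningful for U open. *)
Fixpoint Ck (k : nat) (U : set 'rV[R]_m) f : Prop :=
  (forall y, U y -> {for y, continuous f}) /\
  if k is k'.+1 then
    forall a, (forall y, U y -> derivable f y (delta_mx 0 a)) /\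
              Ck k' U (partial a f)
  else True.

Definition smooth (U : set 'rV[R]_m) f : Prop := forall k, Ck k U f.

Definition quad (h : 'M[R]_m) (v : 'rV[R]_m) : R := (v *m h *m v^T) 0 0.

(* Gamma^c_ab *)
Definition christoffel g (c a b : 'I_m) (y : 'rV[R]_m) : R :=
  2^-1 * \sum_d invmx (g y) c d *
    (partial a (fun z => g z b d) y + partial b (fun z => g z a d) y
     - partial d (fun z => g z a b) y).

(* R(e_a, e_b) e_c = \sum_d (riemann g d c a b) e_d, with
   R(X, Y) Z = nabla_X nabla_Y Z - nabla_Y nabla_X Z - nabla_[X, Y] Z. *)
Definition riemann g (d c a b : 'I_m) (y : 'rV[R]_m) : R :=
  partial a (christoffel g d b c) y - partial b (christoffel g d a c) y
  + \sum_e (christoffel g d a e y * christoffel g e b c y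
            - christoffel g d b e y * christoffel g e a c y).

(* Ric(Y, Z) is the trace of X |-> R(X, Y) Z; round spheres have Ric > 0. *)
Definition ricci g (y : 'rV[R]_m) : 'M[R]_m :=
  \matrix_(b, c) \sum_a riemann g a c a b y.

Definition grad_sqnorm g f (y : 'rV[R]_m) : R :=
  \sum_a \sum_b invmx (g y) a b * partial a f y * partial b f y.

(* div (grad f) *)
Definition laplacian g f (y : 'rV[R]_m) : R :=
  (Num.sqrt (\det (g y)))^-1 *
  \sum_a partial a (fun z => Num.sqrt (\det (g z)) *
                             \sum_b invmx (g z) a b * partial b f z) y.

End Coordinates.

(* Lebesgue integral over R^m of a nonnegative Borel function, written by
   Tonelli as an iterated one-dimensional integral. *)
Fixpoint lebesgue_int (R : realType) (m : nat) : ('rV[R]_m -> \bar R) -> \bar R :=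
  match m with
  | 0 => fun f => f 0
  | m'.+1 => fun f =>
      (\int[lebesgue_measure]_t
         lebesgue_int (fun v : 'rV[R]_m' => f (row_mx (t%:M : 'rV[R]_1) v)))%E
  end.

(* Row vectors are tangent vectors in coordinates: ['J f y] acts on the right,
   and [metric i y] is the Gram matrix of the coordinate frame of chart [i].
   [chart_at x] is a chosen chart around [x]; the geometric quantities
   evaluated below in [chart_at x] do not depend on that choice. *)
Record riemannianManifold (R : realType) (m : nat) := RiemannianManifold {
  carrier :> ptopologicalType ;
  manifold_hausdorff : hausdorff_space carrier ;
  manifold_second_countable : @second_countable carrier ;
  manifold_connected : connected [set: carrier] ;

  chart : Type ;
  dom : chart -> set carrier ;
  coord : chart -> carrier -> 'rV[R]_m ;
  par : chart -> 'rV[R]_m -> carrier ;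
  chart_image i := coord i @` dom i ;
  dom_open : forall i, open (dom i) ;
  chart_image_open : forall i, open (chart_image i) ;
  coordK : forall i x, dom i x -> par i (coord i x) = x ;
  coord_continuous : forall i x, dom i x -> {for x, continuous (coord i)} ;
  par_continuous : forall i y, chart_image i y -> {for y, continuous (par i)} ;
  transition i j := coord j \o par i ;
  transition_smooth : forall i j (a : 'I_m),
    smooth (coord i @` (dom i `&` dom j)) (fun y => transition i j y 0 a) ;
  chart_at : carrier -> chart ;
  dom_chart_at : forall x, dom (chart_at x) x ;

  metric : chart -> 'rV[R]_m -> 'M[R]_m ;
  metric_smooth : forall i (a b : 'I_m),
    smooth (chart_image i) (fun y => metric i y a b) ;
  metric_sym : forall i y, chart_image i y -> (metric i y)^T = metric i y ;
  metric_posdef : forall i y (v : 'rV[R]_m),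
    chart_image i y -> v != 0 -> 0 < quad (metric i y) v ;
  metric_transition : forall i j x, dom i x -> dom j x ->
    let A := 'J (transition i j) (coord i x) in
    metric i (coord i x) = A *m metric j (coord j x) *m A^T
}.

Notation borelType M := (g_sigma_algebraType (@open M)).

Section Manifold.
Variables (R : realType) (m : nat) (M : riemannianManifold R m).

Definition local_repr (i : chart M) (u : M -> R) : 'rV[R]_m -> R := u \o par i.

Definition Ck_on_manifold (k : nat) (u : M -> R) : Prop :=
  forall i, Ck k (chart_image i) (local_repr i u).

Definition smooth_on_manifold (u : M -> R) : Prop :=
  forall k, Ck_on_manifold k u.

Definition compactly_supported (u : M -> R) : Prop :=
  compact (closure [set x | u x != 0]).

(* |nabla u|^2 *)
Definition gradient_sqnorm (u : M -> R) (x : M) : R :=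
  let i := chart_at x in
  grad_sqnorm (metric i) (local_repr i u) (coord i x).

Definition harmonic_function (u : M -> R) : Prop :=
  Ck_on_manifold 2 u /\
  forall x, let i := chart_at x in
    laplacian (metric i) (local_repr i u) (coord i x) = 0.

(* Row [v] is an eigenvector for [a] iff Ric(v, _) = a g(v, _).  The set of
   eigenvalues is finite, and nonempty when 0 < m, so [inf] is a minimum. *)
Definition ricci_min (x : M) : R :=
  let i := chart_at x in let y := coord i x in
  inf [set a | eigenvalue (ricci (metric i) y *m invmx (metric i y)) a].

Definition ricci_min_neg (x : M) : R := Num.min 0 (ricci_min x).

(* Zero speed is allowed, so that a piecewise C^1 path parametrized by [0, 1]
   can be reparametrized, with the same length, as such a curve. *)
Definition C1_curve (c : R -> M) : Prop :=
  continuous c /\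
  forall i t, dom i (c t) ->
    derivable (coord i \o c) t 1 /\
    {for t, continuous (fun s => 'D_1 (coord i \o c) s)}.

Definition speed (c : R -> M) (t : R) : R :=
  let i := chart_at (c t) in
  Num.sqrt (quad (metric i (coord i (c t))) ('D_1 (coord i \o c) t)).

Definition curve_length (c : R -> M) : \bar R :=
  (\int[lebesgue_measure]_(t in `[0%R, 1%R]) (speed c t)%:E)%E.

Definition riemannian_dist (p q : M) : \bar R :=
  ereal_inf [set curve_length c |
             c in [set c | [/\ C1_curve c, c 0 = p & c 1 = q]]].

(* The distance induces the manifold topology, so convergence is stated in
   the latter. *)
Definition complete_manifold : Prop :=
  forall s : nat -> M,
    (forall e : R, 0 < e -> exists N, forall p q : nat,
       (N <= p)%N -> (N <= q)%N -> (riemannian_dist (s p) (s q) < e%:E)%E) ->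
    exists x : M, s n @[n --> \oo] --> x.

(* The Borel measure that is sqrt (det g) dy in every chart; second
   countability makes it unique. *)
Definition is_riemannian_volume (mu : set (borelType M) -> \bar R) : Prop :=
  forall (i : chart M) (A : set (borelType M)), measurable A -> A `<=` dom i ->
    mu A = lebesgue_int (fun y =>
             (\1_(coord i @` A) y * Num.sqrt (\det (metric i y)))%:E).

End Manifold.

(* Multiplication by the imaginary unit on row vectors (x, y) ~ x + iy. *)
Definition mulI_mx (R : realType) (n : nat) : 'M[R]_(n + n) :=
  block_mx 0 1%:M (- 1%:M) 0.

(* The charts, read in C^n = R^n x R^n, are holomorphic (Cauchy-Riemann), the
   metric is Hermitian, and its fundamental form omega(v, w) = g(iv, w) is
   closed. *)
Definition kahler (R : realType) (n : nat)
    (M : riemannianManifold R (n + n)) : Prop :=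
  let I := mulI_mx R n in
  let omega (i : chart M) (a b : 'I_(n + n)) y := (I *m metric i y) a b in
  [/\ forall (i j : chart M) x, dom i x -> dom j x ->
        let A := 'J (transition i j) (coord i x) in I *m A = A *m I,
      forall (i : chart M) y, chart_image i y -> I *m metric i y *m I^T = metric i y
    & forall (i : chart M) y, chart_image i y -> forall a b c,
        partial a (omega i b c) y + partial b (omega i c a) y
        + partial c (omega i a b) y = 0].

(* Main.v *)
(** Let u be harmonic with finite energy, I the complex structure and phi a cutoff function
    supplied by completeness.  On a Kaehler manifold div(G (ddc u) G I du) is, up to sign,
    half of |ddc u|^2, so testing with phi^2 and Cauchy-Schwarz bound the integral of
    phi^2 |ddc u|^2 by that of |d phi|^2 |du|^2; hence ddc u = 0.  In charts u is then harmonic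
    for the flat Laplacian, so it is smooth by Weyl's lemma, and its Hessian anticommutes with
    I, so each eigenvalue comes with its opposite and Kato's inequality improves to
    |Hess u|^2 >= 2 |d|du||^2.  With F = sqrt(|du|^2 + e), Bochner's formula becomes
    F Lap F >= |dF|^2 - |lambda^-| F^2.  Testing with phi^2 F, the extra term |dF|^2 doubles the
    energy of phi F at one's disposal, which is why Hoelder and Sobolev can absorb the
    curvature as soon as ||lambda^-|| C_S < 2.  What remains is a bound of the Sobolev norm of
    phi F by the integral of |d phi|^2 F^2, which tends to 0 along cutoffs; so du = 0. *)

From HB Require Import structures.
From mathcomp Require Import all_boot all_order all_algebra.
From mathcomp Require Import all_classical all_reals all_analysis.
From mathcomp Require Import measurable_realfun.
From mathcomp Require Import perm.
From mathcomp Require Import ring lra.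
(* After the libraries, whose [coord] and [metric_sym] would otherwise shadow those of Defs. *)
Require Import Defs.

Set Implicit Arguments.
Unset Strict Implicit.
Unset Printing Implicit Defensive.

Import Order.TTheory GRing.Theory Num.Theory numFieldNormedType.Exports.
Local Open Scope classical_set_scope.
Local Open Scope ring_scope.

(** * C^k functions *)

(** Since [u] is only C^2, the codifferential of ddc u involves third derivatives that need not
    exist. The identity for ddc u is therefore proved in integrated form, where integrals of
    products of first derivatives stand in for the symmetry of third derivatives; Bochner's formula
    comes in only after Weyl's lemma has made [u] smooth. Both computations rest on one fact:
    holomorphic charts of a Kaehler manifold are harmonic coordinates, so the Laplacian is the plain
    trace of the Hessian.

    The distance function is not smooth, so cutoffs come from a logarithm of a sum of powers of
    bumps. Neither their number nor their size may enter the gradient bound, which dictates the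
    exponent. Distances are infima over chains of coordinate segments, for which the Hopf-Rinow
    theorem is proved.

    Two choices concern integrals. No measurability of the lowest Ricci eigenvalue is established,
    so Hoelder's inequality is applied to a continuous function below |lambda^-|. The volume may be
    infinite, so e is chosen after the cutoff phi, making e times the integral of |d phi|^2 at most
    1/k^2. *)

Lemma near_eq_continuous (T U : topologicalType) (f h : T -> U) y : (\forall z \near y, f z = h z) ->
  {for y, continuous f} -> {for y, continuous h}.
Proof.
move=> fh cf; rewrite /prop_for /continuous_at -(nbhs_singleton fh).
by apply: cvg_trans cf; apply: near_eq_cvg.
Qed.

Section PointwiseContinuity.
Variables (R : realType) (T : topologicalType).
Implicit Types (f h : T -> R) (y : T).

Lemma for_continuousD f h y : {for y, continuous f} -> {for y, continuous h} ->
  {for y, continuous (fun z => f z + h z)}.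
Proof. by move=> F H; exact: (cvgD F H). Qed.

Lemma for_continuousM f h y : {for y, continuous f} -> {for y, continuous h} ->
  {for y, continuous (fun z => f z * h z)}.
Proof. by move=> F H; exact: (cvgM F H). Qed.

Lemma for_continuousV f y : f y != 0 -> {for y, continuous f} ->
  {for y, continuous (fun z => (f z)^-1)}.
Proof. by move=> F H; exact: (cvgV F H). Qed.

End PointwiseContinuity.

Section DirectionalCalculus.
Variables (R : realType) (V : normedModType R).
Implicit Types (f h : V -> R) (y v : V).

Lemma is_derive_line f y v (s : R) : derivable f (y + s *: v) v ->
  is_derive s 1 (fun t : R => f (y + t *: v)) ('D_v f (y + s *: v)).
Proof.
have E : (fun h : R => h^-1 *: (f (y + (h *: (1 : R) + s) *: v) - f (y + s *: v))) =
         (fun h : R => h^-1 *: (f (h *: v + (y + s *: v)) - f (y + s *: v))).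
  by apply/funext => h; rewrite scalerDl [_ *: 1]mulr1 addrCA.
move=> df; apply: DeriveDef; first by rewrite /derivable E.
by rewrite /derive E.
Qed.

Lemma is_derive_comp1 f (p : R -> R) y v df dp :
  is_derive y v f df -> is_derive (f y) 1 p dp ->
  is_derive y v (p \o f) (dp * df).
Proof.
move=> [f1 f2] hp.
have l0 : y = y + (0 : R) *: v by rewrite scale0r addr0.
have H : is_derive (0 : R) 1 (fun t : R => f (y + t *: v)) df.
  by rewrite -f2 {2}l0; apply: is_derive_line; rewrite -l0.
have Hp : is_derive ((fun t : R => f (y + t *: v)) 0) 1 p dp by rewrite -l0.
have [H1 H2] := is_derive1_comp Hp H.
have E : (fun h : R => h^-1 *: ((p \o (fun t : R => f (y + t *: v))) (h *: (1 : R) + 0)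
            - (p \o (fun t : R => f (y + t *: v))) 0)) =
         (fun h : R => h^-1 *: ((p \o f) (h *: v + y) - (p \o f) y)).
  by apply/funext => h /=; rewrite scale0r !addr0 [_ *: 1]mulr1 (addrC y).
apply: DeriveDef; first by move: H1; rewrite /derivable E.
by move: H2; rewrite /derive E.
Qed.

End DirectionalCalculus.

(** Mean value inequality around the affine function of slope [c]. With [c = 0] it yields Lipschitz
    bounds, with [c = e = 0] constancy; a nonzero [c] serves linear approximation and the symmetry
    of second derivatives. *)
Lemma MVT_bound (R : realType) (f : R -> R) (t c e : R) :
  (forall s : R, `|s| <= `|t| -> derivable f s 1 /\ `|'D_1 f s - c| <= e) ->
  `|f t - f 0 - c * t| <= e * `|t|.
Proof.
move=> H.
have e0 : 0 <= e by apply: le_trans (H 0 _).2; rewrite ?normr0.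
have cf (s : R) : `|s| <= `|t| -> {for s, continuous f}.
  by move=> /H[/derivable1_diffP/differentiable_continuous].
have dfs (s : R) : `|s| <= `|t| -> is_derive s 1 f ('D_1 f s).
  by move=> /H[/derivableP].
have [t0|t0|->] := ltgtP t 0; last by rewrite mulr0 subrr subr0 !normr0 mulr0.
- have [||s s1 E] := @MVT _ f (fun s => 'D_1 f s) t 0 t0.
  + move=> s; rewrite in_itv /= => /andP[s1 s2]; apply: dfs.
    by rewrite !ltr0_norm// lerN2 ltW.
  + apply: continuous_in_subspaceT => s; rewrite inE /= in_itv /= => /andP[s1 s2].
    by apply: cf; rewrite !ler0_norm// ?lerN2 // ltW.
  + move: s1; rewrite in_itv /= => /andP[s1 s2].
    rewrite -[f t - f 0]opprB E sub0r mulrN opprK -mulrBl normrM ler_wpM2r//.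
    by apply: (H _ _).2; rewrite !ltr0_norm// lerN2 ltW.
- have [||s s1 E] := @MVT _ f (fun s => 'D_1 f s) 0 t t0.
  + move=> s; rewrite in_itv /= => /andP[s1 s2]; apply: dfs.
    by rewrite !gtr0_norm// ltW.
  + apply: continuous_in_subspaceT => s; rewrite inE /= in_itv /= => /andP[s1 s2].
    by apply: cf; rewrite !ger0_norm// ltW.
  + move: s1; rewrite in_itv /= => /andP[s1 s2].
    rewrite E subr0 -mulrBl normrM ler_wpM2r//.
    by apply: (H _ _).2; rewrite !gtr0_norm// ltW.
Qed.

Section CkCalculus.
Variables (R : realType) (m : nat).
Local Notation V := 'rV[R]_m.
Implicit Types (f h : V -> R) (y v : V) (U W : set V).

Lemma Ck_cont k U f : Ck k U f -> forall y, U y -> {for y, continuous f}.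
Proof. by case: k => [|k] []. Qed.

Lemma Ck_derivable k U f a y : Ck k.+1 U f -> U y -> derivable f y (delta_mx 0 a).
Proof. by move=> [_ /(_ a)[+ _]]; apply. Qed.

Lemma Ck_partial k U f a : Ck k.+1 U f -> Ck k U (partial a f).
Proof. by move=> [_ /(_ a)[]]. Qed.

Lemma smooth_partial U f a : smooth U f -> smooth U (partial a f).
Proof. by move=> sf k; exact: Ck_partial (sf k.+1). Qed.

Lemma Ck_sub k U W f : W `<=` U -> Ck k U f -> Ck k W f.
Proof.
move=> WU; elim: k f => [|k IH] f [cf df]; split; try by move=> y /WU/cf.
  by [].
by move=> a; have [d1 d2] := df a; split; [move=> y /WU/d1|exact: IH].
Qed.

Lemma CkW k U f : Ck k.+1 U f -> Ck k U f.
Proof.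
elim: k f => [|k IH] f; first by case.
by move=> [cf df]; split=> // a; have [d1 d2] := df a; split=> //; exact: IH.
Qed.

Lemma Ck_leq j k U f : (j <= k)%N -> Ck k U f -> Ck j U f.
Proof.
move=> /subnK <-; elim: (k - j)%N => [//|d IH].
by rewrite addSn => /CkW/IH.
Qed.

Lemma Ck_local k U f :
  (forall y, U y -> exists W, [/\ open W, W y & Ck k (U `&` W) f]) -> Ck k U f.
Proof.
elim: k f => [|k IH] f H; split.
- by move=> y Uy; have [W [_ Wy /Ck_cont]] := H y Uy; apply; split.
- by [].
- by move=> y Uy; have [W [_ Wy /Ck_cont]] := H y Uy; apply; split.
move=> a; split.
  by move=> y Uy; have [W [_ Wy /Ck_derivable]] := H y Uy; apply; split.
apply: IH => y Uy; have [W [oW Wy HW]] := H y Uy.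
by exists W; split=> //; exact: Ck_partial.
Qed.

Lemma partial_near f h a y : (\forall z \near y, f z = h z) ->
  partial a f y = partial a h y.
Proof. exact: near_eq_derive. Qed.

Lemma Ck_eq k U f h : open U -> (forall y, U y -> f y = h y) ->
  Ck k U f -> Ck k U h.
Proof.
move=> oU; elim: k f h => [|k IH] f h E F;
  have N y : U y -> \forall z \near y, f z = h z
    by move=> Uy; move/open_nbhs_nbhs: (conj oU Uy); apply: filterS.
  split=> //; move=> y Uy.
  by apply: near_eq_continuous (N y Uy) _; exact: (Ck_cont F Uy).
split=> [y Uy|a].
  by apply: near_eq_continuous (N y Uy) _; exact: (Ck_cont F Uy).
split=> [y Uy|].
  by apply: near_eq_derivable (N y Uy) _; exact: Ck_derivable F Uy.
apply: IH (Ck_partial a F) => y Uy; exact: partial_near (N y Uy).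
Qed.

Section Algebra.
Variables (U : set V) (oU : open U).

Lemma Ck_cst k (c : R) : Ck k U (fun=> c).
Proof.
elim: k c => [|k IH] c; [split=> // y _|split=> [y _|a]]; try exact: cst_continuous.
split=> [y _|]; first exact: derivable_cst.
apply: (Ck_eq oU) (IH 0) => y _.
by rewrite /partial (derive_cst c).
Qed.

Lemma CkD k f h : Ck k U f -> Ck k U h -> Ck k U (fun y => f y + h y).
Proof.
elim: k f h => [|k IH] f h F H; [split=> // y Uy|split=> [y Uy|a]];
  try by apply: for_continuousD; [exact: (Ck_cont F Uy)|exact: (Ck_cont H Uy)].
split=> [y Uy|].
  by apply: derivableD; [exact: Ck_derivable F Uy|exact: Ck_derivable H Uy].
apply: (Ck_eq oU) (IH _ _ (Ck_partial a F) (Ck_partial a H)) => y Uy.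
by rewrite /partial -deriveD//; [exact: Ck_derivable F Uy|exact: Ck_derivable H Uy].
Qed.

Lemma partialM f h a y : derivable f y (delta_mx 0 a) ->
  derivable h y (delta_mx 0 a) ->
  partial a (fun z => f z * h z) y = partial a f y * h y + f y * partial a h y.
Proof.
move=> F H; rewrite /partial (deriveM F H) addrC; congr +%R; exact: mulrC.
Qed.

Lemma CkM k f h : Ck k U f -> Ck k U h -> Ck k U (fun y => f y * h y).
Proof.
elim: k f h => [|k IH] f h F H; [split=> // y Uy|split=> [y Uy|a]];
  try by apply: for_continuousM; [exact: (Ck_cont F Uy)|exact: (Ck_cont H Uy)].
split=> [y Uy|].
  by apply: derivableM; [exact: Ck_derivable F Uy|exact: Ck_derivable H Uy].
apply: (Ck_eq oU _ (CkD (IH _ _ (Ck_partial a F) (CkW H))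
   (IH _ _ (CkW F) (Ck_partial a H)))) => y Uy.
by rewrite partialM//; [exact: Ck_derivable F Uy|exact: Ck_derivable H Uy].
Qed.

Lemma CkZ k f (c : R) : Ck k U f -> Ck k U (fun y => c * f y).
Proof. by move=> F; apply: CkM => //; exact: Ck_cst. Qed.

Lemma CkN k f : Ck k U f -> Ck k U (fun y => - f y).
Proof.
by move=> F; apply: (Ck_eq oU _ (CkZ (-1) F)) => y _; rewrite mulN1r.
Qed.

Lemma CkB k f h : Ck k U f -> Ck k U h -> Ck k U (fun y => f y - h y).
Proof. by move=> F H; apply: CkD => //; exact: CkN. Qed.

Lemma Ck_sum k (I : Type) (r : seq I) (P : pred I) (F : I -> V -> R) :
  (forall i, P i -> Ck k U (F i)) -> Ck k U (fun y => \sum_(i <- r | P i) F i y).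
Proof.
move=> H; elim: r => [|i r IH].
  by apply: (Ck_eq oU _ (Ck_cst k 0)) => y _; rewrite big_nil.
have [Pi|Pi] := boolP (P i); last first.
  by apply: (Ck_eq oU _ IH) => y _; rewrite big_cons (negbTE Pi).
by apply: (Ck_eq oU _ (CkD (H i Pi) IH)) => y _; rewrite big_cons Pi.
Qed.

Lemma Ck_prod k (I : Type) (r : seq I) (P : pred I) (F : I -> V -> R) :
  (forall i, P i -> Ck k U (F i)) -> Ck k U (fun y => \prod_(i <- r | P i) F i y).
Proof.
move=> H; elim: r => [|i r IH].
  by apply: (Ck_eq oU _ (Ck_cst k 1)) => y _; rewrite big_nil.
have [Pi|Pi] := boolP (P i); last first.
  by apply: (Ck_eq oU _ IH) => y _; rewrite big_cons (negbTE Pi).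
by apply: (Ck_eq oU _ (CkM (H i Pi) IH)) => y _; rewrite big_cons Pi.
Qed.

Lemma CkX k f n : Ck k U f -> Ck k U (fun y => f y ^+ n).
Proof.
move=> F; elim: n => [|n IH].
  by apply: (Ck_eq oU _ (Ck_cst k 1)) => y _; rewrite expr0.
by apply: (Ck_eq oU _ (CkM F IH)) => y _; rewrite exprS.
Qed.

Lemma is_derive_coord (a b : 'I_m) y : is_derive y (delta_mx 0 a) (fun z : V => z 0 b) (a == b)%:R.
Proof.
have D : derivable (@id V) y (delta_mx 0 a) by exact: derivable_id.
apply: DeriveDef; first exact: (derivable_mxP _ _ _).1 D 0 b.
have /matrixP/(_ 0 b) := derive_mx D.
by rewrite (derive_id y) !mxE eqxx /= eq_sym => <-.
Qed.

Lemma Ck_coord k b : Ck k U (fun y => y 0 b).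
Proof.
have C y : {for y, continuous (fun y : V => y 0 b)}.
  exact/differentiable_continuous/differentiable_coord.
case: k => [|k]; split=> // a; split=> [y _|]; first by case: (is_derive_coord a b y).
apply: (Ck_eq oU _ (Ck_cst k (a == b)%:R)) => y _.
by rewrite /partial; case: (is_derive_coord a b y).
Qed.

Lemma partial_comp1 (p : R -> R) dp f a y : derivable f y (delta_mx 0 a) ->
  is_derive (f y) 1 p dp -> partial a (p \o f) y = dp * partial a f y.
Proof. by move=> /derivableP F P; have [] := is_derive_comp1 F P. Qed.

Lemma Ck_comp1S k (p dp : R -> R) f :
  (forall y, U y -> is_derive (f y) 1 p (dp (f y))) -> Ck k.+1 U f ->
  Ck k U (dp \o f) -> Ck k.+1 U (p \o f).
Proof.
move=> P F D; split=> [y Uy|a].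
  apply: continuous_comp; first exact: (Ck_cont F Uy).
  by apply/differentiable_continuous/derivable1_diffP; case: (P y Uy).
split=> [y Uy|].
  by have [] := is_derive_comp1 (derivableP (Ck_derivable (a := a) F Uy)) (P y Uy).
apply: (Ck_eq oU _ (CkM D (Ck_partial a F))) => y Uy.
by rewrite (partial_comp1 (Ck_derivable F Uy) (P y Uy)).
Qed.

Lemma CkV k f : (forall y, U y -> f y != 0) -> Ck k U f -> Ck k U (fun y => (f y)^-1).
Proof.
move=> f0; elim: k => [|k IH] F.
  by split=> // y Uy; apply: for_continuousV; [exact: (f0 _ Uy)|exact: (Ck_cont F Uy)].
apply: (@Ck_comp1S k _ (fun x => - x ^- 2)) => //.
  move=> y Uy; apply: is_derive_eq.
    apply: is_deriveV; exact: f0.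
  by rewrite /= [_ *: _]mulr1.
apply: (Ck_eq oU _ (CkN (CkX 2 (IH (CkW F))))) => y Uy /=.
by rewrite exprVn.
Qed.

Lemma Ck_sqrt k f : (forall y, U y -> 0 < f y) -> Ck k U f ->
  Ck k U (fun y => Num.sqrt (f y)).
Proof.
move=> f0; elim: k => [|k IH] F.
  split=> // y Uy; apply: continuous_comp; first exact: (Ck_cont F Uy).
  exact: sqrt_continuous.
apply: (@Ck_comp1S k _ (fun x => (2 * Num.sqrt x)^-1)) => //.
  by move=> y Uy; apply: is_derive1_sqrt; exact: f0.
apply: CkV; last by apply: CkZ; exact: IH (CkW F).
by move=> y Uy; rewrite mulf_neq0 ?gt_eqF// sqrtr_gt0 f0.
Qed.

Lemma Ck_ln k f : (forall y, U y -> 0 < f y) -> Ck k U f -> Ck k U (fun y => ln (f y)).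
Proof.
move=> f0; case: k => [|k] F.
  split=> // y Uy; apply: continuous_comp; first exact: (Ck_cont F Uy).
  exact/continuous_ln/f0.
apply: (@Ck_comp1S k _ (fun x => x^-1)) => //.
  by move=> y Uy; apply: is_derive1_ln; exact: f0.
by apply: CkV; [move=> y Uy; rewrite gt_eqF// f0|exact: CkW].
Qed.

End Algebra.

Lemma coord_le (v : V) a : `|v 0 a| <= `|v|.
Proof.
by rewrite [leRHS]mx_normrE; apply: (@le_bigmax_cond _ _ _ _ (0, a) predT (fun ij : 'I_1 * 'I_m => `|v ij.1 ij.2|)).
Qed.

Lemma norm_rV_le (v : V) (e : R) : 0 <= e -> (forall a, `|v 0 a| <= e) -> `|v| <= e.
Proof.
move=> e0 H; rewrite [leLHS]mx_normrE; apply: bigmax_le => // -[i a] _ /=.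
by rewrite (ord1 i).
Qed.

Lemma Ck1_linear_approx U f y (e : R) : open U -> Ck 1 U f -> U y -> 0 < e ->
  \forall h \near (0 : V), `|f (y + h) - f y - \sum_a h 0 a * partial a f y| <= e * `|h|.
Proof.
move=> oU F Uy e0.
have [d /= d0 D] : exists2 d : R, 0 < d & forall z : V, `|z| < d -> U (y + z) /\
    forall a, `|partial a f (y + z) - partial a f y| <= e / m.+1%:R.
  have : \forall z \near y, U z /\ forall a, `|partial a f z - partial a f y| <= e / m.+1%:R.
    apply: filterI; first exact: open_nbhs_nbhs.
    have e' : 0 < e / m.+1%:R by rewrite divr_gt0.
    have : forall b, \forall z \near y, `|partial b f z - partial b f y| <= e / m.+1%:R.
      move=> b; have /Ck_cont/(_ y Uy) := Ck_partial b F.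
      move=> /cvgrPdist_le/(_ _ e'); by apply: filterS => x; rewrite distrC.
    by move=> Hb; exact: (@filter_forall _ _ _ (nbhs y) (nbhs_filter y) Hb).
  move=> /nbhs_ballP[d /= d0 D]; exists d => // z zd.
  by apply: D; rewrite -ball_normE /= opprD addNKr normrN.
near=> h.
have hd : `|h| < d.
  near: h; apply/nbhs_ballP; exists d => //= z; rewrite -ball_normE /= sub0r normrN //.
(* [t j] keeps the first [j] coordinates of [h], so consecutive points differ along one axis and
   telescoping reduces the claim to one variable. In the sup norm all these points stay in the ball
   of radius [|h|]. Dividing [e] by [m.+1] rather than [m] also covers dimension 0. *)
pose t (j : nat) : V := \row_a (if (a < j)%N then h 0 a else 0).
have tn j : `|t j| <= `|h|.
  by apply: norm_rV_le => // a; rewrite mxE; case: ifP => _; rewrite ?normr0// coord_le.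
have tS (a : 'I_m) : t a.+1 = t a + h 0 a *: delta_mx 0 a.
  apply/rowP => b; rewrite !mxE eqxx /= ltnS leq_eqVlt; case: (ltngtP b a) => /= [ba|ab|/val_inj ->].
  + by rewrite (_ : (b == a) = false) ?mulr0 ?addr0//; apply/negbTE; rewrite neq_ltn ba.
  + by rewrite (_ : (b == a) = false) ?mulr0 ?addr0//; apply/negbTE; rewrite neq_ltn ab orbT.
  + by rewrite eqxx mulr1 add0r.
have t0 : t 0%N = 0 by apply/rowP => b; rewrite !mxE.
have tm : t m = h by apply/rowP => b; rewrite !mxE ltn_ord.
have -> : f (y + h) - f y = \sum_(a < m) (f (y + t a.+1) - f (y + t a)).
  rewrite -(big_mkord xpredT (fun j => f (y + t j.+1) - f (y + t j))) telescope_sumr//.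
  by rewrite tm t0 addr0.
rewrite -sumrB; apply: (le_trans (ler_norm_sum _ _ _)).
have -> : e * `|h| = \sum_(a < m.+1) (e / m.+1%:R * `|h|).
  by rewrite sumr_const card_ord -[RHS]mulr_natl mulrA (mulrC _ (e / _)) divfK.
rewrite big_ord_recr /=; apply: ler_wpDr; first by rewrite mulr_ge0// divr_ge0// ltW.
apply: ler_sum => a _.
apply: (@le_trans _ _ (e / m.+1%:R * `|h 0 a|)); last first.
  by rewrite ler_wpM2l ?coord_le// divr_ge0// ltW.
have L := @MVT_bound R (fun s => f (y + t a + s *: delta_mx 0 a)) (h 0 a)
  (partial a f y) (e / m.+1%:R).
rewrite tS addrA mulrC.
rewrite scale0r addr0 in L; apply: L => s sh.
have sd : `|t a + s *: delta_mx 0 a| < d.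
  apply: le_lt_trans hd; apply: norm_rV_le => // b; rewrite !mxE eqxx /=.
  case: ltnP => ba.
    by rewrite (_ : (b == a) = false) ?mulr0 ?addr0 ?coord_le//; apply/negbTE; rewrite neq_ltn ba.
  rewrite add0r; case: eqP => _; rewrite ?mulr1 ?mulr0 ?normr0//.
  exact: le_trans sh (coord_le _ _).
have [Us Ds] := D _ sd.
have [d1 d2] := is_derive_line (Ck_derivable F (y := y + t a + s *: delta_mx 0 a)
   ltac:(by rewrite -addrA)).
split=> //; rewrite d2 -addrA; exact: Ds.
Unshelve. all: by end_near. Qed.

Lemma Ck1_differentiable U f y : open U -> Ck 1 U f -> U y -> differentiable f y.
Proof.
move=> oU F Uy.
pose c : 'cV[R]_m := \col_a partial a f y.
pose df0 (h : V) : R := (h *m c) 0 0.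
have lin : linear df0 by move=> k u v; rewrite /df0 mulmxDl -scalemxAl !mxE.
pose df : {linear V -> R} := HB.pack df0 (GRing.isLinear.Build R V R _ df0 lin).
have dfE (h : V) : df h = \sum_a h 0 a * partial a f y.
  by rewrite /= /df0 mxE; apply: eq_bigr => a _; rewrite mxE.
have cdf : continuous df.
  have -> : (df : V -> R) = (fun w : V => \sum_a w 0 a * partial a f y).
    by apply/funext => h; exact: dfE.
  move=> h; apply: (@Ck_cont 0 setT) => //; apply: Ck_sum; first exact: openT.
  by move=> a _; apply: CkM; [exact: openT|apply: Ck_coord; exact: openT|apply: Ck_cst; exact: openT].
have A : f \o shift y = cst (f y) + df +o_ (0 : V) id.
  apply/eqaddoP => e e0.
  have := Ck1_linear_approx oU F Uy e0; apply: filterS => h.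
  by rewrite -dfE /= !fctE /= opprD addrA (addrC y).
apply/diff_locallyP; rewrite (diff_unique cdf A); split=> //.
Qed.

End CkCalculus.

Section ChainRule.
Variables (R : realType) (m p : nat).
Local Notation V := 'rV[R]_m.
Local Notation W := 'rV[R]_p.
Implicit Types (y v : V) (U : set V).

Lemma for_continuous_rV (T : topologicalType) (t : T -> W) x :
  (forall b, {for x, continuous (fun z => t z 0 b)}) -> {for x, continuous t}.
Proof.
move=> H; apply/cvgrPdist_le => e e0.
have K b : \forall z \near x, `|t x 0 b - t z 0 b| <= e.
  by have /cvgrPdist_le := H b; apply.
have := @filter_forall _ _ _ (nbhs x) (nbhs_filter x) K; apply: filterS => z Hz.
by apply: norm_rV_le; [exact: ltW|move=> b; rewrite !mxE; exact: Hz].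
Qed.

Lemma Ck1_differentiable_rV U (t : V -> W) y : open U ->
  (forall b, Ck 1 U (fun z => t z 0 b)) -> U y -> differentiable t y.
Proof.
move=> oU H Uy.
have -> : t = \sum_(b < p) (fun z => t z 0 b *: (delta_mx 0 b : W)).
  apply/funext => z; rewrite fct_sumE; apply/rowP => c.
  rewrite summxE (bigD1 c)//= big1 ?addr0 ?mxE ?eqxx ?mulr1// => b bc.
  by rewrite !mxE eqxx /= eq_sym (negbTE bc) mulr0.
apply: differentiable_sum => b; apply: differentiableZl.
exact: Ck1_differentiable oU (H b) Uy.
Qed.

Lemma jacobianE (t : V -> W) y a b : differentiable t y ->
  jacobian t y a b = partial a (fun z => t z 0 b) y.
Proof.
move=> dt; have := deriveEjacobian (delta_mx 0 a) dt.
rewrite -rowE derive_mx; last exact: diff_derivable.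
by move=> /matrixP/(_ 0 b); rewrite !mxE.
Qed.

Lemma is_derive_chain (f : W -> R) (t : V -> W) y v :
  differentiable f (t y) -> differentiable t y ->
  is_derive y v (f \o t) (\sum_b 'D_v (fun z => t z 0 b) y * partial b f (t y)).
Proof.
move=> df dt; apply: DeriveDef.
  exact/diff_derivable/differentiable_comp.
rewrite deriveE; last exact: differentiable_comp.
rewrite diff_comp//= -[X in 'd f _ X]deriveE// -deriveE//.
rewrite (derive_mx (diff_derivable (v := v) dt)).
have -> : \matrix_(i < 1, j < p) 'D_v (fun x => t x i j) y =
   \sum_b 'D_v (fun z => t z 0 b) y *: (delta_mx 0 b : W).
  apply/rowP => c; rewrite summxE (bigD1 c)//= big1 ?addr0 ?mxE ?eqxx ?mulr1//.
  by move=> b bc; rewrite !mxE eqxx /= eq_sym (negbTE bc) mulr0.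
rewrite deriveE// linear_sum; apply: eq_bigr => b _.
by rewrite linearZ /partial -deriveE.
Qed.

Lemma partial_chain (f : W -> R) (t : V -> W) a y :
  differentiable f (t y) -> differentiable t y ->
  partial a (f \o t) y = \sum_b partial a (fun z => t z 0 b) y * partial b f (t y).
Proof. by move=> df dt; case: (is_derive_chain (delta_mx 0 a) df dt). Qed.

Lemma Ck_comp k U (U' : set W) (f : W -> R) (t : V -> W) : open U -> open U' ->
  (forall y, U y -> U' (t y)) ->
  (forall b, Ck k U (fun z => t z 0 b)) -> Ck k U' f -> Ck k U (f \o t).
Proof.
move=> oU oU' tU; elim: k f => [|k IH] f T F;
    have C y : U y -> {for y, continuous (f \o t)}.
- move=> Uy; apply: continuous_comp; last exact: (Ck_cont F (tU _ Uy)).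
  by apply: for_continuous_rV => b; exact: (Ck_cont (T b) Uy).
- by split.
- move=> Uy; apply: continuous_comp; last exact: (Ck_cont F (tU _ Uy)).
  by apply: for_continuous_rV => b; exact: (Ck_cont (T b) Uy).
have D y : U y -> differentiable f (t y) /\ differentiable t y.
  move=> Uy; split; first exact: Ck1_differentiable oU' (Ck_leq (ltn0Sn k) F) (tU _ Uy).
  by apply: Ck1_differentiable_rV oU _ Uy => b; exact: Ck_leq (ltn0Sn k) (T b).
split=> // a; split=> [y Uy|].
  by have [d1 d2] := D y Uy; exact/diff_derivable/differentiable_comp.
have K : Ck k U (fun y => \sum_b partial a (fun z => t z 0 b) y * (partial b f \o t) y).
  apply: Ck_sum => // b _; apply: CkM => //; first exact: Ck_partial (T b).
  by apply: IH; [move=> c; exact: CkW|exact: Ck_partial].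
apply: (Ck_eq oU _ K) => y Uy; have [d1 d2] := D y Uy.
by rewrite partial_chain.
Qed.

End ChainRule.

Section Schwarz.
Variables (R : realType) (m : nat).
Local Notation V := 'rV[R]_m.
Implicit Types (f : V -> R) (y : V) (U : set V).

(* Both mixed derivatives are limits of the second difference quotient. *)
Lemma second_difference_limit U f (a b : 'I_m) y (e : R) :
  open U -> Ck 2 U f -> U y -> 0 < e ->
  exists2 d : R, 0 < d & forall s : R, 0 < s -> s < d ->
    `|f (y + s *: delta_mx 0 a + s *: delta_mx 0 b) - f (y + s *: delta_mx 0 a)
      - f (y + s *: delta_mx 0 b) + f y
      - partial b (partial a f) y * s ^+ 2| <= e * s ^+ 2.
Proof.
move=> oU F Uy e0.
have nz (c : 'I_m) : `|delta_mx 0 c : V| <= 1.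
  by apply: norm_rV_le => // i; rewrite mxE eqxx /=; case: eqP; rewrite ?normr0 ?normr1.
have [d /= d0 D] : exists2 d : R, 0 < d & forall z : V, `|z| < d -> U (y + z) /\
    `|partial b (partial a f) (y + z) - partial b (partial a f) y| <= e.
  have : \forall z \near y, U z /\
      `|partial b (partial a f) z - partial b (partial a f) y| <= e.
    apply: filterI; first exact: open_nbhs_nbhs.
    have := Ck_cont (Ck_partial b (Ck_partial a F)) Uy.
    move: (partial b (partial a f)) => g.
    by move=> /cvgrPdist_le/(_ _ e0); apply: filterS => x; rewrite distrC.
  move=> /nbhs_ballP[d /= d0 D]; exists d => // z zd.
  by apply: D; rewrite -ball_normE /= opprD addNKr normrN.
exists (d / 2); first by rewrite divr_gt0.
move=> s s0 sd.
pose ea : V := delta_mx 0 a; pose eb : V := delta_mx 0 b.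
have small (s1 s2 : R) : `|s1| <= s -> `|s2| <= s -> `|s1 *: ea + s2 *: eb| < d.
  move=> h1 h2; apply: (le_lt_trans (ler_normD _ _)).
  have k1 : `|s1| * `|ea| <= s * 1 by apply: ler_pM => //; exact: nz.
  have k2 : `|s2| * `|eb| <= s * 1 by apply: ler_pM => //; exact: nz.
  rewrite !normrZ; move: k1 k2 sd; move: (_ * _) (_ * `|eb|) => x1 x2; lra.
(* The second difference is the increment in [s1] of a first difference, whose derivative is in turn
   an increment of [partial a f] along [b]. The mean value bound is thus applied twice, the inner
   time in [l2]. *)
have l1 (s1 : R) : `|s1| <= `|s| ->
    derivable (fun s1 : R => f (y + s *: eb + s1 *: ea) - f (y + s1 *: ea)) s1 1 /\
    `|'D_1 (fun s1 : R => f (y + s *: eb + s1 *: ea) - f (y + s1 *: ea)) s1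
       - partial b (partial a f) y * s| <= e * s.
  rewrite (gtr0_norm s0) => h1.
  have dd (s2 : R) : `|s2| <= s -> is_derive s1 1 (fun s1 : R => f (y + s2 *: eb + s1 *: ea))
      (partial a f (y + s2 *: eb + s1 *: ea)).
    move=> h2; apply: is_derive_line; apply: Ck_derivable F _.
    by rewrite -addrA (addrC (s2 *: _)); apply: (D _ _).1; exact: small.
  have ss : `|s| <= s by rewrite gtr0_norm.
  have := dd 0; rewrite normr0 scale0r addr0 => /(_ (ltW s0)) d2.
  have [k1 k2] := is_deriveB (dd s ss) d2; split=> //.
  rewrite k2 (addrAC y (s *: eb)).
  have l2 (s2 : R) : `|s2| <= `|s| ->
      derivable (fun s2 : R => partial a f (y + s1 *: ea + s2 *: eb)) s2 1 /\
      `|'D_1 (fun s2 : R => partial a f (y + s1 *: ea + s2 *: eb)) s2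
        - partial b (partial a f) y| <= e.
    rewrite (gtr0_norm s0) => h2.
    have sm := small s1 s2 h1 h2; have [Us Ds] := D _ sm.
    rewrite addrA in Us Ds.
    have [d3 d4] := is_derive_line (Ck_derivable (a := b) (Ck_partial a F) Us).
    by split; [exact: d3|rewrite d4; exact: Ds].
  by have := MVT_bound l2; rewrite scale0r addr0 (gtr0_norm s0).
have := MVT_bound l1; rewrite !scale0r !addr0 (gtr0_norm s0) -!mulrA -!expr2.
rewrite -/ea -/eb (addrAC y (s *: ea)).
by rewrite opprB !addrA (addrAC _ (f y)).
Qed.

Lemma two_approximations_le (A B C D P Q S e : R) : 0 < S ->
  `|A - B - C + D - Q * S| <= e / 2 * S -> `|A - C - B + D - P * S| <= e / 2 * S ->
  `|Q - P| <= e.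
Proof.
move=> S0; rewrite !ler_norml => /andP[h1 h2] /andP[h3 h4].
by apply/andP; split; rewrite -(ler_pM2r S0); lra.
Qed.

Lemma partialC U f a b y : open U -> Ck 2 U f -> U y ->
  partial a (partial b f) y = partial b (partial a f) y.
Proof.
move=> oU F Uy; apply/eqP; rewrite -subr_eq0 -normr_eq0 eq_le normr_ge0 andbT.
apply/ler_addgt0Pr => e e0; rewrite add0r.
have e2 : 0 < e / 2 by rewrite divr_gt0.
have [d1 d10 D1] := second_difference_limit a b oU F Uy e2.
have [d2 d20 D2] := second_difference_limit b a oU F Uy e2.
pose s := Num.min d1 d2 / 2.
have s0 : 0 < s by rewrite divr_gt0// lt_min d10.
have [s1 s2] : s < d1 /\ s < d2.
  have : s < Num.min d1 d2 by rewrite ltr_pdivrMr// ltr_pMr ?ltr1n// lt_min d10.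
  by rewrite lt_min => /andP.
have := D1 s s0 s1; have := D2 s s0 s2.
rewrite (addrAC y (s *: delta_mx 0 b)).
set A := f (_ + _ + _); set B := f (_ + _); set C := f (_ + _); set P := partial b _ y;
  set Q := partial a _ y; set y0 := f y.
move=> h1 h2; apply: two_approximations_le h1 h2; exact: exprn_gt0.
Qed.

End Schwarz.

(** * Lebesgue measure on row vectors *)

Section BorelMaps.

Lemma measurable_to_borel d (S : measurableType d) (T : ptopologicalType) (f : S -> T) :
  (forall U, open U -> measurable (f @^-1` U)) ->
  measurable_fun [set: S] (f : S -> borelType T).
Proof.
move=> H; apply: (@measurability _ _ S (borelType T) setT f (@open T) erefl).
by move=> _ [U oU <-]; rewrite setTI; exact: H.
Qed.

Lemma continuous_measurable_borel_map (S T : ptopologicalType) (f : S -> T) :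
  continuous f -> measurable_fun [set: borelType S] (f : borelType S -> borelType T).
Proof.
move=> /continuousP cf; apply: measurable_to_borel => U oU.
by apply: sub_sigma_algebra; exact: cf.
Qed.

End BorelMaps.

Section BorelMeasurability.
Variables (R : realType).

Lemma open_measurable_borel (T : ptopologicalType) (U : set T) :
  open U -> measurable (U : set (borelType T)).
Proof. by move=> oU; exact: sub_sigma_algebra. Qed.

Lemma continuous_measurable_borel (T : ptopologicalType) (f : T -> R) :
  continuous f -> measurable_fun [set: borelType T] (f : borelType T -> R).
Proof.
move=> /continuousP cf; apply: (measurability _ (RGenOpens.measurableE R)).
move=> _ [_ [a [b ->] <-]]; rewrite setTI.
by apply: open_measurable_borel; apply: cf; exact: interval_open.
Qed.

End BorelMeasurability.

Section ConsRow.
Variables (R : realType) (m : nat).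

Definition cons_row (z : R * 'rV[R]_m) : 'rV[R]_m.+1 := row_mx (z.1%:M : 'rV_1) z.2.

Lemma cons_row_le (z z' : R * 'rV[R]_m) (e : R) : `|z.1 - z'.1| <= e ->
  `|z.2 - z'.2| <= e -> `|cons_row z - cons_row z'| <= e.
Proof.
move=> h1 h2; apply: norm_rV_le => [|a]; first exact: le_trans h1.
rewrite !mxE; case: splitP => b _.
  by rewrite (ord1 b) !mxE eqxx !mulr1n.
by apply: le_trans h2; apply: le_trans (coord_le _ b); rewrite !mxE.
Qed.

Lemma cons_row_norm (z : R * 'rV[R]_m) (e : R) : `|cons_row z| < e -> `|z.1| < e /\ `|z.2| < e.
Proof.
move=> H; split.
  apply: le_lt_trans H; apply: le_trans (coord_le _ (lshift m (0 : 'I_1))).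
  by rewrite /cons_row row_mxEl mxE eqxx mulr1n.
apply: le_lt_trans H; apply: norm_rV_le => // b.
apply: le_trans (coord_le _ (rshift 1 b)).
by rewrite /cons_row row_mxEr.
Qed.

Lemma cons_rowB (z z' : R * 'rV[R]_m) : cons_row z + cons_row z' = cons_row (z.1 + z'.1, z.2 + z'.2).
Proof. by rewrite /cons_row (@add_row_mx _ 1 1 m) -raddfD. Qed.

Lemma cons_row_ex (v : 'rV[R]_m.+1) : exists z, v = cons_row z.
Proof.
exists ((lsubmx (v : 'rV_(1 + m))) 0 0, rsubmx (v : 'rV_(1 + m))).
by rewrite /cons_row /= -mx11_scalar hsubmxK.
Qed.

(** The source carries the product sigma-algebra, so an open set must be written as a countable
    union of rectangles. A countable base is used in the first factor alone: [W q n] is the open set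
    of those [v] such that [I q n] times some ball around [v] is sent into [U]. *)
Lemma measurable_cons_row : measurable_fun [set: R * borelType 'rV[R]_m]
  (cons_row : R * borelType 'rV[R]_m -> borelType 'rV[R]_m.+1).
Proof.
apply: measurable_to_borel => U oU.
pose I (q : rat) (n : nat) : set R := ball (ratr q : R) n.+1%:R^-1.
pose W (q : rat) (n : nat) : set 'rV[R]_m := [set v | exists2 e : R, 0 < e &
   forall t v', `|v - v'| < e -> I q n t -> U (cons_row (t, v'))].
have -> : cons_row @^-1` U = \bigcup_q \bigcup_n (I q n `*` W q n).
  apply/seteqP; split=> [[t v] /= Utv|[t v] [q _ [n _ [/= It [e e0]]]]]; last first.
    by apply; rewrite // subrr normr0.
  have /nbhs_ballP[e /= e0 He] : nbhs (cons_row (t, v)) U by exact: open_nbhs_nbhs.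
  have e2 : 0 < e / 2 by rewrite divr_gt0.
  have key t' v' : `|t - t'| < e / 2 -> `|v - v'| < e / 2 -> U (cons_row (t', v')).
    move=> h1 h2; apply: He; rewrite -ball_normE /=; apply: (@le_lt_trans _ _ (e / 2)).
      by apply: cons_row_le => /=; exact: ltW.
    by rewrite ltr_pdivrMr// ltr_pMr// ltr1n.
  have [n hn] : exists n : nat, n.+1%:R^-1 < e / 4.
    have e4 : 0 < e / 4 by rewrite divr_gt0.
    by have [n _ hn] := near_infty_natSinv_lt (PosNum e4); exists n; exact: (hn n (leqnn n)).
  have n0 : 0 < n.+1%:R^-1 :> R by rewrite invr_gt0.
  have [q] : exists q : rat, ratr q \in `]t, (t + n.+1%:R^-1)[.
    by apply: rat_in_itvoo; rewrite ltrDl.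
  rewrite in_itv /= => /andP[q1 q2].
  have tq : `|t - ratr q| < n.+1%:R^-1 by rewrite ltr_norml; move: n0 q1 q2; move: (_^-1) => d; move=> *; apply/andP; split; lra.
  exists q => //; exists n => //; split; first by rewrite /I -ball_normE /= distrC.
  exists (e / 2) => // t' v' h1; rewrite /I -ball_normE /= => h2; apply: key => //.
  move: tq h2 hn; rewrite !ltr_norml; move: (_^-1) => d /andP[k1 k2] /andP[k3 k4] k5.
  by apply/andP; split; lra.
apply: bigcupT_measurable_rat => q; apply: bigcupT_measurable => n.
apply: measurableX; first exact: measurable_ball.
apply: open_measurable_borel; rewrite openE => v [e e0 He].
apply/nbhs_ballP; exists (e / 2) => /=; first by rewrite divr_gt0.
move=> v1; rewrite -ball_normE /= => vv1; exists (e / 2); first by rewrite divr_gt0.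
move=> t v' h1 h2; apply: He h2; rewrite [e](splitr e).
by apply: (le_lt_trans (ler_distD v1 _ _)); exact: ltrD.
Qed.

End ConsRow.

Definition pushforward_measure d d' (T1 : measurableType d) (T2 : measurableType d')
    (R : realType) (mu : {measure set T1 -> \bar R}) (f : T1 -> T2)
    (mf : measurable_fun [set: T1] f) : {measure set T2 -> \bar R} :=
  measure_function_pushforward__canonical__measure_function_Measure mu mf.

Section LebesgueRow.
Variable R : realType.

Definition finite_on_balls (m : nat) (mu : {measure set (borelType 'rV[R]_m) -> \bar R}) :=
  forall k : nat, (mu [set v : 'rV[R]_m | `|v|%R < k%:R]%R < +oo)%E.

Lemma open_norm_lt m (r : R) : open [set v : 'rV[R]_m | `|v| < r].
Proof.
rewrite (_ : mkset _ = (fun v : 'rV[R]_m => `|v|) @^-1` [set x | x < r]) //.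
by apply: open_comp; [move=> v _; exact: norm_continuous|exact: open_lt].
Qed.

Lemma finite_on_balls_sigma_finite m mu : @finite_on_balls m mu ->
  sigma_finite [set: borelType 'rV[R]_m] mu.
Proof.
move=> H; exists (fun k => [set v : 'rV[R]_m | `|v| < k%:R]).
  apply/esym/seteqP; split=> // v _.
  by exists (Num.truncn `|v|).+1 => //=; exact: truncnS_gt.
by move=> k; split; [apply: sub_sigma_algebra; exact: open_norm_lt|exact: H].
Qed.

(** Tonelli's theorem requires sigma-finiteness at each stage of the recursion on the dimension.
    Finiteness on balls implies it and passes to the product with the line, so it is carried along
    with the measure. *)
Record ball_finite_measure m := BallFiniteMeasure {
  bfm :> {measure set (borelType 'rV[R]_m) -> \bar R} ;
  bfmP : finite_on_balls bfm }.

Definition bfm_fun m (mu : ball_finite_measure m) : set (borelType 'rV[R]_m) -> \bar R :=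
  bfm mu.
HB.instance Definition _ m mu := Measure.on (@bfm_fun m mu).
HB.instance Definition _ m mu := Measure_isSigmaFinite.Build _ _ _ (@bfm_fun m mu)
  (finite_on_balls_sigma_finite (bfmP mu)).

Definition bfm_sigma_finite m (mu : ball_finite_measure m) :
    {sigma_finite_measure set (borelType 'rV[R]_m) -> \bar R} := bfm_fun mu.

Definition lebesgue_succ m (mu : ball_finite_measure m) :
    {measure set (borelType 'rV[R]_m.+1) -> \bar R} :=
  pushforward_measure (lebesgue_measure \x bfm_sigma_finite mu)%E
    (@measurable_cons_row R m).

Lemma lebesgue_succ_finite m (mu : ball_finite_measure m) :
  finite_on_balls (lebesgue_succ mu).
Proof.
move=> k; rewrite /lebesgue_succ /= /pushforward.
have mB : measurable ([set v : 'rV[R]_m | `|v| < k%:R] : set (borelType 'rV[R]_m)).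
  by apply: sub_sigma_algebra; exact: open_norm_lt.
have mI : measurable (`]- k%:R, k%:R[%classic : set R) by exact: measurable_itv.
apply: (@le_lt_trans _ _ ((lebesgue_measure \x bfm_sigma_finite mu)%E
   (`](- k%:R), (k%:R)[%classic `*` [set v : 'rV[R]_m | `|v| < k%:R]))).
  apply: le_measure; rewrite ?inE.
  - have := @measurable_cons_row R m measurableT _
      (open_measurable_borel (@open_norm_lt m.+1 k%:R)); by rewrite setTI.
  - exact: measurableX.
  - move=> [t v] /cons_row_norm /= [t1 v1]; split => //=.
    by rewrite in_itv /=; move: t1; rewrite ltr_norml.
rewrite product_measure1E//= lebesgue_measure_itv /=.
case: ifP => _; last by rewrite mul0e.
apply: lte_mul_pinfty; rewrite -?EFinB ?lee_fin ?subr_ge0//; last exact: bfmP.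
by apply: (@le_trans _ _ (0 : R)); rewrite ?oppr_le0 ?ler0n.
Qed.

Lemma dirac_finite (x : 'rV[R]_0) :
  finite_on_balls (@dirac _ (borelType 'rV[R]_0) x R : {measure set _ -> \bar R}).
Proof. by move=> k; rewrite /= /dirac indicE; case: (_ \in _); rewrite ltry. Qed.

Fixpoint lebesgue_row (m : nat) : ball_finite_measure m :=
  match m with
  | 0 => BallFiniteMeasure (dirac_finite 0)
  | m'.+1 => BallFiniteMeasure (lebesgue_succ_finite (lebesgue_row m'))
  end.

Lemma integral_lebesgue_succ m (f : borelType 'rV[R]_m.+1 -> \bar R) :
  measurable_fun [set: borelType 'rV[R]_m.+1] f -> (forall y, 0 <= f y)%E ->
  (\int[lebesgue_row m.+1]_y f y =
   \int[lebesgue_measure]_t \int[lebesgue_row m]_v f (cons_row (t, v)))%E.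
Proof.
move=> mf f0; rewrite /= ge0_integral_pushforward//; last exact: measurable_cons_row.
rewrite preimage_setT.
have mff := measurableT_comp mf (@measurable_cons_row R m).
exact: (@fubini_tonelli1 _ _ (measurableTypeR R) _ R lebesgue_measure
  (bfm_sigma_finite (lebesgue_row m)) _ mff (fun z => f0 (cons_row z))).
Qed.

Lemma measurable_cons_row2 m (t : R) : measurable_fun [set: borelType 'rV[R]_m]
  ((fun v => cons_row (t, v)) : borelType 'rV[R]_m -> borelType 'rV[R]_m.+1).
Proof.
apply: continuous_measurable_borel_map => v; apply: for_continuous_rV => b.
case E : (fintype.split (b : 'I_(1 + m))) => [c|c].
  rewrite (_ : (fun z => _) = cst ((t%:M : 'rV[R]_1) 0 c)); first exact: cst_continuous.
  by apply/funext => z; rewrite /cons_row mxE E.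
rewrite (_ : (fun z => _) = (fun z : 'rV[R]_m => z 0 c)); last first.
  by apply/funext => z; rewrite /cons_row mxE E.
exact: (Ck_cont (Ck_coord openT 0 c) I).
Qed.

(** The Riemannian volume is characterized by iterated integrals, while dominated convergence and
    integrability speak of measures. Tonelli's theorem links the two. *)
Lemma lebesgue_intE m (f : borelType 'rV[R]_m -> \bar R) :
  measurable_fun [set: borelType 'rV[R]_m] f ->
  (forall y, 0 <= f y)%E ->
  (lebesgue_int f = \int[lebesgue_row m]_y f y)%E.
Proof.
elim: m f => [|m IH] f mf f0; first by rewrite /= integral_dirac// diracT mul1e.
rewrite integral_lebesgue_succ//.
transitivity (\int[lebesgue_measure]_t lebesgue_int (fun v => f (cons_row (t, v))))%E => //.
apply: eq_integral => t _; rewrite IH//.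
exact: (measurableT_comp mf (measurable_cons_row2 t)).
Qed.

Lemma lebesgue_measure_shift (a : R) (A : set R) : measurable A ->
  lebesgue_measure ((fun t => t + a) @^-1` A) = lebesgue_measure A.
Proof.
have ms : measurable_fun [set: measurableTypeR R] ((fun t => t + a) : measurableTypeR R -> measurableTypeR R).
  by apply: measurable_funD.
move=> mA; apply/esym/(@lebesgue_measure_unique R (pushforward_measure lebesgue_measure ms)) => //.
move=> _ [[x y] _ <-] /=; rewrite /pushforward.
have -> : (fun t : R => t + a) @^-1` `]x, y]%classic = `](x - a), (y - a)]%classic.
  apply/seteqP; split=> t /=; rewrite !in_itv /= ltrBlDr lerBrDr //.
rewrite !lebesgue_measure_itv /= !lte_fin ltrBlDr subrK; case: ifP => // _.
by rewrite -!EFinB; congr EFin; ring.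
Qed.

Lemma continuous_shift m (a : 'rV[R]_m) : continuous (fun y : 'rV[R]_m => y + a).
Proof.
move=> y; apply: for_continuous_rV => b.
rewrite (_ : (fun z => _) = (fun z : 'rV[R]_m => z 0 b + a 0 b)); last first.
  by apply/funext => z; rewrite mxE.
exact: (Ck_cont (CkD openT (Ck_coord openT 0 b) (Ck_cst openT 0 (a 0 b))) I).
Qed.

Lemma ge0_integral_shift m (f : borelType 'rV[R]_m -> \bar R) (a : 'rV[R]_m) :
  measurable_fun [set: borelType 'rV[R]_m] f ->
  (forall y, 0 <= f y)%E ->
  (\int[lebesgue_row m]_y f (y + a)%R = \int[lebesgue_row m]_y f y)%E.
Proof.
elim: m f a => [|m IH] f a mf f0.
  by apply: eq_integral => y _; congr f; apply/rowP => -[].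
have ms : measurable_fun [set: borelType 'rV[R]_m.+1]
   ((fun y => y + a) : borelType 'rV[R]_m.+1 -> borelType 'rV[R]_m.+1).
  apply: continuous_measurable_borel_map.
  exact: continuous_shift.
have [[a1 a2] aE] := cons_row_ex a; rewrite {}aE in ms *.
have mfa := measurableT_comp mf ms.
have fa0 y : (0 <= (f \o +%R^~ (cons_row (a1, a2))) y)%E by exact: f0.
rewrite (integral_lebesgue_succ mf f0).
rewrite (integral_lebesgue_succ mfa fa0).
pose g (t : R) : \bar R := (\int[lebesgue_row m]_v f (cons_row (t, v)))%E.
have mg : measurable_fun [set: measurableTypeR R] g.
  have mff := measurableT_comp mf (@measurable_cons_row R m).
  exact: (@measurable_fun_fubini_tonelli_F _ _ (measurableTypeR R) _ R
    (bfm_sigma_finite (lebesgue_row m)) _ mff (fun z => f0 (cons_row z))).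
have ms1 : measurable_fun [set: measurableTypeR R]
    ((fun t => t + a1) : measurableTypeR R -> measurableTypeR R).
  by apply: measurable_funD.
transitivity (\int[lebesgue_measure]_t g (t + a1)%R)%E.
  apply: eq_integral => t _ /=.
  under eq_integral do rewrite cons_rowB /=.
  apply: (IH (fun v => f (cons_row (t + a1, v)))) => //.
  exact: (measurableT_comp mf (measurable_cons_row2 (t + a1))).
have := @ge0_integral_pushforward _ _ _ _ R _ ms1 lebesgue_measure setT g.
rewrite preimage_setT => <- //; last by move=> t _; exact: integral_ge0.
by apply: eq_measure_integral => A mA _; exact: lebesgue_measure_shift.
Qed.

End LebesgueRow.

(** * Smooth steps and bumps *)

Section FlatFunction.
Variable R : realType.
Implicit Types t s : R.

(* All these functions are flat at 0; the family is closed under derivation. *)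
Definition flat (n : nat) (t : R) : R :=
  if 0 < t then t^-1 ^+ n * expR (- t^-1) else 0.

Lemma flat_le0 n t : t <= 0 -> flat n t = 0.
Proof. by rewrite /flat ltNge => ->. Qed.

Lemma flat_gt0 n t : 0 < t -> 0 < flat n t.
Proof. by move=> t0; rewrite /flat t0 mulr_gt0 ?expR_gt0// exprn_gt0// invr_gt0. Qed.

Lemma flat_ge0 n t : 0 <= flat n t.
Proof. by case: (ltP 0 t) => [/flat_gt0/ltW//|/flat_le0->]. Qed.

(** The exponential beats powers: with s = 1/t, the inequality exp(s/(n+1)) >= s/(n+1) is raised to
    the power n+1. As [flat n t / t] is [flat n.+1 t] for t > 0, this linear bound makes the
    difference quotients at 0 tend to 0. *)
Lemma flat_bound n t : `|flat n t| <= n.+1%:R ^+ n.+1 * `|t|.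
Proof.
have [t0|t0] := ltP 0 t; last by rewrite flat_le0// normr0 mulr_ge0 ?exprn_ge0.
rewrite (gtr0_norm t0) (gtr0_norm (flat_gt0 n t0)) /flat t0.
pose s := t^-1; have s0 : 0 < s by rewrite invr_gt0.
have n0 : 0 < n.+1%:R :> R by [].
have : (s / n.+1%:R) ^+ n.+1 <= expR s.
  have sE : s = n.+1%:R * (s / n.+1%:R) by rewrite mulrC divfK// gt_eqF.
  rewrite [in leRHS]sE expRM_natl; apply: lerXn2r; rewrite ?nnegrE ?expR_ge0 ?divr_ge0 ?ltW//.
  by apply: lt_trans (expR_gt1Dx _); rewrite ?ltrDr// mulf_neq0// ?invr_neq0// gt_eqF.
rewrite expr_div_n ler_pdivrMr ?exprn_gt0// exprS => h.
rewrite expRN -/s ler_pdivrMr ?expR_gt0//.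
have -> : n.+1%:R ^+ n.+1 * t * expR s = t * (expR s * n.+1%:R ^+ n.+1) by ring.
apply: (@le_trans _ _ (t * (s * s ^+ n))); last by rewrite ler_pM2l.
by rewrite mulrA mulfV ?gt_eqF// mul1r.
Qed.

Lemma is_derive_inv t : t != 0 -> is_derive t 1 (fun s : R => s^-1) (- t ^- 2).
Proof.
move=> t0; apply: is_derive_eq; first exact: is_deriveV.
by rewrite /= [_ *: _]mulr1.
Qed.

Lemma is_derive_flat n t : is_derive t 1 (flat n) (flat n.+2 t - n%:R * flat n.+1 t).
Proof.
have [t0|t0|->] := ltgtP t 0.
- rewrite !flat_le0 ?ltW// mulr0 subrr.
  apply: (near_eq_is_derive _ (f := cst 0)) => //.
  by near=> s; rewrite flat_le0//; apply: ltW; near: s; exact: lt_nbhsl.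
- pose g (s : R) : R := s^-1 ^+ n * expR (- s^-1).
  have tn0 : t != 0 by rewrite gt_eqF.
  have D : is_derive t 1 g (flat n.+2 t - n%:R * flat n.+1 t).
    rewrite /flat t0 /g.
    have D1 := is_derive_inv tn0.
    have D2 : is_derive t 1 (fun s : R => s^-1 ^+ n) (n%:R * t^-1 ^+ n.-1 * (- t ^- 2)).
      have D0 : is_derive (t^-1) 1 (fun x : R => x ^+ n) (n%:R * t^-1 ^+ n.-1).
        apply: DeriveDef; first exact: exprn_derivable.
        by rewrite exp_derive; rewrite /= [_ *: 1]mulr1.
      exact: (is_derive1_comp D0 D1).
    have D3 : is_derive t 1 (fun s : R => expR (- s^-1)) (expR (- t^-1) * (- - t ^- 2)).
      exact: (@is_derive1_comp _ expR (fun s => - s^-1)).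
    have [k1 k2] := is_deriveM D2 D3; apply: DeriveDef; first exact: k1.
    rewrite [LHS]k2 /= ![_ *: _]mulrC opprK.
    case: n {D2 g k1 k2} => [|n].
      by rewrite !mul0r subr0 addr0 expr0 mulr1 exprVn mulrC.
    rewrite /= !exprVn !exprS; field.
    by rewrite tn0 expf_neq0.
  apply: (near_eq_is_derive _ D).
  by near=> s; rewrite /g /flat ifT//; near: s; exact: lt_nbhsr.
- rewrite !flat_le0// mulr0 subrr.
  have H : (fun h : R => h^-1 *: (flat n (h *: (1 : R) + 0) - flat n 0)) @ 0^' --> (0 : R).
    apply/cvgrPdist_le => e e0; near=> h.
    have h0 : h != 0 by near: h; exact: nbhs_dnbhs_neq.
    rewrite (flat_le0 n (lexx _)) subr0 addr0 [h *: _]mulr1 sub0r normrN [_ *: _]mulrC.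
    have -> : flat n h * h^-1 = flat n.+1 h.
      by rewrite /flat; case: ifP => _; rewrite ?mul0r// exprSr mulrAC.
    apply: (le_trans (flat_bound _ _)).
    have C0 : 0 < n.+2%:R ^+ n.+2 :> R by rewrite exprn_gt0.
    rewrite mulrC -ler_pdivlMr//; near: h.
    by apply: dnbhs0_le; rewrite divr_gt0.
  apply: DeriveDef; first by apply/cvg_ex; exists 0.
  exact: cvg_lim H.
Unshelve. all: by end_near. Qed.

Lemma continuous_flat n : continuous (flat n).
Proof.
move=> t; apply/differentiable_continuous/derivable1_diffP.
by case: (is_derive_flat n t).
Qed.

Definition smooth_step t : R := flat 0 t / (flat 0 t + flat 0 (1 - t)).

Lemma smooth_step_den t : 0 < flat 0 t + flat 0 (1 - t).
Proof.
have [t0|t0] := ltP 0 t; first by rewrite ltr_pwDl ?flat_gt0 ?flat_ge0.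
by rewrite ltr_wpDl ?flat_ge0// flat_gt0// subr_gt0 (le_lt_trans t0).
Qed.

Lemma smooth_step_ge0 t : 0 <= smooth_step t.
Proof. by rewrite divr_ge0 ?flat_ge0// ltW// smooth_step_den. Qed.

Lemma smooth_step_le1 t : smooth_step t <= 1.
Proof. by rewrite ler_pdivrMr ?smooth_step_den// mul1r lerDl flat_ge0. Qed.

Lemma smooth_step0 t : t <= 0 -> smooth_step t = 0.
Proof. by move=> t0; rewrite /smooth_step flat_le0// mul0r. Qed.

Lemma smooth_step1 t : 1 <= t -> smooth_step t = 1.
Proof.
move=> t1; rewrite /smooth_step (@flat_le0 _ (1 - t)) ?subr_le0// addr0 divff//.
by rewrite gt_eqF// flat_gt0// (lt_le_trans ltr01).
Qed.

Definition dsmooth_step t : R :=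
  (flat 2 t * flat 0 (1 - t) + flat 0 t * flat 2 (1 - t)) /
  (flat 0 t + flat 0 (1 - t)) ^+ 2.

Lemma is_derive_smooth_step t : is_derive t 1 smooth_step (dsmooth_step t).
Proof.
have D1 : is_derive t 1 (flat 0) (flat 2 t).
  by have := is_derive_flat 0 t; rewrite mul0r subr0.
have D2 : is_derive t 1 (fun s => flat 0 (1 - s)) (- flat 2 (1 - t)).
  have D3 : is_derive (1 - t) 1 (flat 0) (flat 2 (1 - t)).
    by have := is_derive_flat 0 (1 - t); rewrite mul0r subr0.
  have D4 : is_derive t 1 (fun s : R => 1 - s) (- 1).
    by have := is_deriveB (is_derive_cst (1 : R) t 1) (is_derive_id t 1); rewrite sub0r.
  by have := @is_derive1_comp _ (flat 0) (fun s => 1 - s) t _ _ D3 D4; rewrite mulrN1.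
have D5 := is_deriveD D1 D2.
have n0 : flat 0 t + flat 0 (1 - t) != 0 by rewrite gt_eqF// smooth_step_den.
have D6 := @is_derive1_comp _ _ (flat 0 + (fun s => flat 0 (1 - s))) t _ _ (is_derive_inv n0) D5.
have D7 := is_deriveM D1 D6.
have [k1 k2] := D7; apply: DeriveDef; first exact: k1.
rewrite [LHS]k2 /= /dsmooth_step !fctE.
rewrite ![_ *: _]mulrC; move: n0; set A := flat 0 t; set B := flat 0 (1 - t) => n0.
by rewrite [LHS]addrC; field.
Qed.

Lemma dsmooth_step_bounded : exists2 B : R, 0 < B & forall t, `|dsmooth_step t| <= B.
Proof.
have C : continuous dsmooth_step.
  have c1 n (t : R) : {for t, continuous (fun s : R => flat n (1 - s))}.
    apply: continuous_comp; last exact: continuous_flat.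
    by apply: continuousB; [exact: cst_continuous|exact: cvg_id].
  have c0 n (t : R) : {for t, continuous (flat n)} by exact: continuous_flat.
  have cD (t : R) : {for t, continuous (fun s : R => flat 0 s + flat 0 (1 - s))}.
    exact: for_continuousD (c0 _ _) (c1 _ _).
  move=> t; apply: (@for_continuousM _ _ (fun s : R => flat 2 s * flat 0 (1 - s) + flat 0 s * flat 2 (1 - s))
    (fun s : R => ((flat 0 s + flat 0 (1 - s)) ^+ 2)^-1)).
    exact: for_continuousD (for_continuousM (c0 _ _) (c1 _ _)) (for_continuousM (c0 _ _) (c1 _ _)).
  apply: for_continuousV; first by rewrite expf_neq0// gt_eqF// smooth_step_den.
  exact: for_continuousM (cD _) (cD _).
have [c _ Hc] := @EVT_max R (fun t => `|dsmooth_step t|) 0 1 ler01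
  (continuous_subspaceT (fun t => cvg_norm (C t))).
exists (`|dsmooth_step c| + 1); first by rewrite ltr_wpDl.
move=> t; apply: (@le_trans _ _ `|dsmooth_step c|); last by rewrite lerDl.
have [t0|t0] := leP t 0.
  by rewrite /dsmooth_step !(@flat_le0 _ t)// !mul0r addr0 mul0r normr0.
have [t1|t1] := leP 1 t.
  by rewrite /dsmooth_step !(@flat_le0 _ (1 - t)) ?subr_le0// !mulr0 addr0 mul0r normr0.
by apply: Hc; rewrite in_itv /= !ltW.
Qed.

End FlatFunction.

Section CkStep.
Variables (R : realType) (m : nat).
Local Notation V := 'rV[R]_m.
Implicit Types (f : V -> R) (y : V) (U K : set V).

Lemma Ck_flat k n U f : open U -> Ck k U f -> Ck k U (flat n \o f).
Proof.
move=> oU; elim: k n => [|k IH] n F.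
  split=> // y Uy; apply: continuous_comp; first exact: (Ck_cont F Uy).
  exact: continuous_flat.
apply: (Ck_comp1S oU (dp := fun t => flat n.+2 t - n%:R * flat n.+1 t)) => //.
  by move=> y _; exact: is_derive_flat.
by apply: CkB => //; [exact/IH/CkW|apply: CkZ => //; exact/IH/CkW].
Qed.

Lemma Ck_smooth_step k U f : open U -> Ck k U f -> Ck k U (smooth_step (R := R) \o f).
Proof.
move=> oU F; apply: CkM => //; first exact: Ck_flat.
apply: CkV => //; first by move=> y _; rewrite gt_eqF// smooth_step_den.
apply: CkD => //; first exact: Ck_flat.
by apply: (@Ck_flat k 0 U (fun y => 1 - f y)) => //; apply: CkB => //; exact: Ck_cst.
Qed.

(** A point outside [U] lies in the open complement of [K], where [f] is identically 0. This turns
    functions known only on a chart image into functions on the whole space, to which [irow]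
    applies. *)
Lemma Ck_extend0 k U K f : open U -> closed K -> K `<=` U ->
  (forall y, ~ K y -> f y = 0) -> Ck k U f -> Ck k setT f.
Proof.
move=> oU cK KU f0 F; apply: Ck_local => y _.
have [Uy|nUy] := pselect (U y).
  by exists U; split=> //; rewrite setTI.
exists (~` K); split; [exact: closed_openC|by move=> /KU|rewrite setTI].
apply: (@Ck_eq _ _ _ _ (fun=> 0)); first exact: closed_openC.
  by move=> z nKz; rewrite f0.
by apply: Ck_cst; exact: closed_openC.
Qed.

Lemma quadE (h : 'M[R]_m) (v : V) : quad h v = \sum_a \sum_b v 0 a * h a b * v 0 b.
Proof.
rewrite /quad mxE exchange_big /=; apply: eq_bigr => b _.
by rewrite !mxE mulr_suml.
Qed.

Lemma Ck_quad k U (h : 'M[R]_m) (y0 : V) : open U -> Ck k U (fun y => quad h (y - y0)).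
Proof.
move=> oU.
have C a : Ck k U (fun y => y 0 a - y0 0 a).
  by apply: CkB => //; [exact: Ck_coord|exact: Ck_cst].
apply: (@Ck_eq _ _ _ _ (fun y => \sum_a \sum_b (y 0 a - y0 0 a) * h a b * (y 0 b - y0 0 b))) => //.
  by move=> y _; rewrite quadE; apply: eq_bigr => a _; apply: eq_bigr => b _; rewrite !mxE.
by do 2!(apply: Ck_sum => // ? _); apply: CkM => //; apply: CkM => //; exact: Ck_cst.
Qed.

(** Built on a quadratic form because the sup norm of row vectors is not smooth. Taking for [h] the
    metric at the centre makes the gradient bound intrinsic; [h = 1] gives plain Euclidean bumps. *)
Definition ellipsoid_bump (h : 'M[R]_m) (y0 : V) (r : R) (y : V) : R :=
  smooth_step (2 - quad h (y - y0) / r ^+ 2).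

Lemma Ck_ellipsoid_bump k U h y0 r : open U -> Ck k U (ellipsoid_bump h y0 r).
Proof.
move=> oU; apply: (@Ck_smooth_step k U (fun y => 2 - quad h (y - y0) / r ^+ 2)) => //.
apply: CkB => //; first exact: Ck_cst.
by apply: CkM => //; [exact: Ck_quad|exact: Ck_cst].
Qed.

Lemma ellipsoid_bump1 h y0 r y : 0 < r -> quad h (y - y0) <= r ^+ 2 ->
  ellipsoid_bump h y0 r y = 1.
Proof.
move=> r0 q; apply: smooth_step1.
have : quad h (y - y0) / r ^+ 2 <= 1 by rewrite ler_pdivrMr ?exprn_gt0// mul1r.
by move: (_ / _) => x; lra.
Qed.

Lemma ellipsoid_bump0 h y0 r y : 0 < r -> 2 * r ^+ 2 <= quad h (y - y0) ->
  ellipsoid_bump h y0 r y = 0.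
Proof.
move=> r0 q; apply: smooth_step0.
have : 2 <= quad h (y - y0) / r ^+ 2 by rewrite ler_pdivlMr ?exprn_gt0.
by move: (_ / _) => x; lra.
Qed.

End CkStep.

Lemma for_continuous_sum (R : realType) (T : topologicalType) (I : Type) (s : seq I)
    (F : I -> T -> R) y : (forall i, {for y, continuous (F i)}) ->
  {for y, continuous (fun z => \sum_(i <- s) F i z)}.
Proof.
move=> cF; elim: s => [|i s IH].
  rewrite (_ : (fun z => _) = cst 0); first exact: cst_continuous.
  by apply/funext => z; rewrite big_nil.
rewrite (_ : (fun z => _) = (fun z => F i z + \sum_(i <- s) F i z)); last first.
  by apply/funext => z; rewrite big_cons.
exact: for_continuousD.
Qed.

(** * Integration by parts *)

Section IntegralRow.
Variables (R : realType) (m : nat).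
Local Notation V := 'rV[R]_m.
Implicit Types (f h : V -> R) (y v : V).

Definition irow f : R := \int[lebesgue_row R m]_y f y.

Definition supp_le (r : R) f := forall y, r <= `|y| -> f y = 0.

Lemma supp_le_leq r r' f : r <= r' -> supp_le r f -> supp_le r' f.
Proof. by move=> rr H y /(le_trans rr)/H. Qed.

Lemma continuous_bounded_on_ball f (r : R) : continuous f ->
  exists2 M : R, 0 < M & forall y, `|y| <= r -> `|f y| <= M.
Proof.
move=> cf; have [r0|r0] := ltP r 0.
  by exists 1 => // y yr; have := le_lt_trans yr r0; rewrite ltNge normr_ge0.
have K : compact [set y : V | `|y| <= r].
  apply: bounded_closed_compact.
    by exists r; split=> [|x rx y /= yr]; [exact: num_real|exact: le_trans yr (ltW rx)].
  rewrite (_ : mkset _ = (fun y : V => `|y|) @^-1` [set x | x <= r]) //.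
  by apply: closed_comp; [move=> y _; exact: norm_continuous|exact: closed_le].
have [||c _ Hc] := @EVT_max_rV R m (fun y => `|f y|) _ _ K.
- by exists 0; rewrite /= normr0.
- by apply: continuous_subspaceT => y; apply: continuous_comp; [exact: cf|exact: norm_continuous].
exists (`|f c| + 1); first by rewrite ltr_wpDl.
by move=> y yr; apply: le_trans (_ : `|f c| <= _); [apply: Hc; rewrite inE|rewrite lerDl].
Qed.

Lemma continuous_bounded f (r : R) : continuous f -> supp_le r f ->
  exists2 M : R, 0 < M & forall y, `|f y| <= M.
Proof.
move=> cf sf; have [M M0 H] := continuous_bounded_on_ball r cf.
exists M => // y; have [/H//|/ltW/sf->] := leP `|y| r.
by rewrite normr0 ltW.
Qed.

Definition ball_volume (r : R) : \bar R := lebesgue_row R m [set y : V | `|y| < r].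

Lemma measurable_norm_lt (r : R) : measurable ([set y : V | `|y| < r] : set (borelType V)).
Proof. by apply: open_measurable_borel; exact: open_norm_lt. Qed.

Lemma ball_volume_lty (r : R) : (ball_volume r < +oo)%E.
Proof.
have [k rk] : exists k : nat, r <= k%:R.
  by exists (Num.truncn `|r|).+1; apply: le_trans (ler_norm _) _; apply/ltW/truncnS_gt.
apply: le_lt_trans (bfmP (lebesgue_row R m) k).
by apply: le_measure; rewrite ?inE; try exact: measurable_norm_lt;
  move=> y /= /lt_le_trans; apply.
Qed.

Lemma integrable_indic_norm_lt (r : R) :
  (lebesgue_row R m).-integrable setT (EFin \o \1_[set y : V | `|y| < r]).
Proof.
apply/integrableP; split.
  by apply/measurable_EFinP; apply: measurable_indic; exact: measurable_norm_lt.
under eq_integral do rewrite /= ger0_norm//.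
by rewrite integral_indic ?setIT//; [exact: ball_volume_lty|exact: measurable_norm_lt].
Qed.

Lemma integrable_indic_ball (r M : R) :
  (lebesgue_row R m).-integrable setT (EFin \o (fun y => M * \1_[set y : V | `|y| < r] y)).
Proof.
have -> : EFin \o (fun y => M * \1_[set y : V | `|y| < r] y) =
   (fun y => M%:E * (\1_[set y : V | `|y| < r] y)%:E)%E.
  by apply/funext => y /=; rewrite EFinM.
apply: integrableZl => //.
exact: (integrable_indic_norm_lt r).
Qed.

Lemma integral_indic_ball (r M : R) :
  irow (fun y => M * \1_[set y : V | `|y| < r] y) = M * fine (ball_volume r).
Proof.
rewrite /irow RintegralZl//; last first.
  exact: (integrable_indic_norm_lt r).
congr (_ * _); rewrite /Rintegral integral_indic// ?setIT//.
exact: measurable_norm_lt.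
Qed.

Lemma integrable_supp f (r : R) : continuous f -> supp_le r f ->
  (lebesgue_row R m).-integrable setT (EFin \o f).
Proof.
move=> cf sf; have [M M0 HM] := continuous_bounded cf sf.
apply: (le_integrable measurableT _ _ (integrable_indic_ball r M)) => /=.
  by apply/measurable_EFinP; exact: continuous_measurable_borel.
have M0' := ltW M0.
move=> y _; rewrite lee_fin [leRHS]ger0_norm ?mulr_ge0// indicE.
have [yr|yr] := ltP `|y| r; first by rewrite mem_set// mulr1; exact: HM.
by rewrite sf// normr0 mulr_ge0.
Qed.

Lemma irowD f h r : continuous f -> continuous h -> supp_le r f -> supp_le r h ->
  irow (fun y => f y + h y) = irow f + irow h.
Proof.
move=> cf ch sf sh; apply: RintegralD => //.
  exact: integrable_supp cf sf.
exact: integrable_supp ch sh.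
Qed.

Lemma irowZ f r (c : R) : continuous f -> supp_le r f ->
  irow (fun y => c * f y) = c * irow f.
Proof. by move=> cf sf; apply: RintegralZl => //; exact: integrable_supp cf sf. Qed.

Lemma irowN f r : continuous f -> supp_le r f -> irow (fun y => - f y) = - irow f.
Proof.
move=> cf sf; rewrite -mulN1r -(irowZ _ cf sf); congr irow.
by apply/funext => y; rewrite mulN1r.
Qed.

Lemma irow0 : irow (fun=> 0) = 0.
Proof. by rewrite /irow /Rintegral integral0. Qed.

Lemma irow_sum (I : Type) (s : seq I) (F : I -> V -> R) r :
  (forall i, continuous (F i)) -> (forall i, supp_le r (F i)) ->
  irow (fun y => \sum_(i <- s) F i y) = \sum_(i <- s) irow (F i).
Proof.
move=> cF sF; elim: s => [|i s IH].
  by rewrite big_nil -[RHS]irow0; congr irow; apply/funext => y; rewrite big_nil.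
rewrite big_cons -IH -(irowD (r := r))//.
- by congr irow; apply/funext => y; rewrite big_cons.
- by move=> y; apply: for_continuous_sum => j; exact: cF.
- by move=> y ry; rewrite big1// => j _; exact: sF.
Qed.

Lemma irow_bound f (r M : R) : continuous f -> supp_le r f ->
  (forall y, `|f y| <= M) -> `|irow f| <= M * fine (ball_volume r).
Proof.
move=> cf sf HM; apply: (le_trans (le_normr_Rintegral _ (integrable_supp cf sf))) => //.
rewrite -integral_indic_ball; apply: le_Rintegral => //.
- by have := integrable_norm (integrable_supp cf sf).
- exact: integrable_indic_ball.
move=> y _; rewrite indicE; have [yr|yr] := ltP `|y| r; first by rewrite mem_set// mulr1.
by rewrite sf// normr0 mulr_ge0//; apply: le_trans (HM 0).
Qed.

Lemma irow_shift f r (a : V) : continuous f -> supp_le r f ->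
  irow (fun y => f (y + a)) = irow f.
Proof.
move=> cf sf; rewrite /irow /Rintegral; congr fine.
have mf : measurable_fun [set: borelType V] (EFin \o f : borelType V -> \bar R).
  by apply/measurable_EFinP; exact: continuous_measurable_borel.
rewrite integralE [RHS]integralE; congr (_ - _)%E.
  by apply: etrans (ge0_integral_shift a (measurable_funepos mf) (funepos_ge0 _));
  apply: eq_integral => y _; rewrite ?funepos.unlock ?funeneg.unlock.
by apply: etrans (ge0_integral_shift a (measurable_funeneg mf) (funeneg_ge0 _));
  apply: eq_integral => y _; rewrite ?funepos.unlock ?funeneg.unlock.
Qed.

Lemma is_derive_irow (F D : R -> V -> R) (r M : R) (s0 : R) :
  (forall s, continuous (F s)) ->
  (forall s, `|s - s0| < 1 -> supp_le r (F s)) ->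
  (forall s, `|s - s0| < 1 -> supp_le r (D s)) ->
  (forall (s : R) y, is_derive s 1 (F^~ y) (D s y)) ->
  (forall s y, `|s - s0| < 1 -> `|D s y| <= M) ->
  is_derive s0 1 (fun s => irow (F s)) (irow (D s0)).
Proof.
move=> cF sF sD dF bD.
have pE (s : R) y : partial1of2 F s y = D s y.
  by rewrite /partial1of2 derive1E; case: (dF s y).
have M0 : 0 <= M by apply: le_trans (bD s0 0 _); rewrite ?subrr ?normr0.
have itvN (s : R) : s0 - 1 < s < s0 + 1 -> `|s - s0| < 1.
  by move=> /andP[s1 s2]; rewrite ltr_norml; apply/andP; split; lra.
have H1 : `](s0 - 1), (s0 + 1)[%classic s0.
  by rewrite /= in_itv /= ltrBlDr ltrDl ltr01.
have H2 s : `](s0 - 1), (s0 + 1)[%classic s -> (lebesgue_row R m).-integrable setT (EFin \o F s).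
  by rewrite /= in_itv /= => hs; apply: integrable_supp (cF s) (sF s _); exact: itvN.
have H3 (s : R) (y : V) : `](s0 - 1), (s0 + 1)[%classic s -> [set: V] y -> derivable (F^~ y) s 1.
  by move=> _ _; case: (dF s y).
have G0 (y : V) : 0 <= M * \1_[set y : V | `|y| < r] y by rewrite mulr_ge0.
have H4 s (y : V) : `](s0 - 1), (s0 + 1)[%classic s -> [set: V] y ->
    `|partial1of2 F s y| <= M * \1_[set y : V | `|y| < r] y.
  rewrite /= in_itv /= => /itvN hs _; rewrite pE indicE.
  have [yr|yr] := ltP `|y| r; last by rewrite (sD s hs)// normr0 mulr_ge0.
  by rewrite mem_set// mulr1; exact: bD.
have K1 := derivable_under_integral measurableT H1 H2 H3 G0 (integrable_indic_ball r M) H4.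
have K2 := differentiation_under_integral measurableT H1 H2 H3 G0 (integrable_indic_ball r M) H4.
apply: DeriveDef; first exact: K1.
rewrite -derive1E [LHS]K2 /irow /Rintegral; congr fine.
by apply: eq_integral => y _; rewrite pE.
Qed.

End IntegralRow.

Lemma open_norm_sub_lt (R : realType) p (v : 'rV[R]_p) (r : R) :
  open [set w : 'rV[R]_p | `|w - v| < r].
Proof.
rewrite (_ : mkset _ = (fun w : 'rV[R]_p => w - v) @^-1` [set w : 'rV[R]_p | `|w| < r]) //.
by apply: open_comp; [move=> w _; exact: continuous_shift|exact: open_norm_lt].
Qed.

Lemma is_derive_reflect (R : realType) (G : R -> R) (d : R) :
  is_derive (0 : R) 1 G d -> is_derive (0 : R) 1 (fun s => - G (- s)) d.
Proof.
move=> D.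
have N : is_derive (0 : R) 1 (fun s : R => - s) (-1) by exact: is_deriveN.
have D0 : is_derive (- 0 : R) 1 G d by rewrite oppr0.
have := is_deriveN (is_derive1_comp D0 N).
by rewrite mulrN1 opprK.
Qed.

Section IntegrationByParts.
Variables (R : realType) (m : nat).
Local Notation V := 'rV[R]_m.
Implicit Types (f h k w : V -> R) (y v x : V).

Lemma Ck_setT_continuous n f : Ck n setT f -> continuous f.
Proof. by move=> F y; exact: (Ck_cont F I). Qed.

Lemma Ck_shift n f v : Ck n setT f -> Ck n setT (fun y => f (y + v)).
Proof.
move=> F; apply: (@Ck_comp R m m n setT setT f (fun y => y + v) openT openT (fun _ _ => I) _ F).
move=> c; rewrite (_ : (fun z => _) = (fun z : V => z 0 c + v 0 c)); last first.
  by apply/funext => z; rewrite mxE.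
by apply: (CkD openT); [apply: Ck_coord; exact: openT|apply: Ck_cst; exact: openT].
Qed.

Lemma supp_le_partial r f a : supp_le r f -> supp_le (r + 1) (partial a f).
Proof.
move=> sf y ry; rewrite (@partial_near R m f (fun=> 0)).
  exact: (derive_cst 0).
apply/nbhs_ballP; exists 1 => //= z; rewrite -ball_normE /= => yz; apply: sf.
have := ler_normD (y - z) z; rewrite subrK; move: `|y - z| `|y| `|z| yz ry => *; lra.
Qed.

Lemma partial_shift f b v y : partial b (fun z => f (z + v)) y = partial b f (y + v).
Proof.
have E : (fun t : R => t^-1 *: (f (t *: delta_mx 0 b + y + v) - f (y + v))) =
         (fun t : R => t^-1 *: (f (t *: delta_mx 0 b + (y + v)) - f (y + v))).
  by apply/funext => t; rewrite addrA.
by rewrite /partial /derive E.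
Qed.

Lemma supp_le_mull r f h : supp_le r f -> supp_le r (fun y => f y * h y).
Proof. by move=> sf y /sf ->; rewrite mul0r. Qed.

Lemma supp_le_mulr r f h : supp_le r h -> supp_le r (fun y => f y * h y).
Proof. by move=> sf y /sf ->; rewrite mulr0. Qed.

Lemma norm_delta (a : 'I_m) : `|delta_mx 0 a : V| <= 1.
Proof.
by apply: norm_rV_le => // i; rewrite mxE eqxx /=; case: eqP; rewrite ?normr0 ?normr1.
Qed.

Lemma supp_le_shift r f (a : V) : supp_le r f -> supp_le (r + `|a|) (fun y => f (y + a)).
Proof.
move=> sf y ry; apply: sf; have := ler_normD (y + a) (- a).
by rewrite addrK normrN; move: `|y + a| `|y| `|a| ry => *; lra.
Qed.

Lemma continuous_comp_shift f (a : V) : continuous f -> continuous (fun y => f (y + a)).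
Proof. by move=> cf y; apply: continuous_comp; [exact: continuous_shift|exact: cf]. Qed.

Lemma supp_le_line r f a (s : R) : supp_le r f ->
  supp_le (r + `|s|) (fun y => f (y + s *: delta_mx 0 a)).
Proof.
move=> sf y ry; apply: (@supp_le_shift _ _ (s *: delta_mx 0 a) sf).
by apply: le_trans ry; rewrite lerD2l normrZ -[leRHS]mulr1 ler_wpM2l// norm_delta.
Qed.

(** The disjunction lets the compact support come either from the translated factor [f] or from the
    fixed factor [w]; both variants occur in [irow_partialC]. *)
Lemma is_derive_irow_line f w r a : Ck 1 setT f -> continuous w ->
  (forall (s : R) y, `|s| < 1 -> r <= `|y| ->
     f (y + s *: delta_mx 0 a) = 0 /\ partial a f (y + s *: delta_mx 0 a) = 0 \/ w y = 0) ->
  is_derive (0 : R) 1 (fun s : R => irow (fun y => f (y + s *: delta_mx 0 a) * w y))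
    (irow (fun y => partial a f y * w y)).
Proof.
move=> F cw sf.
have cp : continuous (partial a f) := Ck_setT_continuous (Ck_partial a F).
have [M1 M10 H1] := continuous_bounded_on_ball (r + 1) cp.
have [M2 M20 H2] := continuous_bounded_on_ball r cw.
have := @is_derive_irow R m (fun s y => f (y + s *: delta_mx 0 a) * w y)
  (fun s y => partial a f (y + s *: delta_mx 0 a) * w y) r (M1 * M2) 0.
rewrite (_ : irow (fun y => partial a f (y + 0 *: delta_mx 0 a) * w y) =
             irow (fun y => partial a f y * w y)); last first.
  by congr irow; apply/funext => y; rewrite scale0r addr0.
apply.
- move=> s y; apply: for_continuousM; last exact: cw.
  exact: continuous_comp_shift (Ck_setT_continuous F) _.
- move=> s; rewrite subr0 => hs y yr.
  by have [[-> _]|->] := sf s y hs yr; rewrite ?mul0r ?mulr0.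
- move=> s; rewrite subr0 => hs y yr.
  by have [[_ ->]|->] := sf s y hs yr; rewrite ?mul0r ?mulr0.
- move=> s y; have d : derivable f (y + s *: delta_mx 0 a) (delta_mx 0 a) := Ck_derivable F I.
  have [k1 k2] := is_deriveM (is_derive_line d) (is_derive_cst (w y) s 1).
  apply: DeriveDef; first exact: k1.
  by rewrite [LHS]k2 scaler0 add0r [_ *: _]mulrC.
- move=> s y; rewrite subr0 => hs; rewrite normrM.
  have [yr|yr] := leP `|y| r.
    apply: ler_pM => //; last exact: H2.
    apply: H1; apply: (le_trans (ler_normD _ _)); apply: lerD => //.
    rewrite normrZ; apply: (@le_trans _ _ (1 * 1)); last by rewrite mulr1.
    by apply: ler_pM => //; [exact: ltW|exact: norm_delta].
  rewrite -normrM; have [[_ ->]|->] := sf s y hs (ltW yr);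
    rewrite ?mul0r ?mulr0 normr0 mulr_ge0//; exact: ltW.
Qed.

Lemma is_derive_irow_line_suppl f w r a : Ck 1 setT f -> continuous w -> supp_le r f ->
  is_derive (0 : R) 1 (fun s : R => irow (fun y => f (y + s *: delta_mx 0 a) * w y))
    (irow (fun y => partial a f y * w y)).
Proof.
(* One unit of the margin pays for the displacement [s], the other for the support of [partial a f],
   which [supp_le_partial] only locates within [r + 1]. *)
move=> F cw sf; apply: (is_derive_irow_line (r := r + 2)) => // s y hs yr; left.
split; first by have := @supp_le_line r f a s sf y; apply; move: hs yr; lra.
by have := @supp_le_line (r + 1) _ a s (supp_le_partial a sf) y; apply; move: hs yr; lra.
Qed.

Lemma is_derive_irow_line_suppr f w r a : Ck 1 setT f -> continuous w -> supp_le r w ->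
  is_derive (0 : R) 1 (fun s : R => irow (fun y => f (y + s *: delta_mx 0 a) * w y))
    (irow (fun y => partial a f y * w y)).
Proof.
by move=> F cw sw; apply: (is_derive_irow_line (r := r)) => // s y _ yr; right; exact: sw.
Qed.

(** By translation invariance the integral of f(y + s e_a) does not depend on s, and its derivative
    at s = 0 is the integral of [partial a f]. All integrations by parts descend from this. *)
Lemma irow_partial f r a : Ck 1 setT f -> supp_le r f -> irow (partial a f) = 0.
Proof.
move=> F sf.
have cf := Ck_setT_continuous F.
have [_ D] := is_derive_irow_line_suppl a F (@cst_continuous V R 1) sf.
have -> : irow (partial a f) = irow (fun y => partial a f y * 1).
  by congr irow; apply/funext => y; rewrite mulr1.
rewrite -D (_ : (fun s => _) = cst (irow f)); first exact: derive_cst.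
apply/funext => s /=; rewrite -[RHS](irow_shift (s *: delta_mx 0 a) cf sf).
by congr irow; apply/funext => y; rewrite mulr1.
Qed.

Lemma irow_parts f h r a : Ck 1 setT f -> Ck 1 setT h -> supp_le r f ->
  irow (fun y => partial a f y * h y) = - irow (fun y => f y * partial a h y).
Proof.
move=> F H sf.
have E : partial a (fun y => f y * h y) = (fun y => partial a f y * h y + f y * partial a h y).
  by apply/funext => y; apply: partialM; [exact: Ck_derivable F I|exact: Ck_derivable H I].
have := irow_partial a (CkM openT F H) (supp_le_mull h sf).
have c1 := Ck_setT_continuous (CkM openT (Ck_partial a F) (CkW H)).
have c2 := Ck_setT_continuous (CkM openT (CkW F) (Ck_partial a H)).
have s1 := supp_le_mull h (supp_le_partial a sf).
have s2 : supp_le (r + 1) (fun y => f y * partial a h y).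
  by apply: supp_le_mull; apply: supp_le_leq sf; rewrite lerDl.
by rewrite E (irowD c1 c2 s1 s2) => /eqP; rewrite addr_eq0 => /eqP.
Qed.

(* Second derivatives never appear: both sides are the derivative at 0 of
   s |-> irow (h (y + s e_a) * d_b k), computed after moving the translation. *)
Lemma irow_partialC h k r a b : Ck 1 setT h -> Ck 1 setT k -> supp_le r h ->
  irow (fun y => partial a h y * partial b k y) =
  irow (fun y => partial b h y * partial a k y).
Proof.
move=> H K sh.
have [_ D1] := is_derive_irow_line_suppl a H (Ck_setT_continuous (Ck_partial b K)) sh.
have E (s : R) : irow (fun y => h (y + s *: delta_mx 0 a) * partial b k y) =
    - irow (fun y => k (y + (- s) *: delta_mx 0 a) * partial b h y).
  have Hs := Ck_shift (s *: delta_mx 0 a) H.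
  have ss := @supp_le_line r h a s sh.
  have -> : irow (fun y => h (y + s *: delta_mx 0 a) * partial b k y) =
     - irow (fun y => partial b (fun z => h (z + s *: delta_mx 0 a)) y * k y).
    by rewrite (irow_parts b Hs K ss) opprK.
  congr (- _).
  have c1 : continuous (fun y => partial b h y * k (y + (- s) *: delta_mx 0 a)).
    move=> y; apply: for_continuousM; first exact: (Ck_setT_continuous (Ck_partial b H)).
    exact: continuous_comp_shift (Ck_setT_continuous K) _.
  have s1 := supp_le_mull (fun y => k (y + (- s) *: delta_mx 0 a)) (supp_le_partial b sh).
  transitivity (irow (fun y => partial b h y * k (y + (- s) *: delta_mx 0 a))); last first.
    by congr irow; apply/funext => y; rewrite mulrC.
  rewrite -(irow_shift (s *: delta_mx 0 a) c1 s1); congr irow; apply/funext => y.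
  rewrite -addrA -scalerDl subrr scale0r addr0; congr (_ * _).
  exact: partial_shift.
have cb : continuous (partial b h) := Ck_setT_continuous (Ck_partial b H).
have D2 := is_derive_irow_line_suppr a K cb (supp_le_partial b sh).
have [_ D4] := is_derive_reflect D2.
transitivity (irow (fun y => partial a k y * partial b h y)); last first.
  by congr irow; apply/funext => y; rewrite mulrC.
rewrite -D1 -D4; congr (derive _ (0 : R) (1 : R)); apply/funext => s; exact: E.
Qed.

Lemma lebesgue_row_ball_gt0 p (y : 'rV[R]_p) (e : R) : 0 < e ->
  (0 < lebesgue_row R p [set v : 'rV[R]_p | `|v - y|%R < e]%R)%E.
Proof.
elim: p y e => [|p IH] y e e0.
  rewrite /= /dirac indicE mem_set ?lte_fin//=.
  by rewrite (_ : 0 - y = 0) ?normr0//; apply/rowP => -[].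
have [[t v] ->] := cons_row_ex y.
rewrite /= /pushforward.
have mB : measurable ([set w : 'rV[R]_p | `|w - v| < e / 2] : set (borelType 'rV[R]_p)).
  by apply: sub_sigma_algebra; exact: open_norm_sub_lt.
have mS : measurable (cons_row (R := R) (m := p) @^-1` [set w | `|w - cons_row (t, v)| < e]
   : set (R * borelType 'rV[R]_p)).
  rewrite -[X in measurable X]setTI; apply: measurable_cons_row => //.
  by apply: sub_sigma_algebra; exact: open_norm_sub_lt.
have mI : measurable (`](t - e / 2), (t + e / 2)[%classic : set (measurableTypeR R)).
  exact: measurable_itv.
apply: (@lt_le_trans _ _ ((lebesgue_measure \x bfm_sigma_finite (lebesgue_row R p))%E
   (`](t - e / 2), (t + e / 2)[%classic `*` [set w : 'rV[R]_p | `|w - v| < e / 2]))).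
  rewrite product_measure1E//= lebesgue_measure_itv /= lte_fin.
  rewrite ifT; last by move: e0; lra.
  by apply: mule_gt0; [rewrite -EFinB lte_fin; move: e0; lra|apply: IH; rewrite divr_gt0].
apply: le_measure; rewrite ?inE//; first exact: measurableX.
move=> [s w] /= []; rewrite in_itv /= => /andP[s1 s2] hw.
apply: (@le_lt_trans _ _ (e / 2)); last by move: e0; lra.
apply: cons_row_le => /=; last exact: ltW.
by apply: ltW; rewrite ltr_norml; apply/andP; split; lra.
Qed.

Lemma irow_gt0 f r y0 : continuous f -> supp_le r f -> (forall y, 0 <= f y) ->
  0 < f y0 -> 0 < irow f.
Proof.
move=> cf sf f0 fy0.
have c0 : 0 < f y0 / 2 by rewrite divr_gt0.
have /cvgrPdist_le/(_ _ c0)/nbhs_ballP[e /= e0 He] := cf y0.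
pose B : set (borelType V) := [set v : V | `|v - y0| < e].
have oB : open (B : set V).
  exact: open_norm_sub_lt.
have mB : measurable B by exact: sub_sigma_algebra.
have fB : (lebesgue_row R m B < +oo)%E.
  apply: le_lt_trans (ball_volume_lty m (e + `|y0|)); apply: le_measure; rewrite ?inE//.
    exact: measurable_norm_lt.
  move=> y /= yB; have := ler_normD (y - y0) y0; rewrite subrK => h.
  by apply: (le_lt_trans h); rewrite ltrD2r.
have iB : (lebesgue_row R m).-integrable setT (EFin \o \1_B).
  apply/integrableP; split; first by apply/measurable_EFinP; exact: measurable_indic.
  under eq_integral do rewrite /= ger0_norm//.
  by rewrite integral_indic ?setIT.
apply: (@lt_le_trans _ _ (irow (fun y => f y0 / 2 * \1_B y))).
  rewrite /irow RintegralZl// mulr_gt0// /Rintegral integral_indic// setIT.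
  by rewrite fine_gt0// fB andbT; exact: lebesgue_row_ball_gt0.
apply: le_Rintegral => //.
- have -> : EFin \o (fun y => f y0 / 2 * \1_B y) = (fun y => (f y0 / 2)%:E * (\1_B y)%:E)%E.
    by apply/funext => y /=; rewrite EFinM.
  exact: integrableZl.
- exact: integrable_supp cf sf.
move=> y _; rewrite indicE; case: (boolP (y \in B)) => [|_]; last by rewrite mulr0.
rewrite inE /B /= => yB; rewrite mulr1.
have := He y; rewrite -ball_normE /= distrC => /(_ yB).
by rewrite ler_norml => /andP[h1 h2]; lra.
Qed.

End IntegrationByParts.

Lemma for_continuousN (R : realType) (T : topologicalType) (f : T -> R) y :
  {for y, continuous f} -> {for y, continuous (fun z => - f z)}.
Proof. by move=> F; exact: (cvgN F). Qed.

(** * Weyl's lemma *)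

Section DirectionalDerivative.
Variables (R : realType) (m : nat).
Local Notation V := 'rV[R]_m.
Implicit Types (f : V -> R) (y v : V).

Lemma is_derive_from_line f y v d : is_derive (0 : R) 1 (fun s : R => f (y + s *: v)) d ->
  is_derive y v f d.
Proof.
have E : (fun h : R => h^-1 *: (f (y + (h *: (1 : R) + 0) *: v) - f (y + (0 : R) *: v))) =
         (fun h : R => h^-1 *: (f (h *: v + y) - f y)).
  by apply/funext => h; rewrite addr0 [h *: 1]mulr1 scale0r addr0 (addrC y).
move=> [d1 d2]; apply: DeriveDef; first by move: d1; rewrite /derivable E.
by move: d2; rewrite /derive E.
Qed.

Lemma derive_partial U f y v : open U -> Ck 1 U f -> U y ->
  derivable f y v /\ 'D_v f y = \sum_a v 0 a * partial a f y.
Proof.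
move=> oU F Uy; have df := Ck1_differentiable oU F Uy.
split; first exact: diff_derivable.
rewrite deriveE// {1}(row_sum_delta v) linear_sum; apply: eq_bigr => a _.
by rewrite linearZ /partial -deriveE.
Qed.

Lemma Ck1_lipschitz_on_ball f (r : R) : Ck 1 setT f ->
  exists2 L : R, 0 < L & forall y z, `|y| <= r -> `|z| <= r -> `|f z - f y| <= L * `|z - y|.
Proof.
move=> F.
(* [MVT_bound] ranges over s in [-1, 1], where y + s (z - y) has norm at most r + 2 r. *)
have H a : exists M : R, 0 < M /\ forall y, `|y| <= 3 * r -> `|partial a f y| <= M.
  have [M M0 HM] := continuous_bounded_on_ball (3 * r) (Ck_setT_continuous (Ck_partial a F)).
  by exists M.
have [M HM] := choice H.
have M0 a : 0 <= M a by apply/ltW; exact: (HM a).1.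
exists (\sum_a M a + 1); first by rewrite ltr_wpDl// sumr_ge0.
move=> y z yr zr.
have zy : `|z - y| <= 2 * r by apply: (le_trans (ler_normB _ _)); move: yr zr; lra.
have l (s : R) : `|s| <= `|1 : R| -> derivable (fun s : R => f (y + s *: (z - y))) s 1 /\
   `|'D_1 (fun s : R => f (y + s *: (z - y))) s - 0| <= (\sum_a M a) * `|z - y|.
  rewrite normr1 => s1.
  have [d1 d2] := derive_partial (y := y + s *: (z - y)) (z - y) openT F I.
  have [k1 k2] := is_derive_line d1.
  split; first exact: k1.
  rewrite k2 d2 subr0; apply: (le_trans (ler_norm_sum _ _ _)).
  rewrite mulr_suml; apply: ler_sum => a _; rewrite normrM mulrC.
  apply: ler_pM => //; last exact: coord_le.
  apply: (HM a).2; apply: (le_trans (ler_normD _ _)); rewrite normrZ.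
  have : `|s| * `|z - y| <= 1 * (2 * r) by apply: ler_pM.
  by move: yr; move: (`|s| * _) => x; lra.
have := MVT_bound l; rewrite scale1r scale0r addr0 mul0r subr0 normr1 mulr1 (addrC y) subrK => h.
by apply: (le_trans h); rewrite ler_wpM2r// lerDl.
Qed.

End DirectionalDerivative.

Section Weyl.
Variables (R : realType) (m : nat).
Local Notation V := 'rV[R]_m.
Implicit Types (f w p : V -> R) (x y v : V).

(** A convolution up to reflection. The point [x] enters through [p] alone, so the result is as
    smooth as [p] while [w] is merely continuous. *)
Definition correlation p w x := irow (fun y => p (y + x) * w y).

Lemma is_derive_correlation p w r a x : Ck 1 setT p -> continuous w -> supp_le r w ->
  is_derive x (delta_mx 0 a) (correlation p w) (correlation (partial a p) w x).
Proof.
move=> P cw sw; apply: is_derive_from_line.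
have := is_derive_irow_line_suppr a (Ck_shift x P) cw sw.
rewrite (_ : irow (fun y => partial a (fun y => p (y + x)) y * w y) =
             correlation (partial a p) w x); last first.
  by congr irow; apply/funext => y; rewrite partial_shift.
rewrite (_ : (fun s : R => irow _) = (fun s : R => correlation p w (x + s *: delta_mx 0 a))) //.
apply/funext => s; congr irow; apply/funext => y; congr (p _ * _).
by rewrite addrAC addrA.
Qed.

Lemma continuous_correlation p w r : Ck 1 setT p -> continuous w -> supp_le r w ->
  continuous (correlation p w).
Proof.
move=> P cw sw; suff H (x : V) : {for x, continuous (correlation p w)} by move=> x; exact: H.
have [L L0 HL] := Ck1_lipschitz_on_ball (`|r| + `|x| + 1) P.
have [M M0 HM] := continuous_bounded cw sw.
pose C := L * M * fine (ball_volume m r) + 1.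
have v0 : 0 <= fine (ball_volume m r) by apply: fine_ge0; exact: measure_ge0.
have C0 : 0 < C by rewrite ltr_wpDl// !mulr_ge0// ltW.
have key (z : V) : `|x - z| < 1 -> `|correlation p w x - correlation p w z| <= C * `|x - z|.
  move=> xz.
  have cc u : continuous (fun y => p (y + u) * w y).
    move=> y; apply: for_continuousM; last exact: cw.
    exact: continuous_comp_shift (Ck_setT_continuous P) _.
  have sc u : supp_le r (fun y => p (y + u) * w y) by exact: supp_le_mulr.
  have cN : continuous (fun y => - (p (y + z) * w y)).
    by move=> y; exact: (for_continuousN (cc z y)).
  have sN : supp_le r (fun y => - (p (y + z) * w y)) by move=> y /sc ->; rewrite oppr0.
  rewrite /correlation -(irowN (cc z) (sc z)) -(irowD (cc x) cN (sc x) sN).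
  apply: (@le_trans _ _ (L * `|x - z| * M * fine (ball_volume m r))).
    apply: irow_bound.
    - by move=> y; exact: (for_continuousD (cc x y) (cN y)).
    - by move=> y ry; rewrite sc// sN// addr0.
    move=> y; rewrite -mulrBl normrM.
    have [yr|yr] := leP r `|y|.
      by rewrite sw// normr0 mulr0 !mulr_ge0// ltW.
    apply: ler_pM => //.
    have -> : x - z = (y + x) - (y + z) by rewrite opprD addrACA subrr add0r.
    have n1 := ler_norm r; have n2 := ler_normD y x; have n3 := ler_normD y z.
    have n4 : `|z| <= `|x| + `|x - z|.
      by have := ler_normB x (x - z); rewrite opprB addrC subrK.
    have e1 : `|y + z| <= `|r| + `|x| + 1.
      by move: `|y + z| `|z| `|x - z| `|y| `|x| `|r| n1 n3 n4 yr xz => *; lra.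
    have e2 : `|y + x| <= `|r| + `|x| + 1.
      by move: `|y + x| `|y| `|x| `|r| n1 n2 yr => *; lra.
    exact: HL.
  by rewrite /C; move: (normr_ge0 (x - z)) v0 => h1 h2; nra.
have FF := nbhs_filter x.
apply/cvgrPdist_le => e e0.
have d0 : 0 < Num.min 1 (e / C) by rewrite lt_min ltr01 divr_gt0.
apply: filterS (nbhsx_ballx x _ d0) => z; rewrite -ball_normE /= lt_min => /andP[z1 z2].
apply: (le_trans (key z z1)); rewrite mulrC -ler_pdivlMr//; exact: ltW.
Qed.

Lemma smooth_correlation p w r : smooth setT p -> continuous w -> supp_le r w ->
  smooth setT (correlation p w).
Proof.
move=> P cw sw k; elim: k p P => [|k IH] p P.
  by split=> // y _; exact: continuous_correlation (P 1%N) cw sw y.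
split=> [y _|a]; first exact: continuous_correlation (P 1%N) cw sw y.
split=> [y _|]; first by case: (is_derive_correlation a y (P 1%N) cw sw).
apply: (Ck_eq openT _ (IH _ (smooth_partial a P))) => y _.
by case: (is_derive_correlation a y (P 1%N) cw sw).
Qed.

Lemma correlation_opp p w r y : continuous p -> continuous w -> supp_le r w ->
  correlation p w (- y) = irow (fun z => w (y + z) * p z).
Proof.
move=> cp cw sw.
have cc : continuous (fun z : V => p (z - y) * w z).
  move=> z; have c1 := @continuous_comp_shift R m _ (- y) cp z.
  exact: (for_continuousM c1 (cw z)).
rewrite /correlation -(irow_shift y cc (supp_le_mulr _ sw)).
by congr irow; apply/funext => z; rewrite addrK mulrC (addrC z).
Qed.

Definition sqnorm (v : V) : R := \sum_a v 0 a ^+ 2.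

Lemma sqnorm_ge0 v : 0 <= sqnorm v.
Proof. by apply: sumr_ge0 => a _; exact: sqr_ge0. Qed.

Lemma le_sqnorm v : `|v| ^+ 2 <= sqnorm v.
Proof.
rewrite -[leRHS]sqr_sqrtr ?sqnorm_ge0// lerXn2r ?nnegrE ?sqrtr_ge0//.
apply: norm_rV_le => [|a]; first exact: sqrtr_ge0.
rewrite -sqrtr_sqr ler_sqrt ?sqnorm_ge0// /sqnorm (bigD1 a)//= lerDl.
by apply: sumr_ge0 => b _; exact: sqr_ge0.
Qed.

Lemma sqnorm_le v : sqnorm v <= m%:R * `|v| ^+ 2.
Proof.
apply: (@le_trans _ _ (\sum_(a < m) `|v| ^+ 2)).
  by apply: ler_sum => a _; rewrite -real_normK ?num_real// lerXn2r ?nnegrE// coord_le.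
by rewrite sumr_const card_ord [leRHS]mulr_natl.
Qed.

Lemma sqnorm_quad v : sqnorm v = quad 1%:M v.
Proof.
by rewrite /quad mulmx1 mxE; apply: eq_bigr => a _; rewrite mxE expr2.
Qed.

Lemma smooth_sqnorm : smooth setT sqnorm.
Proof.
move=> k; apply: Ck_sum => [|a _]; first exact: openT.
by apply: CkX; [exact: openT|apply: Ck_coord; exact: openT].
Qed.

Lemma partial_sqnorm a y : partial a sqnorm y = 2 * y 0 a.
Proof.
have D b : is_derive y (delta_mx 0 a) (fun z : V => z 0 b ^+ 2) (2 * y 0 b * (a == b)%:R).
  have d := is_derive_coord a b y.
  have [k1 k2] := is_deriveM d d; apply: DeriveDef; first exact: k1.
  have sE (c d' : R) : c *: d' = c * d' by [].
  by rewrite [LHS]k2 !sE; ring.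
have E : sqnorm = \sum_(b < m) (fun z : V => z 0 b ^+ 2).
  by apply/funext => z; rewrite fct_sumE.
have [_ K] := is_derive_sum D.
rewrite /partial E K (bigD1 a)//= eqxx mulr1 big1 ?addr0// => b ba.
by rewrite eq_sym (negbTE ba) mulr0.
Qed.

Section MeanValue.
Variable r : R.
Hypothesis r0 : 0 < r.

(** The radial weight is chosen so that y times [kernel] is a gradient: [flat 2] is the derivative
    of [flat 0], and the factor -1/2 in [potential] compensates the derivative -2 y_a of r^2 -
    |y|^2. *)
Definition kernel (y : V) : R := flat 2 (r ^+ 2 - sqnorm y).
Definition potential (y : V) : R := - 2^-1 * flat 0 (r ^+ 2 - sqnorm y).

Lemma smooth_radial n : smooth setT (fun y => flat n (r ^+ 2 - sqnorm y)).
Proof.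
move=> k; apply: (@Ck_flat _ _ k n setT (fun y => r ^+ 2 - sqnorm y)); first exact: openT.
by apply: CkB; [exact: openT|apply: Ck_cst; exact: openT|exact: smooth_sqnorm].
Qed.

Lemma supp_radial n : supp_le r (fun y => flat n (r ^+ 2 - sqnorm y)).
Proof.
move=> y ry; apply: flat_le0; rewrite subr_le0; apply: le_trans (le_sqnorm y).
by rewrite lerXn2r// nnegrE// ltW.
Qed.

Lemma smooth_potential : smooth setT potential.
Proof. by move=> k; apply: CkZ; [exact: openT|exact: smooth_radial]. Qed.

Lemma supp_potential : supp_le r potential.
Proof. by apply: (supp_le_mulr (fun=> - 2^-1)); exact: supp_radial. Qed.

Lemma partial_potential a y : partial a potential y = y 0 a * kernel y.
Proof.
have D : is_derive y (delta_mx 0 a) (fun y => r ^+ 2 - sqnorm y) (- (2 * y 0 a)).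
  have d : derivable sqnorm y (delta_mx 0 a) := Ck_derivable (smooth_sqnorm 1) I.
  have [k1 k2] := is_deriveB (is_derive_cst (r ^+ 2) y (delta_mx 0 a)) (derivableP d).
  apply: DeriveDef; first exact: k1.
  by rewrite [LHS]k2 sub0r -[in RHS]partial_sqnorm.
have := is_derive_flat 0 (r ^+ 2 - sqnorm y); rewrite mul0r subr0 => F.
have [k1 k2] := is_deriveZ (- 2^-1) (is_derive_comp1 D F).
by rewrite /partial [LHS]k2 /kernel [_ *: _]mulrC; field.
Qed.

Lemma irow_kernel_gt0 : 0 < irow kernel.
Proof.
have ck := Ck_setT_continuous (smooth_radial 2 0).
apply: (irow_gt0 (y0 := 0) ck (@supp_radial 2)) => [y|]; first exact: flat_ge0.
apply: flat_gt0; rewrite /sqnorm big1 ?subr0 ?exprn_gt0// => a _.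
by rewrite mxE expr0n.
Qed.

Lemma Ck_scaled_shift k w x (s : R) : Ck k setT w -> Ck k setT (fun y => w (x + s *: y)).
Proof.
move=> W; apply: (@Ck_comp R m m k setT setT w (fun y => x + s *: y) openT openT (fun _ _ => I) _ W).
move=> c; rewrite (_ : (fun z => _) = (fun z : V => x 0 c + s * z 0 c)); last first.
  by apply/funext => z; rewrite !mxE.
apply: (CkD openT); first by apply: Ck_cst; exact: openT.
by apply: CkZ; [exact: openT|apply: Ck_coord; exact: openT].
Qed.

Lemma partial_scaled_shift a w x (s : R) y : Ck 1 setT w ->
  partial a (fun y => w (x + s *: y)) y = s * partial a w (x + s *: y).
Proof.
move=> W.
have T c : Ck 1 setT (fun y : V => (x + s *: y) 0 c).
  exact: (Ck_scaled_shift x s (Ck_coord openT 1 c)).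
have dw : differentiable w (x + s *: y) by exact: (Ck1_differentiable openT W I).
have dt : differentiable (fun y : V => x + s *: y) y by exact: (Ck1_differentiable_rV openT T I).
rewrite (@partial_chain R m m w (fun y => x + s *: y) a y dw dt) (bigD1 a)//= big1 ?addr0 => [|b ba].
  congr (_ * _).
  have [_ K] := is_deriveD (is_derive_cst (x 0 a) y (delta_mx 0 a)) (is_deriveZ s (is_derive_coord a a y)).
  transitivity (0 + s *: (a == a)%:R : R); last by rewrite eqxx add0r [_ *: _]mulr1.
  rewrite -K /partial; congr (derive _ y _); apply/funext => z; by rewrite !mxE.
have [_ K] := is_deriveD (is_derive_cst (x 0 b) y (delta_mx 0 a)) (is_deriveZ s (is_derive_coord a b y)).
rewrite (_ : partial a _ y = 0) ?mul0r//.
transitivity (0 + s *: (a == b)%:R : R); last by rewrite eq_sym (negbTE ba) add0r scaler0.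
rewrite -K /partial; congr (derive _ y _); apply/funext => z; by rewrite !mxE.
Qed.

Lemma is_derive_scaled_shift w x y (s : R) : Ck 1 setT w ->
  is_derive s 1 (fun s : R => w (x + s *: y)) (\sum_a y 0 a * partial a w (x + s *: y)).
Proof.
move=> W; have [d1 d2] := derive_partial (y := x + s *: y) y openT W I.
by have [k1 k2] := is_derive_line d1; apply: DeriveDef; [exact: k1|rewrite [LHS]k2].
Qed.

(* The derivative in s of the average of w over the scaled ball is, after an
   integration by parts against [potential], an average of the Laplacian. *)
Lemma mean_value w R0 x : Ck 2 setT w -> supp_le R0 w ->
  (forall y, `|y - x| <= r -> \sum_a partial a (partial a w) y = 0) ->
  irow (fun y => w (x + y) * kernel y) = w x * irow kernel.
Proof.
move=> W sw H.
have W1 := CkW W.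
pose F (s : R) (y : V) : R := w (x + s *: y) * kernel y.
pose D (s : R) (y : V) : R := (\sum_a y 0 a * partial a w (x + s *: y)) * kernel y.
have ck : continuous kernel := Ck_setT_continuous (smooth_radial 2 0).
have sk : supp_le r kernel := @supp_radial 2.
have bw a : exists M : R, 0 < M /\ forall y, `|partial a w y| <= M.
  have [M M0 HM] := continuous_bounded (Ck_setT_continuous (Ck_partial a W)) (supp_le_partial a sw).
  by exists M.
have [M HM] := choice bw.
have [K K0 HK] := continuous_bounded ck sk.
have M0 a : 0 <= M a by apply/ltW; exact: (HM a).1.
have dG (s : R) : is_derive s 1 (fun s => irow (F s)) (irow (D s)).
  apply: (@is_derive_irow R m F D r (\sum_a r * M a * K) s).
  - move=> s1 y; apply: for_continuousM; last exact: ck.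
    exact: (Ck_setT_continuous (Ck_scaled_shift x s1 W)).
  - by move=> s1 _; exact: supp_le_mulr.
  - by move=> s1 _; exact: supp_le_mulr.
  - move=> s1 y.
    have [k1 k2] := is_deriveM (is_derive_scaled_shift x y s1 W1) (is_derive_cst (kernel y) s1 1).
    apply: DeriveDef; first exact: k1.
    by rewrite [LHS]k2 scaler0 add0r [_ *: _]mulrC.
  - move=> s1 y _; have [yr|yr] := leP r `|y|.
      rewrite /D sk// mulr0 normr0; apply: sumr_ge0 => a _.
      by rewrite !mulr_ge0// ltW.
    rewrite /D mulr_suml; apply: (le_trans (ler_norm_sum _ _ _)); apply: ler_sum => a _.
    rewrite !normrM; apply: (ler_pM (mulr_ge0 (normr_ge0 _) (normr_ge0 _)) (normr_ge0 _)).
      apply: (ler_pM (normr_ge0 _) (normr_ge0 _)); last exact: (HM a).2.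
      by apply: le_trans (ltW yr); exact: coord_le.
    exact: HK.
have D0 (s : R) : `|s| <= 1 -> irow (D s) = 0.
  move=> s1.
  have cD a : continuous (fun y => partial a potential y * partial a w (x + s *: y)).
    move=> y; apply: for_continuousM.
      exact: (Ck_setT_continuous (smooth_partial a smooth_potential 0)).
    exact: (Ck_setT_continuous (Ck_scaled_shift x s (Ck_partial a W))).
  have sD a : supp_le (r + 1) (fun y => partial a potential y * partial a w (x + s *: y)).
    by apply: supp_le_mull; apply: supp_le_partial; exact: supp_potential.
  transitivity (irow (fun y => \sum_a partial a potential y * partial a w (x + s *: y))).
    congr irow; apply/funext => y; rewrite /D mulr_suml; apply: eq_bigr => a _.
    by rewrite partial_potential mulrAC.
  rewrite (irow_sum _ cD sD).
  have cE a : continuous (fun y => potential y * (s * partial a (partial a w) (x + s *: y))).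
    move=> y; apply: for_continuousM; first exact: (Ck_setT_continuous (smooth_potential 0)).
    apply: for_continuousM; first exact: cst_continuous.
    exact: (Ck_setT_continuous (Ck_scaled_shift x s (Ck_partial a (Ck_partial a W)))).
  have sE a : supp_le r (fun y => potential y * (s * partial a (partial a w) (x + s *: y))).
    by apply: supp_le_mull; exact: supp_potential.
  have E a : irow (fun y => partial a potential y * partial a w (x + s *: y)) =
      - irow (fun y => potential y * (s * partial a (partial a w) (x + s *: y))).
    rewrite (irow_parts a (smooth_potential 1) (Ck_scaled_shift x s (Ck_partial a W)) supp_potential).
    congr (- irow _); apply/funext => y.
    by rewrite (partial_scaled_shift a x s y (Ck_partial a W)).
  rewrite (eq_bigr _ (fun a _ => E a)) sumrN -(irow_sum _ cE sE).
  rewrite (_ : (fun y => \sum_a _) = (fun=> 0)) ?irow0 ?oppr0//.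
  apply/funext => y; have [yr|yr] := leP r `|y|.
    by rewrite big1// => a _; rewrite supp_potential// mul0r.
  rewrite -mulr_sumr -mulr_sumr H ?mulr0//.
  rewrite addrAC subrr add0r normrZ -[leRHS]mul1r.
  by apply: ler_pM => //; exact: ltW.
have l (s : R) : `|s| <= `|1 : R| -> derivable (fun s => irow (F s)) s 1 /\
    `|'D_1 (fun s => irow (F s)) s - 0| <= 0.
  rewrite normr1 => s1; have [k1 k2] := dG s; split; first exact: k1.
  by rewrite k2 D0// subrr normr0.
have := MVT_bound l; rewrite mul0r mul0r subr0 normr_le0 subr_eq0 => /eqP E.
have -> : irow (fun y => w (x + y) * kernel y) = irow (F 1).
  by congr irow; apply/funext => y; rewrite /F scale1r.
rewrite E -(irowZ _ ck sk); congr irow; apply/funext => y.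
by rewrite /F scale0r addr0.
Qed.

End MeanValue.

(** Near [y0] the function is replaced by the compactly supported [w1 = chi * w]. The mean value
    property then says that [w] is, up to a constant factor, its correlation with a smooth kernel,
    hence smooth. *)
Lemma weyl U w : open U -> Ck 2 U w ->
  (forall y, U y -> \sum_a partial a (partial a w) y = 0) -> smooth U w.
Proof.
move=> oU W H k; apply: Ck_local => y0 Uy0.
have /nbhs_ballP[d /= d0 Hd] : nbhs y0 U by exact: open_nbhs_nbhs.
have dU y : `|y - y0| < d -> U y.
  by move=> yd; apply: Hd; rewrite -ball_normE /= distrC.
pose r := d / 4.
have r0 : 0 < r by rewrite divr_gt0.
pose chi := ellipsoid_bump 1%:M y0 r.
have chi0 y : d / 2 <= `|y - y0| -> chi y = 0.
  move=> yd; apply: ellipsoid_bump0 => //; rewrite -sqnorm_quad.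
  apply: le_trans (le_sqnorm _).
  have -> : 2 * r ^+ 2 = d ^+ 2 / 8 by rewrite /r; field.
  have : (d / 2) ^+ 2 <= `|y - y0| ^+ 2 by rewrite lerXn2r// nnegrE// ltW// divr_gt0.
  by move: (`|y - y0| ^+ 2) => q; nra.
have chi1 y : sqnorm (y - y0) <= r ^+ 2 -> chi y = 1.
  by move=> h; apply: ellipsoid_bump1 => //; rewrite -sqnorm_quad.
pose w1 y := chi y * w y.
have W1 : Ck 2 setT w1.
  have cK : closed [set y : V | `|y - y0| <= d / 2].
    rewrite (_ : mkset _ = (fun y : V => `|y - y0|) @^-1` [set x | x <= d / 2]) //.
    apply: closed_comp; last exact: closed_le.
    move=> y _; apply: continuous_comp; last exact: norm_continuous.
    exact: continuous_shift.
  have KU : [set y : V | `|y - y0| <= d / 2] `<=` U.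
    by move=> y /= yd; apply: dU; apply: le_lt_trans yd _; move: d0; lra.
  have K0 y : ~ (`|y - y0| <= d / 2) -> w1 y = 0.
    by move=> /negP; rewrite -ltNge => yd; rewrite /w1 chi0 ?mul0r// ltW.
  apply: (Ck_extend0 oU cK KU K0).
  exact: (CkM oU (Ck_ellipsoid_bump 2 1%:M y0 r oU) W).
pose W0 : set V := [set y | sqnorm (y - y0) < r ^+ 2].
have oW0 : open W0.
  rewrite (_ : W0 = (fun y : V => sqnorm (y - y0)) @^-1` [set x | x < r ^+ 2]) //.
  apply: open_comp; last exact: open_lt.
  by move=> y _; exact: (Ck_setT_continuous (Ck_shift (- y0) (smooth_sqnorm 0))).
have W0U y : W0 y -> U y.
  move=> yW; apply: dU.
  have : `|y - y0| ^+ 2 < r ^+ 2 by apply: le_lt_trans (le_sqnorm _) yW.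
  rewrite ltr_pXn2r ?nnegrE ?(ltW r0)// => yr; apply: lt_trans yr _.
  by rewrite /r; move: d0; lra.
have Ew y : W0 y -> w1 y = w y.
  by move=> yW; rewrite /w1 chi1 ?mul1r// ltW.
have Hw y : W0 y -> \sum_a partial a (partial a w1) y = 0.
  move=> yW; apply: etrans (H y (W0U y yW)); apply: eq_bigr => a _.
  have N z : W0 z -> \forall t \near z, w1 t = w t.
    by move=> zW; move/open_nbhs_nbhs: (conj oW0 zW); apply: filterS => t; exact: Ew.
  apply: partial_near; move/open_nbhs_nbhs: (conj oW0 yW); apply: filterS => z zW.
  exact: partial_near (N z zW).
(* The kernel has sup-norm radius [s], whereas [chi] equals 1 on a Euclidean ball of radius [r].
   With this [s], a sup norm below 2 s forces the Euclidean norm below [r], as m (2 s)^2 <= r^2. *)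
pose s := r / (2 * m.+1%:R).
have s0 : 0 < s by rewrite divr_gt0// mulr_gt0.
have sm (v : V) : `|v| < 2 * s -> sqnorm v < r ^+ 2.
  move=> vs; apply: (le_lt_trans (sqnorm_le v)).
  have m1 : m%:R <= m.+1%:R :> R by rewrite ler_nat.
  have mp : 0 < m.+1%:R :> R by [].
  apply: (@le_lt_trans _ _ (m.+1%:R * `|v| ^+ 2)); first by rewrite ler_wpM2r// sqr_ge0.
  apply: (@lt_le_trans _ _ (m.+1%:R * (2 * s) ^+ 2)).
    by rewrite ltr_pM2l// ltrXn2r ?nnegrE// mulr_ge0// ltW.
  have -> : m.+1%:R * (2 * s) ^+ 2 = r ^+ 2 / m.+1%:R.
    by rewrite /s; field; rewrite gt_eqF.
  by rewrite ler_pdivrMr// ler_peMr ?sqr_ge0// ler1n.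
have sw1 : supp_le (`|y0| + d) w1.
  move=> y yd; rewrite /w1 chi0 ?mul0r//.
  have := ler_normD (y - y0) y0; rewrite subrK.
  by move: `|y| `|y0| `|y - y0| yd d0 => *; lra.
have I0 := irow_kernel_gt0 s0.
pose B : set V := [set y | `|y - y0| < s].
have oB : open B by exact: open_norm_sub_lt.
have ys y : B y -> (irow (kernel s))^-1 * correlation (kernel s) w1 (- y) = w y.
  move=> yB.
  have yW : W0 y by apply: sm; apply: lt_trans yB _; move: s0; lra.
  have Hy z : `|z - y| <= s -> \sum_a partial a (partial a w1) z = 0.
    move=> zy; apply: Hw; apply: sm.
    have := ler_normD (z - y) (y - y0); rewrite addrA subrK.
    by move: yB; rewrite /B /=; move: `|z - y0| `|z - y| `|y - y0| zy s0 => *; lra.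
  have mv := mean_value s0 W1 sw1 Hy.
  rewrite (correlation_opp y (Ck_setT_continuous (smooth_radial s 2 0)) (Ck_setT_continuous W1) sw1).
  by rewrite mv Ew// mulrCA mulVf ?mulr1// gt_eqF.
exists B; split => //; first by rewrite /B /= subrr normr0.
have oUB : open (U `&` B) by exact: openI.
apply: (@Ck_eq _ _ _ _ (fun y => (irow (kernel s))^-1 * correlation (kernel s) w1 (- y))) => //.
  by move=> y [_ yB]; exact: ys.
apply: (Ck_sub (W := U `&` B) (U := setT)) => //.
apply: (CkZ openT).
apply: (@Ck_comp R m m k setT setT (correlation (kernel s) w1) (fun y => - y) openT openT (fun _ _ => I)).
  move=> c; rewrite (_ : (fun z => _) = (fun z : V => - z 0 c)); last first.
    by apply/funext => z; rewrite mxE.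
  by apply: CkN; [exact: openT|apply: Ck_coord; exact: openT].
exact: (smooth_correlation (smooth_radial s 2) (Ck_setT_continuous W1) sw1).
Qed.

End Weyl.

(** * Matrix calculus *)

Section MatrixCalculus.
Variables (R : realType) (m : nat).
Local Notation V := 'rV[R]_m.
Variables (U : set V) (oU : open U).

Definition dmx p q (a : 'I_m) (A : V -> 'M[R]_(p, q)) (y : V) : 'M[R]_(p, q) :=
  \matrix_(i, j) partial a (fun z => A z i j) y.

Definition Ckmx k p q (A : V -> 'M[R]_(p, q)) := forall i j, Ck k U (fun z => A z i j).

Lemma Ckmx_cst k p q (A : 'M[R]_(p, q)) : Ckmx k (fun=> A).
Proof. by move=> i j; exact: Ck_cst. Qed.

Lemma Ckmx_dmx k p q a (A : V -> 'M[R]_(p, q)) : Ckmx k.+1 A -> Ckmx k (dmx a A).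
Proof.
move=> H i j; apply: (Ck_eq oU _ (Ck_partial a (H i j))) => y _.
by rewrite mxE.
Qed.

Lemma Ckmx_mul k p q r (A : V -> 'M[R]_(p, q)) (B : V -> 'M[R]_(q, r)) :
  Ckmx k A -> Ckmx k B -> Ckmx k (fun y => A y *m B y).
Proof.
move=> HA HB i j.
apply: (@Ck_eq _ _ _ _ (fun z => \sum_l A z i l * B z l j) _ oU) => [y _|].
  by rewrite mxE.
by apply: Ck_sum => // l _; exact: CkM.
Qed.

Lemma Ckmx_tr k p q (A : V -> 'M[R]_(p, q)) : Ckmx k A -> Ckmx k (fun y => (A y)^T).
Proof. by move=> H i j; apply: (Ck_eq oU _ (H j i)) => y _; rewrite mxE. Qed.

Lemma Ckmx_add k p q (A B : V -> 'M[R]_(p, q)) :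
  Ckmx k A -> Ckmx k B -> Ckmx k (fun y => A y + B y).
Proof.
by move=> HA HB i j; apply: (Ck_eq oU _ (CkD oU (HA i j) (HB i j))) => y _; rewrite mxE.
Qed.

Lemma Ckmx_opp k p q (A : V -> 'M[R]_(p, q)) : Ckmx k A -> Ckmx k (fun y => - A y).
Proof.
by move=> HA i j; apply: (Ck_eq oU _ (CkN oU (HA i j))) => y _; rewrite mxE.
Qed.

Lemma Ck_mxtrace k p (A : V -> 'M[R]_p) : Ckmx k A -> Ck k U (fun y => \tr (A y)).
Proof. by move=> H; apply: Ck_sum => // i _; exact: H. Qed.

Lemma partial_sum (I : Type) (s : seq I) (F : I -> V -> R) a y :
  (forall i, derivable (F i) y (delta_mx 0 a)) ->
  derivable (fun z => \sum_(i <- s) F i z) y (delta_mx 0 a) /\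
  partial a (fun z => \sum_(i <- s) F i z) y = \sum_(i <- s) partial a (F i) y.
Proof.
move=> H; elim: s => [|i s [IH1 IH2]].
  rewrite (_ : (fun z => _) = cst 0); last by apply/funext => z; rewrite big_nil.
  rewrite big_nil; split; first exact: derivable_cst.
  exact: (derive_cst 0).
rewrite (_ : (fun z => _) = (fun z => F i z + \sum_(i <- s) F i z)); last first.
  by apply/funext => z; rewrite big_cons.
rewrite big_cons -IH2; split; first exact: derivableD.
exact: deriveD.
Qed.

Lemma dmx_mul p q r a (A : V -> 'M[R]_(p, q)) (B : V -> 'M[R]_(q, r)) y : U y ->
  Ckmx 1 A -> Ckmx 1 B ->
  dmx a (fun z => A z *m B z) y = dmx a A y *m B y + A y *m dmx a B y.
Proof.
move=> Uy HA HB; apply/matrixP => i j; rewrite !mxE.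
have dA l : derivable (fun z => A z i l) y (delta_mx 0 a) := Ck_derivable (HA i l) Uy.
have dB l : derivable (fun z => B z l j) y (delta_mx 0 a) := Ck_derivable (HB l j) Uy.
rewrite (_ : (fun z => _) = (fun z => \sum_l A z i l * B z l j)); last first.
  by apply/funext => z; rewrite mxE.
have [_ ->] := partial_sum (index_enum _) (fun l => derivableM (dA l) (dB l)).
rewrite -big_split /=; apply: eq_bigr => l _.
by rewrite (partialM (dA l) (dB l)) !mxE.
Qed.

Lemma dmx_tr p q a (A : V -> 'M[R]_(p, q)) y : dmx a (fun z => (A z)^T) y = (dmx a A y)^T.
Proof.
apply/matrixP => i j; rewrite !mxE; congr (partial a _ y).
by apply/funext => z; rewrite mxE.
Qed.

Lemma dmx_add p q a (A B : V -> 'M[R]_(p, q)) y : U y -> Ckmx 1 A -> Ckmx 1 B ->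
  dmx a (fun z => A z + B z) y = dmx a A y + dmx a B y.
Proof.
move=> Uy HA HB; apply/matrixP => i j; rewrite !mxE.
rewrite (_ : (fun z => _) = (fun z => A z i j + B z i j)); last first.
  by apply/funext => z; rewrite mxE.
apply: deriveD; [exact: (Ck_derivable (HA i j) Uy)|exact: (Ck_derivable (HB i j) Uy)].
Qed.

Lemma dmx_opp p q a (A : V -> 'M[R]_(p, q)) y : U y -> Ckmx 1 A ->
  dmx a (fun z => - A z) y = - dmx a A y.
Proof.
move=> Uy HA; apply/matrixP => i j; rewrite !mxE.
rewrite (_ : (fun z => _) = (fun z => - A z i j)); last first.
  by apply/funext => z; rewrite mxE.
by apply: deriveN; exact: (Ck_derivable (HA i j) Uy).
Qed.

Lemma dmx_cst p q a (A : 'M[R]_(p, q)) y : dmx a (fun=> A) y = 0.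
Proof. by apply/matrixP => i j; rewrite !mxE; exact: (derive_cst (A i j)). Qed.

Lemma dmx_near p q a (A B : V -> 'M[R]_(p, q)) y : U y -> (forall z, U z -> A z = B z) ->
  dmx a A y = dmx a B y.
Proof.
move=> Uy H; apply/matrixP => i j; rewrite !mxE; apply: partial_near.
by move/open_nbhs_nbhs: (conj oU Uy); apply: filterS => z Uz; rewrite H.
Qed.

Lemma Ck_det k p (A : V -> 'M[R]_p) : Ckmx k A -> Ck k U (fun y => \det (A y)).
Proof.
move=> H; apply: Ck_sum => // s _; apply: CkM => //; first exact: Ck_cst.
by apply: Ck_prod => // i _; exact: H.
Qed.

Lemma Ckmx_adj k p (A : V -> 'M[R]_p) : Ckmx k A -> Ckmx k (fun y => \adj (A y)).
Proof.
move=> H i j.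
apply: (@Ck_eq _ _ _ _ (fun z => cofactor (A z) j i) _ oU) => [y _|]; first by rewrite mxE.
apply: CkM => //; first exact: Ck_cst.
by apply: Ck_det => i1 j1; apply: (Ck_eq oU _ (H (lift j i1) (lift i j1))) => y _; rewrite !mxE.
Qed.

Lemma Ckmx_inv k p (A : V -> 'M[R]_p) : (forall y, U y -> A y \in unitmx) ->
  Ckmx k A -> Ckmx k (fun y => invmx (A y)).
Proof.
move=> uA H i j.
apply: (@Ck_eq _ _ _ _ (fun z => (\det (A z))^-1 * (\adj (A z)) i j) _ oU) => [y Uy|].
  by rewrite /invmx uA// !mxE.
apply: CkM => //; last exact: Ckmx_adj.
apply: CkV => //; last exact: Ck_det.
by move=> y Uy; move: (uA y Uy); rewrite unitmxE unitfE.
Qed.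

Lemma dmx_inv a p (A : V -> 'M[R]_p) y : U y -> (forall y, U y -> A y \in unitmx) ->
  Ckmx 1 A -> dmx a (fun z => invmx (A z)) y = - (invmx (A y) *m dmx a A y *m invmx (A y)).
Proof.
move=> Uy uA H; have Hi := Ckmx_inv uA H.
have E : dmx a (fun z => A z *m invmx (A z)) y = 0.
  rewrite -(dmx_cst a (1%:M : 'M[R]_p) y); apply: dmx_near => // z Uz.
  by rewrite mulmxV// uA.
move: E; rewrite dmx_mul// => /(congr1 (mulmx (invmx (A y)))).
rewrite mulmx0 mulmxDr !mulmxA mulVmx ?uA// mul1mx => /eqP.
by rewrite addrC addr_eq0 => /eqP.
Qed.

Lemma partial_prod (p : nat) (F : 'I_p -> V -> R) a y :
  (forall i, derivable (F i) y (delta_mx 0 a)) ->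
  derivable (fun z => \prod_i F i z) y (delta_mx 0 a) /\
  partial a (fun z => \prod_i F i z) y =
  \sum_i partial a (F i) y * \prod_(j | j != i) F j y.
Proof.
elim: p F => [|p IH] F H.
  rewrite (_ : (fun z => _) = cst 1); last by apply/funext => z; rewrite big_ord0.
  by split; [exact: derivable_cst|rewrite [RHS]big_ord0; exact: (derive_cst (1 : R))].
rewrite (_ : (fun z => _) = (fun z => F ord0 z * \prod_i F (lift ord0 i) z)); last first.
  by apply/funext => z; rewrite big_ord_recl.
have [d e] := IH (fun i => F (lift ord0 i)) (fun i => H (lift ord0 i)).
split; first exact: derivableM.
rewrite (partialM (H ord0) d) e big_ord_recl; congr (_ + _).
  by congr (_ * _); rewrite [RHS]big_mkcond big_ord_recl /= mul1r.
rewrite mulr_sumr; apply: eq_bigr => i _; rewrite mulrCA; congr (_ * _).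
rewrite [RHS]big_mkcond big_ord_recl /=; congr (_ * _).
by rewrite [LHS]big_mkcond; apply: eq_bigr => j _; rewrite (inj_eq lift_inj).
Qed.

(** Jacobi's formula. Differentiating the Leibniz expansion changes one row at a time; each
    resulting determinant is expanded along that row, which produces the cofactors. *)
Lemma partial_det a p (A : V -> 'M[R]_p) y : U y -> Ckmx 1 A ->
  partial a (fun z => \det (A z)) y = \tr (\adj (A y) *m dmx a A y).
Proof.
move=> Uy H.
have dA i j : derivable (fun z => A z i j) y (delta_mx 0 a) := Ck_derivable (H i j) Uy.
have P s := partial_prod (fun i => dA i (s i)).
have D (s : {perm 'I_p}) : derivable (fun z => (-1) ^+ s * \prod_i A z i (s i)) y (delta_mx 0 a).
  by apply: derivableM; [exact: derivable_cst|exact: (P s).1].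
rewrite (_ : (fun z => \det (A z)) = (fun z => \sum_(s : {perm 'I_p}) (-1) ^+ s * \prod_i A z i (s i))) //.
have [_ ->] := partial_sum (index_enum _) D.
transitivity (\sum_(s : {perm 'I_p}) \sum_i (-1) ^+ s * (dmx a A y i (s i) * \prod_(j | j != i) A y j (s j))).
  apply: eq_bigr => s _.
  have dc : derivable (fun=> (-1) ^+ s : R) y (delta_mx 0 a) by exact: derivable_cst.
  rewrite (partialM dc (P s).1) (P s).2.
  have -> : partial a (fun=> (-1) ^+ s) y = 0 :> R by exact: (derive_cst ((-1) ^+ s : R)).
  by rewrite mul0r add0r mulr_sumr; apply: eq_bigr => i _; rewrite mxE.
rewrite exchange_big /=.
transitivity (\sum_i \det (\matrix_(k, l) if k == i then dmx a A y k l else A y k l)).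
  apply: eq_bigr => i _; apply: eq_bigr => s _; congr (_ * _).
  rewrite [RHS](bigD1 i)//= mxE eqxx; congr (_ * _).
  by apply: eq_bigr => j ji; rewrite mxE (negbTE ji).
rewrite /mxtrace.
transitivity (\sum_i \sum_j dmx a A y i j * cofactor (A y) i j).
  apply: eq_bigr => i _; rewrite (expand_det_row _ i); apply: eq_bigr => j _.
  rewrite mxE eqxx; congr (_ * _); rewrite /cofactor; congr (_ * \det _).
  by apply/matrixP => k l; rewrite !mxE eq_sym (negbTE (neq_lift _ _)).
rewrite exchange_big /=; apply: eq_bigr => j _.
rewrite [RHS]mxE; apply: eq_bigr => i _; rewrite mulrC; congr (_ * _).
by rewrite mxE.
Qed.

End MatrixCalculus.

(** * Positive definite matrices *)

Section PositiveDefinite.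
Variable R : realType.

Definition posdefmx p (h : 'M[R]_p) := h^T = h /\ forall v : 'rV[R]_p, v != 0 -> 0 < quad h v.

(** Induction on the size, through the Schur complement [D'] of the first diagonal entry. *)
Lemma cholesky p (h : 'M[R]_p) : posdefmx h -> exists E : 'M[R]_p, h = E^T *m E.
Proof.
elim: p h => [|p IH] h [hT hp]; first by exists 0; apply/matrixP => -[].
pose h' : 'M[R]_(1 + p) := h.
pose a := ulsubmx h' 0 0; pose b : 'M[R]_(1, p) := ursubmx h'; pose D : 'M[R]_p := drsubmx h'.
have hp' (v : 'rV[R]_(1 + p)) : v != 0 -> 0 < (v *m h' *m v^T) 0 0 := hp v.
have aE : ulsubmx h' = a%:M by rewrite -mx11_scalar.
have hE : h' = block_mx a%:M b b^T D.
  have hd : dlsubmx h' = b^T by rewrite /b trmx_ursub [h'^T]hT.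
  by rewrite -aE -hd submxK.
have DT : D^T = D by rewrite /D trmx_drsub [h'^T]hT.
have a0 : 0 < a.
  have := hp' (row_mx (1%:M : 'M[R]_1) (0 : 'M[R]_(1, p))).
  have -> : row_mx (1%:M : 'M[R]_1) (0 : 'M[R]_(1, p)) != 0.
    apply/eqP => /(congr1 (fun M : 'M[R]_(1, 1 + p) => lsubmx M 0 0)).
    by rewrite row_mxKl linear0 !mxE /= => /eqP; rewrite oner_eq0.
  move=> /(_ isT); rewrite hE mul_row_block !mul0mx !mul1mx !addr0.
  by rewrite tr_row_mx mul_row_col trmx0 mulmx0 addr0 trmx1 mulmx1 mxE.
pose D' := D - a^-1 *: (b^T *m b).
have D'p : posdefmx D'.
  split; first by rewrite /D' linearB /= DT linearZ /= trmx_mul trmxK.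
  move=> v v0.
  (* The first coordinate is the one that cancels the first block of the product, so that the value
     of [h'] on this vector is the value of the Schur complement at [v]. *)
  have := hp' (row_mx (- a^-1 *: (v *m b^T)) v).
  have -> : row_mx (- a^-1 *: (v *m b^T)) v != 0.
    apply: contra_neq v0 => /(congr1 (fun M : 'M[R]_(1, 1 + p) => rsubmx M)).
    by rewrite row_mxKr linear0.
  move=> /(_ isT); rewrite hE mul_row_block mul_mx_scalar.
  rewrite scalerA mulrN divff ?gt_eqF// scaleN1r addNr.
  rewrite tr_row_mx mul_row_col mul0mx add0r /D'.
  by rewrite /quad mulmxBr -!scalemxAl -!scalemxAr mulmxA addrC scaleNr.
have [E' D'E] := IH D' D'p.
pose s := Num.sqrt a.
have ss : s * s = a by rewrite -expr2 sqr_sqrtr// ltW.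
have s0 : s != 0 by rewrite gt_eqF// sqrtr_gt0.
pose E1 : 'M[R]_(1 + p) := block_mx s%:M (s^-1 *: b) 0 E'.
suff h'E : h' = E1^T *m E1 by exists E1.
rewrite hE /E1 (@tr_block_mx _ 1 p 1 p) mulmx_block trmx0 tr_scalar_mx !mulmx0 !mul0mx !addr0.
rewrite -scalar_mxM ss mul_scalar_mx scalerA divff// scale1r linearZ /= mul_mx_scalar.
rewrite scalerA divff// scale1r -D'E -scalemxAl -scalemxAr scalerA -invfM ss.
by rewrite /D' addrC subrK.
Qed.

Lemma posdefmx_unit p (h : 'M[R]_p) : posdefmx h -> h \in unitmx.
Proof.
move=> [hT hp]; rewrite -row_free_unit -kermx_eq0; apply/rowV0P => v.
move=> /sub_kermxP vh; apply/eqP; apply: contraT => /hp.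
by rewrite /quad vh mul0mx mxE ltxx.
Qed.

Lemma posdefmx_det p (h : 'M[R]_p) : posdefmx h -> 0 < \det h.
Proof.
move=> hp; have [E hE] := cholesky hp.
have := posdefmx_unit hp; rewrite unitmxE unitfE hE det_mulmx det_tr mulf_eq0 orbb => d0.
by rewrite -expr2 exprn_even_gt0.
Qed.

Lemma posdefmx_inv p (h : 'M[R]_p) : posdefmx h -> posdefmx (invmx h).
Proof.
move=> hp; have hu := posdefmx_unit hp; case: (hp) => hT hq.
have iT : (invmx h)^T = invmx h by rewrite trmx_inv hT.
split=> // v v0; have := hq (v *m invmx h).
have -> : v *m invmx h != 0.
  by apply: contra_neq v0 => /(congr1 (mulmx^~ h)); rewrite mulmxKV// mul0mx.
by move=> /(_ isT); rewrite /quad mulmxKV// trmx_mul iT mulmxA.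
Qed.

Lemma posdefmx1 p : posdefmx (1%:M : 'M[R]_p).
Proof.
split; first by rewrite trmx1.
move=> v v0; rewrite -sqnorm_quad lt_neqAle sqnorm_ge0 andbT eq_sym.
apply: contra_neq v0 => q0; apply/eqP; rewrite -normr_eq0 -sqrf_eq0.
by rewrite eq_le sqr_ge0 andbT -q0 le_sqnorm.
Qed.

Lemma mxtrace_sqr_ge0 p q (A : 'M[R]_(p, q)) : 0 <= \tr (A *m A^T).
Proof.
apply: sumr_ge0 => i _; rewrite mxE; apply: sumr_ge0 => j _.
by rewrite mxE -expr2 sqr_ge0.
Qed.

Lemma mxtrace_sqr_eq0 p q (A : 'M[R]_(p, q)) : \tr (A *m A^T) = 0 -> A = 0.
Proof.
move=> /eqP; rewrite psumr_eq0 => [/allP H|i _]; last first.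
  by rewrite mxE; apply: sumr_ge0 => j _; rewrite mxE -expr2 sqr_ge0.
apply/matrixP => i j; rewrite mxE; have := H i (mem_index_enum _).
rewrite mxE psumr_eq0 => [/allP/(_ j (mem_index_enum _))|l _]; last first.
  by rewrite mxE -expr2 sqr_ge0.
by rewrite mxE -expr2 sqrf_eq0 => /eqP.
Qed.

End PositiveDefinite.

(** * Linear consequences of the closedness of the Kaehler form *)

Section KaehlerTensor.
Variables (R : realType) (T : zmodType) (J : T -> T) (d : T -> T -> T -> R).
Hypothesis JJ : forall x, J (J x) = - x.
Hypothesis dN1 : forall x y z, d (- x) y z = - d x y z.
Hypothesis dN2 : forall x y z, d x (- y) z = - d x y z.
Hypothesis dsym : forall x y z, d x y z = d x z y.
Hypothesis dJ : forall x y z, d x (J y) (J z) = d x y z.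
Hypothesis dclosed : forall x y z, d x (J y) z + d y (J z) x + d z (J x) y = 0.

Let dN3 x y z : d x y (- z) = - d x y z. Proof. by rewrite dsym dN2 dsym. Qed.
Let dJ1 x y z : d x (J y) z = - d x y (J z).
Proof. by rewrite -(dJ x y (J z)) JJ dN3 opprK. Qed.

(* In complex terms: the derivatives d_i g_{j kbar} are symmetric in i, j. *)
Lemma kaehler_christoffel x y z :
  d (J x) y z + d y (J x) z - d z (J x) y = d x (J y) z + d (J y) x z - d z x (J y).
Proof.
have := dclosed y x z; have := dclosed x y z.
have := dclosed (J x) y (J z); have := dclosed (J y) x (J z).
have := dclosed x (J y) (J z); have := dclosed y (J x) (J z).
have := dclosed (J x) (J y) z; have := dclosed (J y) (J x) z.
rewrite !JJ ?dN1 ?dN2 ?dN3 !dJ !dJ1 ?dN3.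
rewrite ?(dsym _ z x) ?(dsym _ z y) ?(dsym _ y x) ?(dsym _ (J z)) ?(dsym _ z (J x)) ?(dsym _ z (J y)).
lra.
Qed.

(** Obtained by elimination among the instances of [dclosed] with some arguments rotated by [J]. It
    is the relation among first derivatives of the metric that kills the lower order terms in the
    divergence of ddc u. *)
Lemma kaehler_codifferential b x y :
  2 * d (J b) x y = d x y (J b) + d y x (J b) + d (J x) y b + d (J y) x b.
Proof.
have := dclosed y x b; have := dclosed x y b.
have := dclosed (J x) y (J b); have := dclosed (J y) x (J b).
have := dclosed x (J y) (J b); have := dclosed y (J x) (J b).
have := dclosed (J x) (J y) b; have := dclosed (J y) (J x) b.
have := dJ1 b x y.
rewrite !JJ ?dN1 ?dN2 ?dN3 !dJ !dJ1 ?dN3 ?(dsym _ b) ?(dsym (J b) y x) ?(dsym b (J x)).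
lra.
Qed.

End KaehlerTensor.

(** * Riemannian geometry in a chart *)

Section LocalGeometry.
Variables (R : realType) (m : nat).
Local Notation V := 'rV[R]_m.
Variables (U : set V) (oU : open U) (g : V -> 'M[R]_m).
Hypothesis g_smooth : forall k, Ckmx U k g.
Hypothesis g_pos : forall y, U y -> posdefmx (g y).

Let g_unit y : U y -> g y \in unitmx. Proof. by move=> /g_pos/posdefmx_unit. Qed.
Let g_sym y : U y -> (g y)^T = g y. Proof. by move=> /g_pos[]. Qed.

Definition cometric (y : V) := invmx (g y).

Lemma cometric_smooth k : Ckmx U k cometric.
Proof. by apply: Ckmx_inv => //; exact: g_unit. Qed.

Lemma cometric_sym y : U y -> (cometric y)^T = cometric y.
Proof. by move=> Uy; rewrite /cometric trmx_inv g_sym. Qed.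

Definition voldens (y : V) := Num.sqrt (\det (g y)).

Lemma voldens_smooth k : Ck k U voldens.
Proof.
apply: (@Ck_sqrt _ _ U oU k (fun y => \det (g y))); last exact: (Ck_det oU (g_smooth k)).
by move=> y Uy; apply: posdefmx_det; exact: g_pos.
Qed.

Lemma voldens_gt0 y : U y -> 0 < voldens y.
Proof. by move=> Uy; rewrite sqrtr_gt0 posdefmx_det//; exact: g_pos. Qed.

(* Christoffel symbols of the first kind, [ab, c] at (b, c) *)
Definition chr1 (a : 'I_m) (y : V) : 'M[R]_m :=
  \matrix_(b, c) (2^-1 * (dmx a g y b c + dmx b g y a c - dmx c g y a b)).

Lemma dmx_sym a y : U y -> (dmx a g y)^T = dmx a g y.
Proof.
by move=> Uy; rewrite -dmx_tr; apply: (dmx_near oU) => // z; exact: g_sym.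
Qed.

Lemma chr1_sym a b c y : U y -> chr1 a y b c = chr1 b y a c.
Proof.
move=> Uy; rewrite !mxE; have /matrixP/(_ a b) := dmx_sym c Uy; rewrite !mxE => ->.
by rewrite [X in _ * (X - _)]addrC.
Qed.

Lemma dmx_chr1 a y : U y -> dmx a g y = chr1 a y + (chr1 a y)^T.
Proof.
move=> Uy; apply/matrixP => b c; have /matrixP/(_ b c) := dmx_sym a Uy.
rewrite !mxE; move: (partial _ _ _) (partial _ _ _) => X Y.
move: (partial _ _ _) (partial _ _ _) => Z T e; lra.
Qed.

Lemma chr1_smooth a k : Ckmx U k (chr1 a).
Proof.
move=> b c.
have F i j l : Ck k U (fun z => dmx i g z j l) by apply: Ckmx_dmx.
apply: (Ck_eq oU _ (CkZ oU (2^-1) (CkB oU (CkD oU (F a b c) (F b a c)) (F c a b)))).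
by move=> y _; rewrite [RHS]mxE.
Qed.

Definition chr2 (a : 'I_m) (y : V) : 'M[R]_m := chr1 a y *m cometric y.

Lemma chr2E a b c y : U y -> christoffel g c a b y = chr2 a y b c.
Proof.
move=> Uy; rewrite /christoffel [RHS]mxE mulr_sumr; apply: eq_bigr => d _.
have -> : cometric y d c = invmx (g y) c d.
  by rewrite -[in LHS](cometric_sym Uy) mxE.
by rewrite [chr1 _ _ _ _]mxE !mxE mulrCA [RHS]mulrC mulrCA.
Qed.

Lemma chr2_smooth a k : Ckmx U k (chr2 a).
Proof. by apply: Ckmx_mul => //; [exact: chr1_smooth|exact: cometric_smooth]. Qed.

Lemma chr2_sym a b c y : U y -> chr2 a y b c = chr2 b y a c.
Proof. by move=> Uy; rewrite !mxE; apply: eq_bigr => d _; rewrite chr1_sym. Qed.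

Lemma dmx_metric a y : U y -> dmx a g y = chr2 a y *m g y + g y *m (chr2 a y)^T.
Proof.
move=> Uy; rewrite /chr2 mulmxKV ?g_unit// trmx_mul cometric_sym// mulmxA.
by rewrite /cometric mulmxV ?g_unit// mul1mx; exact: dmx_chr1.
Qed.

Lemma dmx_cometric a y : U y ->
  dmx a cometric y = - (cometric y *m chr2 a y + (chr2 a y)^T *m cometric y).
Proof.
move=> Uy; rewrite (dmx_inv oU a Uy g_unit (g_smooth 1)) dmx_metric//.
rewrite mulmxDr mulmxDl !mulmxA mulVmx ?g_unit// mul1mx mulmxK ?g_unit//.
Qed.

Lemma partial_voldens a y : U y ->
  partial a voldens y = voldens y * \tr (chr2 a y).
Proof.
move=> Uy.
have dd : is_derive y (delta_mx 0 a) (fun z => \det (g z)) (\tr (\adj (g y) *m dmx a g y)).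
  apply: DeriveDef; first exact: (Ck_derivable (Ck_det oU (g_smooth 1)) Uy).
  exact: (partial_det a Uy (g_smooth 1)).
have pd := posdefmx_det (g_pos Uy).
have [_ e] := is_derive_comp1 dd (is_derive1_sqrt pd).
rewrite /partial [LHS]e {e dd}.
have -> : \adj (g y) = \det (g y) *: cometric y.
  rewrite /cometric /invmx g_unit// scalerA divff ?scale1r//; exact: lt0r_neq0.
rewrite dmx_metric// -scalemxAl linearZ /=; move: (chr2 a y) => C.
rewrite mulmxDr linearD /= mxtrace_mulC -mulmxA /cometric mulmxV ?g_unit// mulmx1.
rewrite mulmxA mulVmx ?g_unit// mul1mx mxtrace_tr -/(voldens y).
have vs : \det (g y) = voldens y * voldens y by rewrite -expr2 sqr_sqrtr// ltW.
have v0 : voldens y != 0 by rewrite gt_eqF// voldens_gt0.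
by rewrite vs; field.
Qed.

Hypothesis coords_harmonic : forall c y, U y ->
  \sum_a \sum_b cometric y a b * chr1 a y b c = 0.

(** The hypothesis [coords_harmonic] says that the coordinates are harmonic functions, which holds
    in Kaehler charts. The trace term coming from the density cancels against one half of the
    derivative of the cometric by symmetry of the Christoffel symbols; the other half is the
    hypothesis. First order terms thus disappear from the Laplacian. *)
Lemma divergence_cometric b y : U y ->
  \sum_a partial a (fun z => voldens z * cometric z a b) y = 0.
Proof.
move=> Uy.
have E a : partial a (fun z => voldens z * cometric z a b) y =
    voldens y * (\tr (chr2 a y) * cometric y a b -
     (cometric y *m chr2 a y) a b - ((chr2 a y)^T *m cometric y) a b).
  have d1 : derivable voldens y (delta_mx 0 a) := Ck_derivable (voldens_smooth 1) Uy.
  have d2 : derivable (fun z => cometric z a b) y (delta_mx 0 a) := Ck_derivable (cometric_smooth 1 a b) Uy.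
  rewrite (partialM d1 d2) partial_voldens//.
  have -> : partial a (fun z => cometric z a b) y = dmx a cometric y a b by rewrite mxE.
  rewrite dmx_cometric// [(- (_ + _) : 'M[R]_m) a b]mxE [(_ + _ : 'M[R]_m) a b]mxE; ring.
under eq_bigr do rewrite E.
rewrite -mulr_sumr; apply/eqP; rewrite mulf_eq0; apply/orP; right; apply/eqP.
rewrite !sumrB.
have -> : \sum_i (cometric y *m chr2 i y) i b = 0.
  under eq_bigr do rewrite mxE.
  transitivity (\sum_c (\sum_i \sum_j cometric y i j * chr1 i y j c) * cometric y c b).
    under [RHS]eq_bigr do rewrite mulr_suml.
    rewrite [RHS]exchange_big /=; apply: eq_bigr => i _.
    under [RHS]eq_bigr do rewrite mulr_suml.
    rewrite [RHS]exchange_big /=; apply: eq_bigr => j _.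
    by rewrite mxE mulr_sumr; apply: eq_bigr => c _; rewrite mulrA.
  by apply: big1 => c _; rewrite coords_harmonic// mul0r.
rewrite subr0; apply/eqP; rewrite subr_eq0; apply/eqP.
under [RHS]eq_bigr do rewrite mxE.
rewrite [RHS]exchange_big /=; apply: eq_bigr => i _.
rewrite /mxtrace mulr_suml; apply: eq_bigr => j _.
by rewrite [_^T j i]mxE (chr2_sym j i j Uy).
Qed.

Definition hess (f : V -> R) (y : V) : 'M[R]_m := \matrix_(a, b) partial a (partial b f) y.
Definition dcol (f : V -> R) (y : V) : 'cV[R]_m := \col_a partial a f y.

Lemma laplacian_hess f y : Ck 2 U f -> U y ->
  laplacian g f y = \tr (cometric y *m hess f y).
Proof.
move=> F Uy; rewrite /laplacian.
have v0 : voldens y != 0 by rewrite gt_eqF// voldens_gt0.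
apply: (mulfI v0); rewrite mulrA divff// mul1r.
have dw a b : derivable (fun z => voldens z * cometric z a b) y (delta_mx 0 a).
  exact: (Ck_derivable (CkM oU (voldens_smooth 1) (cometric_smooth 1 a b)) Uy).
have df a b : derivable (partial b f) y (delta_mx 0 a).
  exact: (Ck_derivable (Ck_partial b F) Uy).
transitivity (\sum_a \sum_b (partial a (fun z => voldens z * cometric z a b) y * partial b f y
   + voldens y * (cometric y a b * partial a (partial b f) y))).
  apply: eq_bigr => a _.
  rewrite (_ : (fun z => _) = (fun z => \sum_b voldens z * cometric z a b * partial b f z)); last first.
    by apply/funext => z; rewrite mulr_sumr; apply: eq_bigr => b _; rewrite mulrA.
  have [_ ->] := partial_sum (index_enum _) (fun b => derivableM (dw a b) (df a b)).
  by apply: eq_bigr => b _; rewrite (partialM (dw a b) (df a b)) mulrA.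
under eq_bigr do rewrite big_split /=.
rewrite big_split /= exchange_big /=.
rewrite [X in X + _]big1 ?add0r => [|b _]; last by rewrite -mulr_suml divergence_cometric// mul0r.
rewrite /mxtrace mulr_sumr; apply: eq_bigr => a _.
rewrite mxE mulr_sumr; apply: eq_bigr => b _.
by rewrite [hess _ _ _ _]mxE (partialC b a oU F Uy).
Qed.

Lemma grad_sqnormE f y : grad_sqnorm g f y = ((dcol f y)^T *m cometric y *m dcol f y) 0 0.
Proof.
rewrite /grad_sqnorm mxE exchange_big /=; apply: eq_bigr => b _.
rewrite !mxE mulr_suml; apply: eq_bigr => a _; rewrite !mxE; ring.
Qed.

End LocalGeometry.

Lemma addmxE (R : nmodType) p q (A B : 'M[R]_(p, q)) i j : (A + B) i j = A i j + B i j.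
Proof. by rewrite mxE. Qed.

Lemma oppmxE (R : zmodType) p q (A : 'M[R]_(p, q)) i j : (- A) i j = - A i j.
Proof. by rewrite mxE. Qed.

(** * Curvature and Bochner's formula in harmonic coordinates *)

Lemma curv_antisym_aux (R : realType) m (X Y h D1 D2 : 'M[R]_m) : h^T = h ->
  D1 *m h + Y *m (X *m h + h *m X^T) + ((X *m h + h *m X^T) *m Y^T + h *m D1^T) =
  D2 *m h + X *m (Y *m h + h *m Y^T) + ((Y *m h + h *m Y^T) *m X^T + h *m D2^T) ->
  (D1 - D2 + Y *m X - X *m Y) *m h = - ((D1 - D2 + Y *m X - X *m Y) *m h)^T.
Proof.
move=> hT H; apply/matrixP => i j; move/matrixP/(_ i j): H.
have tD (P Q : 'M[R]_m) : (P + Q)^T = P^T + Q^T by exact: raddfD.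
have tN (P : 'M[R]_m) : (- P)^T = - P^T by exact: raddfN.
rewrite !(mulmxDl, mulmxDr, mulNmx, mulmxN) !mulmxA.
rewrite !(tD, tN) !trmx_mul hT !mulmxA !(addmxE, oppmxE); lra.
Qed.

Section Bochner.
Variables (R : realType) (m : nat).
Local Notation V := 'rV[R]_m.
Variables (U : set V) (oU : open U) (g : V -> 'M[R]_m).
Hypothesis g_smooth : forall k, Ckmx U k g.
Hypothesis g_pos : forall y, U y -> posdefmx (g y).
Local Notation G := (cometric g).
Local Notation A := (chr2 g).

Let g_unit y : U y -> g y \in unitmx. Proof. by move=> /g_pos/posdefmx_unit. Qed.
Let A_smooth a k : Ckmx U k (A a). Proof. exact: chr2_smooth. Qed.
Let G_smooth k : Ckmx U k G. Proof. exact: cometric_smooth. Qed.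

Definition curv a b y := dmx a (A b) y - dmx b (A a) y + A b y *m A a y - A a y *m A b y.

Lemma riemannE d c a b y : U y -> riemann g d c a b y = curv a b y c d.
Proof.
move=> Uy; rewrite /riemann /curv !addmxE !oppmxE -!addrA.
have P a' b' : partial a' (christoffel g d b' c) y = dmx a' (A b') y c d.
  rewrite [RHS]mxE; apply: partial_near; move/open_nbhs_nbhs: (conj oU Uy).
  by apply: filterS => z Uz; exact: (chr2E g_pos).
rewrite !P; congr (_ + (_ + _)); rewrite sumrB; congr (_ - _).
  by rewrite [RHS]mxE; apply: eq_bigr => e _; rewrite !(chr2E g_pos)// mulrC.
by rewrite [RHS]mxE; apply: eq_bigr => e _; rewrite !(chr2E g_pos)// mulrC.
Qed.

Lemma ricciE y b c : U y -> ricci g y b c = \sum_a curv a b y c a.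
Proof. by move=> Uy; rewrite mxE; apply: eq_bigr => a _; exact: riemannE. Qed.

Lemma dmxC p q a b (B : V -> 'M[R]_(p, q)) y : U y -> Ckmx U 2 B ->
  dmx a (dmx b B) y = dmx b (dmx a B) y.
Proof.
move=> Uy H; apply/matrixP => i j; rewrite [LHS]mxE [RHS]mxE.
have E c : (fun z => dmx c B z i j) = partial c (fun z => B z i j).
  by apply/funext => z; rewrite mxE.
by rewrite !E; exact: (partialC a b oU (H i j) Uy).
Qed.

(** Second derivatives of [g] commute. Once first derivatives of [g] are eliminated by metric
    compatibility, this commutation is the skewness of the curvature endomorphism. *)
Lemma curv_antisym a b y : U y -> curv a b y *m g y = - (curv a b y *m g y)^T.
Proof.
move=> Uy.
have P a' b' : dmx a' (dmx b' g) y =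
    dmx a' (A b') y *m g y + A b' y *m dmx a' g y
    + (dmx a' g y *m (A b' y)^T + g y *m (dmx a' (A b') y)^T).
  have E z : U z -> dmx b' g z = A b' z *m g z + g z *m (A b' z)^T.
    by move=> Uz; exact: (dmx_metric oU g_pos).
  rewrite (dmx_near oU a' Uy E) (dmx_add _ Uy); last 2 first.
    by apply: Ckmx_mul => //; exact: A_smooth.
    by apply: Ckmx_mul => //; apply: Ckmx_tr => //; exact: A_smooth.
  rewrite (dmx_mul _ Uy (A_smooth _ 1) (g_smooth 1)).
  rewrite (dmx_mul _ Uy (g_smooth 1) (Ckmx_tr oU (A_smooth _ 1))).
  by rewrite dmx_tr.
have := dmxC a b Uy (g_smooth 2); rewrite !P {P}.
rewrite !(dmx_metric oU g_pos)// /curv.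
exact: curv_antisym_aux (g_pos Uy).1.
Qed.

Lemma mxtrace_curv a b y : U y -> \tr (curv a b y) = 0.
Proof.
move=> Uy; have : \tr (curv a b y *m g y *m G y) = - \tr (curv a b y *m g y *m G y).
  rewrite {1}curv_antisym// mulNmx linearN /= -[in LHS]mxtrace_tr trmx_mul trmxK.
  by rewrite (cometric_sym g_pos)// mxtrace_mulC.
by rewrite mulmxK ?g_unit// => /eqP; rewrite -addr_eq0 -mulr2n mulrn_eq0 => /eqP.
Qed.

Lemma first_bianchi a b c d y : U y ->
  curv a b y c d + curv b c y a d + curv c a y b d = 0.
Proof.
move=> Uy; rewrite /curv !addmxE !oppmxE.
have DS a' b' c' : dmx a' (A b') y c' d = dmx a' (A c') y b' d.
  rewrite [LHS]mxE [RHS]mxE; apply: partial_near; move/open_nbhs_nbhs: (conj oU Uy).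
  by apply: filterS => z Uz; exact: (chr2_sym oU g_pos).
have AS a' b' c' : (A b' y *m A a' y) c' d = (A c' y *m A a' y) b' d.
  by rewrite 2!mxE; apply: eq_bigr => e _; rewrite (chr2_sym oU g_pos b').
rewrite (DS a b c) (DS b a c) (DS c a b) (AS a b c) (AS b c a) (AS c a b); lra.
Qed.

(** Contraction of the first Bianchi identity: its middle term is a trace of the curvature
    endomorphism and vanishes by skewness. *)
Lemma ricci_sym y : U y -> (ricci g y)^T = ricci g y.
Proof.
move=> Uy; apply/matrixP => b c; rewrite mxE !ricciE//.
have := mxtrace_curv b c Uy; rewrite /mxtrace => T0.
have : \sum_a (curv a b y c a + curv b c y a a + curv c a y b a) = 0.
  by apply: big1 => a _; exact: first_bianchi.
rewrite !big_split /= T0 addr0 => /eqP; rewrite addr_eq0 => /eqP ->.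
rewrite -sumrN; apply: eq_bigr => a _; rewrite /curv !addmxE !oppmxE; lra.
Qed.

Hypothesis coords_harmonic : forall c y, U y ->
  \sum_a \sum_b G y a b * chr1 g a y b c = 0.

Lemma chr2_trace c y : U y -> \sum_a \sum_b G y a b * A a y b c = 0.
Proof.
move=> Uy.
transitivity (\sum_d (\sum_a \sum_b G y a b * chr1 g a y b d) * G y d c).
  under [RHS]eq_bigr do rewrite mulr_suml.
  rewrite [RHS]exchange_big /=; apply: eq_bigr => a _.
  under [RHS]eq_bigr do rewrite mulr_suml.
  rewrite [RHS]exchange_big /=; apply: eq_bigr => b _.
  by rewrite mxE mulr_sumr; apply: eq_bigr => d _; rewrite mulrA.
by apply: big1 => d _; rewrite coords_harmonic// mul0r.
Qed.

Variables (u : V -> R) (u_smooth : forall k, Ck k U u).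
Hypothesis u_harmonic : forall y, U y -> \tr (G y *m hess u y) = 0.
Local Notation q := (dcol u).

Lemma dcol_smooth k : Ckmx U k q.
Proof.
move=> i j; apply: (Ck_eq oU _ (Ck_partial i (u_smooth k.+1))) => y _.
by rewrite mxE.
Qed.

Definition cov_hess_col a y : 'cV[R]_m := dmx a q y - A a y *m q y.
Local Notation n := cov_hess_col.
Definition cov_hess y : 'M[R]_m := \matrix_(a, b) n a y b 0.
Local Notation N := cov_hess.

Lemma cov_hess_col_smooth a k : Ckmx U k (n a).
Proof.
apply: Ckmx_add => //; first by apply: Ckmx_dmx => //; exact: dcol_smooth.
by apply: Ckmx_opp => //; apply: Ckmx_mul => //; exact: dcol_smooth.
Qed.

Lemma cov_hess_sym a b y : U y -> N y a b = N y b a.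
Proof.
move=> Uy; rewrite [N y a b]mxE [N y b a]mxE /cov_hess_col !addmxE !oppmxE; congr (_ - _).
  have E c : (fun z => q z c 0) = partial c u by apply/funext => z; rewrite mxE.
  by rewrite [LHS]mxE [RHS]mxE !E; exact: (partialC a b oU (u_smooth 2) Uy).
by rewrite [LHS]mxE [RHS]mxE; apply: eq_bigr => c _; rewrite (chr2_sym oU g_pos a).
Qed.

Lemma cov_hess_trace y : U y -> \tr (G y *m N y) = 0.
Proof.
move=> Uy; rewrite -[RHS](u_harmonic Uy) /mxtrace.
apply/eqP; rewrite -subr_eq0 -sumrB; apply/eqP.
transitivity (- \sum_c (\sum_a \sum_b G y a b * A a y b c) * q y c 0); last first.
  by rewrite big1 ?oppr0// => c _; rewrite chr2_trace// mul0r.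
under [in RHS]eq_bigr do rewrite mulr_suml.
rewrite exchange_big /= -sumrN; apply: eq_bigr => a _.
rewrite !mxE -sumrB.
under [in RHS]eq_bigr do rewrite mulr_suml.
rewrite [in RHS]exchange_big /= -sumrN; apply: eq_bigr => b _.
rewrite cov_hess_sym// /hess [N _ _ _]mxE addmxE oppmxE [(\matrix_(_, _) _) _ _]mxE.
rewrite (partialC b a oU (u_smooth 2) Uy).
have -> : dmx a q y b 0 = partial a (partial b u) y.
  by rewrite mxE; congr (partial _ _ _); apply/funext => z; rewrite mxE.
rewrite -mulrBr [_ - _ - _]addrAC subrr add0r mulrN; congr (- _).
by rewrite mxE mulr_sumr; apply: eq_bigr => c _; rewrite mulrA.
Qed.

End Bochner.

Section BochnerFormula.
Variables (R : realType) (m : nat).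
Local Notation V := 'rV[R]_m.
Variables (U : set V) (oU : open U) (g : V -> 'M[R]_m).
Hypothesis g_smooth : forall k, Ckmx U k g.
Hypothesis g_pos : forall y, U y -> posdefmx (g y).
Local Notation G := (cometric g).
Local Notation A := (chr2 g).

Let g_unit y : U y -> g y \in unitmx. Proof. by move=> /g_pos/posdefmx_unit. Qed.
Let A_smooth a k : Ckmx U k (A a). Proof. exact: chr2_smooth. Qed.
Let G_smooth k : Ckmx U k G. Proof. exact: cometric_smooth. Qed.

Definition covd (a : 'I_m) (x : V -> 'cV[R]_m) y := dmx a x y - A a y *m x y.

Lemma partial_pairing a (x z : V -> 'cV[R]_m) y : U y -> Ckmx U 1 x -> Ckmx U 1 z ->
  partial a (fun y => ((x y)^T *m G y *m z y) 0 0) y =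
  ((covd a x y)^T *m G y *m z y) 0 0 + ((x y)^T *m G y *m covd a z y) 0 0.
Proof.
move=> Uy X Z.
have -> : partial a (fun y => ((x y)^T *m G y *m z y) 0 0) y
        = dmx a (fun y => (x y)^T *m G y *m z y) y 0 0 by rewrite mxE.
have XT : Ckmx U 1 (fun y => (x y)^T) by exact: Ckmx_tr.
rewrite (dmx_mul a Uy (Ckmx_mul oU XT (G_smooth 1)) Z) (dmx_mul a Uy XT (G_smooth 1)).
rewrite dmx_tr (dmx_cometric oU g_smooth g_pos)// /covd.
have tB (P Q : 'cV[R]_m) : (P - Q)^T = P^T - Q^T by exact: raddfB.
move: (A a y) (G y) (x y) (z y) (dmx a x y) (dmx a z y) => B H x0 z0 x1 z1.
rewrite tB trmx_mul !(mulmxDl, mulmxDr, mulNmx, mulmxN) !mulmxA.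
rewrite !(addmxE, oppmxE, mulmxDl, mulNmx); lra.
Qed.

Variables (u : V -> R) (u_smooth : forall k, Ck k U u).
Local Notation q := (dcol u).
Local Notation n := (cov_hess_col g u).
Local Notation N := (cov_hess g u).

Lemma pairingC (x z : 'cV[R]_m) y : U y -> (x^T *m G y *m z) 0 0 = (z^T *m G y *m x) 0 0.
Proof.
move=> Uy; have -> : z^T *m G y *m x = (x^T *m G y *m z)^T.
  by rewrite !trmx_mul trmxK (cometric_sym g_pos)// mulmxA.
by rewrite [RHS]mxE.
Qed.

Lemma grad_sqnorm_smooth k : Ck k U (grad_sqnorm g u).
Proof.
have Q := dcol_smooth oU u_smooth k.
have S := Ckmx_mul oU (Ckmx_mul oU (Ckmx_tr oU Q) (G_smooth k)) Q.
by apply: (Ck_eq oU _ (S 0 0)) => y _; rewrite grad_sqnormE.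
Qed.

Lemma partial_grad_sqnorm a y : U y ->
  partial a (grad_sqnorm g u) y = 2 * ((q y)^T *m G y *m n a y) 0 0.
Proof.
move=> Uy; have Q := dcol_smooth oU u_smooth 1.
have -> : grad_sqnorm g u = fun y => ((q y)^T *m G y *m q y) 0 0.
  by apply/funext => z; exact: grad_sqnormE.
rewrite (partial_pairing a Uy Q Q) pairingC// mulr_natl mulr2n; reflexivity.
Qed.

Hypothesis coords_harmonic : forall c y, U y ->
  \sum_a \sum_b G y a b * chr1 g a y b c = 0.
Hypothesis u_harmonic : forall y, U y -> \tr (G y *m hess u y) = 0.

(** The Ricci identity. [covd] differentiates the column only and leaves the labels [b], [c] alone;
    the Christoffel terms that a full covariant derivative would add are symmetric in [b], [c] and
    cancel in the difference. *)
Lemma covd_comm b c y : U y ->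
  covd b (n c) y - covd c (n b) y = curv g c b y *m q y.
Proof.
move=> Uy; have Q := dcol_smooth oU u_smooth.
have P b' c' : dmx b' (n c') y = dmx b' (dmx c' q) y - (dmx b' (A c') y *m q y + A c' y *m dmx b' q y).
  have AQ : Ckmx U 1 (fun z => A c' z *m q z) by apply: Ckmx_mul => //; exact: Q.
  have DQ : Ckmx U 1 (dmx c' q) by apply: Ckmx_dmx => //; exact: Q.
  rewrite (dmx_add b' Uy DQ (Ckmx_opp oU AQ)) (dmx_opp b' Uy AQ).
  by rewrite (dmx_mul b' Uy (A_smooth c' 1) (Q 1%N)).
rewrite /covd !P (dmxC oU b c Uy (Q 2)) /cov_hess_col /curv.
move: (A b y) (A c y) (q y) (dmx _ _ y) (dmx _ _ y) (dmx _ _ y) (dmx _ _ y) (dmx _ _ y) => B C x D1 D2 D3 D4 D5.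
rewrite !(mulmxDl, mulmxDr, mulNmx, mulmxN) !mulmxA.
by apply/matrixP => i j; rewrite !(addmxE, oppmxE); lra.
Qed.

Lemma covd_trace c y : U y ->
  \sum_a \sum_b G y a b * covd b (n a) y c 0 =
  \sum_a \sum_b G y a b * (curv g c b y *m q y) a 0.
Proof.
move=> Uy.
have NS := cov_hess_sym oU g_pos u_smooth.
(* [T] is the Christoffel correction for the label that [covd] leaves alone. By symmetry of the
   Hessian the divergence on the left equals that of [n c] minus [T] ([E1], [E2]), and [E3]
   identifies [T] with the contraction of [covd c], because the trace of the Hessian is 0. The
   difference is the commutator of [covd_comm]. *)
pose T := \tr (G y *m A c y *m N y).
have NE a b : N y a b = n a y b 0 by rewrite mxE.
have DE a b d : dmx a (n b) y d 0 = dmx a (n d) y b 0.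
  rewrite [LHS]mxE [RHS]mxE; apply: partial_near; move/open_nbhs_nbhs: (conj oU Uy).
  by apply: filterS => z Uz; have := NS b d z Uz; rewrite /cov_hess [LHS]mxE [RHS]mxE.
have E1 : \sum_a \sum_b G y a b * covd b (n a) y c 0 =
          \sum_a \sum_b G y a b * dmx b (n c) y a 0 - T.
  rewrite /T /mxtrace -sumrB; apply: eq_bigr => a _.
  have -> : (G y *m A c y *m N y) a a = \sum_b G y a b * (A c y *m N y) b a.
    by rewrite -mulmxA mxE.
  rewrite -sumrB; apply: eq_bigr => b _; rewrite -mulrBr; congr (_ * _).
  rewrite /covd addmxE oppmxE DE; congr (_ - _).
  rewrite [LHS]mxE [RHS]mxE; apply: eq_bigr => d _.
  by rewrite (chr2_sym oU g_pos b c d Uy) (NS d a _ Uy) NE.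
have E2 : \sum_a \sum_b G y a b * covd b (n c) y a 0 =
          \sum_a \sum_b G y a b * dmx b (n c) y a 0.
  apply/eqP; rewrite -subr_eq0 -sumrB; apply/eqP.
  transitivity (- \sum_d (\sum_a \sum_b G y a b * A a y b d) * N y c d); last first.
    by rewrite big1 ?oppr0// => d _; rewrite (chr2_trace coords_harmonic)// mul0r.
  under [in RHS]eq_bigr do rewrite mulr_suml.
  rewrite exchange_big /= -sumrN; apply: eq_bigr => a _.
  rewrite -sumrB.
  under [in RHS]eq_bigr do rewrite mulr_suml.
  rewrite [in RHS]exchange_big /= -sumrN; apply: eq_bigr => b _.
  rewrite /covd addmxE oppmxE -mulrBr [_ - _ - _]addrAC subrr add0r mulrN; congr (- _).
  rewrite [X in _ * X]mxE mulr_sumr; apply: eq_bigr => d _.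
  by rewrite mulrA NE (chr2_sym oU g_pos b a d Uy).
have E3 : \sum_a \sum_b G y a b * covd c (n b) y a 0 = T.
  have E0 : \sum_a \sum_b G y a b * dmx c (n b) y a 0 = 2 * T.
    have dG a b : derivable (fun z => G z a b) y (delta_mx 0 c) := Ck_derivable (G_smooth 1 a b) Uy.
    have dN a b : derivable (fun z => n b z a 0) y (delta_mx 0 c) :=
      Ck_derivable (cov_hess_col_smooth oU g_smooth g_pos u_smooth b 1 a 0) Uy.
    have Z : partial c (fun z => \sum_a \sum_b G z a b * n b z a 0) y = 0.
      transitivity (partial c (fun=> 0 : R) y); last exact: (derive_cst (0:R)).
      apply: partial_near.
      move/open_nbhs_nbhs: (conj oU Uy); apply: filterS => z Uz.
      rewrite -[RHS](cov_hess_trace oU g_pos coords_harmonic u_smooth u_harmonic Uz).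
      rewrite /mxtrace; apply: eq_bigr => a _; rewrite [RHS]mxE; apply: eq_bigr => b _.
      by rewrite [N z b a]mxE.
    have D1 a := partial_sum (index_enum _) (fun b => derivableM (dG a b) (dN a b)).
    have D2 := partial_sum (index_enum _) (fun a => (D1 a).1).
    move: Z; rewrite D2.2.
    under eq_bigr do rewrite (D1 _).2.
    have -> : \sum_a \sum_b partial c (fun z => G z a b * n b z a 0) y =
       \sum_a \sum_b dmx c G y a b * N y b a + \sum_a \sum_b G y a b * dmx c (n b) y a 0.
      rewrite -big_split; apply: eq_bigr => a _; rewrite -big_split; apply: eq_bigr => b _.
      by rewrite (partialM (dG a b) (dN a b)) NE; congr (_ * _ + _ * _); rewrite mxE.
    have -> : \sum_a \sum_b dmx c G y a b * N y b a = \tr (dmx c G y *m N y).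
      by apply: eq_bigr => a _; rewrite mxE.
    rewrite (dmx_cometric oU g_smooth g_pos)// mulNmx mulmxDl raddfN raddfD /=.
    have -> : \tr ((A c y)^T *m G y *m N y) = T.
      have NT : (N y)^T = N y by apply/matrixP => i j; rewrite mxE NS.
      rewrite /T; move: (A c y) (N y) (G y) NT (cometric_sym g_pos Uy) => B K H KT HT.
      by rewrite -mxtrace_tr !trmx_mul KT trmxK HT mxtrace_mulC.
    by rewrite -/T => /eqP; rewrite addrC subr_eq0 => /eqP ->; rewrite mulr_natl mulr2n.
  transitivity (\sum_a \sum_b G y a b * dmx c (n b) y a 0 - T); last by rewrite E0 mulr_natl mulr2n addrK.
  have -> : T = \tr (A c y *m N y *m G y) by rewrite /T -mulmxA mxtrace_mulC.
  rewrite /mxtrace -sumrB; apply: eq_bigr => a _; rewrite [in X in _ - X]mxE -sumrB.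
  apply: eq_bigr => b _; rewrite /covd addmxE oppmxE mulrBr; congr (_ - _).
  rewrite mulrC -[in LHS](cometric_sym g_pos Uy) [(G y)^T a b]mxE; congr (_ * _).
  by rewrite [LHS]mxE [RHS]mxE; apply: eq_bigr => d _; rewrite -NE NS.
have E4 : \sum_a \sum_b G y a b * (covd b (n c) y - covd c (n b) y) a 0 =
          \sum_a \sum_b G y a b * (curv g c b y *m q y) a 0.
  by apply: eq_bigr => a _; apply: eq_bigr => b _; rewrite covd_comm.
rewrite -E4 E1 -E2 -E3 -sumrB; apply: eq_bigr => a _; rewrite -sumrB.
by apply: eq_bigr => b _; rewrite -mulrBr addmxE oppmxE.
Qed.

(** In harmonic coordinates the left side is the Laplacian of |du|^2, and [(q y)^T *m G y] is the
    gradient of [u] as a row vector. Differentiating |du|^2 twice leaves |N|^2 and the divergence of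
    the Hessian, which [covd_trace] turns into Ricci curvature. *)
Lemma bochner y : U y ->
  \tr (G y *m hess (grad_sqnorm g u) y) =
  2 * (\tr (G y *m N y *m G y *m (N y)^T) + quad (ricci g y) ((q y)^T *m G y)).
Proof.
move=> Uy; have Q := dcol_smooth oU u_smooth 1.
have NE a b : N y a b = n a y b 0 by rewrite mxE.
pose v := (q y)^T *m G y.
have H a b : hess (grad_sqnorm g u) y b a =
    2 * ((N y *m G y *m (N y)^T) b a + \sum_c v 0 c * covd b (n a) y c 0).
  have S := cov_hess_col_smooth oU g_smooth g_pos u_smooth a 1.
  rewrite mxE.
  have -> : partial b (partial a (grad_sqnorm g u)) y =
            partial b (fun z => 2 * ((q z)^T *m G z *m n a z) 0 0) y.
    apply: partial_near; move/open_nbhs_nbhs: (conj oU Uy).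
    by apply: filterS => z Uz; exact: partial_grad_sqnorm.
  have F : Ck 1 U (fun z => ((q z)^T *m G z *m n a z) 0 0).
    by apply: Ckmx_mul => //; apply: Ckmx_mul => //; exact: Ckmx_tr.
  rewrite [LHS](deriveZ 2 (Ck_derivable F Uy)) [LHS]/GRing.scale /=; congr (2 * _).
  rewrite [LHS](partial_pairing b Uy Q S); congr (_ + _).
    rewrite [LHS]mxE [RHS]mxE; apply: eq_bigr => c _; congr (_ * _); last first.
      by rewrite -NE [RHS]mxE.
    rewrite [LHS]mxE [RHS]mxE; apply: eq_bigr => d _; congr (_ * _).
    by rewrite NE [LHS]mxE.
  by rewrite [LHS]mxE.
rewrite /mxtrace.
transitivity (\sum_a \sum_b G y a b * (2 * ((N y *m G y *m (N y)^T) b a + \sum_c v 0 c * covd b (n a) y c 0))).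
  by apply: eq_bigr => a _; rewrite [LHS]mxE; apply: eq_bigr => b _; rewrite H.
rewrite -[G y *m N y *m G y *m (N y)^T]mulmxA.
transitivity (2 * (\sum_a \sum_b G y a b * (N y *m G y *m (N y)^T) b a +
   \sum_c v 0 c * \sum_a \sum_b G y a b * covd b (n a) y c 0)).
  have -> : \sum_c v 0 c * (\sum_a \sum_b G y a b * covd b (n a) y c 0) =
     \sum_a \sum_b G y a b * \sum_c v 0 c * covd b (n a) y c 0.
    under eq_bigr do rewrite mulr_sumr.
    rewrite exchange_big; apply: eq_bigr => a _ /=.
    under eq_bigr do rewrite mulr_sumr.
    rewrite exchange_big; apply: eq_bigr => b _ /=.
    by rewrite mulr_sumr; apply: eq_bigr => c _; rewrite mulrCA.
  rewrite mulrDr !mulr_sumr -big_split; apply: eq_bigr => a _ /=.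
  rewrite !mulr_sumr -big_split; apply: eq_bigr => b _ /=; lra.
congr (2 * (_ + _)).
  apply: eq_bigr => a _; rewrite -!mulmxA [RHS]mxE; apply: eq_bigr => b _.
  by rewrite !mulmxA.
under eq_bigr do rewrite covd_trace//.
have gv : q y = g y *m v^T.
  by rewrite /v trmx_mul trmxK (cometric_sym g_pos)// mulmxA mulmxV ?g_unit// mul1mx.
have X c b : (curv g c b y *m q y)^T = - (v *m curv g c b y *m g y).
  have CA := curv_antisym oU g_smooth g_pos c b Uy.
  by rewrite gv mulmxA trmx_mul trmxK -[in RHS]mulmxA [in RHS]CA mulmxN opprK.
rewrite /quad -/v [RHS]mxE.
transitivity (\sum_c v 0 c * \sum_b - (v *m curv g c b y) 0 b).
  apply: eq_bigr => c _; congr (_ * _); rewrite exchange_big /=; apply: eq_bigr => b _.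
  have -> : - (v *m curv g c b y) 0 b = (- (v *m curv g c b y *m g y) *m G y) 0 b.
    by rewrite mulNmx oppmxE mulmxK// g_unit.
  rewrite -X [RHS]mxE; apply: eq_bigr => a _; rewrite mulrC; congr (_ * _).
  by rewrite [RHS]mxE.
apply: eq_bigr => c _; rewrite mulrC [v^T c 0]mxE; congr (_ * _).
have curvN b d e : - curv g c b y d e = curv g b c y d e.
  by rewrite /curv !(addmxE, oppmxE); lra.
transitivity (\sum_b \sum_d v 0 d * curv g b c y d b).
  apply: eq_bigr => b _; rewrite mxE -sumrN; apply: eq_bigr => d _.
  by rewrite -mulrN curvN.
rewrite exchange_big mxE; apply: eq_bigr => d _; rewrite -mulr_sumr; congr (_ * _).
by rewrite -(ricci_sym oU g_smooth g_pos Uy) [RHS]mxE (ricciE oU g_pos).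
Qed.

End BochnerFormula.

(** * Kaehler geometry in a chart *)

Section HermitianAlgebra.
Variables (R : realType) (n : nat).
Local Notation I := (mulI_mx R n).

Lemma mulI_sqr : I *m I = - 1%:M.
Proof.
rewrite /mulI_mx mulmx_block !mulmx1 !mul1mx !mulmx0 !mul0mx !add0r !addr0.
by rewrite [in RHS]scalar_mx_block opp_block_mx !oppr0.
Qed.

Lemma mulI_tr : I^T = - I.
Proof. by rewrite /mulI_mx tr_block_mx !trmx0 linearN /= !trmx1 opp_block_mx !oppr0 opprK. Qed.

Lemma mulI_trK : I *m I^T = 1%:M.
Proof. by rewrite mulI_tr mulmxN mulI_sqr opprK. Qed.

Lemma mulI_trVK : I^T *m I = 1%:M.
Proof. by rewrite mulI_tr mulNmx mulI_sqr opprK. Qed.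

Lemma hermitian_comm (g : 'M[R]_(n + n)) : I *m g *m I^T = g <-> I *m g = g *m I.
Proof.
split=> [H|H]; last by rewrite H -mulmxA mulI_trK mulmx1.
by rewrite -[in RHS]H -!mulmxA mulI_trVK mulmx1.
Qed.

Lemma hermitian_inv (g : 'M[R]_(n + n)) : g \in unitmx -> I *m g = g *m I ->
  I *m invmx g = invmx g *m I.
Proof.
move=> gu H; apply: (can_inj (mulKmx gu)).
by rewrite !mulmxA -H mulmxV// mul1mx mulmxK.
Qed.

(* A symmetric form that is anti-invariant under the complex structure is
   orthogonal to every Hermitian one. *)
Lemma antiinv_trace (G S : 'M[R]_(n + n)) : I *m G = G *m I -> I *m S = S *m I^T ->
  \tr (G *m S) = 0.
Proof.
move=> GI SI.
have : \tr (G *m S) = - \tr (G *m S).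
  rewrite -[in LHS](mul1mx (G *m S)) -mulI_trVK -!mulmxA (mulmxA I) GI -!mulmxA SI.
  rewrite mxtrace_mulC -!mulmxA -trmx_mul mulI_sqr.
  by rewrite linearN /= trmx1 !mulmxN mulmx1 linearN.
by move=> /eqP; rewrite -addr_eq0 -mulr2n mulrn_eq0 => /eqP.
Qed.

Lemma mxtrace_psd p (G X : 'M[R]_p) : posdefmx G ->
  0 <= \tr (G *m X *m G *m X^T) /\ (\tr (G *m X *m G *m X^T) = 0 -> X = 0).
Proof.
move=> Gp; have [E GE] := cholesky Gp.
have Eu : E \in unitmx.
  have := posdefmx_unit Gp; rewrite GE unitmx_mul => /andP[_ //].
have -> : \tr (G *m X *m G *m X^T) = \tr ((E *m X *m E^T) *m (E *m X *m E^T)^T).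
  by rewrite GE -!mulmxA mxtrace_mulC !trmx_mul trmxK !mulmxA.
split; first exact: mxtrace_sqr_ge0.
move=> /mxtrace_sqr_eq0 H.
have ETu : E^T \in unitmx by rewrite unitmx_tr.
apply: (can_inj (mulKmx Eu)); rewrite mulmx0.
by apply: (can_inj (mulmxK ETu)); rewrite H mul0mx.
Qed.

(** The vectors [v] and [w = I^T v] are orthogonal of equal length, and N w = I (N v) has the length
    of N v. The plane they span therefore already contributes 2 |N v|^2 / |v|^2 to the squared norm
    of N. [Q] is the orthogonal projector that kills this plane, and the squared norm of N Q is the
    nonnegative remainder. *)
Lemma kato (g N : 'M[R]_(n + n)) (v : 'cV[R]_(n + n)) :
  posdefmx g -> I *m g = g *m I -> N^T = N -> I *m N = N *m I^T ->
  2 * ((N *m v)^T *m invmx g *m (N *m v)) 0 0 <=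
  (v^T *m g *m v) 0 0 * \tr (invmx g *m N *m invmx g *m N^T).
Proof.
move=> gp gI NT NI; have gu := posdefmx_unit gp; set G := invmx g.
have Gp : posdefmx G := posdefmx_inv gp.
have GI : I *m G = G *m I := hermitian_inv gu gI.
have [->|v0] := eqVneq v 0.
  by rewrite trmx0 !mul0mx mulmx0 trmx0 !mul0mx !mxE !mul0r mulr0.
pose w := I^T *m v.
set E := (v^T *m g *m v) 0 0.
have gT := gp.1.
have E0 : 0 < E.
  have := gp.2 v^T; rewrite /quad trmxK; apply.
  by apply: contra_neq v0 => /(congr1 trmx); rewrite trmxK trmx0.
have vv : v^T *m g *m v = E%:M by rewrite [LHS]mx11_scalar.
have ww : w^T *m g *m w = E%:M.
  rewrite /w trmx_mul trmxK -!mulmxA (mulmxA g) (mulmxA I) (mulmxA I g) gI.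
  by rewrite -(mulmxA g I) mulI_trK mulmx1 mulmxA.
have vw : v^T *m g *m w = 0.
  have X : (v^T *m g *m w)^T = - (v^T *m g *m w).
    rewrite /w !trmx_mul !trmxK gT mulI_tr !mulNmx !mulmxN opprK.
    by rewrite -!mulmxA; congr (v^T *m _); rewrite !mulmxA gI.
  rewrite [LHS]mx11_scalar; move/matrixP/(_ 0 0): X; rewrite mxE oppmxE => /eqP.
  by rewrite -addr_eq0 -mulr2n mulrn_eq0 => /eqP ->; rewrite raddf0.
have wv : w^T *m g *m v = 0.
  by apply: trmx_inj; rewrite [LHS]trmx_mul [X in _ *m X]trmx_mul trmxK gT mulmxA vw trmx0.
pose P := v *m v^T + w *m w^T.
have PgP : P *m g *m P = E *: P.
  have pp (x z : 'cV[R]_(n + n)) :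
      x *m x^T *m g *m (z *m z^T) = x *m (x^T *m g *m z) *m z^T by rewrite !mulmxA.
  rewrite /P !mulmxDl !mulmxDr !pp vv ww vw wv !mulmx0 !mul0mx addr0 add0r.
  by rewrite !mul_mx_scalar -!scalemxAl scalerDr.
pose Q := 1%:M - E^-1 *: (P *m g).
have QGQ : Q *m G *m Q^T = G - E^-1 *: P.
  have PT : P^T = P by rewrite /P linearD /= !trmx_mul !trmxK.
  have QT : Q^T = 1%:M - E^-1 *: (g *m P).
    by rewrite /Q linearB linearZ /= trmx1 trmx_mul PT gT.
  have QG : Q *m G = G - E^-1 *: P.
    by rewrite /Q mulmxBl mul1mx -scalemxAl mulmxK.
  rewrite QT QG mulmxBr mulmx1 -scalemxAr mulmxBl mulKmx// -scalemxAl mulmxA PgP.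
  by rewrite scalerA mulVf ?gt_eqF// scale1r subrr scaler0 subr0.
have := (mxtrace_psd (N *m Q) Gp).1.
have -> : \tr (G *m (N *m Q) *m G *m (N *m Q)^T) = \tr (G *m N *m (Q *m G *m Q^T) *m N^T).
  by rewrite trmx_mul !mulmxA.
rewrite QGQ mulmxBr mulmxBl linearB /= -!scalemxAr -scalemxAl linearZ /= => H.
have T (x : 'cV[R]_(n + n)) : \tr (G *m N *m (x *m x^T) *m N^T) = ((N *m x)^T *m G *m (N *m x)) 0 0.
  have -> : G *m N *m (x *m x^T) *m N^T = G *m (N *m x) *m (N *m x)^T.
    by rewrite trmx_mul !mulmxA.
  rewrite mxtrace_mulC [LHS]/mxtrace big_ord1.
  by rewrite !mulmxA.
have Nw : N *m w = I *m (N *m v) by rewrite /w mulmxA -NI mulmxA.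
have TP : \tr (G *m N *m P *m N^T) = 2 * ((N *m v)^T *m G *m (N *m v)) 0 0.
  rewrite /P mulmxDr mulmxDl linearD /= !T Nw mulr_natl mulr2n; congr (_ + _).
  rewrite trmx_mul -!mulmxA (mulmxA G) -GI -(mulmxA I G) (mulmxA I^T).
  by rewrite mulI_trVK mul1mx.
by rewrite -TP -ler_pdivrMl// -subr_ge0.
Qed.

End HermitianAlgebra.

(** * Lowest eigenvalue relative to a metric *)

Lemma quadD (R : realType) m (h : 'M[R]_m) (v w : 'rV[R]_m) (t : R) : h^T = h ->
  quad h (v + t *: w) = quad h v + 2 * t * (v *m h *m w^T) 0 0 + t ^+ 2 * quad h w.
Proof.
move=> hT; rewrite /quad.
have tD : (v + t *: w)^T = v^T + t *: w^T by apply/matrixP => i j; rewrite !mxE.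
have E : (w *m h *m v^T) 0 0 = (v *m h *m w^T) 0 0.
  have -> : w *m h *m v^T = (v *m h *m w^T)^T by rewrite !trmx_mul trmxK hT mulmxA.
  by rewrite mxE.
rewrite tD !mulmxDl !mulmxDr -?scalemxAl -?scalemxAr -?scalemxAl ?mulmxDl -?scalemxAl -?scalemxAr !addmxE.
have sE (c : R) (X : 'M[R]_1) : (c *: X) 0 0 = c * X 0 0 by rewrite mxE.
by rewrite !sE E; ring.
Qed.

Lemma psd_kernel_aux (R : realType) (b c : R) : 0 <= c ->
  0 <= 2 * (- b / (c + 1)) * b + (- b / (c + 1)) ^+ 2 * c -> b = 0.
Proof.
move=> c0.
have c1 : 0 < c + 1 by lra.
have -> : 2 * (- b / (c + 1)) * b + (- b / (c + 1)) ^+ 2 * c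
    = - (b ^+ 2 * (c + 2)) / (c + 1) ^+ 2 by field; rewrite gt_eqF.
rewrite pmulr_lge0 ?invr_gt0 ?exprn_gt0// oppr_ge0 => H.
have c2 : 0 < c + 2 by lra.
have : b ^+ 2 * (c + 2) == 0 by rewrite eq_le H mulr_ge0 ?sqr_ge0// ltW.
by rewrite mulf_eq0 sqrf_eq0 (gt_eqF c2) orbF => /eqP.
Qed.

(** The form is tested at v + t w with w = v T. Its linear coefficient in t is 2 |w|^2, which a
    small negative t exposes; the +1 in t = - b / (c + 1) keeps the denominator positive when c =
    0. *)
Lemma psd_kernel (R : realType) m (T : 'M[R]_m) v : T^T = T ->
  (forall w, 0 <= quad T w) -> quad T v = 0 -> v *m T = 0.
Proof.
move=> TT Tp v0; pose w := v *m T.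
pose b := sqnorm w; pose c := quad T w.
have E : (v *m T *m w^T) 0 0 = b by rewrite /b sqnorm_quad /quad mulmx1.
have c0 : 0 <= c := Tp w.
have := Tp (v + (- b / (c + 1)) *: w); rewrite quadD// v0 E -/c add0r => H.
have b0 := psd_kernel_aux c0 H; apply/eqP; rewrite -normr_eq0 -sqrf_eq0.
by rewrite eq_le sqr_ge0 andbT -[0]b0 /b -/w le_sqnorm.
Qed.

(** The quotient of the two forms attains a minimum [l] on the sup-norm unit sphere, and
    [psd_kernel] makes the minimizer an eigenvector. So [l] is an eigenvalue, and all eigenvalues
    are at least [l], which gives the lower bound that comparison with the infimum requires. *)
Lemma rayleigh (R : realType) m (S g : 'M[R]_m) (v : 'rV[R]_m) :
  S^T = S -> posdefmx g ->
  inf [set a | eigenvalue (S *m invmx g) a] * quad g v <= quad S v.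
Proof.
move=> ST gp; have gu := posdefmx_unit gp.
have [->|v0] := eqVneq v 0.
  by rewrite /quad !mul0mx !mxE mulr0.
pose K : set 'rV[R]_m := [set x | `|x| = 1].
have Kc : compact K.
  apply: bounded_closed_compact.
    by exists 1; split => // M M1 x xK; apply: (@le_trans _ _ 1); [rewrite le_eqVlt; apply/orP; left; apply/eqP; exact: xK|exact: ltW].
  have -> : K = (@Num.norm _ 'rV[R]_m) @^-1` [set (1:R)] by [].
  by apply: closed_comp => [x _|]; [exact: norm_continuous|exact: closed_eq].
have K0 (x : 'rV[R]_m) : x != 0 -> K (`|x|^-1 *: x).
  by move=> x0; rewrite /K /= normrZ normfV normr_id mulVf// normr_eq0.
have qz (h : 'M[R]_m) (t : R) x : quad h (t *: x) = t ^+ 2 * quad h x.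
  by rewrite /quad linearZ /= -!scalemxAl -scalemxAr scalerA mxE expr2.
have qc (h : 'M[R]_m) : continuous (quad h).
  have -> : quad h = (fun y => quad h (y - 0)) by apply/funext => y; rewrite subr0.
  exact: (Ck_setT_continuous (Ck_quad 0 h 0 openT)).
pose r x := quad S x / quad g x.
have rc : {within K, continuous r}.
  apply: continuous_in_subspaceT => x /set_mem xK.
  apply: continuousM; first exact: qc.
  apply: continuousV; last exact: qc.
  rewrite gt_eqF// gp.2//; apply/eqP => x0; move: xK.
  by rewrite /K /= x0 normr0 => /esym/eqP; rewrite oner_eq0.
have [x xK xmin] := compact_EVT_min (ex_intro _ _ (K0 v v0)) Kc rc.
have x0 : x != 0.
  apply/eqP => x0; move/set_mem: xK.
  by rewrite /K /= x0 normr0 => /esym/eqP; rewrite oner_eq0.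
pose l := r x; pose T := S - l *: g.
have qT y : quad T y = quad S y - l * quad g y.
  by rewrite /quad /T mulmxBr mulmxBl -scalemxAr -scalemxAl !mxE.
have Tp y : 0 <= quad T y.
  have [->|y0] := eqVneq y 0; first by rewrite /quad !mul0mx mxE.
  have y1 : 0 < `|y| by rewrite normr_gt0.
  have := xmin _ (mem_set (K0 y y0)); rewrite -/l /r !qz.
  rewrite invfM mulrACA divff ?sqrf_eq0 ?invr_eq0 ?gt_eqF// mul1r.
  by rewrite ler_pdivlMr ?gp.2// qT subr_ge0.
have xT : x *m T = 0.
  apply: psd_kernel => //; first by rewrite /T linearB linearZ /= ST gp.1.
  by rewrite qT /l /r divfK ?subrr// gt_eqF// gp.2.
have El : eigenvalue (S *m invmx g) l.
  apply/eigenvalueP; exists x => //.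
  move/eqP: xT; rewrite /T mulmxBr subr_eq0 -scalemxAr => /eqP xS.
  by rewrite mulmxA xS -scalemxAl mulmxK.
have lb : has_lbound [set a | eigenvalue (S *m invmx g) a].
  exists l => a /= /eigenvalueP[y yE y0].
  have yS : y *m S = a *: (y *m g).
    by rewrite scalemxAl -yE mulmxA mulmxKV.
  have := Tp y; rewrite qT {1}/quad yS -scalemxAl mxE -/(quad g y) -mulrBl.
  by rewrite pmulr_lge0 ?gp.2// subr_ge0.
apply: le_trans (_ : l * quad g v <= _); last by have := Tp v; rewrite qT subr_ge0.
by rewrite ler_wpM2r//; [exact/ltW/gp.2|exact: ge_inf].
Qed.

Lemma bochner_aux (R : realType) (a b c d : R) :
  2 * (a + b) = 2 * (c + d) -> 2 * a <= c -> a - b <= - d.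
Proof. move=> *; lra. Qed.

(** * Kaehler metrics in a holomorphic chart *)

Section KaehlerLocal.
Variables (R : realType) (n : nat).
Local Notation V := 'rV[R]_(n + n).
Local Notation I := (mulI_mx R n).
Variables (U : set V) (oU : open U) (g : V -> 'M[R]_(n + n)).
Hypothesis g_smooth : forall k, Ckmx U k g.
Hypothesis g_pos : forall y, U y -> posdefmx (g y).
Hypothesis g_hermitian : forall y, U y -> I *m g y *m I^T = g y.
Hypothesis g_closed : forall y, U y -> forall a b c,
  partial a (fun z => (I *m g z) b c) y + partial b (fun z => (I *m g z) c a) y
  + partial c (fun z => (I *m g z) a b) y = 0.
Local Notation G := (cometric g).

Let g_unit y : U y -> g y \in unitmx. Proof. by move=> /g_pos/posdefmx_unit. Qed.
Let g_I y : U y -> I *m g y = g y *m I. Proof. by move=> /g_hermitian/hermitian_comm. Qed.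

Lemma cometric_comm y : U y -> I *m G y = G y *m I.
Proof. by move=> Uy; apply: hermitian_inv; [exact: g_unit|exact: g_I]. Qed.

(* [dmetric y x v w] is the derivative of g(v, w) in the direction x *)
Definition dmetric (y x v w : V) : R := (v *m (\sum_a x 0 a *: dmx a g y) *m w^T) 0 0.

Lemma dmetricE y x v w :
  dmetric y x v w = \sum_a x 0 a * (v *m dmx a g y *m w^T) 0 0.
Proof.
rewrite /dmetric mulmx_sumr mulmx_suml summxE; apply: eq_bigr => a _.
by rewrite -scalemxAr -scalemxAl mxE.
Qed.

Lemma dmetric_sym y x v w : U y -> dmetric y x v w = dmetric y x w v.
Proof.
move=> Uy; rewrite !dmetricE; apply: eq_bigr => a _; congr (_ * _).
have -> : w *m dmx a g y *m v^T = (v *m dmx a g y *m w^T)^T.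
  by rewrite !trmx_mul trmxK (dmx_sym oU g_pos)// mulmxA.
by rewrite [RHS]mxE.
Qed.

Lemma dmetric_hermitian y x v w : U y -> dmetric y x (v *m I) (w *m I) = dmetric y x v w.
Proof.
move=> Uy; rewrite !dmetricE; apply: eq_bigr => a _; congr (_ * _).
have C B : Ckmx U 1 (fun=> B : 'M[R]_(n + n)) by exact: Ckmx_cst.
have H : dmx a g y = I *m dmx a g y *m I^T.
  have E z : U z -> g z = I *m g z *m I^T by move=> Uz; rewrite g_hermitian.
  rewrite {1}(dmx_near oU a Uy E) (dmx_mul a Uy (Ckmx_mul oU (C I) (g_smooth 1)) (C I^T)).
  by rewrite (dmx_mul a Uy (C I) (g_smooth 1)) !dmx_cst mul0mx add0r mulmx0 addr0.
by rewrite [in RHS]H trmx_mul !mulmxA.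
Qed.

Lemma dmetric_omega y x v w : U y -> dmetric y x (v *m I) w =
  \sum_a \sum_b \sum_c x 0 a * v 0 b * w 0 c * partial a (fun z => (I *m g z) b c) y.
Proof.
move=> Uy; rewrite dmetricE; apply: eq_bigr => a _.
have H : I *m dmx a g y = dmx a (fun z => I *m g z) y.
  by rewrite (dmx_mul a Uy (Ckmx_cst oU 1 I) (g_smooth 1)) dmx_cst mul0mx add0r.
rewrite -(mulmxA v) H mxE mulr_sumr exchange_big; apply: eq_bigr => c _ /=.
rewrite mxE mulr_suml mulr_sumr; apply: eq_bigr => b _; rewrite !mxE.
set p := partial _ _ _; ring.
Qed.

Lemma dmetric_closed y x v w : U y ->
  dmetric y x (v *m I) w + dmetric y v (w *m I) x + dmetric y w (x *m I) v = 0.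
Proof.
move=> Uy; rewrite !dmetric_omega//.
pose K a b c := partial a (fun z => (I *m g z) b c) y.
rewrite -!/(K _ _ _).
have -> : \sum_a \sum_b \sum_c v 0 a * w 0 b * x 0 c * partial a (fun z => (I *m g z) b c) y =
          \sum_a \sum_b \sum_c x 0 a * v 0 b * w 0 c * K b c a.
  rewrite [RHS]exchange_big; apply: eq_bigr => a _ /=.
  rewrite [RHS]exchange_big; apply: eq_bigr => b _ /=.
  by apply: eq_bigr => c _; rewrite -/(K a b c); ring.
have -> : \sum_a \sum_b \sum_c w 0 a * x 0 b * v 0 c * partial a (fun z => (I *m g z) b c) y =
          \sum_a \sum_b \sum_c x 0 a * v 0 b * w 0 c * K c a b.
  rewrite exchange_big; apply: eq_bigr => a _ /=.
  rewrite exchange_big; apply: eq_bigr => b _ /=.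
  by apply: eq_bigr => c _; rewrite -/(K c a b); ring.
rewrite -!big_split big1// => a _; rewrite -!big_split big1// => b _ /=.
rewrite -!big_split big1// => c _ /=.
by rewrite -!mulrDr g_closed// mulr0.
Qed.

Let J : V -> V := mulmx^~ I.
Let JJ x : J (J x) = - x. Proof. by rewrite /J -mulmxA mulI_sqr mulmxN mulmx1. Qed.

Let dmetricN2 y x v w : dmetric y x (- v) w = - dmetric y x v w.
Proof. by rewrite /dmetric !mulNmx mxE. Qed.

Lemma dmetric_christoffel y x v w : U y ->
  dmetric y (x *m I) v w + dmetric y v (x *m I) w - dmetric y w (x *m I) v =
  dmetric y x (v *m I) w + dmetric y (v *m I) x w - dmetric y w x (v *m I).
Proof.
move=> Uy; apply: (@kaehler_christoffel R _ J (dmetric y)).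
- exact: JJ.
- exact: dmetricN2.
- by move=> *; exact: dmetric_sym.
- by move=> *; exact: dmetric_hermitian.
- by move=> *; exact: dmetric_closed.
Qed.

Lemma dmetric_codifferential y b x v : U y ->
  2 * dmetric y (b *m I) x v = dmetric y x v (b *m I) + dmetric y v x (b *m I)
     + dmetric y (x *m I) v b + dmetric y (v *m I) x b.
Proof.
move=> Uy; apply: (@kaehler_codifferential R _ J (dmetric y)).
- exact: JJ.
- exact: dmetricN2.
- by move=> *; exact: dmetric_sym.
- by move=> *; exact: dmetric_hermitian.
- by move=> *; exact: dmetric_closed.
Qed.

Definition lower_chr c y : 'M[R]_(n + n) := \matrix_(a, b) chr1 g a y b c.

Lemma lower_chrE c y (x v : V) : U y ->
  (x *m lower_chr c y *m v^T) 0 0 =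
  2^-1 * (dmetric y x v (delta_mx 0 c) + dmetric y v x (delta_mx 0 c)
          - dmetric y (delta_mx 0 c) x v).
Proof.
move=> Uy.
have D3 : dmetric y (delta_mx 0 c) x v = \sum_a \sum_b x 0 a * v 0 b * dmx c g y a b.
  rewrite dmetricE (bigD1 c)//= big1 ?addr0 => [|e ea]; last first.
    by rewrite mxE (negbTE ea) andbF mul0r.
  rewrite mxE !eqxx mul1r mxE exchange_big; apply: eq_bigr => b _ /=.
  rewrite mxE mulr_suml; apply: eq_bigr => a _; rewrite [v^T _ _]mxE; ring.
have D1 x' v' : dmetric y x' v' (delta_mx 0 c) = \sum_a \sum_b x' 0 a * v' 0 b * dmx a g y b c.
  rewrite dmetricE; apply: eq_bigr => a _.
  rewrite trmx_delta -colE [col _ _ _ _]mxE mxE mulr_sumr.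
  by apply: eq_bigr => b _; rewrite mulrA.
rewrite !D1 D3 mxE.
rewrite [X in _ + X - _]exchange_big /=.
rewrite -big_split -sumrB mulr_sumr.
under eq_bigr do rewrite mxE mulr_suml.
rewrite exchange_big; apply: eq_bigr => a _ /=.
rewrite -big_split -sumrB mulr_sumr; apply: eq_bigr => b _ /=.
rewrite [lower_chr _ _ _ _]mxE [chr1 _ _ _ _ _]mxE [v^T _ _]mxE.
move: (dmx _ _ _ _ _) (dmx _ _ _ _ _) (dmx _ _ _ _ _) => X Y Z; ring.
Qed.

(** In complex terms: the Christoffel symbols of mixed type vanish. *)
Lemma lower_chr_antiinv c y : U y -> I *m lower_chr c y = lower_chr c y *m I^T.
Proof.
move=> Uy; apply/matrixP => a b.
have E (B : 'M[R]_(n + n)) : B a b = ((delta_mx 0 a : V) *m B *m (delta_mx 0 b : V)^T) 0 0.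
  by rewrite -rowE trmx_delta -colE !mxE.
rewrite E [RHS]E.
have -> : delta_mx 0 a *m (I *m lower_chr c y) *m (delta_mx 0 b : V)^T =
  (delta_mx 0 a : V) *m I *m lower_chr c y *m (delta_mx 0 b : V)^T by rewrite !mulmxA.
have -> : delta_mx 0 a *m (lower_chr c y *m I^T) *m (delta_mx 0 b : V)^T =
  (delta_mx 0 a : V) *m lower_chr c y *m ((delta_mx 0 b : V) *m I)^T.
  by rewrite trmx_mul !mulmxA.
rewrite !lower_chrE//; congr (_ * _).
exact: dmetric_christoffel.
Qed.

(** Anti-invariant forms are traceless against the Hermitian cometric. This discharges the
    hypothesis [coords_harmonic] under which the Laplacian and Bochner's formula were computed. *)
Lemma kaehler_coords_harmonic c y : U y ->
  \sum_a \sum_b G y a b * chr1 g a y b c = 0.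
Proof.
move=> Uy; rewrite -[RHS](antiinv_trace (cometric_comm Uy) (lower_chr_antiinv c Uy)).
apply: eq_bigr => a _; rewrite [RHS]mxE; apply: eq_bigr => b _.
by rewrite [lower_chr c y b a]mxE (chr1_sym oU g_pos a b c Uy).
Qed.

Variables (u : V -> R).

Lemma cov_hess_antiinv y : U y -> Ck 2 U u -> I *m hess u y = hess u y *m I^T ->
  I *m cov_hess g u y = cov_hess g u y *m I^T.
Proof.
move=> Uy u2 Hu.
have -> : cov_hess g u y = hess u y - \sum_d (G y *m dcol u y) d 0 *: lower_chr d y.
  apply/matrixP => a b; rewrite mxE addmxE [RHS]addmxE !oppmxE summxE; congr (_ - _).
    rewrite [LHS]mxE [RHS]mxE; congr (partial _ _ _).
    by apply/funext => z; rewrite mxE.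
  rewrite /chr2 -mulmxA [LHS]mxE; apply: eq_bigr => d _; rewrite mulrC [RHS]mxE.
  by congr (_ * _); rewrite [lower_chr _ _ _ _]mxE.
rewrite mulmxBr mulmxBl Hu mulmx_sumr mulmx_suml; congr (_ - _).
by apply: eq_bigr => d _; rewrite -scalemxAr -scalemxAl lower_chr_antiinv.
Qed.

Hypothesis u_smooth : forall k, Ck k U u.
Hypothesis u_pluriharmonic : forall y, U y -> I *m hess u y = hess u y *m I^T.

Lemma pluriharmonic_harmonic y : U y -> \tr (G y *m hess u y) = 0.
Proof.
by move=> Uy; apply: antiinv_trace; [exact: cometric_comm|exact: u_pluriharmonic].
Qed.

Variables (e : R) (e_gt0 : 0 < e).
(** The term [e] keeps the square root smooth at the critical points of [u]. *)
Definition reg_grad y := Num.sqrt (grad_sqnorm g u y + e).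
Local Notation F := reg_grad.

Lemma grad_sqnorm_ge0 f y : U y -> 0 <= grad_sqnorm g f y.
Proof.
move=> Uy; rewrite grad_sqnormE.
have [->|v0] := eqVneq (dcol f y) 0; first by rewrite mulmx0 mxE.
have /(_ (dcol f y)^T) := (posdefmx_inv (g_pos Uy)).2.
rewrite /quad trmxK => H; apply/ltW/H.
by apply: contra_neq v0 => /(congr1 trmx); rewrite trmxK trmx0.
Qed.

Lemma reg_grad_gt0 y : U y -> 0 < grad_sqnorm g u y + e.
Proof. by move=> Uy; rewrite ltr_wpDl// grad_sqnorm_ge0. Qed.

Lemma reg_grad_sqr y : U y -> F y * F y = grad_sqnorm g u y + e.
Proof. by move=> Uy; rewrite -expr2 sqr_sqrtr// ltW// reg_grad_gt0. Qed.

Lemma reg_grad_smooth k : Ck k U F.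
Proof.
apply: (@Ck_sqrt _ _ U oU k (fun y => grad_sqnorm g u y + e)); first exact: reg_grad_gt0.
apply: CkD => //; last exact: Ck_cst.
exact: (grad_sqnorm_smooth oU g_smooth g_pos u_smooth).
Qed.

(** As F^2 = |du|^2 + e, the Laplacian of |du|^2 is 2 (|dF|^2 + F Lap F), and the Hessian N applied
    to the gradient is F dF. Kato's inequality then reads 2 F^2 |dF|^2 <= |du|^2 |N|^2; since |du|^2
    <= F^2, it gives 2 |dF|^2 <= |N|^2, to be inserted in Bochner's formula. *)
Lemma reg_grad_bochner y : U y ->
  grad_sqnorm g F y - F y * laplacian g F y <=
  - quad (ricci g y) ((dcol u y)^T *m G y).
Proof.
move=> Uy; set N := cov_hess g u y; pose v := G y *m dcol u y.
have ch := kaehler_coords_harmonic.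
have Fs := reg_grad_smooth.
have dE a z : U z -> partial a (grad_sqnorm g u) z = 2 * (F z * partial a F z).
  move=> Uz.
  have -> : partial a (grad_sqnorm g u) z = partial a (fun z => F z * F z - e) z.
    apply: partial_near; move/open_nbhs_nbhs: (conj oU Uz).
    by apply: filterS => w Uw; rewrite reg_grad_sqr// addrK.
  have dF : derivable F z (delta_mx 0 a) := Ck_derivable (Fs 1%N) Uz.
  have dc : derivable (fun=> e : R) z (delta_mx 0 a) by exact: derivable_cst.
  rewrite /partial [LHS](deriveB (derivableM dF dF) dc).
  rewrite [X in _ - X](derive_cst e) subr0.
  rewrite -[LHS]/(partial a (fun z => F z * F z) z) (partialM dF dF).
  by rewrite mulr_natl mulr2n [X in X + _]mulrC.
have hE : \tr (G y *m hess (grad_sqnorm g u) y) =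
    2 * (grad_sqnorm g F y + F y * \tr (G y *m hess F y)).
  have H a b : partial a (partial b (grad_sqnorm g u)) y =
     2 * (partial a F y * partial b F y + F y * partial a (partial b F) y).
    have -> : partial a (partial b (grad_sqnorm g u)) y =
              partial a (fun z => 2 * (F z * partial b F z)) y.
      apply: partial_near; move/open_nbhs_nbhs: (conj oU Uy).
      by apply: filterS => z Uz; exact: dE.
    have dF : derivable F y (delta_mx 0 a) := Ck_derivable (Fs 1%N) Uy.
    have ddF : derivable (partial b F) y (delta_mx 0 a) := Ck_derivable (Ck_partial b (Fs 2%N)) Uy.
    rewrite [LHS](deriveZ 2 (derivableM dF ddF)) [LHS]/GRing.scale /=; congr (2 * _).
    exact: (partialM dF ddF).
  rewrite /mxtrace /grad_sqnorm [F y * _]mulr_sumr -big_split mulr_sumr.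
  apply: eq_bigr => a _ /=; rewrite [X in X = _]mxE [X in F y * X]mxE mulr_sumr -big_split mulr_sumr.
  apply: eq_bigr => b _ /=; rewrite [hess _ _ _ _]mxE [hess F _ _ _]mxE H /cometric.
  move: (partial a F y) (partial b F y) (partial _ _ _) (F y) (invmx _ _ _) => x1 x2 x3 x4 x5; ring.
have := bochner oU g_smooth g_pos u_smooth ch pluriharmonic_harmonic Uy.
rewrite hE -/N => B.
rewrite (laplacian_hess oU g_smooth g_pos ch (Fs 2%N) Uy).
have NT : N^T = N by apply/matrixP => i j; rewrite mxE (cov_hess_sym oU g_pos u_smooth).
have NI : I *m N = N *m I^T.
  by apply: cov_hess_antiinv => //; exact: u_pluriharmonic.
have := kato v (g_pos Uy) (g_I Uy) NT NI.
have GT := cometric_sym g_pos Uy.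
have -> : v^T *m g y *m v = (dcol u y)^T *m G y *m dcol u y.
  by rewrite /v trmx_mul GT !mulmxA /cometric mulmxKV// g_unit.
rewrite -grad_sqnormE -/(G y).
have Nv a : (N *m v) a 0 = F y * partial a F y.
  have H := partial_grad_sqnorm oU g_smooth g_pos u_smooth a Uy.
  have two : (2 : R) != 0 by rewrite pnatr_eq0.
  apply: (mulfI two); rewrite -dE// H; congr (2 * _).
  have -> : (N *m v) a 0 = ((cov_hess_col g u a y)^T *m v) 0 0.
    by rewrite [LHS]mxE [RHS]mxE; apply: eq_bigr => b _; rewrite !mxE.
  by rewrite (pairingC g_pos)// /v mulmxA.
have -> : ((N *m v)^T *m G y *m (N *m v)) 0 0 = F y ^+ 2 * grad_sqnorm g F y.
  have -> : N *m v = F y *: dcol F y.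
    by apply/matrixP => i j; rewrite ord1 Nv !mxE.
  have tZ : (F y *: dcol F y)^T = F y *: (dcol F y)^T by apply/matrixP => i j; rewrite !mxE.
  by rewrite tZ -scalemxAr -!scalemxAl scalerA -expr2 grad_sqnormE [LHS]mxE.
have t0 := (mxtrace_psd N (posdefmx_inv (g_pos Uy))).1.
move: t0 B; rewrite -/(G y).
set t := \tr _; set q := quad _ _; set s := grad_sqnorm g F y; set h := F y * _.
move=> t0 B K.
have F0 : 0 < F y by rewrite sqrtr_gt0 reg_grad_gt0.
have E0 : grad_sqnorm g u y <= F y ^+ 2 by rewrite expr2 reg_grad_sqr// lerDl ltW.
have : 2 * s <= t.
  have F2 : 0 < F y ^+ 2 by rewrite exprn_gt0.
  rewrite -(ler_pM2l F2); apply: le_trans (ler_wpM2r t0 E0).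
  by move: K; rewrite mulrCA.
by move=> H; exact: bochner_aux B H.
Qed.

End KaehlerLocal.

(** * The divergence of ddc u in weak form *)

Lemma mulmx3E (R : pzRingType) p q r s (A : 'M[R]_(p, q)) (B : 'M[R]_(q, r)) (C : 'M[R]_(r, s)) a b :
  (A *m B *m C) a b = \sum_c \sum_d A a c * B c d * C d b.
Proof.
rewrite exchange_big mxE; apply: eq_bigr => d _ /=.
by rewrite mxE mulr_suml.
Qed.

Section WeakCodifferential.
Variables (R : realType) (n : nat).
Local Notation V := 'rV[R]_(n + n).
Local Notation I := (mulI_mx R n).
Variables (U : set V) (oU : open U) (g : V -> 'M[R]_(n + n)).
Hypothesis g_smooth : forall k, Ckmx U k g.
Hypothesis g_pos : forall y, U y -> posdefmx (g y).
Hypothesis g_hermitian : forall y, U y -> I *m g y *m I^T = g y.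
Hypothesis g_closed : forall y, U y -> forall a b c,
  partial a (fun z => (I *m g z) b c) y + partial b (fun z => (I *m g z) c a) y
  + partial c (fun z => (I *m g z) a b) y = 0.
Local Notation G := (cometric g).
Local Notation K := (fun y => G y *m I).
Local Notation rho := (voldens g).

Let G_smooth k : Ckmx U k G. Proof. exact: cometric_smooth. Qed.
Let K_smooth k : Ckmx U k K. Proof. by apply: Ckmx_mul => //; exact: Ckmx_cst. Qed.
Let GI y : U y -> I *m G y = G y *m I. Proof. exact: cometric_comm. Qed.
Let GT y : U y -> (G y)^T = G y. Proof. exact: cometric_sym. Qed.

Lemma K_antisym y : U y -> (G y *m I)^T = - (G y *m I).
Proof. by move=> Uy; rewrite trmx_mul GT// mulI_tr mulNmx GI. Qed.

Lemma mulmx_rows p q r s (A : 'M[R]_(p, q)) (X : 'M[R]_(q, r)) (B : 'M[R]_(s, r)) c d :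
  (row c A *m X *m (row d B)^T) 0 0 = (A *m X *m B^T) c d.
Proof.
rewrite -row_mul [LHS]mxE [RHS]mxE; apply: eq_bigr => k _.
by rewrite [row c _ _ _]mxE [(row d B)^T _ _]mxE [row d B _ _]mxE [B^T _ _]mxE.
Qed.

Lemma dir_cometric (x : V) y : U y ->
  \sum_a x 0 a *: dmx a G y = - (G y *m (\sum_a x 0 a *: dmx a g y) *m G y).
Proof.
move=> Uy; rewrite mulmx_sumr mulmx_suml -sumrN; apply: eq_bigr => a _.
rewrite (dmx_inv oU a Uy (fun z Uz => posdefmx_unit (g_pos Uz)) (g_smooth 1)) -/(G y).
by rewrite scalerN -scalemxAr -scalemxAl.
Qed.

Lemma dir_cometric_rows (x : V) c d y : U y ->
  \sum_a x 0 a * dmx a G y c d = - dmetric g y x (row c (G y)) (row d (G y)).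
Proof.
move=> Uy; rewrite /dmetric mulmx_rows GT// -oppmxE -dir_cometric// summxE.
by apply: eq_bigr => a _; rewrite [RHS]mxE.
Qed.

(** These terms remain when every derivative falls on the metric. Each derivative of G is - G (dg)
    G, so the terms become values of [dmetric] on rows of G. As H is symmetric, the sum may be
    symmetrized in c, d, and each summand is then an instance of [dmetric_codifferential]. *)
Lemma codifferential_algebra (H : 'M[R]_(n + n)) b y : U y -> H^T = H ->
  \sum_a \sum_c \sum_d
    (H c a * (G y *m I) d b * dmx d G y a c - H c d * G y a c * dmx a K y d b
     - H c d * (G y *m I) a c * dmx a G y d b) = 0.
Proof.
move=> Uy HT.
pose r c := row c (G y); pose D := dmetric g y.
have KE c : (\row_a (G y *m I) a c : V) = - (r c *m I).
  have /matrixP KA := K_antisym Uy.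
  apply/rowP => a; rewrite mxE /r -row_mul; have := KA c a.
  by rewrite [(_^T) _ _]mxE oppmxE => ->; rewrite !oppmxE [row _ _ _ _]mxE.
have DN x v w : dmetric g y (- x) v w = - dmetric g y x v w.
  by rewrite !dmetricE -sumrN; apply: eq_bigr => a _; rewrite mxE mulNr.
have GE c : (\row_a G y a c : V) = r c.
  have /matrixP GS := GT Uy.
  by apply/rowP => a; rewrite mxE -GS !mxE.
have E1 a c : \sum_d (G y *m I) d b * dmx d G y a c = D (r b *m I) (r a) (r c).
  have := dir_cometric_rows (\row_a (G y *m I) a b) a c Uy.
  rewrite KE DN opprK => E; rewrite -[RHS]E; apply: eq_bigr => d _; congr (_ * _).
  by rewrite -KE [RHS]mxE.
have E2 c d : \sum_a G y a c * dmx a K y d b = D (r c) (r d) (r b *m I).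
  have dK a : dmx a K y = dmx a G y *m I.
    rewrite (dmx_mul a Uy (G_smooth 1) (Ckmx_cst oU 1 I)) dmx_cst mulmx0 addr0.
    by [].
  rewrite /D /r -row_mul /dmetric mulmx_rows K_antisym// mulmxN mulmxA -mulNmx.
  rewrite -dir_cometric// mulmx_suml summxE; apply: eq_bigr => a _.
  rewrite dK -scalemxAl [RHS]mxE; congr (_ * _).
  by rewrite [RHS]mxE; have /matrixP/(_ c a) := GT Uy; rewrite mxE.
have E3 c d : \sum_a (G y *m I) a c * dmx a G y d b = D (r c *m I) (r d) (r b).
  have := dir_cometric_rows (\row_a (G y *m I) a c) d b Uy.
  rewrite KE DN opprK => E; rewrite -[RHS]E; apply: eq_bigr => a _; congr (_ * _).
  by rewrite -KE [RHS]mxE.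
transitivity (\sum_c \sum_d H c d * (D (r b *m I) (r c) (r d)
   - D (r c) (r d) (r b *m I) - D (r c *m I) (r d) (r b))).
  transitivity (\sum_a \sum_c \sum_d H c a * (G y *m I) d b * dmx d G y a c
    - \sum_a \sum_c \sum_d H c d * G y a c * dmx a K y d b
    - \sum_a \sum_c \sum_d H c d * (G y *m I) a c * dmx a G y d b).
    rewrite -!sumrB; apply: eq_bigr => a _; rewrite -!sumrB; apply: eq_bigr => c _.
    by rewrite -!sumrB.
  have HS c d : H c d = H d c by rewrite -[in LHS]HT mxE.
  have -> : \sum_a \sum_c \sum_d H c a * (G y *m I) d b * dmx d G y a c =
     \sum_c \sum_d H c d * D (r b *m I) (r c) (r d).
    apply: eq_bigr => a _; apply: eq_bigr => c _; rewrite -E1 mulr_sumr.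
    by apply: eq_bigr => d _; rewrite HS mulrA.
  have -> : \sum_a \sum_c \sum_d H c d * G y a c * dmx a K y d b =
     \sum_c \sum_d H c d * D (r c) (r d) (r b *m I).
    rewrite exchange_big; apply: eq_bigr => c _ /=; rewrite exchange_big /=.
    apply: eq_bigr => d _; rewrite -E2 mulr_sumr.
    by apply: eq_bigr => a _; rewrite mulrA.
  have -> : \sum_a \sum_c \sum_d H c d * (G y *m I) a c * dmx a G y d b =
     \sum_c \sum_d H c d * D (r c *m I) (r d) (r b).
    rewrite exchange_big; apply: eq_bigr => c _ /=; rewrite exchange_big /=.
    apply: eq_bigr => d _; rewrite -E3 mulr_sumr.
    by apply: eq_bigr => a _; rewrite mulrA.
  rewrite -!sumrB; apply: eq_bigr => c _; rewrite -!sumrB; apply: eq_bigr => d _.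
  by rewrite !mulrBr.
set S := LHS.
suff : S + S = 0 by move=> /eqP; rewrite -mulr2n mulrn_eq0 => /eqP.
rewrite {2}/S exchange_big /= /S -big_split big1// => c _; rewrite -big_split big1// => d _ /=.
have -> : H d c = H c d by rewrite -[in LHS]HT mxE.
rewrite -mulrDr.
have Z := dmetric_codifferential oU g_smooth g_pos g_hermitian g_closed (r b) (r c) (r d) Uy.
have S1 := dmetric_sym oU g_pos (r b *m I) (r d) (r c) Uy.
rewrite /D S1.
apply/eqP; rewrite mulf_eq0; apply/orP; right; apply/eqP.
move: Z; do !move: (dmetric _ _ _ _ _) => ?; lra.
Qed.

Lemma irow_sum3 (X : 'I_(n + n) -> 'I_(n + n) -> 'I_(n + n) -> V -> R) r :
  (forall a c d, continuous (X a c d)) -> (forall a c d, supp_le r (X a c d)) ->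
  irow (fun y => \sum_a \sum_c \sum_d X a c d y) =
  \sum_a \sum_c \sum_d irow (X a c d).
Proof.
move=> cX sX.
have c1 a c : continuous (fun y => \sum_d X a c d y).
  by move=> y; apply: for_continuous_sum => d; exact: cX.
have s1 a c : supp_le r (fun y => \sum_d X a c d y).
  by move=> y ry; apply: big1 => d _; exact: sX.
have c2 a : continuous (fun y => \sum_c \sum_d X a c d y).
  by move=> y; apply: for_continuous_sum => c; exact: c1.
have s2 a : supp_le r (fun y => \sum_c \sum_d X a c d y).
  by move=> y ry; apply: big1 => c _; exact: s1.
rewrite (irow_sum (index_enum _) c2 s2); apply: eq_bigr => a _.
rewrite (irow_sum (index_enum _) (c1 a) (s1 a)); apply: eq_bigr => c _.
exact: (irow_sum (index_enum _) (cX a c) (sX a c)).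
Qed.

Variables (u : V -> R) (u2 : Ck 2 setT u) (C : set V) (C_closed : closed C) (CU : C `<=` U).
Hypothesis u_harmonic : forall y, C y -> \tr (G y *m hess u y) = 0.
Variables (r : R) (Cr : forall y, C y -> `|y| < r).

Let hess_cont c d : continuous (fun y => hess u y c d).
Proof.
have F : Ck 0 setT (partial c (partial d u)) := Ck_partial c (Ck_partial d u2).
have -> : (fun y => hess u y c d) = partial c (partial d u).
  by apply/funext => y; rewrite mxE.
exact: Ck_setT_continuous F.
Qed.

Let hess_sym y : (hess u y)^T = hess u y.
Proof.
apply/matrixP => a b; rewrite [LHS]mxE [LHS]mxE [RHS]mxE.
exact: (partialC b a openT u2 Logic.I).
Qed.

Let suppC f : (forall y, ~ C y -> f y = 0) -> supp_le r f.
Proof. by move=> f0 y ry; apply: f0 => /Cr; rewrite ltNge ry. Qed.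

Let partialC0 (f : V -> R) a y : (forall y, ~ C y -> f y = 0) -> ~ C y -> partial a f y = 0.
Proof.
move=> f0 nC; transitivity (partial a (fun=> 0 : R) y); last exact: (derive_cst (0 : R)).
apply: partial_near.
have : nbhs y (~` C) by apply: open_nbhs_nbhs; split => //; exact: closed_openC.
by apply: filterS => z nz; exact: f0.
Qed.

(** Stands for the symmetry in a, c of the third derivatives of u, tested against [h]; for a C^2
    function it holds in this integrated form. *)
Lemma third_derivative_sym a c d h : Ck 1 setT h -> (forall y, ~ C y -> h y = 0) ->
  irow (fun y => hess u y c d * partial a h y) = irow (fun y => hess u y a d * partial c h y).
Proof.
move=> H h0; have := irow_partialC a c H (Ck_partial d u2) (suppC h0).
have E i j : irow (fun y => hess u y i d * partial j h y) =
             irow (fun y => partial j h y * partial i (partial d u) y).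
  by congr irow; apply/funext => y; rewrite mxE mulrC.
by rewrite !E.
Qed.

Variable eta : V -> R.
Hypothesis eta1 : Ck 1 setT eta.
Hypothesis eta0 : forall y, ~ C y -> eta y = 0.

Let extC k (f : V -> R) : Ck k U f -> (forall y, ~ C y -> f y = 0) -> Ck k setT f.
Proof. by move=> F f0; exact: (Ck_extend0 oU C_closed CU f0 F). Qed.

(** The tensor in parentheses is, up to sign, ddc u with both indices raised. The statement says
    that it is weakly divergence free. [X1] and [X2] put the derivative on the whole coefficient
    times [eta], and [Z] subtracts the part where it falls on the coefficient. *)
Lemma weak_codifferential b :
  irow (fun y => \sum_a rho y *
    (G y *m hess u y *m (G y *m I) + G y *m I *m hess u y *m G y) a b * partial a eta y) = 0.
Proof.
pose c1 a c d y := rho y * G y a c * (G y *m I) d b.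
pose c2 a c d y := rho y * (G y *m I) a c * G y d b.
have rs k : Ck k U rho by exact: voldens_smooth.
have c1s k a c d : Ck k U (c1 a c d).
  by apply: CkM => //; [apply: CkM => //; exact: G_smooth|exact: K_smooth].
have c2s k a c d : Ck k U (c2 a c d).
  by apply: CkM => //; [apply: CkM => //; exact: K_smooth|exact: G_smooth].
have etaU : Ck 1 U eta by exact: (Ck_sub (@subsetT _ U) eta1).
pose w1 a c d y := c1 a c d y * eta y; pose w2 a c d y := c2 a c d y * eta y.
have w10 a c d y : ~ C y -> w1 a c d y = 0 by move=> nC; rewrite /w1 eta0// mulr0.
have w20 a c d y : ~ C y -> w2 a c d y = 0 by move=> nC; rewrite /w2 eta0// mulr0.
have w1s a c d : Ck 1 setT (w1 a c d) by apply: extC (w10 a c d); exact: CkM.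
have w2s a c d : Ck 1 setT (w2 a c d) by apply: extC (w20 a c d); exact: CkM.
pose X1 a c d y := hess u y c d * partial a (w1 a c d) y.
pose X1' a c d y := hess u y c a * partial d (w1 a c d) y.
pose X2 a c d y := hess u y c d * partial a (w2 a c d) y.
pose Z a c d y := hess u y c d * (partial a (c1 a c d) y + partial a (c2 a c d) y) * eta y.
have cpart (f : V -> R) a : Ck 1 setT f -> continuous (partial a f).
  by move=> F; apply: Ck_setT_continuous (Ck_partial a F).
have X1c a c d : continuous (X1 a c d).
  by move=> y; exact: (for_continuousM (@hess_cont _ _ y) (cpart _ _ (w1s a c d) y)).
have X1'c a c d : continuous (X1' a c d).
  by move=> y; exact: (for_continuousM (@hess_cont _ _ y) (cpart _ _ (w1s a c d) y)).
have X2c a c d : continuous (X2 a c d).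
  by move=> y; exact: (for_continuousM (@hess_cont _ _ y) (cpart _ _ (w2s a c d) y)).
have Z0 a c d y : ~ C y -> Z a c d y = 0 by move=> nC; rewrite /Z eta0// mulr0.
have Zc a c d : continuous (Z a c d).
  apply: (@Ck_setT_continuous _ _ 0); apply: extC (Z0 a c d).
  apply: CkM => //; last exact: Ck_leq etaU.
  apply: CkM => //; last by apply: CkD => //; apply: Ck_partial; [exact: c1s|exact: c2s].
  have F : Ck 0 setT (partial c (partial d u)) := Ck_partial c (Ck_partial d u2).
  by apply: (Ck_eq oU _ (Ck_sub (@subsetT _ U) F)) => y _; rewrite mxE.
have X1s a c d : supp_le r (X1 a c d).
  by apply: suppC => y nC; rewrite /X1 (partialC0 _ (w10 a c d) nC) mulr0.
have X1's a c d : supp_le r (X1' a c d).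
  by apply: suppC => y nC; rewrite /X1' (partialC0 _ (w10 a c d) nC) mulr0.
have X2s a c d : supp_le r (X2 a c d).
  by apply: suppC => y nC; rewrite /X2 (partialC0 _ (w20 a c d) nC) mulr0.
have Zs a c d : supp_le r (Z a c d) by apply: suppC => y nC; exact: Z0.
pose S3 (X : 'I_(n + n) -> 'I_(n + n) -> 'I_(n + n) -> V -> R) y := \sum_a \sum_c \sum_d X a c d y.
have S3c X : (forall a c d, continuous (X a c d)) -> continuous (S3 X).
  move=> cX y; apply: for_continuous_sum => a; apply: for_continuous_sum => c.
  by apply: for_continuous_sum => d; exact: cX.
have S3s X : (forall a c d, supp_le r (X a c d)) -> supp_le r (S3 X).
  by move=> sX y ry; rewrite /S3 big1// => a _; rewrite big1// => c _; rewrite big1// => d _; exact: sX.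
have -> : (fun y => \sum_a rho y *
    (G y *m hess u y *m (G y *m I) + G y *m I *m hess u y *m G y) a b * partial a eta y)
    = (fun y => S3 X1 y + S3 X2 y + - S3 Z y).
  apply/funext => y; rewrite /S3 -big_split -sumrN -big_split; apply: eq_bigr => a _ /=.
  rewrite -big_split -sumrN -big_split /=.
  transitivity (\sum_c \sum_d hess u y c d * ((c1 a c d y + c2 a c d y) * partial a eta y)).
    rewrite addmxE !mulmx3E -big_split mulr_sumr mulr_suml; apply: eq_bigr => c _ /=.
    rewrite -big_split mulr_sumr mulr_suml; apply: eq_bigr => d _ /=.
    rewrite /c1 /c2; move: (hess u y c d) (partial a eta y) (rho y) => x1 x2 x3; ring.
  apply: eq_bigr => c _; rewrite -big_split -sumrN -big_split; apply: eq_bigr => d _ /=.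
  have [yC|nC] := pselect (C y); last first.
    rewrite (Z0 _ _ _ _ nC) /X1 /X2 (partialC0 a (w10 a c d) nC) (partialC0 a (w20 a c d) nC).
    by rewrite (partialC0 a eta0 nC) !mulr0 addr0 subr0.
  have Uy := CU yC.
  have d1 : derivable (c1 a c d) y (delta_mx 0 a) := Ck_derivable (c1s 1%N a c d) Uy.
  have d2 : derivable (c2 a c d) y (delta_mx 0 a) := Ck_derivable (c2s 1%N a c d) Uy.
  have de : derivable eta y (delta_mx 0 a) := Ck_derivable eta1 Logic.I.
  rewrite /X1 /X2 /Z /w1 /w2 (partialM d1 de) (partialM d2 de); ring.
(* The coefficient is antisymmetric in a, c, as G I is, while the third derivative it is paired with
   is symmetric. *)
have S2 : irow (S3 X2) = 0.
  rewrite /S3 (irow_sum3 X2c X2s).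
  set S := LHS.
  suff : S + S = 0 by move=> /eqP; rewrite -mulr2n mulrn_eq0 => /eqP.
  rewrite {2}/S exchange_big /= /S -big_split big1// => a _; rewrite -big_split big1// => c _ /=.
  rewrite -big_split big1// => d _ /=.
  rewrite /X2 (third_derivative_sym c a d (w2s c a d) (w20 c a d)).
  have w2N : w2 c a d = fun y => - w2 a c d y.
    apply/funext => y; have [yC|nC] := pselect (C y); last by rewrite !w20// oppr0.
    rewrite /w2 /c2; have /matrixP/(_ a c) := K_antisym (CU yC).
    rewrite [(_^T) _ _]mxE oppmxE => ->; move: (eta y) (rho y) => x1 x2; ring.
  have -> : (fun y => hess u y c d * partial a (w2 c a d) y) =
            (fun y => - (hess u y c d * partial a (w2 a c d) y)).
    apply/funext => y; rewrite w2N -mulrN; congr (_ * _).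
    exact: (deriveN (Ck_derivable (a:=a) (w2s a c d) Logic.I)).
  by rewrite (irowN (X2c a c d) (X2s a c d)) subrr.
(* Moving the derivative to the index d leaves the Hessian contracted with G, where harmonicity
   applies: only the derivative of G survives, and [S4] matches it with [Z] pointwise. *)
have S1 : irow (S3 X1) = irow (S3 X1').
  rewrite /S3 (irow_sum3 X1c X1s) (irow_sum3 X1'c X1's).
  apply: eq_bigr => a _; apply: eq_bigr => c _; apply: eq_bigr => d _.
  rewrite /X1 /X1'.
  have E i j k : (fun y => hess u y i j * partial k (w1 a c d) y) =
                 (fun y => hess u y j i * partial k (w1 a c d) y).
    by apply/funext => y; have /matrixP/(_ i j) := hess_sym y; rewrite mxE => ->.
  by rewrite E (third_derivative_sym _ _ _ (w1s a c d) (w10 a c d)) E.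
have S4 : S3 X1' = S3 Z.
  apply/funext => y; have [yC|nC] := pselect (C y); last first.
    rewrite /S3; apply: eq_bigr => a _; apply: eq_bigr => c _; apply: eq_bigr => d _.
    by rewrite (Z0 _ _ _ _ nC) /X1' (partialC0 d (w10 a c d) nC) mulr0.
  have Uy := CU yC.
  have dG a i j : derivable (fun z => G z i j) y (delta_mx 0 a) := Ck_derivable (G_smooth 1 i j) Uy.
  have dK a i j : derivable (fun z => (G z *m I) i j) y (delta_mx 0 a) := Ck_derivable (K_smooth 1 i j) Uy.
  have drG a i j : derivable (fun z => rho z * G z i j) y (delta_mx 0 a) :=
    Ck_derivable (CkM oU (rs 1%N) (G_smooth 1 i j)) Uy.
  have drK a i j : derivable (fun z => rho z * (G z *m I) i j) y (delta_mx 0 a) :=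
    Ck_derivable (CkM oU (rs 1%N) (K_smooth 1 i j)) Uy.
  pose s d z := rho z * (G z *m I) d b * eta z.
  have ds a d : derivable (s d) y (delta_mx 0 a) :=
    Ck_derivable (CkM oU (CkM oU (rs 1%N) (K_smooth 1 d b)) etaU) Uy.
  have divG c : \sum_a partial a (fun z => rho z * G z a c) y = 0.
    have ch := kaehler_coords_harmonic oU g_smooth g_pos g_hermitian g_closed.
    exact: (divergence_cometric oU g_smooth g_pos ch c Uy).
  have divK c : \sum_a partial a (fun z => rho z * (G z *m I) a c) y = 0.
    transitivity (\sum_a \sum_e partial a (fun z => rho z * G z a e) y * I e c).
      apply: eq_bigr => a _.
      have dsum e : derivable (fun z => rho z * G z a e * I e c) y (delta_mx 0 a).
        by apply: derivableM; [exact: drG|exact: derivable_cst].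
      have -> : (fun z => rho z * (G z *m I) a c) = (fun z => \sum_e rho z * G z a e * I e c).
        by apply/funext => z; rewrite mxE mulr_sumr; apply: eq_bigr => e _; rewrite mulrA.
      rewrite (partial_sum (index_enum _) dsum).2; apply: eq_bigr => e _.
      have dc : derivable (fun=> I e c : R) y (delta_mx 0 a) by exact: derivable_cst.
      rewrite (partialM (drG a a e) dc).
      by have -> : partial a (fun=> I e c) y = 0 :> R; [exact: (derive_cst (I e c : R))|rewrite mulr0 addr0].
    rewrite exchange_big; apply: big1 => e _ /=; rewrite -mulr_suml divG; exact: mul0r.
  have H0 := hess_sym y.
  have hG : \sum_a \sum_c hess u y c a * G y a c = 0.
    rewrite -[RHS](u_harmonic yC) /mxtrace; apply: eq_bigr => a _; rewrite [RHS]mxE.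
    by apply: eq_bigr => c _; rewrite mulrC.
  apply/eqP; rewrite -subr_eq0; apply/eqP.
  transitivity (rho y * eta y * \sum_a \sum_c \sum_d
    (hess u y c a * (G y *m I) d b * dmx d G y a c - hess u y c d * G y a c * dmx a K y d b
     - hess u y c d * (G y *m I) a c * dmx a G y d b)
    + (\sum_d partial d (s d) y) * \sum_a \sum_c hess u y c a * G y a c
    - eta y * \sum_c \sum_d hess u y c d * ((\sum_a partial a (fun z => rho z * G z a c) y) * (G y *m I) d b +
       (\sum_a partial a (fun z => rho z * (G z *m I) a c) y) * G y d b)); last first.
    rewrite (codifferential_algebra b Uy H0) hG !mulr0 addr0 sub0r.
    apply/eqP; rewrite oppr_eq0 mulf_eq0; apply/orP; right; apply/eqP.
    apply: big1 => c _; apply: big1 => d _; rewrite divG divK !mul0r addr0; exact: mulr0.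
  have -> : \sum_c \sum_d hess u y c d * ((\sum_a partial a (fun z => rho z * G z a c) y) * (G y *m I) d b +
       (\sum_a partial a (fun z => rho z * (G z *m I) a c) y) * G y d b) =
    \sum_a \sum_c \sum_d hess u y c d * (partial a (fun z => rho z * G z a c) y * (G y *m I) d b +
       partial a (fun z => rho z * (G z *m I) a c) y * G y d b).
    rewrite [RHS]exchange_big; apply: eq_bigr => c _ /=; rewrite [RHS]exchange_big /=.
    by apply: eq_bigr => d _; rewrite -mulr_sumr big_split /= !mulr_suml.
  have -> : (\sum_d partial d (s d) y) * (\sum_a \sum_c hess u y c a * G y a c) =
     \sum_a \sum_c \sum_d hess u y c a * G y a c * partial d (s d) y.
    rewrite mulrC mulr_suml; apply: eq_bigr => a _; rewrite mulr_suml; apply: eq_bigr => c _.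
    by rewrite mulr_sumr.
  rewrite /S3 -sumrB !mulr_sumr -big_split -sumrB; apply: eq_bigr => a _ /=.
  rewrite -sumrB !mulr_sumr -big_split -sumrB; apply: eq_bigr => c _ /=.
  rewrite -sumrB !mulr_sumr -big_split -sumrB; apply: eq_bigr => d _ /=.
  have E1 : partial d (w1 a c d) y = partial d (s d) y * G y a c + s d y * dmx d G y a c.
    have -> : w1 a c d = fun z => s d z * G z a c.
      apply/funext => z; rewrite /w1 /c1 /s; move: (eta z) (rho z) => x1 x2; ring.
    by rewrite (partialM (ds d d) (dG d a c)) [dmx _ _ _ _ _]mxE.
  have E2 : partial a (c1 a c d) y = partial a (fun z => rho z * G z a c) y * (G y *m I) d b
      + rho y * G y a c * dmx a K y d b.
    by rewrite /c1 (partialM (drG a a c) (dK a d b)) [dmx _ _ _ _ _]mxE.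
  have E3 : partial a (c2 a c d) y = partial a (fun z => rho z * (G z *m I) a c) y * G y d b
      + rho y * (G y *m I) a c * dmx a G y d b.
    by rewrite /c2 (partialM (drK a a c) (dG a d b)) [dmx _ _ _ _ _]mxE.
  rewrite /X1' /Z E1 E2 E3 /s.
  move: (dmx d G y a c) (dmx a K y d b) (dmx a G y d b) (partial _ _ _) (partial _ _ _) (partial _ _ _).
  move: (hess u y c d) (hess u y c a) (G y a c) (G y d b) ((G y *m I) d b) ((G y *m I) a c) (rho y) (eta y).
  move=> z1 z2 z3 z4 z5 z6 z7 z8 x1 x2 x3 x4 x5 x6; ring.
have c12 : continuous (fun y => S3 X1 y + S3 X2 y).
  by move=> y; exact: (for_continuousD (S3c _ X1c y) (S3c _ X2c y)).
have s12 : supp_le r (fun y => S3 X1 y + S3 X2 y).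
  by move=> y ry; rewrite (S3s _ X1s y ry) (S3s _ X2s y ry) addr0.
have cN : continuous (fun y => - S3 Z y).
  by move=> y; exact: (for_continuousN (S3c _ Zc y)).
have sN : supp_le r (fun y => - S3 Z y).
  by move=> y ry; rewrite (S3s _ Zs y ry) oppr0.
rewrite (irowD c12 cN s12 sN) (irowD (S3c _ X1c) (S3c _ X2c) (S3s _ X1s) (S3s _ X2s)).
by rewrite (irowN (S3c _ Zc) (S3s _ Zs)) S2 S1 S4 addr0 subrr.
Qed.

End WeakCodifferential.

(** * Integral identities in a chart *)

Section GreenLocal.
Variables (R : realType) (m : nat).
Local Notation V := 'rV[R]_m.
Variables (U : set V) (oU : open U) (g : V -> 'M[R]_m).
Hypothesis g_smooth : forall k, Ckmx U k g.
Hypothesis g_pos : forall y, U y -> posdefmx (g y).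

Definition ginner (f h : V -> R) y := ((dcol f y)^T *m cometric g y *m dcol h y) 0 0.

Lemma ginnerE f h y : ginner f h y = \sum_a partial a f y * \sum_b cometric g y a b * partial b h y.
Proof.
rewrite /ginner -mulmxA mxE; apply: eq_bigr => a _; rewrite !mxE; congr (_ * _).
by apply: eq_bigr => b _; rewrite mxE.
Qed.

Variables (C : set V) (C_closed : closed C) (CU : C `<=` U) (r : R) (Cr : forall y, C y -> `|y| < r).

Lemma partial_off f a y : (forall y, ~ C y -> f y = 0) -> ~ C y -> partial a f y = 0.
Proof.
move=> f0 nC; transitivity (partial a (fun=> 0 : R) y); last exact: (derive_cst (0 : R)).
apply: partial_near.
have : nbhs y (~` C) by apply: open_nbhs_nbhs; split => //; exact: closed_openC.
by apply: filterS => z nz; exact: f0.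
Qed.

Lemma supp_off (f : V -> R) : (forall y, ~ C y -> f y = 0) -> supp_le r f.
Proof. by move=> f0 y ry; apply: f0 => /Cr; rewrite ltNge ry. Qed.

Lemma green_local f h : Ck 2 U h -> Ck 1 setT f -> (forall y, ~ C y -> f y = 0) ->
  irow (fun y => voldens g y * (f y * laplacian g h y + ginner f h y)) = 0.
Proof.
move=> h2 f1 f0.
have rs k : Ck k U (voldens g) by exact: voldens_smooth.
pose W a y := voldens g y * \sum_b cometric g y a b * partial b h y.
have Ws a : Ck 1 U (W a).
  apply: CkM => //; apply: Ck_sum => // b _; apply: CkM => //.
    exact: cometric_smooth.
  exact: Ck_partial.
have f1U : Ck 1 U f by exact: (Ck_sub (@subsetT _ U) f1).
pose w a y := f y * W a y.
have w0 a y : ~ C y -> w a y = 0 by move=> nC; rewrite /w f0// mul0r.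
have w1 a : Ck 1 setT (w a).
  by apply: (Ck_extend0 oU C_closed CU (w0 a)); exact: CkM.
have -> : (fun y => voldens g y * (f y * laplacian g h y + ginner f h y)) =
          (fun y => \sum_a partial a (w a) y).
  apply/funext => y; have [yC|nC] := pselect (C y); last first.
    rewrite f0// mul0r add0r ginnerE big1 ?mulr0 => [|a _]; last by rewrite (partial_off a f0 nC) mul0r.
    by apply/esym/big1 => a _; exact: partial_off (w0 a) nC.
  have Uy := CU yC.
  have v0 : voldens g y != 0 by rewrite gt_eqF// (voldens_gt0 g_pos).
  rewrite /laplacian mulrDr mulrCA (mulrA (voldens g y)) divff// mul1r mulr_sumr.
  rewrite ginnerE mulr_sumr -big_split; apply: eq_bigr => a _ /=.
  rewrite (partialM (Ck_derivable (a:=a) f1 Logic.I) (Ck_derivable (a:=a) (Ws a) Uy)).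
  rewrite addrC; congr (_ + _).
  by rewrite mulrCA.
have cw a : continuous (partial a (w a)).
  by apply: Ck_setT_continuous (Ck_partial a (w1 a)).
have sw a : supp_le r (partial a (w a)).
  by apply: supp_off => y; exact: partial_off (w0 a).
rewrite (irow_sum (index_enum _) cw sw); apply: big1 => a _.
exact: (irow_partial a (w1 a) (supp_off (w0 a))).
Qed.

End GreenLocal.

Section PluriharmonicLocal.
Variables (R : realType) (n : nat).
Local Notation V := 'rV[R]_(n + n).
Local Notation I := (mulI_mx R n).
Variables (U : set V) (oU : open U) (g : V -> 'M[R]_(n + n)).
Hypothesis g_smooth : forall k, Ckmx U k g.
Hypothesis g_pos : forall y, U y -> posdefmx (g y).
Hypothesis g_hermitian : forall y, U y -> I *m g y *m I^T = g y.
Hypothesis g_closed : forall y, U y -> forall a b c,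
  partial a (fun z => (I *m g z) b c) y + partial b (fun z => (I *m g z) c a) y
  + partial c (fun z => (I *m g z) a b) y = 0.
Local Notation G := (cometric g).

(* the form d(du o J); it vanishes iff u is pluriharmonic *)
Definition ddc (u : V -> R) y : 'M[R]_(n + n) := hess u y *m I^T - I *m hess u y.

Definition ddc_sqnorm u y := \tr (G y *m ddc u y *m G y *m (ddc u y)^T).

Definition ddc_flux u f y := ((dcol f y)^T *m (G y *m ddc u y *m G y) *m (I *m dcol u y)) 0 0.

Variables (C : set V) (C_closed : closed C) (CU : C `<=` U) (r : R) (Cr : forall y, C y -> `|y| < r).

(** [weak_codifferential] is used with eta_b = f (I du)_b and summed over b. The derivative of f
    produces the flux; the derivative of I du produces the pairing of the antisymmetric tensor M
    with hess u I^T, which is half of its pairing with ddc u by antisymmetry. *)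
Lemma ddc_local u f : Ck 2 setT u -> (forall y, C y -> \tr (G y *m hess u y) = 0) ->
  Ck 1 setT f -> (forall y, ~ C y -> f y = 0) ->
  irow (fun y => voldens g y * (f y * (2^-1 * ddc_sqnorm u y) + ddc_flux u f y)) = 0.
Proof.
move=> u2 uh f1 f0.
pose th b y := (I *m dcol u y) b 0.
have th1 b : Ck 1 setT (th b).
  apply: (@Ck_eq _ _ _ _ (fun y => \sum_c I b c * partial c u y) _ openT) => [y _|].
    by rewrite /th [RHS]mxE; apply: eq_bigr => c _; rewrite [dcol u y c 0]mxE.
  apply: Ck_sum => [|c _]; first exact: openT.
  by apply: CkZ; [exact: openT|exact: Ck_partial].
pose eta b y := f y * th b y.
have eta0 b y : ~ C y -> eta b y = 0 by move=> nC; rewrite /eta f0// mul0r.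
have eta1 b : Ck 1 setT (eta b) by apply: CkM => //; exact: openT.
pose M y := G y *m hess u y *m (G y *m I) + G y *m I *m hess u y *m G y.
pose X b y := \sum_a voldens g y * M y a b * partial a (eta b) y.
have X0 b y : ~ C y -> X b y = 0.
  move=> nC; rewrite /X; apply: big1 => a _.
  by rewrite (partial_off C_closed a (eta0 b) nC) mulr0.
have Gs k : Ckmx U k G by exact: cometric_smooth.
have Is k : Ckmx U k (fun=> I) by exact: Ckmx_cst.
have Hs : Ckmx U 0 (hess u).
  move=> i j; apply: (Ck_eq oU _ (Ck_sub (@subsetT _ U) (Ck_partial i (Ck_partial j u2)))).
  by move=> y _; rewrite mxE.
have Ms : Ckmx U 0 M.
  by apply: Ckmx_add => //; repeat (apply: Ckmx_mul => //).
have Xc b : continuous (X b).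
  apply: (@Ck_setT_continuous _ _ 0).
  apply: (Ck_extend0 oU C_closed CU (X0 b)); apply: Ck_sum => // a _.
  apply: CkM => //; last exact: Ck_sub (@subsetT _ U) (Ck_partial a (eta1 b)).
  by apply: CkM => //; exact: voldens_smooth.
have Xs b : supp_le r (X b) by apply: (supp_off Cr); exact: X0.
have XI b : irow (X b) = 0.
  exact: (weak_codifferential oU g_smooth g_pos g_hermitian g_closed u2 C_closed CU uh Cr (eta1 b) (eta0 b) b).
have -> : (fun y => voldens g y * (f y * (2^-1 * ddc_sqnorm u y) + ddc_flux u f y)) =
          (fun y => - \sum_b X b y); last first.
  have cS : continuous (fun y => \sum_b X b y).
    by move=> y; apply: for_continuous_sum => b; exact: Xc.
  have sS : supp_le r (fun y => \sum_b X b y) by move=> y ry; apply: big1 => b _; exact: Xs.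
  rewrite (irowN cS sS) (irow_sum (index_enum _) Xc Xs) big1 ?oppr0// => b _; exact: XI.
apply/funext => y; have [yC|nC] := pselect (C y); last first.
  rewrite f0// mul0r add0r /ddc_flux.
  have -> : dcol f y = 0.
    by apply/matrixP => i j; rewrite !mxE (partial_off C_closed i f0 nC).
  rewrite trmx0 !mul0mx mxE mulr0 big1 ?oppr0// => b _; exact: X0.
have Uy := CU yC.
have GI : I *m G y = G y *m I by exact: (cometric_comm g_pos g_hermitian Uy).
have GT : (G y)^T = G y by exact: (cometric_sym g_pos Uy).
have HT : (hess u y)^T = hess u y.
  apply/matrixP => a b; rewrite [LHS]mxE [LHS]mxE [RHS]mxE.
  exact: (partialC b a openT u2 Logic.I).
have ME : M y = - (G y *m ddc u y *m G y).
  rewrite /M /ddc mulmxBr mulmxBl opprB addrC mulI_tr; congr (_ + _).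
    by rewrite !mulmxA -GI.
  by rewrite mulmxN !mulmxA mulmxN mulNmx opprK -!mulmxA GI.
have BT : (ddc u y)^T = - ddc u y.
  rewrite /ddc [LHS]linearB /= !trmx_mul trmxK HT opprB; reflexivity.
have MT : (M y)^T = - M y.
  rewrite ME; move: (ddc u y) BT => B BT.
  by rewrite [LHS]linearN /= !trmx_mul GT BT mulNmx mulmxN !mulmxA.
have dth a b : partial a (th b) y = (hess u y *m I^T) a b.
  have d c : derivable (fun z => I b c * partial c u z) y (delta_mx 0 a).
    by apply: derivableZ; exact: (Ck_derivable (Ck_partial c u2) Logic.I).
  have -> : th b = fun z => \sum_c I b c * partial c u z.
    by apply/funext => z; rewrite /th [LHS]mxE; apply: eq_bigr => c _; rewrite [dcol u z c 0]mxE.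
  rewrite (partial_sum (index_enum _) d).2 [RHS]mxE; apply: eq_bigr => c _.
  rewrite [hess u y a c]mxE [I^T c b]mxE mulrC.
  rewrite [LHS](deriveZ (I b c) (Ck_derivable (a:=a) (Ck_partial c u2) Logic.I)).
  reflexivity.
have tr2 (A B : 'M[R]_(n + n)) : \tr (A *m B^T) = \sum_b \sum_a A a b * B a b.
  rewrite exchange_big; apply: eq_bigr => a _ /=; rewrite mxE; apply: eq_bigr => b _.
  by rewrite mxE.
have S1 : \sum_b \sum_a M y a b * (hess u y *m I^T) a b = - (2^-1 * ddc_sqnorm u y).
  rewrite -tr2; set t := LHS.
  have t2 : t = - \tr (M y *m (I *m hess u y)^T).
    rewrite /t -mxtrace_tr trmx_mul trmxK MT mxtrace_mulC mulNmx [LHS]linearN /=; congr (- \tr (_ *m _)).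
    by rewrite trmx_mul HT.
  have : t + t = - ddc_sqnorm u y.
    rewrite {2}t2 /t /ddc_sqnorm -[X in _ = - \tr (X *m _)]opprK -ME mulNmx [in RHS]linearN /= opprK.
    rewrite -[LHS]linearB /= -mulmxBr; congr (\tr (_ *m _)).
    by rewrite /ddc [RHS]linearB.
  move: t (ddc_sqnorm u y) {t2} => t s; lra.
transitivity (voldens g y * \sum_b - \sum_a M y a b * (partial a f y * th b y + f y * partial a (th b) y)); last first.
  rewrite mulr_sumr -sumrN; apply: eq_bigr => b _; rewrite /X mulrN; congr (- _).
  rewrite mulr_sumr; apply: eq_bigr => a _.
  rewrite (partialM (Ck_derivable (a:=a) f1 Logic.I) (Ck_derivable (a:=a) (th1 b) Logic.I)).
  by rewrite mulrA.
congr (_ * _).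
transitivity (- (f y * \sum_b \sum_a M y a b * (hess u y *m I^T) a b)
   - \sum_b \sum_a M y a b * (partial a f y * th b y)).
  rewrite S1 mulrN opprK; congr (_ + _).
  rewrite /ddc_flux -[G y *m ddc u y *m G y]opprK -ME mulmxN mulNmx oppmxE; congr (- _).
  rewrite mulmx3E exchange_big; apply: eq_bigr => b _ /=; apply: eq_bigr => a _.
  by rewrite [(dcol f y)^T _ _]mxE [dcol f y _ _]mxE (mulrC (partial a f y)) -mulrA.
rewrite mulr_sumr -sumrN -sumrB; apply: eq_bigr => b _; rewrite mulr_sumr -sumrN -sumrB -sumrN.
apply: eq_bigr => a _; rewrite dth.
move: (M y a b) (partial a f y) (th b y) (f y) ((hess u y *m I^T) a b) => x1 x2 x3 x4 x5; ring.
Qed.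

End PluriharmonicLocal.

(** * Changes of charts *)

Section Charts.
Variables (R : realType) (m : nat) (M : riemannianManifold R m).
Local Notation V := 'rV[R]_m.
Implicit Types (i j : chart M) (x : M) (y z : V) (u : M -> R).

Lemma chart_imageP i y : chart_image i y -> dom i (par i y) /\ coord i (par i y) = y.
Proof. by move=> [x dx <-]; rewrite coordK. Qed.

Lemma chart_image_coord i x : dom i x -> chart_image i (coord i x).
Proof. by move=> dx; exists x. Qed.

Definition overlap i j := coord i @` (dom i `&` dom j).

Lemma overlapE i j : overlap i j = chart_image i `&` par i @^-1` dom j.
Proof.
apply/seteqP; split=> [_ [x [xi xj] <-]|y [/chart_imageP[yi yE] yj]].
  by split; [exact: chart_image_coord|rewrite /= coordK].
by exists (par i y).
Qed.

Lemma overlap_coord i j x : dom i x -> dom j x -> overlap i j (coord i x).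
Proof. by move=> xi xj; exists x. Qed.

Lemma open_par_preimage i (A : set M) : open A -> open (chart_image i `&` par i @^-1` A).
Proof.
move=> oA; rewrite openE => y [Uy Ay]; rewrite /interior.
have FF := nbhs_filter y; apply: filterI.
  by apply: open_nbhs_nbhs; split => //; exact: chart_image_open.
by apply: (par_continuous Uy); apply: open_nbhs_nbhs.
Qed.

Lemma overlap_open i j : open (overlap i j).
Proof. by rewrite overlapE; apply: open_par_preimage; exact: dom_open. Qed.

Lemma transition_image i j y : overlap i j y -> chart_image j (transition i j y).
Proof. by move=> [x [xi xj] <-]; rewrite /transition /= coordK//; exact: chart_image_coord. Qed.

Lemma transition_coord i j x : dom i x -> transition i j (coord i x) = coord j x.
Proof. by move=> xi; rewrite /transition /= coordK. Qed.

Lemma local_repr_change i j u y : overlap i j y ->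
  local_repr i u y = local_repr j u (transition i j y).
Proof. by move=> [x [xi xj] <-]; rewrite transition_coord// /local_repr /= !coordK. Qed.

Lemma Ck_transition k i j a : Ck k (overlap i j) (fun y => transition i j y 0 a).
Proof. exact: transition_smooth. Qed.

Lemma Ck_overlap k i j u : Ck k (chart_image j) (local_repr j u) ->
  Ck k (overlap i j) (local_repr i u).
Proof.
move=> F; have oU := @overlap_open i j.
apply: (@Ck_eq _ _ _ _ (local_repr j u \o transition i j) _ oU).
  by move=> y Uy; rewrite /= -local_repr_change.
apply: (Ck_comp oU (chart_image_open (i := j))) => // [y Uy|b].
  exact: transition_image.
exact: Ck_transition.
Qed.

Definition trans_jac i j y : 'M[R]_m := 'J (transition i j) y.

Lemma transition_diff i j y : overlap i j y -> differentiable (transition i j) y.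
Proof.
move=> Uy; apply: (Ck1_differentiable_rV (@overlap_open i j) _ Uy) => b.
exact: Ck_transition.
Qed.

Lemma trans_jacE i j y a b : overlap i j y ->
  trans_jac i j y a b = partial a (fun z => transition i j z 0 b) y.
Proof. by move=> Uy; exact: jacobianE (transition_diff Uy). Qed.

Lemma metric_pos i y : chart_image i y -> posdefmx (metric i y).
Proof.
move=> Uy; split; first exact: metric_sym.
by move=> v v0; exact: metric_posdef.
Qed.

Lemma metric_change i j x : dom i x -> dom j x ->
  metric i (coord i x) =
  trans_jac i j (coord i x) *m metric j (coord j x) *m (trans_jac i j (coord i x))^T.
Proof. by move=> xi xj; exact: metric_transition. Qed.

Lemma trans_jac_unit i j x : dom i x -> dom j x -> trans_jac i j (coord i x) \in unitmx.
Proof.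
move=> xi xj; have := posdefmx_unit (metric_pos (chart_image_coord xi)).
by rewrite (metric_change xi xj) !unitmx_mul => /andP[/andP[]].
Qed.

Lemma cometric_change i j x : dom i x -> dom j x ->
  let A := trans_jac i j (coord i x) in
  A^T *m cometric (metric i) (coord i x) *m A = cometric (metric j) (coord j x).
Proof.
move=> xi xj A; have Au : A \in unitmx := trans_jac_unit xi xj.
have ju := posdefmx_unit (metric_pos (chart_image_coord xj)).
have iu := posdefmx_unit (metric_pos (chart_image_coord xi)).
rewrite /cometric; set gi := metric i _; set gj := metric j _ in ju *.
have E : gi = A *m gj *m A^T by exact: metric_change.
have ATu : A^T \in unitmx by rewrite unitmx_tr.
suff H : A^T *m invmx gi *m A *m gj = 1%:M.
  by rewrite -[LHS](mulmxK ju) H mul1mx.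
apply: (can_inj (mulmxK ATu)); rewrite mul1mx -!mulmxA (mulmxA A gj) -E mulVmx//.
by rewrite mulmx1.
Qed.

Lemma dcol_change i j x u : Ck 1 (chart_image j) (local_repr j u) -> dom i x -> dom j x ->
  dcol (local_repr i u) (coord i x) =
  trans_jac i j (coord i x) *m dcol (local_repr j u) (coord j x).
Proof.
move=> F xi xj; have Uy := overlap_coord xi xj.
apply/matrixP => a b; rewrite [LHS]mxE.
have -> : partial a (local_repr i u) (coord i x) =
          partial a (local_repr j u \o transition i j) (coord i x).
  apply: partial_near; move/open_nbhs_nbhs: (conj (@overlap_open i j) Uy).
  by apply: filterS => z; exact: local_repr_change.
have df : differentiable (local_repr j u) (transition i j (coord i x)).
  exact: Ck1_differentiable (chart_image_open (i := j)) F (transition_image Uy).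
rewrite (partial_chain a df (transition_diff Uy)) [RHS]mxE; apply: eq_bigr => c _.
by rewrite trans_jacE// transition_coord// [dcol _ _ _ _]mxE.
Qed.

Lemma ginner_change i j x u w : Ck 1 (chart_image j) (local_repr j u) ->
  Ck 1 (chart_image j) (local_repr j w) -> dom i x -> dom j x ->
  ginner (metric i) (local_repr i u) (local_repr i w) (coord i x) =
  ginner (metric j) (local_repr j u) (local_repr j w) (coord j x).
Proof.
move=> u1 w1 xi xj; rewrite /ginner (dcol_change u1 xi xj) (dcol_change w1 xi xj).
by rewrite trmx_mul -(cometric_change xi xj) !mulmxA.
Qed.

Definition trans_hess i j c y : 'M[R]_m := hess (fun z => transition i j z 0 c) y.

Lemma hess_change i j x u : Ck 2 (chart_image j) (local_repr j u) -> dom i x -> dom j x ->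
  let A := trans_jac i j (coord i x) in
  hess (local_repr i u) (coord i x) =
  A *m hess (local_repr j u) (coord j x) *m A^T +
  \sum_c dcol (local_repr j u) (coord j x) c 0 *: trans_hess i j c (coord i x).
Proof.
move=> F xi xj A; have Uy := overlap_coord xi xj; have oU := @overlap_open i j.
set y := coord i x in Uy A *; set uj := local_repr j u.
have oj := chart_image_open (i := j).
have d1 c : Ck 1 (overlap i j) (partial c uj \o transition i j).
  apply: (Ck_comp oU oj) => [z|b|]; first exact: transition_image.
    exact: Ck_transition.
  exact: Ck_partial.
have d2 b c : Ck 1 (overlap i j) (partial b (fun z => transition i j z 0 c)).
  by apply: Ck_partial; exact: Ck_transition.
apply/matrixP => a b; rewrite [LHS]mxE.
have -> : partial a (partial b (local_repr i u)) y =
   partial a (fun z => \sum_c partial b (fun z => transition i j z 0 c) z * partial c uj (transition i j z)) y.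
  apply: partial_near; move/open_nbhs_nbhs: (conj oU Uy).
  apply: filterS => z Uz.
  have df : differentiable uj (transition i j z).
    exact: Ck1_differentiable oj (CkW F) (transition_image Uz).
  rewrite -(partial_chain b df (transition_diff Uz)).
  apply: partial_near; move/open_nbhs_nbhs: (conj oU Uz).
  by apply: filterS => w; exact: local_repr_change.
have D c : derivable (fun z => partial b (fun z => transition i j z 0 c) z * partial c uj (transition i j z)) y (delta_mx 0 a).
  by apply: derivableM; [exact: (Ck_derivable (d2 b c) Uy)|exact: (Ck_derivable (d1 c) Uy)].
rewrite (partial_sum (index_enum _) D).2 addmxE summxE addrC mulmx3E exchange_big -big_split.
apply: eq_bigr => c _ /=.
rewrite (partialM (Ck_derivable (a:=a) (d2 b c) Uy) (Ck_derivable (a:=a) (d1 c) Uy)).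
have ty : transition i j y = coord j x by exact: transition_coord.
rewrite [(partial c uj \o _) y]/= ty; congr (_ + _).
  by rewrite [RHS]mxE [trans_hess _ _ _ _ _ _]mxE [dcol _ _ _ _]mxE mulrC.
have df : differentiable (partial c uj) (transition i j y).
  exact: Ck1_differentiable oj (Ck_partial c F) (transition_image Uy).
rewrite (partial_chain a df (transition_diff Uy)) mulr_sumr; apply: eq_bigr => d _.
rewrite ty [hess _ _ _ _]mxE [(A^T) _ _]mxE /A !trans_jacE//.
by rewrite mulrC.
Qed.

End Charts.

Section KaehlerCharts.
Variables (R : realType) (n : nat) (M : riemannianManifold R (n + n)).
Hypothesis M_kahler : kahler M.
Local Notation V := 'rV[R]_(n + n).
Local Notation I := (mulI_mx R n).
Implicit Types (i j : chart M) (x : M) (y z : V) (u : M -> R).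

Lemma trans_jac_holo i j x : dom i x -> dom j x ->
  I *m trans_jac i j (coord i x) = trans_jac i j (coord i x) *m I.
Proof. by case: M_kahler => H _ _; exact: H. Qed.

Lemma metric_hermitian i y : chart_image i y -> I *m metric i y *m I^T = metric i y.
Proof. by case: M_kahler => _ H _; exact: H. Qed.

Lemma metric_closed i y : chart_image i y -> forall a b c,
  partial a (fun z => (I *m metric i z) b c) y + partial b (fun z => (I *m metric i z) c a) y
  + partial c (fun z => (I *m metric i z) a b) y = 0.
Proof. by case: M_kahler => _ _ H; exact: H. Qed.

Lemma metric_Ckmx i k : Ckmx (chart_image i) k (metric i).
Proof. by move=> a b; exact: metric_smooth. Qed.

(** Differentiating the commutation of the Jacobian with I, and using that second derivatives
    commute, lets I pass from one index to the other. Consequently the inhomogeneous term of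
    [hess_change] is invisible both to Hermitian traces and to ddc, although the Hessian itself is
    not a tensor. *)
Lemma trans_hess_antiinv i j c x : dom i x -> dom j x ->
  I *m trans_hess i j c (coord i x) = trans_hess i j c (coord i x) *m I^T.
Proof.
move=> xi xj; have Uy := overlap_coord xi xj; have oU := @overlap_open _ _ M i j.
set y := coord i x in Uy *; set S := trans_hess i j c y.
have ST d : (trans_hess i j d y)^T = trans_hess i j d y.
  apply/matrixP => a b; rewrite [LHS]mxE [LHS]mxE [RHS]mxE.
  exact: (partialC b a oU (Ck_transition 2 i j d) Uy).
pose A z := trans_jac i j z.
have As k : Ckmx (overlap i j) k A.
  move=> a b; apply: (Ck_eq oU _ (Ck_partial a (Ck_transition k.+1 i j b))) => z Uz.
  by rewrite -trans_jacE.
have AI z : overlap i j z -> I *m A z = A z *m I.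
  by move=> [x' [xi' xj'] <-]; exact: trans_jac_holo.
have Ik k : Ckmx (overlap i j) k (fun=> I) by exact: Ckmx_cst.
have E (b : 'I_(n + n)) : I *m dmx b A y = dmx b A y *m I.
  have := dmx_near oU b Uy AI.
  rewrite (dmx_mul b Uy (Ik 1%N) (As 1%N)) (dmx_mul b Uy (As 1%N) (Ik 1%N)) !dmx_cst.
  by rewrite mul0mx mulmx0 add0r addr0.
have DA b a d : dmx b A y a d = trans_hess i j d y b a.
  rewrite [LHS]mxE [RHS]mxE; apply: partial_near.
  move/open_nbhs_nbhs: (conj oU Uy); apply: filterS => z Uz.
  exact: trans_jacE.
have SE d a b : trans_hess i j d y a b = trans_hess i j d y b a.
  by rewrite -[in LHS]ST [LHS]mxE.
have F a b : (I *m S) a b = \sum_d trans_hess i j d y a b * I d c.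
  have /matrixP/(_ a c) := E b; rewrite [LHS]mxE [X in _ = X -> _]mxE => H.
  transitivity (\sum_e I a e * dmx b A y e c).
    rewrite [LHS]mxE; apply: eq_bigr => e _.
    by rewrite DA /S SE.
  rewrite H; apply: eq_bigr => d _.
  by rewrite DA SE.
have -> : S *m I^T = (I *m S)^T by rewrite trmx_mul ST.
apply/matrixP => a b; rewrite [RHS]mxE !F; apply: eq_bigr => d _.
by rewrite SE.
Qed.

Lemma laplacian_trace i u y : Ck 2 (chart_image i) (local_repr i u) -> chart_image i y ->
  laplacian (metric i) (local_repr i u) y =
  \tr (cometric (metric i) y *m hess (local_repr i u) y).
Proof.
move=> F Uy; have oi := chart_image_open (i := i).
have pos := @metric_pos _ _ M i; have sm := @metric_Ckmx i.
have ch := kaehler_coords_harmonic oi sm pos (@metric_hermitian i) (@metric_closed i).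
exact: (laplacian_hess oi sm pos ch F Uy).
Qed.

Lemma laplacian_change i j x u : Ck 2 (chart_image i) (local_repr i u) ->
  Ck 2 (chart_image j) (local_repr j u) -> dom i x -> dom j x ->
  laplacian (metric i) (local_repr i u) (coord i x) =
  laplacian (metric j) (local_repr j u) (coord j x).
Proof.
move=> Fi Fj xi xj.
have Ui := chart_image_coord xi; have Uj := chart_image_coord xj.
rewrite (laplacian_trace Fi Ui) (laplacian_trace Fj Uj) (hess_change Fj xi xj) mulmxDr mulmx_sumr.
rewrite raddfD raddf_sum /= [X in _ + X]big1 ?addr0 => [|c _]; last first.
  have H := trans_hess_antiinv c xi xj.
  have GI : I *m cometric (metric i) (coord i x) = cometric (metric i) (coord i x) *m I.
    exact: (cometric_comm (@metric_pos _ _ M i) (@metric_hermitian i) Ui).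
  rewrite -scalemxAr [LHS]linearZ /= (antiinv_trace GI H); exact: mulr0.
rewrite -(cometric_change xi xj) mulmxA mxtrace_mulC !mulmxA; reflexivity.
Qed.

Lemma ddc_change i j x u : Ck 2 (chart_image j) (local_repr j u) -> dom i x -> dom j x ->
  let A := trans_jac i j (coord i x) in
  ddc (local_repr i u) (coord i x) = A *m ddc (local_repr j u) (coord j x) *m A^T.
Proof.
move=> Fj xi xj A; rewrite /ddc (hess_change Fj xi xj) -/A.
have AI : I *m A = A *m I := trans_jac_holo xi xj.
have ATI : A^T *m I^T = I^T *m A^T by rewrite -!trmx_mul AI.
rewrite mulmxDl mulmxDr opprD addrACA mulmx_suml mulmx_sumr -sumrB.
rewrite [X in _ + X]big1 ?addr0 => [|c _]; last first.
  by rewrite -scalemxAl -scalemxAr (trans_hess_antiinv c xi xj) subrr.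
rewrite mulmxBr mulmxBl; congr (_ - _); first by rewrite -!mulmxA ATI.
by rewrite !mulmxA AI.
Qed.

Lemma ddc_sqnorm_change i j x u : Ck 2 (chart_image j) (local_repr j u) -> dom i x -> dom j x ->
  ddc_sqnorm (metric i) (local_repr i u) (coord i x) =
  ddc_sqnorm (metric j) (local_repr j u) (coord j x).
Proof.
move=> Fj xi xj; rewrite /ddc_sqnorm (ddc_change Fj xi xj) -(cometric_change xi xj).
rewrite !trmx_mul trmxK; move: (trans_jac _ _ _) (ddc _ _) (cometric _ _) => A B G.
by rewrite -!mulmxA [RHS]mxtrace_mulC !mulmxA.
Qed.

Lemma ddc_flux_change i j x u w : Ck 2 (chart_image j) (local_repr j u) ->
  Ck 1 (chart_image j) (local_repr j w) -> dom i x -> dom j x ->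
  ddc_flux (metric i) (local_repr i u) (local_repr i w) (coord i x) =
  ddc_flux (metric j) (local_repr j u) (local_repr j w) (coord j x).
Proof.
move=> u2 w1 xi xj; rewrite /ddc_flux (ddc_change u2 xi xj) (dcol_change w1 xi xj).
rewrite (dcol_change (CkW u2) xi xj) -(cometric_change xi xj) trmx_mul.
have AI := trans_jac_holo xi xj; move: AI.
move: (trans_jac _ _ _) (ddc _ _) (cometric _ _) (dcol _ _) (dcol _ _) => A B G p q AI.
by rewrite (mulmxA I) AI !mulmxA.
Qed.

End KaehlerCharts.

(** * Functions on the manifold built in charts *)

Lemma posdef_lower (R : realType) m (h : 'M[R]_m) : posdefmx h ->
  exists2 c : R, 0 < c & forall v : 'rV[R]_m, c * `|v| ^+ 2 <= quad h v.
Proof.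
move=> hp; pose l := inf [set a | eigenvalue (1%:M *m invmx h) a].
have [E hE] := cholesky hp.
have hu := posdefmx_unit hp.
have Eu : E \in unitmx by move: hu; rewrite hE unitmx_mul => /andP[].
pose F : 'rV[R]_m -> R := fun v => sqnorm (v *m invmx E^T).
pose N := \sum_i \sum_j `|invmx E^T i j|.
have N0 : 0 <= N by apply: sumr_ge0 => i _; apply: sumr_ge0.
exists ((N + 1) ^+ 2)^-1; first by rewrite invr_gt0 exprn_gt0// ltr_wpDl.
move=> v; rewrite mulrC ler_pdivrMr; last by rewrite exprn_gt0// ltr_wpDl.
pose w := v *m E^T.
have -> : quad h v = sqnorm w.
  by rewrite sqnorm_quad /quad mulmx1 hE /w trmx_mul trmxK !mulmxA.
have ETu : E^T \in unitmx by rewrite unitmx_tr.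
have vE : v = w *m invmx E^T by rewrite /w mulmxK.
have : `|v| <= `|w| * N.
  rewrite {1}vE; apply: norm_rV_le => [|j]; first by rewrite mulr_ge0.
  rewrite mxE; apply: le_trans (ler_norm_sum _ _ _) _.
  rewrite /N mulr_sumr; apply: ler_sum => i _; rewrite normrM.
  apply: ler_pM => //; first exact: coord_le.
  by rewrite (bigD1 j)//= lerDl sumr_ge0.
move=> H; apply: (@le_trans _ _ ((`|w| * (N + 1)) ^+ 2)).
  rewrite ler_sqr ?nnegrE ?mulr_ge0 ?addr_ge0//.
  by apply: le_trans H _; rewrite ler_wpM2l// lerDl.
by rewrite exprMn; apply: ler_wpM2r; [exact: sqr_ge0|exact: le_sqnorm].
Qed.

Lemma ellipsoid_compact (R : realType) m (h : 'M[R]_m) (y0 : 'rV[R]_m) (c : R) : posdefmx h ->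
  compact [set y : 'rV[R]_m | quad h (y - y0) <= c].
Proof.
move=> hp; have [k k0 kP] := posdef_lower hp.
apply: bounded_closed_compact.
  exists (`|y0| + (`|c / k| + 1)); split => // M' M1 y /= yc.
  apply: le_trans (ltW M1).
  rewrite -[y](subrK y0) addrC; apply: le_trans (ler_normD _ _) _; rewrite lerD2l.
  have H : `|y - y0| ^+ 2 <= c / k.
    by rewrite ler_pdivlMr// mulrC; apply: le_trans (kP _) yc.
  have H2 : `|y - y0| ^+ 2 <= `|c / k| := le_trans H (ler_norm _).
  have := normr_ge0 (y - y0); have := normr_ge0 (c / k).
  move: H2; move: `|y - y0| `|c / k| => a b ab b0 a0.
  rewrite -ler_sqr ?nnegrE ?addr_ge0//; apply: le_trans ab _.
  by rewrite sqrrD1 -addrA; have := sqr_ge0 b; move: (b ^+ 2) => d; rewrite mulr2n; lra.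
have -> : [set y : 'rV[R]_m | quad h (y - y0) <= c] =
          (fun y => quad h (y - y0)) @^-1` [set t | t <= c] by [].
apply: closed_comp => [y _|]; last exact: closed_le.
exact: (Ck_setT_continuous (Ck_quad 0 h y0 openT)).
Qed.

Section ManifoldFunctions.
Variables (R : realType) (m : nat) (M : riemannianManifold R m).
Local Notation V := 'rV[R]_m.
Implicit Types (i j : chart M) (x : M) (y z : V) (u f : M -> R).

Lemma continuous_from_charts f :
  (forall x, exists2 i, dom i x & {for coord i x, continuous (local_repr i f)}) -> continuous f.
Proof.
move=> H x; have [i xi ci] := H x.
have cc : {for x, continuous (local_repr i f \o coord i)}.
  by apply: continuous_comp; [exact: coord_continuous|exact: ci].
apply: (near_eq_continuous _ cc).
have : nbhs x (dom i) by apply: open_nbhs_nbhs; split; [exact: dom_open|].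
by apply: filterS => z zi; rewrite /= /local_repr /= coordK.
Qed.

Lemma Ck_continuous k f : Ck_on_manifold k f -> continuous f.
Proof.
move=> F; apply: continuous_from_charts => x; exists (chart_at x); first exact: dom_chart_at.
exact: (Ck_cont (F _) (chart_image_coord (dom_chart_at x))).
Qed.

(** The chosen chart [chart_at x] may jump from point to point, so regularity of [glob Q] is always
    read off in a fixed chart, through [chart_indep]. *)
Definition glob (Q : chart M -> V -> R) x := Q (chart_at x) (coord (chart_at x) x).

Definition chart_indep (Q : chart M -> V -> R) :=
  forall i j x, dom i x -> dom j x -> Q i (coord i x) = Q j (coord j x).

Lemma glob_chart Q i x : chart_indep Q -> dom i x -> glob Q x = Q i (coord i x).
Proof. by move=> H xi; apply: H => //; exact: dom_chart_at. Qed.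

Lemma glob_continuous Q : chart_indep Q -> (forall i, Ck 0 (chart_image i) (Q i)) ->
  continuous (glob Q).
Proof.
move=> QI Qc; apply: continuous_from_charts => x; exists (chart_at x); first exact: dom_chart_at.
set i := chart_at x; have xi : dom i x := dom_chart_at x.
have C0 : Ck 0 (chart_image i) (local_repr i (glob Q)).
  apply: (Ck_eq (chart_image_open (i := i)) _ (Qc i)) => y /chart_imageP[yi yE].
  by rewrite /local_repr /= (glob_chart QI yi) yE.
exact: (Ck_cont C0 (chart_image_coord xi)).
Qed.

Definition chart_ext i (f : V -> R) x : R := if `[< dom i x >] then f (coord i x) else 0.

Lemma chart_extE i (f : V -> R) x : dom i x -> chart_ext i f x = f (coord i x).
Proof. by move=> xi; rewrite /chart_ext asboolT. Qed.

Lemma chart_ext_out i (f : V -> R) x : ~ dom i x -> chart_ext i f x = 0.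
Proof. by move=> xi; rewrite /chart_ext asboolF. Qed.

Lemma compact_par i (C : set V) : compact C -> C `<=` chart_image i ->
  compact (par i @` C) /\ closed (par i @` C).
Proof.
move=> Cc CU; have K : compact (par i @` C).
  apply: continuous_compact Cc; apply: continuous_in_subspaceT => y /set_mem yC.
  exact: par_continuous (CU _ yC).
by split=> //; exact: compact_closed (manifold_hausdorff (r:=M)) K.
Qed.

(** The manifold being Hausdorff, the image of the compact set [C] is closed. A point outside the
    chart domain thus has a neighbourhood on which the extension is 0. *)
Lemma Ck_chart_ext k i (C : set V) (f : V -> R) : compact C -> C `<=` chart_image i ->
  (forall y, ~ C y -> f y = 0) -> Ck k (chart_image i) f -> Ck_on_manifold k (chart_ext i f).
Proof.
move=> Cc CU f0 F j; have [_ Kc] := compact_par Cc CU.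
apply: Ck_local => y Uy.
have [yj yE] := chart_imageP Uy.
have [yi|nyi] := pselect (dom i (par j y)).
  have Oy : overlap j i y by rewrite -yE; exact: overlap_coord.
  exists (overlap j i); split; [exact: overlap_open|exact: Oy|].
  apply: (@Ck_sub _ _ _ (overlap j i)); first by move=> ? [].
  apply: Ck_overlap.
  apply: (Ck_eq (chart_image_open (i := i)) _ F) => z /chart_imageP[zi zE].
  by rewrite /local_repr /= chart_extE// zE.
have oW : open (chart_image j `&` par j @^-1` (~` (par i @` C))).
  by apply: open_par_preimage; exact: closed_openC.
exists (chart_image j `&` par j @^-1` (~` (par i @` C))); split=> //.
  by split=> // -[z zC zy]; apply: nyi; rewrite -zy; case: (chart_imageP (CU _ zC)).
apply: (@Ck_sub _ _ _ (chart_image j `&` par j @^-1` (~` (par i @` C)))); first by move=> ? [].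
apply: (Ck_eq oW _ (Ck_cst oW k (0 : R))) => z [Uz nz]; rewrite /local_repr /=.
have [zi|nzi] := pselect (dom i (par j z)); last by rewrite chart_ext_out.
rewrite chart_extE// f0// => zC; apply: nz.
by exists (coord i (par j z)) => //; exact: coordK.
Qed.

Lemma compactly_supported_sub (K : set M) f : compact K -> closed K ->
  (forall x, ~ K x -> f x = 0) -> compactly_supported f.
Proof.
move=> Kc Kcl f0; apply: (subclosed_compact _ Kc); first exact: closed_closure.
have -> : K = closure K by apply/closure_id.
by apply: closure_subset => x /= fx; apply: contrapT => /f0 /eqP; exact/negP.
Qed.

Lemma chart_ext_off i (C : set V) (f : V -> R) x : (forall y, ~ C y -> f y = 0) -> C `<=` chart_image i ->
  ~ (par i @` C) x -> chart_ext i f x = 0.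
Proof.
move=> f0 CU nx; have [xi|nxi] := pselect (dom i x); last exact: chart_ext_out.
by rewrite chart_extE// f0// => xC; apply: nx; exists (coord i x) => //; exact: coordK.
Qed.

Lemma csupp_off f x : ~ closure [set x | f x != 0] x -> f x = 0.
Proof.
by move=> nx; apply/eqP; apply: contrapT => /negP fx; apply: nx; exact: subset_closure.
Qed.

Lemma Ck_manifoldM k f u : Ck_on_manifold k f -> Ck_on_manifold k u ->
  Ck_on_manifold k (fun x => f x * u x).
Proof. by move=> F H i; apply: (CkM (chart_image_open (i := i)) (F i) (H i)). Qed.

Lemma Ck_manifoldB k f u : Ck_on_manifold k f -> Ck_on_manifold k u ->
  Ck_on_manifold k (fun x => f x - u x).
Proof. by move=> F H i; apply: (CkB (chart_image_open (i := i)) (F i) (H i)). Qed.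

Lemma Ck_manifold_cst k (c : R) : Ck_on_manifold k ((fun=> c) : M -> R).
Proof. by move=> i; exact: (Ck_cst (chart_image_open (i := i)) k c). Qed.

End ManifoldFunctions.

(** * Integration on the manifold *)

Section DensityTransfer.
Import HBNNSimple.
Context d d' (X : measurableType d) (Y : measurableType d') (R : realType).
Variables (mu : {measure set X -> \bar R}) (la : {measure set Y -> \bar R}).
Variables (D : set X) (p : Y -> X) (rho : Y -> R).
Hypothesis mD : measurable D.
Hypothesis mp : measurable_fun setT p.
Hypothesis mrho : measurable_fun setT rho.
Hypothesis rho_ge0 : forall y, 0 <= rho y.
Hypothesis mu_density : forall A, measurable A ->
  mu (A `&` D) = (\int[la]_y (\1_A (p y) * rho y)%:E)%E.

Let mrhoE : measurable_fun setT (fun y => (rho y)%:E).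
Proof. exact/measurable_EFinP. Qed.

Let mfp (f : X -> \bar R) : measurable_fun setT f ->
  measurable_fun setT (fun y => (f (p y) * (rho y)%:E)%E).
Proof.
move=> mf; apply: emeasurable_funM; last exact: mrhoE.
exact: (measurableT_comp mf mp).
Qed.

Let transfer_nnsfun (f : {nnsfun X >-> R}) :
  (\int[mu]_(x in D) (f x)%:E = \int[la]_y ((f (p y))%:E * (rho y)%:E))%E.
Proof.
under [in LHS]eq_integral do rewrite fimfunE -fsumEFin//.
rewrite ge0_integral_fsum//; last 2 first.
  - by move=> r; apply/measurable_EFinP; apply: measurable_funTS; exact: measurableT_comp.
  - by move=> r z _; rewrite EFinM nnfun_muleindic_ge0.
transitivity (\int[la]_y \sum_(r \in range f) ((r * \1_(f @^-1` [set r]) (p y))%:E * (rho y)%:E))%E; last first.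
  apply: eq_integral => y _; rewrite -ge0_mule_fsuml; last by move=> r; exact: nnfun_muleindic_ge0.
  by rewrite fsumEFin// -fimfunE.
rewrite ge0_integral_fsum//; last 2 first.
  - move=> r; apply: (mfp (f := fun x => (r * \1_(f @^-1` [set r]) x)%:E)).
    by apply/measurable_EFinP; exact: measurableT_comp.
  - by move=> r y _; rewrite mule_ge0 ?lee_fin//; exact: nnfun_muleindic_ge0.
apply: eq_fsbigr => r _.
have mA : measurable (f @^-1` [set r]) by rewrite -[X in measurable X]setTI; exact: measurable_funP.
have [r0|r0] := leP 0 r; last first.
  rewrite preimage_nnfun0//.
  by rewrite !integral0_eq// => y _; rewrite indic0 mulr0 ?mul0e.
transitivity (r%:E * mu ((f @^-1` [set r]) `&` D))%E.
  under eq_integral do rewrite EFinM.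
  rewrite ge0_integralZl//; first by rewrite integral_indic.
  by apply/measurable_EFinP; apply: measurable_funTS; exact: measurable_indic.
rewrite mu_density// -ge0_integralZl//.
- by apply: eq_integral => y _; rewrite -!EFinM mulrA.
- apply/measurable_EFinP; apply: measurable_funM => //.
  by apply: (measurableT_comp _ mp); exact: measurable_indic.
- by move=> y _; rewrite lee_fin mulr_ge0.
Qed.

(** The density formula, known on measurable sets, passes to simple functions by linearity and to
    nonnegative functions by monotone convergence. *)
Lemma density_transfer (f : X -> \bar R) : measurable_fun setT f -> (forall x, 0 <= f x)%E ->
  (\int[mu]_(x in D) f x = \int[la]_y (f (p y) * (rho y)%:E))%E.
Proof.
move=> mf f0; pose f_ := nnsfun_approx measurableT mf.
have fc x : (f_ k x)%:E @[k --> \oo] --> f x by exact: cvg_nnsfun_approx.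
have nd x a b : (a <= b)%N -> f_ a x <= f_ b x by move=> ab; exact/lefP/nd_nnsfun_approx.
have mf_ k : measurable_fun setT (fun x => (f_ k x)%:E) by exact/measurable_EFinP.
transitivity (\int[mu]_(x in D) lim ((f_ k x)%:E @[k --> \oo]))%E.
  by apply: eq_integral => x _; apply/esym/cvg_lim => //; exact: fc.
rewrite monotone_convergence//; last 3 first.
  by move=> k; apply: measurable_funTS; exact: mf_.
  by move=> k x _; rewrite lee_fin.
  by move=> x _ a b ab; rewrite lee_fin; exact: nd.
under eq_fun do rewrite transfer_nnsfun.
rewrite -monotone_convergence//; last 3 first.
  by move=> k; exact: mfp (mf_ k).
  by move=> k y _; rewrite mule_ge0 ?lee_fin.
  by move=> y _ a b ab; rewrite lee_wpmul2r ?lee_fin//; exact: nd.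
apply: eq_integral => y _; apply/cvg_lim => //.
by apply: cvgeMr => //; exact: fc.
Qed.

End DensityTransfer.

Lemma compact_seq_cover (T : ptopologicalType) (K : set T) (W : T -> set T) :
  compact K -> (forall x, K x -> open (W x) /\ W x x) ->
  exists2 s : seq T, (forall x, x \in s -> K x) & forall z, K z -> exists2 x, x \in s & W x z.
Proof.
move=> Kc H; have : cover_compact K by move: Kc; rewrite compact_cover.
move=> /(_ T K W (fun x Kx => (H x Kx).1)) [].
  by move=> x Kx; exists x => //; exact: (H x Kx).2.
move=> D DK KD; exists (finmap.enum_fset D); first by move=> x /DK; rewrite inE.
by move=> z /KD[x xD Wxz]; exists x.
Qed.

Section OpenPatch.
Variables (R : realType) (S T : ptopologicalType) (U : set S) (oU : open U).

Lemma open_patch_preimage (f : S -> T) (z0 : T) (O : set T) :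
  (forall y, U y -> {for y, continuous f}) -> open O ->
  measurable ((fun y => if `[< U y >] then f y else z0) @^-1` O : set (borelType S)).
Proof.
move=> cf oO.
have -> : (fun y => if `[< U y >] then f y else z0) @^-1` O =
   (U `&` f @^-1` O) `|` (~` U `&` [set _ | O z0]).
  apply/seteqP; split=> y /=.
    by case: asboolP => Uy; [left|right].
  by case=> -[Uy fy]; [rewrite asboolT|rewrite asboolF].
have mU : measurable (U : set (borelType S)) := open_measurable_borel oU.
apply: measurableU.
  apply: open_measurable_borel; rewrite openE => y [Uy fy]; rewrite /interior.
  by apply: filterI; [exact: open_nbhs_nbhs|apply: (cf _ Uy); exact: open_nbhs_nbhs].
apply: measurableI; first exact: measurableC.
have [Oz|Oz] := pselect (O z0).
  rewrite (_ : [set _ | O z0] = setT); first exact: measurableT.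
  by apply/seteqP; split.
by rewrite (_ : [set _ | O z0] = set0)//; apply/seteqP; split.
Qed.

End OpenPatch.

Section VolumeInCharts.
Variables (R : realType) (m : nat) (M : riemannianManifold R m).
Variables (vol : {measure set (borelType M) -> \bar R}) (volP : is_riemannian_volume vol).
Local Notation V := 'rV[R]_m.
Local Notation rho i := (voldens (metric (r:=M) i)).

(** Total versions of [par] and of the density, so that measurability can be stated on the whole
    space. The default [point] carries no weight, since [chart_dens] is 0 there. *)
Definition chart_par (i : chart M) (y : V) : M := if `[< chart_image i y >] then par i y else point.
Definition chart_dens (i : chart M) (y : V) : R := if `[< chart_image i y >] then rho i y else 0.

Lemma measurable_chart_par i :
  measurable_fun [set: borelType V] (chart_par i : borelType V -> borelType M).
Proof.
apply: measurable_to_borel => O oO; rewrite /chart_par.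
apply: (open_patch_preimage (chart_image_open (i := i)) point _ oO).
by move=> y Uy; exact: par_continuous.
Qed.

Let rho_smooth k i : Ck k (chart_image i) (rho i).
Proof.
apply: voldens_smooth; first exact: chart_image_open.
  by move=> k' a b; exact: metric_smooth.
exact: metric_pos.
Qed.

Lemma measurable_chart_dens i :
  measurable_fun [set: borelType V] (chart_dens i : borelType V -> R).
Proof.
apply: (measurability _ (RGenOpens.measurableE R)).
move=> _ [_ [a [b ->] <-]]; rewrite setTI.
apply: (open_patch_preimage (T := R) (chart_image_open (i := i)) 0); last exact: interval_open.
by move=> y Uy; exact: (Ck_cont (rho_smooth 0 i) Uy).
Qed.

Lemma chart_dens_ge0 i y : 0 <= chart_dens i y.
Proof. by rewrite /chart_dens; case: ifP => // _; exact: sqrtr_ge0. Qed.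

Lemma chart_transfer i (f : M -> \bar R) :
  measurable_fun [set: borelType M] f -> (forall x, 0 <= f x)%E ->
  (forall x, ~ dom i x -> f x = 0%E) ->
  (\int[vol]_x f x = \int[lebesgue_row R m]_y (f (chart_par i y) * (chart_dens i y)%:E))%E.
Proof.
move=> mf f0 fi.
have mD : measurable (dom i : set (borelType M)) by apply: open_measurable_borel; exact: dom_open.
rewrite -(@density_transfer _ _ _ _ _ vol (lebesgue_row R m) (dom i) (chart_par i) (chart_dens i)) //.
- rewrite [RHS]integral_mkcond; apply: eq_integral => x _; rewrite /patch.
  by case: ifPn => // /negP xi; apply: fi => xi'; apply: xi; rewrite inE.
- exact: measurable_chart_par.
- exact: measurable_chart_dens.
- exact: chart_dens_ge0.
move=> A mA.
have mAD : measurable (A `&` dom i : set (borelType M)) by exact: measurableI.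
have sAD : A `&` dom i `<=` dom i by move=> x [].
rewrite (@volP i _ mAD sAD).
have E : (fun y : V => (\1_(coord i @` (A `&` dom i)) y * Num.sqrt (\det (metric i y)))%:E) =
         (fun y => (\1_A (chart_par i y) * chart_dens i y)%:E).
  apply/funext => y; congr (_%:E); rewrite /chart_par /chart_dens.
  case: asboolP => Uy; last first.
    rewrite mulr0 indicE memNset ?mul0r// => -[x [_ xi] xy]; apply: Uy.
    by rewrite -xy; exact: chart_image_coord.
  rewrite !indicE -/(voldens (metric i) y); congr (_%:R * _); congr nat_of_bool.
  have [yi yE] := chart_imageP Uy.
  apply/idP/idP; rewrite !inE.
    by move=> -[x [Ax xi] <-]; rewrite coordK.
  by move=> Ay; exists (par i y).
rewrite E lebesgue_intE//.
  apply/measurable_EFinP; apply: measurable_funM; last exact: measurable_chart_dens.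
  have mI : measurable_fun [set: borelType M] (\1_A : borelType M -> R) by exact: measurable_indic.
  exact: (measurableT_comp mI (measurable_chart_par i)).
by move=> y; rewrite lee_fin mulr_ge0//; exact: chart_dens_ge0.
Qed.

Definition integral_vol (f : M -> R) : R := \int[vol]_x f x.

Lemma integral_vol_chart i (f : M -> R) (h : V -> R) (C : set V) :
  continuous f -> C `<=` chart_image i -> (forall y, ~ C y -> h y = 0) ->
  (forall x, dom i x -> f x = h (coord i x)) -> (forall x, ~ dom i x -> f x = 0) ->
  (\int[vol]_x (f x)%:E = \int[lebesgue_row R m]_y (rho i y * h y)%:E)%E.
Proof.
move=> cf CU h0 fh f0.
have mf : measurable_fun [set: borelType M] (EFin \o f).
  by apply/measurable_EFinP; exact: continuous_measurable_borel.
have E y : f (chart_par i y) * chart_dens i y = rho i y * h y.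
  rewrite /chart_par /chart_dens; case: asboolP => Uy; last first.
    by rewrite mulr0 h0 ?mulr0// => /CU.
  have [yi yE] := chart_imageP Uy.
  by rewrite fh// yE mulrC.
rewrite integralE [RHS]integralE; congr (_ - _)%E.
  rewrite (@chart_transfer i ((EFin \o f)^\+%E)).
  - apply: eq_integral => y _; rewrite ?funepos.unlock /=.
    have d0 := chart_dens_ge0 i y.
    by rewrite -E maxe_pMl ?lee_fin ?mul0e.
  - exact: measurable_funepos.
  - by move=> x; exact: funepos_ge0.
  - by move=> x xi; rewrite ?funepos.unlock /= f0// maxxx.
rewrite (@chart_transfer i ((EFin \o f)^\-%E)).
- apply: eq_integral => y _; rewrite ?funeneg.unlock /=.
  have d0 := chart_dens_ge0 i y.
  by rewrite -E -mulNr maxe_pMl ?lee_fin ?mul0e.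
- exact: measurable_funeneg.
- by move=> x; exact: funeneg_ge0.
- by move=> x xi; rewrite ?funeneg.unlock /= f0// oppr0 maxxx.
Qed.

End VolumeInCharts.

Section ChartBumps.
Variables (R : realType) (m : nat) (M : riemannianManifold R m).
Local Notation V := 'rV[R]_m.

Lemma small_ellipsoid (h : 'M[R]_m) (U : set V) y0 : posdefmx h -> open U -> U y0 ->
  exists2 r : R, 0 < r & [set y | quad h (y - y0) <= r ^+ 2] `<=` U.
Proof.
move=> hp oU Uy; have [c c0 cP] := posdef_lower hp.
have /nbhs_ballP[e /= e0 eU] : nbhs y0 U by exact: open_nbhs_nbhs.
exists (Num.sqrt c * (e / 2)); first by rewrite mulr_gt0 ?sqrtr_gt0 ?divr_gt0.
move=> y /= yq; apply: eU; rewrite -ball_normE /ball_ /= distrC.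
apply: (@le_lt_trans _ _ (e / 2)); last by rewrite ltr_pdivrMr// mulr_natr mulr2n ltrDl.
have := le_trans (cP (y - y0)) yq.
rewrite exprMn sqr_sqrtr ?(ltW c0)// ler_pM2l// ler_sqr ?nnegrE// divr_ge0// ltW//.
Qed.

(* Two nested bumps: chi = 1 on the support of f, whose interior contains x. *)
Lemma chart_bump (x : M) (W : set M) : open W -> W x ->
  exists i (f chi : V -> R) (C C' : set V),
  [/\ dom i x, smooth setT f /\ smooth setT chi,
      compact C /\ compact C', C `<=` C' /\ C' `<=` chart_image i `&` par i @^-1` W &
   [/\ (forall y, ~ C y -> f y = 0), (forall y, ~ C' y -> chi y = 0),
       (forall y, 0 <= f y <= 1), (exists O, [/\ open O, C `<=` O & forall y, O y -> chi y = 1]) &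
       exists O, [/\ open O, O x & forall z, O z -> chart_ext i f z = 1]]].
Proof.
move=> oW Wx; set i := chart_at x; have xi : dom i x := dom_chart_at x.
set y0 := coord i x.
have p1 := posdefmx1 R m.
have Uy0 : (chart_image i `&` par i @^-1` W) y0.
  by split; [exact: chart_image_coord|rewrite /= coordK].
have [r r0 rU] := small_ellipsoid p1 (open_par_preimage oW) Uy0.
pose s := r / 4.
have s0 : 0 < s by rewrite divr_gt0.
have s20 : 0 < 2 * s by rewrite mulr_gt0.
exists i, (ellipsoid_bump 1%:M y0 s), (ellipsoid_bump 1%:M y0 (2 * s)),
  [set y | quad 1%:M (y - y0) <= 2 * s ^+ 2], [set y | quad 1%:M (y - y0) <= 2 * (2 * s) ^+ 2].
have ss : (2 * s) ^+ 2 = 4 * s ^+ 2 by rewrite exprMn; congr (_ * _); rewrite expr2 -natrM.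
have r2 : r ^+ 2 = 16 * s ^+ 2.
  by rewrite /s; field.
have sq0 : 0 < s ^+ 2 by rewrite exprn_gt0.
split=> //.
- by split=> k; apply: Ck_ellipsoid_bump; exact: openT.
- by split; exact: ellipsoid_compact.
- split=> y /= yq; first by apply: le_trans yq _; rewrite ss; move: (s ^+ 2) sq0 => d; lra.
  by apply: rU => /=; apply: le_trans yq _; rewrite ss r2; move: (s ^+ 2) sq0 => d; lra.
split.
- by move=> y /= /negP; rewrite -ltNge => /ltW; exact: ellipsoid_bump0.
- by move=> y /= /negP; rewrite -ltNge => /ltW; exact: ellipsoid_bump0.
- by move=> y; rewrite smooth_step_ge0 smooth_step_le1.
- exists [set y | quad 1%:M (y - y0) < (2 * s) ^+ 2]; split.
  + have -> : [set y : V | quad 1%:M (y - y0) < (2 * s) ^+ 2] =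
        (fun y : V => quad 1%:M (y - y0)) @^-1` [set t | t < (2 * s) ^+ 2] by [].
    apply: open_comp => [y _|]; last exact: open_lt.
    exact: (Ck_setT_continuous (Ck_quad 0 1%:M y0 openT)).
  + by move=> y /= yq; apply: le_lt_trans yq _; rewrite ss; move: (s ^+ 2) sq0 => d; lra.
  + by move=> y /= /ltW; exact: ellipsoid_bump1.
exists (dom i `&` coord i @^-1` [set y | quad 1%:M (y - y0) < s ^+ 2]); split.
- rewrite openE => z [zi zq]; rewrite /interior; apply: filterI.
    by apply: open_nbhs_nbhs; split=> //; exact: dom_open.
  apply: (coord_continuous zi); apply: open_nbhs_nbhs; split=> //.
  have -> : [set y : V | quad 1%:M (y - y0) < s ^+ 2] =
      (fun y : V => quad 1%:M (y - y0)) @^-1` [set t | t < s ^+ 2] by [].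
  apply: open_comp => [y _|]; last exact: open_lt.
  exact: (Ck_setT_continuous (Ck_quad 0 1%:M y0 openT)).
- by split=> //=; rewrite /y0 subrr /quad !mul0mx mxE.
- by move=> z [zi zq]; rewrite chart_extE//; apply: ellipsoid_bump1 => //; exact: ltW.
Qed.

Variables (vol : {measure set (borelType M) -> \bar R}) (volP : is_riemannian_volume vol).

Lemma integrable_chart i (C : set V) (f : M -> R) : continuous f -> compact C ->
  C `<=` chart_image i -> (forall x, ~ (par i @` C) x -> f x = 0) ->
  vol.-integrable setT (EFin \o f).
Proof.
move=> cf Cc CU f0.
have Ccl : closed C by apply: compact_closed => //; exact: norm_hausdorff.
have [r Cr] : exists r : R, forall y, C y -> `|y| < r.
  have [B [_ HB]] := compact_bounded Cc.
  by exists (B + 1 + 1) => y yC; apply: le_lt_trans (HB (B + 1) _ y yC) _; rewrite ?ltrDl.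
pose h y := if `[< C y >] then `|f (par i y)| else 0.
have h0 y : ~ C y -> h y = 0 by move=> nC; rewrite /h asboolF.
have caf : continuous (fun x => `|f x|) by move=> x; apply: continuous_comp; [exact: cf|exact: norm_continuous].
have fh x : dom i x -> `|f x| = h (coord i x).
  move=> xi; rewrite /h coordK//; case: asboolP => // nC.
  rewrite f0 ?normr0// => -[y yC yx]; apply: nC; rewrite -yx.
  by have [_ ->] := chart_imageP (CU _ yC).
have f0' x : ~ dom i x -> `|f x| = 0.
  move=> nx; rewrite f0 ?normr0// => -[y yC yx]; apply: nx; rewrite -yx.
  by case: (chart_imageP (CU _ yC)).
have mf : measurable_fun [set: borelType M] (EFin \o f).
  by apply/measurable_EFinP; exact: continuous_measurable_borel.
apply/integrableP; split=> //.
have -> : (\int[vol]_x `|(EFin \o f) x|)%E = (\int[vol]_x (`|f x|)%:E)%E by [].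
rewrite (integral_vol_chart volP caf CU h0 fh f0').
have c1 : continuous (fun y => voldens (metric (r:=M) i) y * h y).
  apply: (@Ck_setT_continuous _ _ 0).
  apply: (Ck_extend0 (chart_image_open (i:=i)) Ccl CU (f:=fun y => voldens (metric (r:=M) i) y * h y)).
    by move=> y nC; rewrite h0// mulr0.
  apply: CkM => //; first exact: chart_image_open.
    apply: voldens_smooth; first exact: chart_image_open.
      by move=> k' a b; exact: metric_smooth.
    exact: metric_pos.
  split=> // y Uy; have [yi yE] := chart_imageP Uy.
  apply: (@near_eq_continuous _ _ (fun y => `|f (par i y)|)).
    have : nbhs y (chart_image i) by apply: open_nbhs_nbhs; split => //; exact: chart_image_open.
    apply: filterS => z /chart_imageP[zi zE].
    by rewrite [LHS](fh _ zi) zE.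
  by apply: (continuous_comp (f := par i) (g := fun x => `|f x|)); [exact: par_continuous|exact: caf].
have s1 : supp_le r (fun y => voldens (metric (r:=M) i) y * h y).
  by apply: (supp_off Cr) => y nC; rewrite h0// mulr0.
have /integrableP[_] := integrable_supp c1 s1.
apply: le_lt_trans; apply: ge0_le_integral => //.
- by move=> y _; rewrite lee_fin mulr_ge0 ?sqrtr_ge0// /h; case: ifP.
- by apply/measurable_EFinP; exact: continuous_measurable_borel.
- apply/measurable_EFinP; apply: measurableT_comp => //.
  exact: continuous_measurable_borel.
- by move=> y _; rewrite lee_fin; exact: ler_norm.
Qed.

(** Local finiteness of the volume comes from the charts: the support is covered by finitely many
    sets on which some integrable bump equals 1, and a multiple [G] of the sum of these bumps
    dominates |f|. *)
Lemma integrable_csupp (f : M -> R) : continuous f -> compactly_supported f ->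
  vol.-integrable setT (EFin \o f).
Proof.
move=> cf; rewrite /compactly_supported; set K := closure _ => Kc.
have B x : {bO : (M -> R) * set M | [/\ continuous bO.1, vol.-integrable setT (EFin \o bO.1),
    (forall z, 0 <= bO.1 z), open bO.2 /\ bO.2 x & forall z, bO.2 z -> bO.1 z = 1]}.
  apply: cid.
  have [i [b [chi [C [C' [xi [sb sc] [Cc C'c] [CC' C'U] [b0 chi0 b01 ch1 [W1 [oW Wx W1E]]]]]]]]] :=
    chart_bump (W := setT) openT (x:=x) Logic.I.
  have CU : C `<=` chart_image i by move=> y /CC'/C'U[].
  have sbM : Ck_on_manifold 0 (chart_ext i b).
    apply: (Ck_chart_ext Cc CU b0); exact: Ck_sub (@subsetT _ _) (sb 0%N).
  exists (chart_ext i b, W1); split=> //=.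
  - exact: Ck_continuous sbM.
  - apply: (integrable_chart (Ck_continuous sbM) Cc CU) => z; exact: chart_ext_off.
  - by move=> z; rewrite /chart_ext; case: ifP => // _; case/andP: (b01 (coord i z)).
pose b x := (sval (B x)).1; pose O x := (sval (B x)).2.
have bP x : [/\ continuous (b x), vol.-integrable setT (EFin \o b x),
    (forall z, 0 <= b x z), open (O x) /\ O x x & forall z, O x z -> b x z = 1] := svalP (B x).
have [s _ sK] : exists2 s : seq M, (forall x, x \in s -> K x) & forall z, K z -> exists2 x, x \in s & O x z.
  by apply: compact_seq_cover => // x _; case: (bP x) => _ _ _ [].
have [F F0 HF] : exists2 F : R, 0 <= F & forall x, `|f x| <= F.
  have : bounded_set (f @` K).
    by apply: compact_bounded; apply: continuous_compact Kc; exact: continuous_subspaceT.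
  move=> [F [_ HF]]; exists (`|F| + 1); first by rewrite addr_ge0.
  move=> x; have [xK|xK] := pselect (K x).
    by apply: (HF (`|F| + 1)) => /=; [rewrite ltr_pwDr// ler_norm|exists x].
  by rewrite (csupp_off xK) normr0 addr_ge0.
pose G z := F * \sum_(x <- s) b x z.
have Gi : vol.-integrable setT (EFin \o G).
  have : vol.-integrable setT (fun z => F%:E * (\sum_(x <- s) (b x z)%:E))%E.
    apply: integrableZl => //; apply: (integrable_sum measurableT).
    by move=> x _; case: (bP x).
  apply: eq_integrable => // z _; rewrite /= /G EFinM; congr (_ * _)%E.
  by rewrite -sumEFin.
apply: (le_integrable measurableT _ _ Gi).
  by apply/measurable_EFinP; exact: continuous_measurable_borel.
move=> z _ /=; rewrite lee_fin.
have b0 x : 0 <= b x z by case: (bP x).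
have S0 : 0 <= \sum_(x <- s) b x z by apply: sumr_ge0 => x _; exact: b0.
rewrite [leRHS]ger0_norm ?mulr_ge0//.
have [zK|zK] := pselect (K z); last by rewrite (csupp_off zK) normr0 mulr_ge0.
apply: le_trans (HF z) _; rewrite ler_peMr//.
have [x xs Oz] := sK z zK.
have b1 : b x z = 1 by case: (bP x) => _ _ _ _ ->.
rewrite -b1 (perm_big _ (perm_to_rem xs)) /= big_cons lerDl.
by apply: sumr_ge0 => x' _; exact: b0.
Qed.

End ChartBumps.

(** * From charts to global integral identities *)

Section Glue.
Variables (R : realType) (m : nat) (M : riemannianManifold R m).
Variables (vol : {measure set (borelType M) -> \bar R}) (volP : is_riemannian_volume vol).

Lemma integral_volD (f h : M -> R) : continuous f -> continuous h ->
  compactly_supported f -> compactly_supported h ->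
  integral_vol vol (fun x => f x + h x) = integral_vol vol f + integral_vol vol h.
Proof.
move=> cf ch sf sh; apply: RintegralD => //.
  exact: (integrable_csupp volP).
exact: (integrable_csupp volP).
Qed.

Lemma compactly_supported_by (f h : M -> R) : compactly_supported f ->
  (forall x, ~ closure [set x | f x != 0] x -> h x = 0) -> compactly_supported h.
Proof.
move=> sf fh; apply: (compactly_supported_sub (K := closure [set x | f x != 0])) => //.
exact: closed_closure.
Qed.

(** Takes the place of a partition of unity. For an additive local operator T, split f = b f + (1 -
    b) f: the first part has integral 0 by hypothesis, and the second vanishes where b = 1, so one
    fewer set covers the points where it is nonzero. *)
Lemma glue k (T : (M -> R) -> M -> R) :
  (forall f h, Ck_on_manifold k f -> Ck_on_manifold k h ->
     T (fun x => f x + h x) = (fun x => T f x + T h x)) ->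
  (forall f, Ck_on_manifold k f -> continuous (T f)) ->
  (forall f x, Ck_on_manifold k f -> ~ closure [set x | f x != 0] x -> T f x = 0) ->
  (forall x, exists (b : M -> R) (W : set M), [/\ open W, W x, forall z, W z -> b z = 1,
     Ck_on_manifold k b &
     forall f, Ck_on_manifold k f -> integral_vol vol (T (fun x => b x * f x)) = 0]) ->
  forall f, Ck_on_manifold k f -> compactly_supported f -> integral_vol vol (T f) = 0.
Proof.
move=> TD Tc T0 Tb f fk fs.
have B x : {bW : (M -> R) * set M | [/\ open bW.2, bW.2 x, forall z, bW.2 z -> bW.1 z = 1,
     Ck_on_manifold k bW.1 &
     forall f, Ck_on_manifold k f -> integral_vol vol (T (fun x => bW.1 x * f x)) = 0]}.
  by apply: cid; have [b [W H]] := Tb x; exists (b, W).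
pose b x := (sval (B x)).1; pose W x := (sval (B x)).2.
have bP x : [/\ open (W x), W x x, forall z, W x z -> b x z = 1, Ck_on_manifold k (b x) &
     forall f, Ck_on_manifold k f -> integral_vol vol (T (fun z => b x z * f z)) = 0] := svalP (B x).
have [s _ sK] : exists2 s : seq M, (forall x, x \in s -> closure [set x | f x != 0] x) &
    forall z, closure [set x | f x != 0] z -> exists2 x, x \in s & W x z.
  by apply: compact_seq_cover => // x _; case: (bP x).
have Ts h : Ck_on_manifold k h -> compactly_supported h -> compactly_supported (T h).
  by move=> hk hs; apply: (compactly_supported_by hs) => x; exact: T0.
have H : forall z, f z != 0 -> exists2 x, x \in s & W x z.
  by move=> z fz; apply: sK; exact: subset_closure.
elim: s f fk fs H {sK} => [|x s IH] f fk fs H.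
  have f0 : [set x | f x != 0] = set0.
    by apply/seteqP; split => // z /H[].
  have -> : T f = fun=> 0.
    by apply/funext => z; apply: T0 => //; rewrite f0 closure0.
  by rewrite /integral_vol /Rintegral integral0_eq.
have [_ _ b1 bk bI] := bP x.
pose f1 z := b x z * f z; pose f2 z := (1 - b x z) * f z.
have f1k : Ck_on_manifold k f1 by exact: Ck_manifoldM.
have f2k : Ck_on_manifold k f2.
  by apply: Ck_manifoldM => //; apply: Ck_manifoldB => //; exact: Ck_manifold_cst.
have f1s : compactly_supported f1.
  by apply: (compactly_supported_by fs) => z /csupp_off fz; rewrite /f1 fz mulr0.
have f2s : compactly_supported f2.
  by apply: (compactly_supported_by fs) => z /csupp_off fz; rewrite /f2 fz mulr0.
have -> : T f = fun z => T f1 z + T f2 z.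
  rewrite -(TD f1 f2 f1k f2k); congr T; apply/funext => z.
  by rewrite /f1 /f2 -mulrDl addrCA subrr addr0 mul1r.
rewrite (integral_volD (Tc _ f1k) (Tc _ f2k) (Ts _ f1k f1s) (Ts _ f2k f2s)).
rewrite [X in X + _](bI f fk) add0r; apply: IH => // z f2z.
have fz : f z != 0 by move: f2z; rewrite /f2; apply: contra_neq => ->; rewrite mulr0.
have [y] := H z fz; rewrite inE => /orP[/eqP ->|ys] Wz; last by exists y.
by move: f2z; rewrite /f2 b1// subrr mul0r eqxx.
Qed.

End Glue.

Section KaehlerGlobal.
Variables (R : realType) (n : nat) (M : riemannianManifold R (n + n)).
Hypothesis M_kahler : kahler M.
Variables (vol : {measure set (borelType M) -> \bar R}) (volP : is_riemannian_volume vol).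
Local Notation V := 'rV[R]_(n + n).
Local Notation I := (mulI_mx R n).
Implicit Types (u f h : M -> R) (i : chart M).

Definition gradpair f h := glob (fun i => ginner (metric (r:=M) i) (local_repr i f) (local_repr i h)).
Definition lap h := glob (fun i => laplacian (metric (r:=M) i) (local_repr i h)).
Definition ddc_sq u := glob (fun i => ddc_sqnorm (metric (r:=M) i) (local_repr i u)).
Definition flux u f := glob (fun i => ddc_flux (metric (r:=M) i) (local_repr i u) (local_repr i f)).

Local Notation oc i := (@chart_image_open R _ M i).

Lemma gradpair_indep f h : Ck_on_manifold 1 f -> Ck_on_manifold 1 h ->
  chart_indep (fun i => ginner (metric (r:=M) i) (local_repr i f) (local_repr i h)).
Proof. by move=> F H i j x xi xj; exact: ginner_change. Qed.

Lemma lap_indep h : Ck_on_manifold 2 h ->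
  chart_indep (fun i => laplacian (metric (r:=M) i) (local_repr i h)).
Proof. by move=> H i j x xi xj; exact: (laplacian_change M_kahler). Qed.

Lemma ddc_sq_indep u : Ck_on_manifold 2 u ->
  chart_indep (fun i => ddc_sqnorm (metric (r:=M) i) (local_repr i u)).
Proof. by move=> H i j x xi xj; exact: (ddc_sqnorm_change M_kahler). Qed.

Lemma flux_indep u f : Ck_on_manifold 2 u -> Ck_on_manifold 1 f ->
  chart_indep (fun i => ddc_flux (metric (r:=M) i) (local_repr i u) (local_repr i f)).
Proof. by move=> H F i j x xi xj; exact: (ddc_flux_change M_kahler). Qed.

Let Gs k i : Ckmx (chart_image i) k (cometric (metric (r:=M) i)).
Proof.
apply: cometric_smooth; first exact: (oc i).
  by move=> k'; exact: metric_Ckmx.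
exact: metric_pos.
Qed.

Lemma dcol_Ckmx k i f : Ck_on_manifold k.+1 f -> Ckmx (chart_image i) k (dcol (local_repr i f)).
Proof.
move=> F a b; apply: (Ck_eq (oc i) _ (Ck_partial a (F i))) => y _.
by rewrite [RHS]mxE.
Qed.

Lemma hess_Ckmx k i f : Ck_on_manifold k.+2 f -> Ckmx (chart_image i) k (hess (local_repr i f)).
Proof.
move=> F a b; apply: (Ck_eq (oc i) _ (Ck_partial a (Ck_partial b (F i)))) => y _.
by rewrite [RHS]mxE.
Qed.

Lemma ginner_Ck k i f h : Ck_on_manifold k.+1 f -> Ck_on_manifold k.+1 h ->
  Ck k (chart_image i) (ginner (metric (r:=M) i) (local_repr i f) (local_repr i h)).
Proof.
move=> F H; apply: (Ckmx_mul (oc i)); last exact: dcol_Ckmx.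
by apply: (Ckmx_mul (oc i)); [apply: (Ckmx_tr (oc i)); exact: dcol_Ckmx|exact: Gs].
Qed.

Lemma lap_Ck k i h : Ck_on_manifold k.+2 h ->
  Ck k (chart_image i) (laplacian (metric (r:=M) i) (local_repr i h)).
Proof.
move=> H; have h2 : Ck 2 (chart_image i) (local_repr i h) by exact: Ck_leq (H i).
apply: (Ck_eq (oc i) (f := fun y => \tr (cometric (metric i) y *m hess (local_repr i h) y))).
  by move=> y Uy; rewrite (laplacian_trace M_kahler h2 Uy).
apply: (Ck_mxtrace (oc i)); apply: (Ckmx_mul (oc i)); first exact: Gs.
exact: hess_Ckmx.
Qed.

Let ddc_Ckmx i u : Ck_on_manifold 2 u -> Ckmx (chart_image i) 0 (ddc (local_repr i u)).
Proof.
move=> H; have C B : Ckmx (chart_image i) 0 (fun=> B : 'M[R]_(n + n)) by exact: (Ckmx_cst (oc i)).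
apply: (Ckmx_add (oc i)); first by apply: (Ckmx_mul (oc i)); [exact: hess_Ckmx|exact: C].
by apply: (Ckmx_opp (oc i)); apply: (Ckmx_mul (oc i)); [exact: C|exact: hess_Ckmx].
Qed.

Lemma gradpair_continuous f h : Ck_on_manifold 1 f -> Ck_on_manifold 1 h ->
  continuous (gradpair f h).
Proof.
move=> F H; apply: (glob_continuous (gradpair_indep F H)) => i; exact: ginner_Ck.
Qed.

Lemma lap_continuous h : Ck_on_manifold 2 h -> continuous (lap h).
Proof. by move=> H; apply: (glob_continuous (lap_indep H)) => i; exact: lap_Ck. Qed.

Lemma ddc_sq_continuous u : Ck_on_manifold 2 u -> continuous (ddc_sq u).
Proof.
move=> H; apply: (glob_continuous (ddc_sq_indep H)) => i.
apply: (Ck_mxtrace (oc i)); apply: (Ckmx_mul (oc i)); last by apply: (Ckmx_tr (oc i)); exact: ddc_Ckmx.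
apply: (Ckmx_mul (oc i)); last exact: Gs.
by apply: (Ckmx_mul (oc i)); [exact: Gs|exact: ddc_Ckmx].
Qed.

Lemma flux_continuous u f : Ck_on_manifold 2 u -> Ck_on_manifold 1 f -> continuous (flux u f).
Proof.
move=> H F; apply: (glob_continuous (flux_indep H F)) => i.
have u1 : Ck_on_manifold 1 u by move=> j; exact: CkW (H j).
apply: (Ckmx_mul (oc i)); last first.
  by apply: (Ckmx_mul (oc i)); [exact: (Ckmx_cst (oc i))|exact: dcol_Ckmx].
apply: (Ckmx_mul (oc i)); first by apply: (Ckmx_tr (oc i)); exact: dcol_Ckmx.
apply: (Ckmx_mul (oc i)); last exact: Gs.
by apply: (Ckmx_mul (oc i)); [exact: Gs|exact: ddc_Ckmx].
Qed.

Lemma dcol_add (f h : V -> R) U y : open U -> U y -> Ck 1 U f -> Ck 1 U h ->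
  dcol (fun z => f z + h z) y = dcol f y + dcol h y.
Proof.
move=> oU Uy F H; apply/matrixP => a b; rewrite [RHS]addmxE [LHS]mxE [X in X + _]mxE [X in _ + X]mxE.
exact: (deriveD (Ck_derivable F Uy) (Ck_derivable H Uy)).
Qed.

Lemma dcol_near (f h : V -> R) y : (\forall z \near y, f z = h z) -> dcol f y = dcol h y.
Proof. by move=> fh; apply/matrixP => a b; rewrite [LHS]mxE [RHS]mxE; exact: partial_near. Qed.

Lemma local_repr_near_off f x : ~ closure [set x | f x != 0] x ->
  dcol (local_repr (chart_at x) f) (coord (chart_at x) x) = 0.
Proof.
move=> nx; set i := chart_at x; have xi : dom i x := dom_chart_at x.
have -> : 0 = dcol (fun=> 0 : R) (coord i x) :> 'cV[R]_(n + n).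
  by apply/matrixP => a b; rewrite [RHS]mxE [LHS]mxE; apply/esym; exact: (derive_cst (0 : R)).
apply: dcol_near.
have cK : closed (closure [set x | f x != 0]) by exact: closed_closure.
have oW := open_par_preimage (i := i) (closed_openC cK).
have Wx : (chart_image i `&` par i @^-1` ~` closure [set x | f x != 0]) (coord i x).
  by split; [exact: chart_image_coord|rewrite /= coordK].
move/open_nbhs_nbhs: (conj oW Wx); apply: filterS => z [Uz nz].
exact: csupp_off nz.
Qed.

Lemma local_repr_bump i (b : V -> R) f z : dom i z ->
  \forall w \near coord i z, local_repr i (fun x => chart_ext i b x * f x) w = b w * local_repr i f w.
Proof.
move=> zi; have : nbhs (coord i z) (chart_image i).
  by apply: open_nbhs_nbhs; split; [exact: (oc i)|exact: chart_image_coord].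
apply: filterS => w /chart_imageP[wi wE].
by rewrite /local_repr /= chart_extE// wE.
Qed.

Lemma bump_closure_off i (b : V -> R) (C : set V) f z : compact C -> C `<=` chart_image i ->
  (forall y, ~ C y -> b y = 0) -> ~ dom i z ->
  ~ closure [set x | chart_ext i b x * f x != 0] z.
Proof.
move=> Cc CU b0 nz; have [_ Kcl] := compact_par Cc CU.
have sub : [set x | chart_ext i b x * f x != 0] `<=` par i @` C.
  move=> w /= wb; apply: contrapT => nw; move: wb.
  by rewrite (chart_ext_off b0 CU nw) mul0r eqxx.
move=> zc; apply: nz; have := closure_subset sub zc.
have <- : par i @` C = closure (par i @` C) by apply/closure_id.
by move=> [y yC <-]; case: (chart_imageP (CU _ yC)).
Qed.

Lemma green_global h f : Ck_on_manifold 2 h -> Ck_on_manifold 1 f -> compactly_supported f ->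
  integral_vol vol (fun x => f x * lap h x + gradpair f h x) = 0.
Proof.
move=> h2; have h1 : Ck_on_manifold 1 h by move=> i; exact: CkW (h2 i).
move: f; apply: (glue volP (T := fun f x => f x * lap h x + gradpair f h x)).
- move=> f1 f2 F1 F2; apply/funext => x; rewrite /gradpair /glob /ginner.
  set i := chart_at x; have Uy : chart_image i (coord i x) := chart_image_coord (dom_chart_at x).
  have -> : dcol (local_repr i (fun x => f1 x + f2 x)) (coord i x) =
            dcol (local_repr i f1) (coord i x) + dcol (local_repr i f2) (coord i x).
    exact: (dcol_add (oc i) Uy (F1 i) (F2 i)).
  have tD (P Q : 'cV[R]_(n + n)) : (P + Q)^T = P^T + Q^T by exact: raddfD.
  by rewrite tD !mulmxDl addmxE mulrDl addrACA.
- move=> f F x.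
  exact: (cvgD (cvgM (Ck_continuous F (x:=x)) (lap_continuous h2 (x:=x))) (gradpair_continuous F h1 (x:=x))).
- move=> f x F nx; rewrite (csupp_off nx) mul0r add0r /gradpair /glob /ginner.
  by rewrite local_repr_near_off// trmx0 !mul0mx mxE.
move=> x.
have [i [b [chi [C [C' [xi [sb sc] [Cc C'c] [CC' C'U] [b0 chi0 b01 ch1 [W [oW Wx W1]]]]]]]]] :=
  chart_bump (W := setT) openT (x:=x) Logic.I.
have CU : C `<=` chart_image i by move=> y /CC'/C'U[].
have Ccl : closed C by apply: compact_closed => //; exact: norm_hausdorff.
have bM k : Ck_on_manifold k (chart_ext i b).
  by apply: (Ck_chart_ext Cc CU b0); exact: Ck_sub (@subsetT _ _) (sb k).
exists (chart_ext i b), W; split=> // f F.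
have [r Cr] : exists r : R, forall y, C y -> `|y| < r.
  have [B [_ HB]] := compact_bounded Cc.
  by exists (B + 1 + 1) => y yC; apply: le_lt_trans (HB (B + 1) _ y yC) _; rewrite ?ltrDl.
pose f' y := b y * local_repr i f y.
have f'0 y : ~ C y -> f' y = 0 by move=> nC; rewrite /f' b0// mul0r.
have f'1 : Ck 1 setT f'.
  apply: (Ck_extend0 (oc i) Ccl CU f'0); apply: (CkM (oc i)); last exact: F.
  exact: Ck_sub (@subsetT _ _) (sb 1%N).
pose hi := local_repr i h.
pose q y := f' y * laplacian (metric i) hi y + ginner (metric i) f' hi y.
have q0 y : ~ C y -> q y = 0.
  move=> nC; rewrite /q f'0// mul0r add0r ginnerE big1// => a _.
  by rewrite (partial_off Ccl a f'0 nC) mul0r.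
have FM : Ck_on_manifold 1 (fun x => chart_ext i b x * f x) by exact: Ck_manifoldM.
rewrite /integral_vol /Rintegral.
rewrite (integral_vol_chart volP (i:=i) (h:=q) (C:=C)) //.
- exact: (green_local (oc i) (@metric_Ckmx _ _ M i) (@metric_pos _ _ M i) Ccl CU Cr (h2 i) f'1 f'0).
- move=> z.
  exact: (cvgD (cvgM (Ck_continuous FM (x:=z)) (lap_continuous h2 (x:=z))) (gradpair_continuous FM h1 (x:=z))).
- move=> z zi; rewrite /q /lap /gradpair (glob_chart (lap_indep h2) zi) (glob_chart (gradpair_indep FM h1) zi).
  congr (_ * _ + _); first by rewrite chart_extE// /f' /local_repr /= coordK.
  rewrite /ginner.
  by rewrite (dcol_near (local_repr_bump b f zi)).
move=> z nz; have nx := bump_closure_off (f := f) Cc CU b0 nz.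
rewrite (csupp_off nx) mul0r add0r /gradpair /glob /ginner.
by rewrite local_repr_near_off// trmx0 !mul0mx mxE.
Qed.

Lemma hess_near (f h : V -> R) y : (\forall z \near y, f z = h z) -> hess f y = hess h y.
Proof.
move=> fh; apply/matrixP => a b; rewrite [LHS]mxE [RHS]mxE; apply: partial_near.
have /nbhs_ballP[e /= e0 He] := fh.
apply: (filterS _ (nbhsx_ballx y (e / 2) _)) => [z zy|]; last by rewrite divr_gt0.
apply: partial_near; apply: (filterS _ (nbhsx_ballx z (e / 2) _)) => [w wz|]; last by rewrite divr_gt0.
by apply: He; rewrite [e]splitr; exact: ball_triangle zy wz.
Qed.

Lemma ddc_global u f : Ck_on_manifold 2 u -> (forall x, lap u x = 0) ->
  Ck_on_manifold 1 f -> compactly_supported f ->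
  integral_vol vol (fun x => f x * (2^-1 * ddc_sq u x) + flux u f x) = 0.
Proof.
move=> u2 uh; have u1 : Ck_on_manifold 1 u by move=> i; exact: CkW (u2 i).
move: f; apply: (glue volP (T := fun f x => f x * (2^-1 * ddc_sq u x) + flux u f x)).
- move=> f1 f2 F1 F2; apply/funext => x; rewrite /flux /glob /ddc_flux.
  set i := chart_at x; have Uy : chart_image i (coord i x) := chart_image_coord (dom_chart_at x).
  have -> : dcol (local_repr i (fun x => f1 x + f2 x)) (coord i x) =
            dcol (local_repr i f1) (coord i x) + dcol (local_repr i f2) (coord i x).
    exact: (dcol_add (oc i) Uy (F1 i) (F2 i)).
  have tD (P Q : 'cV[R]_(n + n)) : (P + Q)^T = P^T + Q^T by exact: raddfD.
  by rewrite tD !mulmxDl addmxE mulrDl addrACA.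
- move=> f F x.
  exact: (cvgD (cvgM (Ck_continuous F (x:=x)) (cvgM (cvg_cst (2^-1 : R)) (ddc_sq_continuous u2 (x:=x))))
    (flux_continuous u2 F (x:=x))).
- move=> f x F nx; rewrite (csupp_off nx) mul0r add0r /flux /glob /ddc_flux.
  by rewrite local_repr_near_off// trmx0 !mul0mx mxE.
move=> x.
have [i [b [chi [C [C' [xi [sb sc] [Cc C'c] [CC' C'U] [b0 chi0 b01 [W0 [oW0 CW0 chi1]] [W [oW Wx W1]]]]]]]]] :=
  chart_bump (W := setT) openT (x:=x) Logic.I.
have CU : C `<=` chart_image i by move=> y /CC'/C'U[].
have C'U1 : C' `<=` chart_image i by move=> y /C'U[].
have Ccl : closed C by apply: compact_closed => //; exact: norm_hausdorff.
have C'cl : closed C' by apply: compact_closed => //; exact: norm_hausdorff.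
have bM k : Ck_on_manifold k (chart_ext i b).
  by apply: (Ck_chart_ext Cc CU b0); exact: Ck_sub (@subsetT _ _) (sb k).
exists (chart_ext i b), W; split=> // f F.
have [r Cr] : exists r : R, forall y, C y -> `|y| < r.
  have [B [_ HB]] := compact_bounded Cc.
  by exists (B + 1 + 1) => y yC; apply: le_lt_trans (HB (B + 1) _ y yC) _; rewrite ?ltrDl.
pose f' y := b y * local_repr i f y.
have f'0 y : ~ C y -> f' y = 0 by move=> nC; rewrite /f' b0// mul0r.
have f'1 : Ck 1 setT f'.
  apply: (Ck_extend0 (oc i) Ccl CU f'0); apply: (CkM (oc i)); last exact: F.
  exact: Ck_sub (@subsetT _ _) (sb 1%N).
pose ui := local_repr i u.
(* The local identity requires a C^2 function on the whole space. The wider bump [chi] equals 1 near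
   the support [C] of the test function, so [u'] and [ui] have the same derivatives there. *)
pose u' y := chi y * ui y.
have u'2 : Ck 2 setT u'.
  apply: (Ck_extend0 (oc i) C'cl C'U1 (f := u')).
    by move=> y nC; rewrite /u' chi0// mul0r.
  apply: (CkM (oc i)); last exact: u2.
  exact: Ck_sub (@subsetT _ _) (sc 2%N).
have u'u y : C y -> \forall z \near y, u' z = ui z.
  move=> /CW0 Wy; have : nbhs y W0 by exact: open_nbhs_nbhs.
  by apply: filterS => z /chi1; rewrite /u' => ->; rewrite mul1r.
pose q y := f' y * (2^-1 * ddc_sqnorm (metric i) u' y) + ddc_flux (metric i) u' f' y.
have q0 y : ~ C y -> q y = 0.
  move=> nC; rewrite /q f'0// mul0r add0r /ddc_flux.
  have -> : dcol f' y = 0 by apply/matrixP => a a'; rewrite [LHS]mxE [RHS]mxE (partial_off Ccl a f'0 nC).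
  by rewrite trmx0 !mul0mx mxE.
have u'h y : C y -> \tr (cometric (metric i) y *m hess u' y) = 0.
  move=> yC; rewrite (hess_near (u'u y yC)) -(laplacian_trace M_kahler (u2 i) (CU _ yC)).
  have [yi yE] := chart_imageP (CU _ yC).
  by rewrite -[RHS](uh (par i y)) /lap (glob_chart (lap_indep u2) yi) yE.
have FM : Ck_on_manifold 1 (fun x => chart_ext i b x * f x) by exact: Ck_manifoldM.
rewrite /integral_vol /Rintegral.
rewrite (integral_vol_chart volP (i:=i) (h:=q) (C:=C)) //.
- exact: (ddc_local (oc i) (@metric_Ckmx _ _ M i) (@metric_pos _ _ M i) (@metric_hermitian _ _ M M_kahler i)
    (@metric_closed _ _ M M_kahler i) Ccl CU Cr u'2 u'h f'1 f'0).
- move=> z.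
  exact: (cvgD (cvgM (Ck_continuous FM (x:=z)) (cvgM (cvg_cst (2^-1 : R)) (ddc_sq_continuous u2 (x:=z))))
    (flux_continuous u2 FM (x:=z))).
- move=> z zi; rewrite /ddc_sq /flux (glob_chart (ddc_sq_indep u2) zi) (glob_chart (flux_indep u2 FM) zi).
  rewrite chart_extE// {1}/ddc_flux (dcol_near (local_repr_bump b f zi)) -/f' -/ui.
  have [zC|nC] := pselect (C (coord i z)); last first.
    rewrite q0// b0// !mul0r add0r.
    have -> : dcol f' (coord i z) = 0.
      by apply/matrixP => a a'; rewrite [LHS]mxE [RHS]mxE (partial_off Ccl a f'0 nC).
    by rewrite trmx0 !mul0mx mxE.
  rewrite /q /ddc_sqnorm /ddc_flux /ddc (hess_near (u'u _ zC)) (dcol_near (u'u _ zC)).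
  by rewrite {2}/f' /local_repr /= coordK.
move=> z nz; have nx := bump_closure_off (f := f) Cc CU b0 nz.
rewrite (csupp_off nx) mul0r add0r /flux /glob /ddc_flux.
by rewrite local_repr_near_off// trmx0 !mul0mx mxE.
Qed.

End KaehlerGlobal.

Lemma cauchy_schwarz_metric (R : realType) m (g : 'M[R]_m) (w : 'rV[R]_m) (q : 'cV[R]_m) :
  posdefmx g -> ((w *m q) 0 0) ^+ 2 <= quad g w * (q^T *m invmx g *m q) 0 0.
Proof.
move=> gp; have gu := posdefmx_unit gp; have gT := gp.1.
set E := (_ *m q) 0 0; set F := (q^T *m _ *m _) 0 0.
pose v := q^T *m invmx g.
have qv : quad g v = F.
  rewrite /quad /v trmx_mul trmxK trmx_inv gT /F !mulmxA mulmxKV//.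
have wv : (w *m g *m v^T) 0 0 = E.
  by rewrite /v trmx_mul trmxK trmx_inv gT -mulmxA mulKVmx.
have F0 : 0 <= F.
  rewrite -qv; have [->|/(gp.2 _)/ltW//] := eqVneq v 0.
  by rewrite /quad !mul0mx mxE.
have [Fz|Fnz] := eqVneq F 0.
  have v0 : v = 0.
    by apply/eqP; apply: contraT => /(gp.2 _); rewrite qv Fz ltxx.
  by rewrite -wv v0 trmx0 mulmx0 mxE expr0n /= Fz mulr0.
have Fp : 0 < F by rewrite lt_neqAle eq_sym Fnz.
have H : 0 <= quad g (w + (- (E / F)) *: v).
  have [->|/(gp.2 _)/ltW//] := eqVneq (w + (- (E / F)) *: v) 0.
  by rewrite /quad !mul0mx mxE.
move: H; rewrite quadD// wv qv.
have -> : quad g w + 2 * (- (E / F)) * E + (- (E / F)) ^+ 2 * F = quad g w - E ^+ 2 / F.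
  by field.
by rewrite subr_ge0 ler_pdivrMr.
Qed.

Lemma quad_entry_bound (R : realType) m (h : 'M[R]_m) (e : R) (w : 'rV[R]_m) :
  (forall a b, `|h a b| <= e) -> `|quad h w| <= (m%:R ^+ 2 * e) * `|w| ^+ 2.
Proof.
move=> he; rewrite quadE; apply: le_trans (ler_norm_sum _ _ _) _.
have -> : m%:R ^+ 2 * e * `|w| ^+ 2 = \sum_(a < m) \sum_(b < m) `|w| * e * `|w|.
  under eq_bigr do rewrite sumr_const card_ord -mulr_natl.
  rewrite sumr_const card_ord -mulr_natl; ring.
apply: ler_sum => a _; apply: le_trans (ler_norm_sum _ _ _) _; apply: ler_sum => b _.
rewrite !normrM; apply: ler_pM => //.
  by apply: ler_pM => //; exact: coord_le.
exact: coord_le.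
Qed.

Lemma continuous_near (R : realType) m (f : 'rV[R]_m -> R) y (e : R) : {for y, continuous f} ->
  0 < e -> \forall z \near y, `|f z - f y| <= e.
Proof.
move=> cf e0; have FF := nbhs_filter y.
have /cvgrPdist_le/(_ e e0) : f z @[z --> y] --> f y := cf.
by apply: filterS => z; rewrite distrC.
Qed.

(** * Completeness and cutoff functions *)

Section Reach.
Variables (R : realType) (n : nat) (M : riemannianManifold R (n + n)).
Local Notation m := (n + n)%N.
Local Notation V := 'rV[R]_m.
Implicit Types (x : M) (i j : chart M).

(* In the chart j, the metric is comparable to its value at the centre of the ellipsoid. *)
Definition good_ellipsoid j (y : V) (r : R) := forall z : V, quad (metric j y) (z - y) <= 2 * r ^+ 2 ->
  chart_image j z /\ forall w, quad (metric j z) w <= 4 * quad (metric j y) w /\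
                               quad (metric j y) w <= 4 * quad (metric j z) w.

Lemma good_chart x1 : exists j W r0, [/\ open W, W x1, 0 < r0 &
  forall x, W x -> dom j x /\ forall r, 0 < r <= r0 -> good_ellipsoid j (coord j x) r].
Proof.
set j := chart_at x1; have xj : dom j x1 := dom_chart_at x1.
set y1 := coord j x1; have Uy1 : chart_image j y1 := chart_image_coord xj.
have [c c0 cP] := posdef_lower (metric_pos Uy1).
set g1 := metric j y1 in cP *.
(* Entries off by at most [e] change the quadratic form by at most m^2 e |w|^2, which is below half
   of c |w|^2. All metrics near [y1] thus lie between 1/2 and 3/2 of [g1], hence within a factor 3
   of each other. *)
pose e := c / (2 * (m%:R ^+ 2 + 1)).
have m0 : 0 <= (m%:R : R) ^+ 2 by rewrite sqr_ge0.
have e0 : 0 < e by rewrite divr_gt0// mulr_gt0// ltr_wpDl.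
have Nab a b : \forall z \near y1, `|metric j z a b - g1 a b| <= e.
  have cf : {for y1, continuous (fun z => metric j z a b)}.
    exact: (Ck_cont (@metric_smooth _ _ M j a b 0%N) Uy1).
  exact: (continuous_near cf e0).
have FF := nbhs_filter y1.
have N1 : \forall z \near y1, forall a b, `|metric j z a b - g1 a b| <= e.
  have H1 a : \forall z \near y1, forall b, `|metric j z a b - g1 a b| <= e.
    exact: (@filter_forall _ _ _ _ FF (Nab a)).
  exact: (@filter_forall _ _ _ _ FF H1).
have N2 : \forall z \near y1, chart_image j z.
  by apply: open_nbhs_nbhs; split=> //; exact: chart_image_open.
have /nbhs_ballP[d /= d0 Hd] : nbhs y1 ([set z : V | forall a b, `|metric j z a b - g1 a b| <= e] `&` chart_image j).
  exact: filterI N1 N2.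
have cmp z : ball y1 d z -> chart_image j z /\ forall w,
    2^-1 * quad g1 w <= quad (metric j z) w <= 3 / 2 * quad g1 w.
  move=> /Hd[H Uz]; split=> // w.
  have : `|quad (metric j z - g1) w| <= m%:R ^+ 2 * e * `|w| ^+ 2.
    by apply: quad_entry_bound => a b; rewrite addmxE oppmxE.
  have -> : quad (metric j z - g1) w = quad (metric j z) w - quad g1 w.
    by rewrite /quad mulmxBr mulmxBl addmxE oppmxE.
  have E : m%:R ^+ 2 * e * `|w| ^+ 2 <= 2^-1 * (c * `|w| ^+ 2).
    rewrite (mulrA 2^-1); apply: ler_wpM2r; first exact: sqr_ge0.
    rewrite /e mulrA ler_pdivrMr; last by rewrite mulr_gt0// ltr_wpDl.
    have -> : 2^-1 * c * (2 * (m%:R ^+ 2 + 1)) = (m%:R ^+ 2 + 1) * c by field.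
    by apply: ler_wpM2r; [exact: ltW|rewrite lerDl].
  have := le_trans E (ler_wpM2l _ (cP w)) => /(_ ltac:(by rewrite invr_ge0)).
  rewrite ler_norml => E2 /andP[]; move: (quad _ _) (quad _ _) (_ * _ * _) E2 => q1 q2 q3 E2 h1 h2.
  apply/andP; split; lra.
(* With this choice 4 r0^2 = c (d/4)^2, so an ellipsoid of parameter r <= r0 stays within d/4 of its
   centre, which itself lies within d/2 of [y1]. *)
pose r0 := d / 4 * Num.sqrt c / 2.
have sc : 0 < Num.sqrt c by rewrite sqrtr_gt0.
exists j, (dom j `&` coord j @^-1` (ball y1 (d / 2))), r0; split.
- rewrite openE => z [zj zb]; rewrite /interior; apply: filterI.
    by apply: open_nbhs_nbhs; split=> //; exact: dom_open.
  by apply: (coord_continuous zj); apply: open_nbhs_nbhs; split=> //; exact: ball_open.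
- by split=> //=; apply: ballxx; rewrite divr_gt0.
- by rewrite /r0 !divr_gt0// mulr_gt0// divr_gt0.
move=> x [xj' xb]; split=> // r /andP[r_gt0 rr0] z zq.
set y := coord j x in xb zq *.
have yb : ball y1 d y by apply: le_ball xb; rewrite ler_pdivrMr// mulr_natr mulr2n lerDl ltW.
have [Uy Hy] := cmp y yb.
have zb : ball y1 d z.
  rewrite [d]splitr; apply: ball_triangle xb _.
  rewrite -ball_normE /ball_ /= distrC.
  have /andP[h1 _] := Hy (z - y); have h2 := cP (z - y).
  have : c * `|z - y| ^+ 2 <= 4 * r ^+ 2.
    by move: h1 h2 zq; move: (quad _ _) (quad _ _) (_ * _ ^+ 2) (r ^+ 2) => q1 q2 q3 q4 *; lra.
  move=> H; have : `|z - y| ^+ 2 <= (d / 4) ^+ 2.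
    rewrite -(ler_pM2l c0); apply: le_trans H _.
    have rr : r ^+ 2 <= r0 ^+ 2 by apply: lerXn2r => //; rewrite nnegrE ltW// (lt_le_trans r_gt0).
    have r0E : 4 * r0 ^+ 2 = c * (d / 4) ^+ 2.
      by rewrite /r0 !exprMn (sqr_sqrtr (ltW c0)); field.
    by rewrite -r0E ler_pM2l.
  have d40 : 0 <= d / 4 by rewrite divr_ge0// ltW.
  rewrite ler_sqr ?nnegrE// => /le_lt_trans; apply.
  by rewrite ltr_pM2l// ltf_pV2 ?posrE// ltr_nat.
have [Uz Hz] := cmp z zb; split=> // w.
have /andP[a1 a2] := Hy w; have /andP[b1 b2] := Hz w.
have q0 : 0 <= quad g1 w by apply: le_trans (cP w); rewrite mulr_ge0 ?sqr_ge0// ltW.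
by move: a1 a2 b1 b2 q0; move: (quad _ _) (quad _ _) (quad _ _) => p1 p2 p3 *; split; lra.
Qed.

(** A coordinate segment run in unit time with speed at most [l]; so [l] bounds its length from
    above. It is positive even for a constant segment, because segments are later reparametrized by
    [l^-1]. *)
Definition chart_step x y (l : R) := 0 < l /\ exists i (p w : V),
  [/\ forall s : R, 0 <= s <= 1 -> chart_image i (p + s *: w),
      forall s : R, 0 <= s <= 1 -> quad (metric i (p + s *: w)) w <= l ^+ 2,
      par i p = x & par i (p + w) = y].

(* Finite chains of coordinate segments, with a bound l on their length.  They replace C^1
   curves everywhere except in the comparison with [riemannian_dist]. *)
Inductive reach : M -> M -> R -> Prop :=
| reach0 x : reach x x 0
| reach_step x y z l l' : chart_step x y l -> reach y z l' -> reach x z (l + l').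

Lemma reach1 x y l : chart_step x y l -> reach x y l.
Proof. by move=> H; rewrite -[l]addr0; apply: reach_step H _; exact: reach0. Qed.

Lemma reach_trans y x z l l' : reach x y l -> reach y z l' -> reach x z (l + l').
Proof.
elim=> {x y l} [x|x y y' l k S _ IH] H; first by rewrite add0r.
by rewrite -addrA; apply: reach_step S _; exact: IH.
Qed.

Lemma reach_ge0 x y l : reach x y l -> 0 <= l.
Proof. by elim=> // {}x {}y z {}l l' [l0 _] _ l'0; rewrite addr_ge0// ltW. Qed.

Lemma chart_step_sym x y l : chart_step x y l -> chart_step y x l.
Proof.
move=> [l0 [i [p [w [H1 H2 <- <-]]]]]; split=> //.
have E (s : R) : p + w + s *: (- w) = p + (1 - s) *: w.
  by rewrite scalerBl scale1r scalerN addrA.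
have S (s : R) : 0 <= s <= 1 -> 0 <= 1 - s <= 1.
  by move=> /andP[s0 s1]; apply/andP; split; lra.
exists i, (p + w), (- w); split=> [s /S|s /S s1||].
- by rewrite E; exact: H1.
- by rewrite E /quad linearN /= mulNmx mulmxN mulNmx opprK; exact: H2.
- by [].
- by rewrite addrK.
Qed.

Lemma reach_sym x y l : reach x y l -> reach y x l.
Proof.
elim=> {x y l} [x|x y z l l' S _ IH]; first exact: reach0.
by rewrite addrC; apply: reach_trans IH _; apply/reach1/chart_step_sym.
Qed.

Lemma good_reach j x (r : R) (z : V) : dom j x -> 0 < r -> good_ellipsoid j (coord j x) r ->
  quad (metric j (coord j x)) (z - coord j x) <= 2 * r ^+ 2 -> reach x (par j z) (3 * r).
Proof.
move=> xj r0 gd zq; apply: reach1; split; first by rewrite mulr_gt0.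
set y := coord j x in gd zq *.
have Uy : chart_image j y := chart_image_coord xj.
have q0 : 0 <= quad (metric j y) (z - y).
  have [->|/((metric_pos Uy).2 _)/ltW//] := eqVneq (z - y) 0.
  by rewrite /quad !mul0mx mxE.
have H (s : R) : 0 <= s <= 1 -> quad (metric j y) (y + s *: (z - y) - y) <= 2 * r ^+ 2.
  move=> /andP[s0 s1]; rewrite addrAC subrr add0r.
  have -> : quad (metric j y) (s *: (z - y)) = s ^+ 2 * quad (metric j y) (z - y).
    by rewrite /quad linearZ /= -!scalemxAl -scalemxAr scalerA mxE expr2.
  by apply: le_trans zq; rewrite ler_piMl// expr_le1.
exists j, y, (z - y); split=> [s s01|s s01||].
- by case: (gd _ (H s s01)).
(* The metric along the segment is at most 4 times the one at the centre, and 4 (2 r^2) = 8 r^2 <=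
   (3 r)^2. *)
- have [_ /(_ (z - y))[h _]] := gd _ (H s s01); apply: le_trans h _.
  rewrite exprMn -natrX; move: zq q0 (sqr_ge0 r); move: (quad _ _) (r ^+ 2) => a b h1 h2 h3.
  by have -> : (3 ^ 2)%N = 9%N by []; lra.
- by rewrite /y coordK.
- by rewrite addrC subrK.
Qed.

Lemma local_reach x (e : R) : 0 < e -> exists W, [/\ open W, W x &
  forall z, W z -> exists2 l, l < e & reach x z l].
Proof.
move=> e0; have [j [W [r0 [oW Wx r0_gt0 H]]]] := good_chart x.
have [xj Hr] := H x Wx; set y := coord j x.
pose r := Num.min r0 (e / 4).
have r_gt0 : 0 < r by rewrite lt_min r0_gt0 divr_gt0.
have gd : good_ellipsoid j y r by apply: Hr; rewrite r_gt0 ge_min lexx.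
exists (dom j `&` coord j @^-1` [set z | quad (metric j y) (z - y) < 2 * r ^+ 2]); split.
- rewrite openE => z [zj zq]; rewrite /interior; apply: filterI.
    by apply: open_nbhs_nbhs; split=> //; exact: dom_open.
  apply: (coord_continuous zj); apply: open_nbhs_nbhs; split=> //.
  have -> : [set z : V | quad (metric j y) (z - y) < 2 * r ^+ 2] =
      (fun z : V => quad (metric j y) (z - y)) @^-1` [set t | t < 2 * r ^+ 2] by [].
  apply: open_comp => [z' _|]; last exact: open_lt.
  exact: (Ck_setT_continuous (Ck_quad 0 (metric j y) y openT)).
- by split=> //=; rewrite -/y subrr /quad !mul0mx mxE mulr_gt0// exprn_gt0.
move=> z [zj zq]; exists (3 * r).
  apply: (@le_lt_trans _ _ (3 * (e / 4))); last lra.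
  by rewrite ler_pM2l// ge_min lexx orbT.
by rewrite -(coordK zj); apply: good_reach => //; exact: ltW.
Qed.

End Reach.

Lemma quad_ge0 (R : realType) m (g : 'M[R]_m) (w : 'rV[R]_m) : posdefmx g -> 0 <= quad g w.
Proof.
move=> gp; have [->|/(gp.2 _)/ltW//] := eqVneq w 0.
by rewrite /quad !mul0mx mxE.
Qed.

Lemma is_derive_quad (R : realType) m (h : 'M[R]_m) (y0 y w : 'rV[R]_m) : h^T = h ->
  is_derive y w (fun z => quad h (z - y0)) (2 * (w *m (h *m (y - y0)^T)) 0 0).
Proof.
move=> hT; apply: is_derive_from_line.
have -> : (fun s : R => quad h (y + s *: w - y0)) =
    (fun s => quad h (y - y0) + s * (2 * (w *m (h *m (y - y0)^T)) 0 0) + s ^+ 2 * quad h w).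
  apply/funext => s; rewrite addrAC quadD//; congr (_ + _ + _).
  rewrite [2 * s]mulrC -mulrA; congr (_ * (_ * _)).
  by rewrite -[_ *m w^T]trmxK [LHS]mxE trmx_mul trmxK trmx_mul hT.
apply: is_derive_eq; rewrite /=.
by rewrite /GRing.scale /= expr0n /=; ring.
Qed.

(** * Gradient bounds along chains, and bumps of controlled gradient *)

Section GradientBounds.
Variables (R : realType) (n : nat) (M : riemannianManifold R (n + n)).
Local Notation m := (n + n)%N.
Local Notation V := 'rV[R]_m.
Local Notation oc i := (@chart_image_open R _ M i).
Implicit Types (x : M) (i j : chart M) (f : M -> R).

Lemma deriveE_dcol i f x (w : V) : Ck_on_manifold 1 f -> dom i x ->
  'D_w (local_repr i f) (coord i x) = (w *m dcol (local_repr i f) (coord i x)) 0 0.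
Proof.
move=> F xi; have [_ ->] := derive_partial w (oc i) (F i) (chart_image_coord xi).
by rewrite [RHS]mxE; apply: eq_bigr => a _; rewrite [dcol _ _ _ _]mxE.
Qed.

(** Cauchy-Schwarz in one direction; in the other, the inequality is evaluated on the gradient
    vector itself. Gradient bounds can then be checked on directional derivatives, where the
    one-variable chain rule applies. *)
Lemma grad_dual f (C : R) i x : Ck_on_manifold 1 f -> dom i x ->
  gradpair f f x <= C ^+ 2 <->
  forall w : V, ('D_w (local_repr i f) (coord i x)) ^+ 2 <= C ^+ 2 * quad (metric i (coord i x)) w.
Proof.
move=> F xi; rewrite /gradpair (glob_chart (gradpair_indep F F) xi) /ginner.
set y := coord i x; have gp := metric_pos (chart_image_coord xi).
have E (w : V) := deriveE_dcol w F xi.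
split=> [H w|H].
  rewrite E; apply: le_trans (cauchy_schwarz_metric w (dcol (local_repr i f) y) gp) _.
  by rewrite mulrC; apply: ler_wpM2r => //; exact: quad_ge0.
move: H E; rewrite /cometric -/y; move: (dcol _ y) (metric i y) gp => q g gp H E.
have gu := posdefmx_unit gp.
set F0 := (_ *m _ *m q) 0 0; pose v := q^T *m invmx g.
have qv : quad g v = F0.
  by rewrite /quad /v trmx_mul trmxK trmx_inv gp.1 /F0 !mulmxA mulmxKV.
have := H v; rewrite E -/F0 qv => H1.
have [F0p|] := ltP 0 F0; last by move=> /le_trans; apply; exact: sqr_ge0.
by rewrite -(ler_pM2r F0p) -expr2.
Qed.

Lemma step_lipschitz f (C : R) x y l : Ck_on_manifold 1 f -> 0 <= C ->
  (forall z, gradpair f f z <= C ^+ 2) -> chart_step x y l -> `|f y - f x| <= C * l.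
Proof.
move=> F C0 H [l0 [i [p [w [HU Hq <- <-]]]]].
pose L (s : R) := local_repr i f (p + s *: w).
have dL (s : R) : 0 <= s <= 1 -> is_derive s 1 L ('D_w (local_repr i f) (p + s *: w)).
  by move=> s01; apply: is_derive_line; case: (derive_partial w (oc i) (F i) (HU s s01)).
have -> : f (par i (p + w)) = L 1 by rewrite /L scale1r.
have -> : f (par i p) = L 0 by rewrite /L scale0r addr0.
have [c| |c cI ->] := @MVT_segment R L (fun s => 'D_w (local_repr i f) (p + s *: w)) 0 1 ler01.
- by rewrite in_itv /= => /andP[/ltW c0 /ltW c1]; apply: dL; rewrite c0.
- apply: derivable_within_continuous => c; rewrite in_itv /= => c01.
  by have [] := dL c c01.
have c01 : 0 <= c <= 1 by move: cI; rewrite in_itv.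
have [xi yE] := chart_imageP (HU c c01).
rewrite subr0 mulr1 -ler_sqr ?nnegrE ?mulr_ge0 ?(ltW l0)// real_normK ?num_real//.
have /(grad_dual C F xi)/(_ w) := H (par i (p + c *: w)); rewrite yE => /le_trans; apply.
by rewrite exprMn; apply: ler_wpM2l; [exact: sqr_ge0|exact: Hq].
Qed.

Lemma reach_lipschitz f (C : R) x y l : Ck_on_manifold 1 f -> 0 <= C ->
  (forall z, gradpair f f z <= C ^+ 2) -> reach x y l -> `|f y - f x| <= C * l.
Proof.
move=> F C0 H; elim=> {x y l} [x|x y z l l' S _ IH]; first by rewrite subrr normr0 mulr0.
rewrite mulrDr; have -> : f z - f x = (f z - f y) + (f y - f x).
  by rewrite addrA subrK.
by rewrite [X in _ <= X]addrC; apply: le_trans (ler_normD _ _) (lerD IH _); exact: step_lipschitz S.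
Qed.

Lemma gradpair_off f x : ~ closure [set x | f x != 0] x -> gradpair f f x = 0.
Proof.
by move=> nx; rewrite /gradpair /glob /ginner local_repr_near_off// trmx0 !mul0mx mxE.
Qed.

Lemma ellipsoid_bump_grad j x (B r : R) : (forall t, `|dsmooth_step t| <= B) ->
  dom j x -> 0 < r -> good_ellipsoid j (coord j x) r ->
  let b := chart_ext j (ellipsoid_bump (metric j (coord j x)) (coord j x) r) in
  [/\ smooth_on_manifold b, compactly_supported b, forall z, 0 <= b z <= 1,
      forall z, gradpair b b z <= (6 * B / r) ^+ 2 &
      (forall z, b z != 0 -> reach x z (3 * r)) /\
      exists O, [/\ open O, O x & forall z, O z -> b z = 1]].
Proof.
move=> HB xj r0; set y := coord j x; set h := metric j y => gd b.
have Uy : chart_image j y := chart_image_coord xj.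
have hp : posdefmx h := metric_pos Uy.
pose C := [set z : V | quad h (z - y) <= 2 * r ^+ 2].
have Cc : compact C by exact: ellipsoid_compact hp.
have CU : C `<=` chart_image j by move=> z /gd[].
have b0 z : ~ C z -> ellipsoid_bump h y r z = 0.
  by move=> nC; apply: ellipsoid_bump0 => //; rewrite leNgt; apply/negP => /ltW.
have [Kc Kcl] := compact_par Cc CU.
have sb : smooth_on_manifold b.
  by move=> k; apply: (Ck_chart_ext Cc CU b0); exact: (Ck_ellipsoid_bump _ _ _ _ (oc j)).
have bK z : ~ (par j @` C) z -> b z = 0 by exact: chart_ext_off b0 CU.
have clK : closure [set x | b x != 0] `<=` par j @` C.
  rewrite closureE => z; apply; split=> // z'; apply: contraPP => /bK /= ->; rewrite eqxx; exact.
split=> //.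
- exact: compactly_supported_sub Kc Kcl bK.
- move=> z; rewrite /b; have [zj|/chart_ext_out ->] := pselect (dom j z); last by rewrite lexx ler01.
  by rewrite chart_extE// smooth_step_ge0 smooth_step_le1.
- move=> z; have [[z' z'C <-]|nz] := pselect ((par j @` C) z); last first.
    by rewrite gradpair_off ?sqr_ge0// => /clK.
  have [zj zE] := chart_imageP (CU _ z'C).
  apply/(grad_dual _ (sb 1%N) zj) => w; rewrite zE.
  have dq := is_derive_quad y z' w hp.1.
  set q' := (w *m _) 0 0 in dq.
  pose dss := dsmooth_step (2 - quad h (z' - y) / r ^+ 2).
  have dE : is_derive z' w (ellipsoid_bump h y r) (dss * (- (r ^+ 2)^-1 * (2 * q'))).
    apply: (@is_derive_comp1 _ _ (fun z => 2 - quad h (z - y) / r ^+ 2)); last exact: is_derive_smooth_step.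
    have -> : (fun z : V => 2 - quad h (z - y) / r ^+ 2) =
      (fun t => 2 - t / r ^+ 2) \o (fun z => quad h (z - y)) by [].
    apply: is_derive_comp1 dq _; apply: is_derive_eq.
    by rewrite /GRing.scale /=; ring.
  have -> : 'D_w (local_repr j b) z' = dss * (- (r ^+ 2)^-1 * (2 * q')).
    have <- : 'D_w (ellipsoid_bump h y r) z' = dss * (- (r ^+ 2)^-1 * (2 * q')) by case: dE.
    apply: near_eq_derive.
    have : nbhs z' (chart_image j) by apply: open_nbhs_nbhs; split; [exact: (oc j)|exact: CU].
    apply: filterS => t /chart_imageP[tj tE]; rewrite /local_repr /= /b chart_extE// tE//.
  have q2 : q' ^+ 2 <= quad h w * (2 * r ^+ 2).
    have := cauchy_schwarz_metric w (h *m (z' - y)^T) hp.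
    rewrite -/q' => /le_trans; apply; apply: ler_wpM2l; first exact: quad_ge0.
    rewrite trmx_mul trmxK hp.1 -mulmxA mulKmx ?posdefmx_unit//.
  have [_ /(_ w)[_ hw]] := gd _ z'C; rewrite -/h in hw.
  have d2 : dss ^+ 2 <= B ^+ 2.
    have B0 : 0 <= B by apply: le_trans (HB 0).
    rewrite -[dss ^+ 2]real_normK ?num_real// ler_sqr ?nnegrE//; exact: HB.
  set Q := quad (metric j z') w in hw *.
  have Q0 : 0 <= Q by apply: quad_ge0; exact: metric_pos (CU _ z'C).
  have r2 : 0 < r ^+ 2 by rewrite exprn_gt0.
  have -> : (dss * (- (r ^+ 2)^-1 * (2 * q'))) ^+ 2 = dss ^+ 2 * (4 / (r ^+ 2) ^+ 2 * q' ^+ 2).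
    by field; rewrite gt_eqF.
  (* Cauchy-Schwarz at the centre bounds q'^2 by 2 r^2 [quad h w], and the comparison of metrics
     gives q'^2 <= 8 r^2 Q. Rounding 8 up to 9 makes the constant the square of 6. *)
  have -> : (6 * B / r) ^+ 2 * Q = B ^+ 2 * (4 / (r ^+ 2) ^+ 2 * (9 * r ^+ 2 * Q)).
    by field; rewrite gt_eqF.
  have r4 : 0 <= 4 / (r ^+ 2) ^+ 2 by rewrite divr_ge0// sqr_ge0.
  apply: ler_pM d2 _; first exact: sqr_ge0.
    by apply: mulr_ge0 r4 _; exact: sqr_ge0.
  apply: ler_wpM2l r4 _ _ _.
  apply: le_trans q2 _; rewrite -!mulrA; apply: le_trans (ler_wpM2r _ hw) _.
    by rewrite mulr_ge0// ltW.
  have -> : 4 * Q * (2 * r ^+ 2) = 8 * (r * (r * Q)) by ring.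
  apply: ler_wpM2r; last by rewrite ler_nat.
  by rewrite !mulr_ge0// ltW.
split.
- move=> z bz; have [z' z'C <-] : (par j @` C) z.
    by apply: contrapT => /bK bz0; move: bz; rewrite bz0 eqxx.
  exact: good_reach.
exists (dom j `&` coord j @^-1` [set z | quad h (z - y) < r ^+ 2]); split.
- rewrite openE => z [zj zq]; rewrite /interior; apply: filterI.
    by apply: open_nbhs_nbhs; split=> //; exact: dom_open.
  apply: (coord_continuous zj); apply: open_nbhs_nbhs; split=> //.
  have -> : [set z : V | quad h (z - y) < r ^+ 2] =
      (fun z : V => quad h (z - y)) @^-1` [set t | t < r ^+ 2] by [].
  apply: open_comp => [z' _|]; last exact: open_lt.
  exact: (Ck_setT_continuous (Ck_quad 0 h y openT)).
- by split=> //=; rewrite -/y subrr /quad !mul0mx mxE exprn_gt0.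
by move=> z [zj zq]; rewrite /b chart_extE//; apply: ellipsoid_bump1 => //; exact: ltW.
Qed.

Definition is_bump x (tau C : R) (b : M -> R) :=
  [/\ smooth_on_manifold b, compactly_supported b, forall z, 0 <= b z <= 1,
      forall z, gradpair b b z <= (C / tau) ^+ 2 &
      (forall z, b z != 0 -> reach x z (tau / 8)) /\
      exists O, [/\ open O, O x & forall z, O z -> b z = 1]].

(** [C] is fixed before the compact set: only the admissible sizes tau depend on [K]. The gradient
    of the cutoffs inherits this uniformity. *)
Lemma uniform_bumps : exists2 C : R, 0 < C & forall K : set M, compact K ->
  exists2 tau0 : R, 0 < tau0 & forall tau x, 0 < tau <= tau0 -> K x -> exists b, is_bump x tau C b.
Proof.
have [B B0 HB] := dsmooth_step_bounded R.
(* The ellipsoid parameter will be r = tau / 24, so that 3 r = tau / 8 and 6 B / r = 144 B / tau. *)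
exists (144 * B) => [|K Kc]; first by rewrite mulr_gt0.
have /choice[W HW] : forall x1 : M, exists W : set M, exists jr : chart M * R, [/\ open W, W x1, 0 < jr.2 &
  forall x, W x -> dom jr.1 x /\ forall r, 0 < r <= jr.2 -> good_ellipsoid jr.1 (coord jr.1 x) r].
  by move=> x1; have [j [W [r0 [? ? ? ?]]]] := good_chart x1; exists W, (j, r0).
have {HW}[jr HW] := choice HW.
have [s _ sK] := compact_seq_cover (W := W) Kc (fun x _ => conj (let: And4 a _ _ _ := HW x in a) (let: And4 _ a _ _ := HW x in a)).
have [t0 t00 Ht0] : exists2 t0 : R, 0 < t0 & forall x, x \in s -> t0 <= (jr x).2.
  elim: s {sK} => [|z s [t0 t00 IH]]; first by exists 1.
  exists (Num.min t0 (jr z).2); first by rewrite lt_min t00; case: (HW z).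
  move=> x; rewrite inE => /orP[/eqP ->|/IH H]; first by rewrite ge_min lexx orbT.
  by rewrite ge_min H.
exists (24 * t0) => [|tau x /andP[tau0 taut] /sK [z zs Wx]]; first by rewrite mulr_gt0.
have [_ _ _ /(_ x Wx)[xj Hr]] := HW z.
have r0 : 0 < tau / 24 by rewrite divr_gt0.
have rt : 0 < tau / 24 <= (jr z).2.
  by rewrite r0 /=; apply: le_trans (Ht0 z zs); rewrite ler_pdivrMr// mulrC.
have := ellipsoid_bump_grad HB xj r0 (Hr _ rt); set b := chart_ext _ _ => /= bP.
exists b; rewrite /is_bump.
have -> : 144 * B / tau = 6 * B / (tau / 24) by field; rewrite gt_eqF.
by have -> : tau / 8 = 3 * (tau / 24) by field.
Qed.

Definition reach_ball x (r : R) : set M := [set y | exists2 l, l < r & reach x y l].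
Definition precompact (A : set M) := exists2 K, compact K & A `<=` K.

(** A bump equal to 1 at [x] is Lipschitz along chains with constant C / tau, so a chain shorter
    than tau / C cannot reach a point where it vanishes. *)
Lemma small_ball_precompact x : exists2 r : R, 0 < r & precompact (reach_ball x r).
Proof.
have [C C0 H] := uniform_bumps.
have [tau tau0 /(_ tau x)] := H _ (@compact_set1 M x).
rewrite tau0 lexx => /(_ isT erefl)[b [sb cb _ gb [_ bO]]]; have [W [_ Ox O11]] := bO.
exists (tau / C); first by rewrite divr_gt0.
exists (closure [set x | b x != 0]) => // z [l lr /(reach_lipschitz (sb 1%N) (ltW (divr_gt0 C0 tau0)) gb)].
rewrite (O11 _ Ox) => bz; apply: subset_closure; apply/eqP => b0; move: bz.
rewrite b0 sub0r normrN1 leNgt => /negP; apply.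
by rewrite mulrAC ltr_pdivrMr// mul1r mulrC -ltr_pdivlMr.
Qed.

End GradientBounds.

Section IntegralMono.
Context d (T : measurableType d) (R : realType).

(* The integral of a nonnegative function is a supremum over simple functions, so no
   measurability is needed. *)
Lemma ge0_integral_mono (mu : {measure set T -> \bar R}) (D : set T) (f h : T -> \bar R) :
  (forall x, D x -> 0 <= f x)%E -> (forall x, D x -> f x <= h x)%E ->
  (\int[mu]_(x in D) f x <= \int[mu]_(x in D) h x)%E.
Proof.
move=> f0 fh; have h0 x : D x -> (0 <= h x)%E by move=> xD; apply: le_trans (f0 x xD) (fh x xD).
rewrite !ge0_integralE//; apply: ub_ereal_sup => _ /= [s sf <-].
apply: ereal_sup_ubound; exists s => //= x; apply: le_trans (sf x) _.
rewrite /patch; case: ifPn => // /set_mem; exact: fh.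
Qed.

End IntegralMono.

(** * Chains as C^1 curves *)

Lemma derive_affine (R : realType) (W : normedModType R) (f : R -> W) (a b t : R) :
  derivable f (a * t + b) 1 ->
  derivable (fun s => f (a * s + b)) t 1 /\
  'D_1 (fun s => f (a * s + b)) t = a *: 'D_1 f (a * t + b).
Proof.
move=> df; pose h (s : R) := a * s + b.
have dh : is_derive t 1 h a.
  have -> : h = (fun s => a *: s) \+ cst b by apply/funext.
  by apply: is_derive_eq; rewrite addr0 /GRing.scale /= mulr1.
have [dh1 dh2] := dh.
have Df : differentiable f (h t) by apply/derivable1_diffP.
have Dh : differentiable h t by apply/derivable1_diffP.
have Dfh : differentiable (f \o h) t by exact: differentiable_comp.
split; first exact/derivable1_diffP.
rewrite [LHS](deriveE _ Dfh) diff_comp//= -(deriveE _ Dh) dh2.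
by rewrite -[X in 'd f _ X]mulr1 -/(a *: (1 : R)) linearZ/= -(deriveE _ Df).
Qed.

Lemma continuous_dsmooth_step (R : realType) : continuous (@dsmooth_step R).
Proof.
move=> t; have c1 k : {for t, continuous (fun s : R => flat k (1 - s))}.
  apply: (@continuous_comp _ _ _ (fun s : R => 1 - s) (flat k)); last exact: continuous_flat.
  by apply: cvgB; [exact: cvg_cst|exact: cvg_id].
have c0 k : {for t, continuous (@flat R k)} by exact: continuous_flat.
apply: cvgM; first by apply: cvgD; apply: cvgM; (exact: c0 || exact: c1).
apply: cvgV; first by rewrite expf_neq0// gt_eqF// smooth_step_den.
have -> : (fun s : R => (flat 0 s + flat 0 (1 - s)) ^+ 2) =
  (fun s => (flat 0 s + flat 0 (1 - s)) * (flat 0 s + flat 0 (1 - s))) by [].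
by apply: cvgM; apply: cvgD; (exact: c0 || exact: c1).
Qed.

Section Curves.
Variables (R : realType) (n : nat) (M : riemannianManifold R (n + n)).
Local Notation m := (n + n)%N.
Local Notation V := 'rV[R]_m.
Local Notation oc i := (@chart_image_open R _ M i).
Implicit Types (x y z : M) (i j : chart M) (c : R -> M).

(** [C1_curve] at a single time: a concatenation coincides near each time with one of its pieces,
    and the property depends on the germ only. *)
Definition C1_at c (t : R) := {for t, continuous c} /\
  forall i, dom i (c t) -> derivable (coord i \o c) t 1 /\
    {for t, continuous (fun s => 'D_1 (coord i \o c) s)}.

Lemma C1_at_near c c' t : (\forall s \near t, c s = c' s) -> C1_at c t ->
  C1_at c' t /\ speed c' t = speed c t.
Proof.
move=> cc' [c0 c1]; have E := nbhs_singleton cc'.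
have N i : \forall s \near t, coord i (c s) = coord i (c' s) by apply: filterS cc' => s ->.
have D i : \forall s \near t, 'D_1 (coord i \o c) s = 'D_1 (coord i \o c') s.
  by apply: filterS (near_join (N i)) => s Hs; apply: near_eq_derive.
split; last by rewrite /speed E (nbhs_singleton (D _)).
split=> [|i]; first exact: near_eq_continuous cc' c0.
rewrite -E => /c1 [d1 d2]; split; first exact: near_eq_derivable (N i) d1.
exact: near_eq_continuous (D i) d2.
Qed.

Lemma C1_at_affine c (a b t : R) : C1_curve c ->
  C1_at (fun s => c (a * s + b)) t /\ speed (fun s => c (a * s + b)) t = `|a| * speed c (a * t + b).
Proof.
move=> [c0 c1]; have ca : continuous (fun s : R => a * s + b).
  move=> s; apply: cvgD; last exact: cvg_cst.
  by apply: cvgM; [exact: cvg_cst|exact: cvg_id].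
have c0' : continuous (fun s => c (a * s + b)).
  by move=> s; apply: (@continuous_comp _ _ _ (fun s : R => a * s + b) c); [exact: ca|exact: c0].
split; first split=> [|i xi]; first exact: c0'.
  have [d1 d2] := c1 i (a * t + b) xi; have [d3 _] := derive_affine d1; split; first exact: d3.
  apply: (@near_eq_continuous _ _ (fun s => a *: 'D_1 (coord i \o c) (a * s + b))).
    have : nbhs t (fun s => dom i (c (a * s + b))).
      by apply: c0'; apply: open_nbhs_nbhs; split=> //; exact: dom_open.
    by apply: filterS => s /c1 [/derive_affine[_ ->]].
  apply: cvgZ; first exact: cvg_cst.
  by apply: (@continuous_comp _ _ _ (fun s : R => a * s + b) (fun s => 'D_1 (coord i \o c) s)); [exact: ca|exact: d2].
rewrite /speed; set i := chart_at _; have xi : dom i (c (a * t + b)) := dom_chart_at _.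
have [d1 _] := c1 i _ xi; have [_ dE] := derive_affine d1.
rewrite [X in quad _ X](_ : _ = a *: 'D_1 (coord i \o c) (a * t + b))//.
have -> : quad (metric i (coord i (c (a * t + b)))) (a *: 'D_1 (coord i \o c) (a * t + b)) =
   a ^+ 2 * quad (metric i (coord i (c (a * t + b)))) ('D_1 (coord i \o c) (a * t + b)).
  by rewrite /quad linearZ /= -!scalemxAl -scalemxAr scalerA [LHS]mxE expr2.
by rewrite sqrtrM ?sqr_ge0// sqrtr_sqr.
Qed.

Section Segment.
Variables (j : chart M) (p w : V) (l B : R).
Hypotheses (l0 : 0 < l) (HU : forall s : R, 0 <= s <= 1 -> chart_image j (p + s *: w)).
Hypothesis Hq : forall s : R, 0 <= s <= 1 -> quad (metric j (p + s *: w)) w <= l ^+ 2.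
Hypothesis HB : forall t : R, `|dsmooth_step t| <= B.

(** Reparametrized by [smooth_step], the segment rests before time 0 and after time [l], so that
    segments can be joined without losing C^1. Spreading it over time [l] makes the speed at most
    [B], whatever [l] is. *)
Let sg t := smooth_step (l^-1 * t).
Let gam t := p + sg t *: w.
Let c t := par j (gam t).

Let sg01 t : 0 <= sg t <= 1.
Proof. by rewrite smooth_step_ge0 smooth_step_le1. Qed.

Let dsg (t : R) : is_derive t 1 sg (dsmooth_step (l^-1 * t) * l^-1).
Proof.
have -> : sg = @smooth_step R \o (fun s => l^-1 * s) by [].
apply: is_derive1_comp; first exact: is_derive_smooth_step.
by apply: is_derive_eq; rewrite /GRing.scale /= mulr1.
Qed.

Let csg : continuous sg.
Proof. by move=> t; apply/differentiable_continuous/derivable1_diffP; case: (dsg t). Qed.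

Let cgam : continuous gam.
Proof.
move=> t; apply: cvgD; first exact: cvg_cst.
by apply: cvgZ; [exact: csg|exact: cvg_cst].
Qed.

Let cc : continuous c.
Proof.
move=> t; apply: (@continuous_comp _ _ _ gam (par j)); first exact: cgam.
exact: par_continuous (HU (sg01 t)).
Qed.

Let f i b (y : V) : R := transition j i y 0 b.

Let ovl i t : dom i (c t) -> overlap j i (gam t).
Proof. by rewrite overlapE => H; split=> //; exact: HU (sg01 t). Qed.

Let dc i (t : R) : dom i (c t) -> forall b,
  is_derive t 1 (fun s => f i b (gam s)) (\sum_a w 0 a * partial a (f i b) (gam t) * (dsmooth_step (l^-1 * t) * l^-1)).
Proof.
move=> xi b; have [d1 d2] := derive_partial w (@overlap_open _ _ M j i) (Ck_transition 1 j i b) (ovl xi).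
rewrite -mulr_suml -d2.
apply: (@is_derive1_comp _ (fun s => f i b (p + s *: w)) sg); last exact: dsg.
exact: is_derive_line.
Qed.

Let deriv i t : dom i (c t) -> derivable (coord i \o c) t 1 /\
  'D_1 (coord i \o c) t = (dsmooth_step (l^-1 * t) * l^-1) *: (w *m trans_jac j i (gam t)).
Proof.
move=> xi; have d : derivable (coord i \o c) t 1.
  by apply/derivable_mxP => a b; rewrite ord1; case: (dc xi b).
split=> //; rewrite derive_mx//; apply/matrixP => a b; rewrite ord1 [LHS]mxE.
have -> : 'D_1 (fun t0 => (coord i \o c) t0 0 b) t = 'D_1 (fun s => f i b (gam s)) t by [].
have [_ ->] := dc xi b; rewrite -mulr_suml mulrC [RHS]mxE; congr (_ * _).
by rewrite [RHS]mxE; apply: eq_bigr => k _; rewrite trans_jacE//; exact: ovl.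
Qed.

Lemma segment_C1 : C1_curve c.
Proof.
split=> // i t xi; have [d1 _] := deriv xi; split=> //.
have N : nbhs t (fun s => dom i (c s)).
  by apply: cc; apply: open_nbhs_nbhs; split=> //; exact: dom_open.
apply: (@near_eq_continuous _ _ (fun s => (dsmooth_step (l^-1 * s) * l^-1) *: (w *m trans_jac j i (gam s)))).
  by apply: filterS N => s /deriv[].
apply: cvgZ.
  apply: cvgM; last exact: cvg_cst.
  apply: (@continuous_comp _ _ _ (fun s : R => l^-1 * s)); last exact: continuous_dsmooth_step.
  by apply: cvgM; [exact: cvg_cst|exact: cvg_id].
suff : {for t, continuous (fun s => w *m trans_jac j i (gam s))} by [].
apply: for_continuous_rV => b.
apply: (@near_eq_continuous _ _ (fun s => \sum_a w 0 a * partial a (f i b) (gam s))).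
  apply: filterS N => s xs; rewrite [RHS]mxE; apply: eq_bigr => a _.
  by rewrite trans_jacE//; exact: ovl.
suff : {for t, continuous ((fun y : V => \sum_a w 0 a * partial a (f i b) y) \o gam)} by [].
apply: continuous_comp; first exact: cgam.
have oU := @overlap_open _ _ M j i.
apply: (@Ck_cont _ _ 0 (overlap j i)); last exact: ovl.
apply: Ck_sum => // a _; apply: CkM => //; first exact: Ck_cst.
exact: Ck_partial (Ck_transition 1 j i b).
Qed.

Lemma segment_speed t : speed c t <= B.
Proof.
have B0 : 0 <= B by apply: le_trans (HB 0).
rewrite /speed; set i := chart_at _; have xi : dom i (c t) := dom_chart_at _.
have [_ ->] := deriv xi; have [xj yE'] := chart_imageP (HU (sg01 t)).
have yE : coord j (c t) = gam t := yE'.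
set k := _ * l^-1.
have -> : quad (metric i (coord i (c t))) (k *: (w *m trans_jac j i (gam t))) =
    k ^+ 2 * quad (metric j (gam t)) w.
  rewrite -[in RHS]yE (metric_change xj xi) yE /quad linearZ /= trmx_mul.
  rewrite -!scalemxAl -scalemxAr scalerA [LHS]mxE expr2; congr (_ * _).
  by rewrite !mulmxA.
rewrite -[B]ger0_norm// -sqrtr_sqr; apply: ler_wsqrtr.
apply: (@le_trans _ _ (k ^+ 2 * l ^+ 2)).
  by apply: ler_wpM2l; [exact: sqr_ge0|exact: Hq (sg01 t)].
rewrite -exprMn /k mulfVK ?gt_eqF// -[_ ^+ 2 in X in X <= _]real_normK ?num_real//.
by rewrite ler_sqr ?nnegrE//; exact: HB.
Qed.

Lemma segment_start t : t <= 0 -> c t = par j p.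
Proof.
move=> t0; rewrite /c /gam /sg smooth_step0 ?scale0r ?addr0//.
by rewrite mulr_ge0_le0// invr_ge0 ltW.
Qed.

Lemma segment_end t : l <= t -> c t = par j (p + w).
Proof.
move=> t0; rewrite /c /gam /sg smooth_step1 ?scale1r//.
by rewrite mulrC ler_pdivlMr// mul1r.
Qed.

End Segment.

Definition joins (B : R) x y (T : R) c :=
  [/\ C1_curve c, forall t, speed c t <= B, forall t, t <= 0 -> c t = x &
      exists2 d, 0 < d & forall t, T - d <= t -> c t = y].

(** The switch takes place at T - d/2, inside an interval where both curves rest at [y]. Hence near
    every time the concatenation is equal to one of the two. *)
Lemma joins_cat B x y z T T' c c' : 0 <= T -> 0 <= T' -> joins B x y T c -> joins B y z T' c' ->
  exists c'', joins B x z (T + T') c''.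
Proof.
move=> T0 T'0 [C sp cx [d d0 cy]] [C' sp' cy' [d' d'0 cz]].
pose T1 := T - d / 2; pose c2 t := c' (1 * t + (- T)).
pose c3 t := if t < T1 then c t else c2 t.
have d20 : 0 < d / 2 by rewrite divr_gt0.
have dd : d / 2 < d by rewrite ltr_pdivrMr// mulr_natr mulr2n ltrDl.
have H t : C1_at c3 t /\ speed c3 t <= B.
  have [tT|tT] := ltP t T1.
    have [] : C1_at c3 t /\ speed c3 t = speed c t; last by move=> ? ->.
    apply: C1_at_near; last by split; [exact: C.1|move=> i; exact: C.2].
    have : nbhs t [set s : R | s < T1] by apply: open_nbhs_nbhs; split=> //; exact: open_lt.
    by apply: filterS => s /= sT; rewrite /c3 sT.
  have [A1 A2] := C1_at_affine 1 (- T) t C'.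
  have [] : C1_at c3 t /\ speed c3 t = speed c2 t; last first.
    by move=> ? ->; rewrite A2 normr1 mul1r.
  apply: C1_at_near A1.
  have : nbhs t [set s : R | T - d < s].
    by apply: open_nbhs_nbhs; split; [exact: open_gt|rewrite /= (lt_le_trans _ tT)// ltrD2l ltrN2].
  apply: filterS => s /= sT; rewrite /c3; case: ltP => // s1.
  by rewrite cy ?ltW// /c2 cy'// mul1r subr_le0 (le_trans (ltW s1))// gerBl ltW.
exists c3; split.
- by split=> [t|i t]; have [[] H1 H2 _] := H t; [exact: H1|exact: H2].
- by move=> t; have [] := H t.
- move=> t t0; rewrite /c3; case: ltP => tT; first exact: cx.
  rewrite /c2 cy' ?mul1r ?subr_le0 ?(le_trans t0)//; rewrite -(cy t) ?cx//.
  by rewrite (le_trans _ tT)// lerD2l lerN2 ltW.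
exists (Num.min d' (d / 2)); first by rewrite lt_min d'0.
move=> t tT; have h1 : T + T' - d' <= t.
  by apply: le_trans tT; rewrite lerD2l lerN2 ge_min lexx.
have h2 : T1 <= t.
  apply: le_trans tT; rewrite /T1 -addrA lerD2l; apply: (@le_trans _ _ (- Num.min d' (d / 2))).
    by rewrite lerN2 ge_min lexx orbT.
  by rewrite lerDr.
rewrite /c3 ltNge h2 /= /c2 cz// mul1r lerBrDr; apply: le_trans h1.
by rewrite addrAC [T' + T]addrC.
Qed.

Lemma reach_joins : exists2 B : R, 0 < B & forall x y l, reach x y l -> exists c, joins B x y (2 * l) c.
Proof.
have [B B0 HB] := dsmooth_step_bounded R; exists B => // x y l.
elim=> {x y l} [x|x y z l l' [l0 [j [p [w [HU Hq <- <-]]]]] H' [c' Hc']].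
  exists (fun=> x); rewrite mulr0; split=> //; last by exists 1.
    split=> [t|i t _]; first exact: cvg_cst.
    split; first exact: derivable_cst.
    apply: (@near_eq_continuous _ _ (fun=> 0)); last exact: cvg_cst.
    by apply: (@filterE _ (nbhs t) (nbhs_filter t)) => s; rewrite [RHS](derive_cst (coord i x) s).
  move=> t; rewrite /speed [X in quad _ X](_ : _ = 0) ?/quad ?mul0mx ?mxE ?sqrtr0 ?ltW//.
  exact: (derive_cst (coord (chart_at x) x) t).
have J : joins B (par j p) (par j (p + w)) (2 * l) (fun t => par j (p + smooth_step (l^-1 * t) *: w)); last first.
  rewrite mulrDr; apply: joins_cat J Hc'; first by rewrite mulr_ge0// ltW.
  by rewrite mulr_ge0// (reach_ge0 H').
split; [exact: segment_C1 HU|exact: segment_speed HU Hq HB|by move=> t t0; exact: segment_start|].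
exists l => // t tl; apply: segment_end => //.
by apply: le_trans tl; rewrite mulr_natl mulr2n addrK.
Qed.

(** Carries Cauchy sequences for chains to Cauchy sequences for [riemannian_dist], which is how
    completeness is exploited. The curve is run on [0, 1] at speed at most 2 l B. *)
Lemma reach_dist : exists2 B : R, 0 < B & forall x y l, reach x y l ->
  (riemannian_dist x y <= (B * l)%:E)%E.
Proof.
have [B B0 H] := reach_joins; exists (2 * B) => [|x y l xyl]; first by rewrite mulr_gt0.
have [c [C sp cx [d d0 cy]]] := H x y l xyl; have l0 := reach_ge0 xyl.
have A t := C1_at_affine (2 * l) 0 t C.
apply: ge_ereal_inf; exists (curve_length (fun s => c (2 * l * s + 0))).
  exists (fun s => c (2 * l * s + 0)) => //; split.
  - by split=> [t|i t]; have [[] H1 H2 _] := A t; [exact: H1|exact: H2].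
  - by rewrite mulr0 addr0 cx.
  - by rewrite mulr1 addr0 cy// gerBl ltW.
rewrite /curve_length.
apply: (@le_trans _ _ (\int[lebesgue_measure]_(t in `[0%R, 1%R]) (2 * B * l)%:E)%E).
  apply: ge0_integral_mono => t _; first by rewrite lee_fin sqrtr_ge0.
  have [_ ->] := A t; rewrite lee_fin ger0_norm ?mulr_ge0// [2 * B * l]mulrAC.
  by apply: ler_wpM2l; [rewrite mulr_ge0|exact: sp].
rewrite integral_cst//= lebesgue_measure_itv/= lte_fin ltr01 oppr0 adde0.
by rewrite mule1.
Qed.

End Curves.

(** * Hopf-Rinow for chains *)

Lemma small_pow2 (R : realType) (a e : R) : 0 <= a -> 0 < e ->
  exists N, forall k, (N <= k)%N -> a / 2 ^+ k < e.
Proof.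
move=> a0 e0; exists (Num.bound (a / e)) => k Nk.
have p2 : 0 < (2 : R) ^+ k by rewrite exprn_gt0.
rewrite ltr_pdivrMr// mulrC -ltr_pdivrMr//.
apply: lt_le_trans (archi_boundP _) _; first by rewrite divr_ge0// ltW.
by rewrite -natrX ler_nat (leq_trans Nk)// ltnW// ltn_expl.
Qed.

Section HopfRinow.
Variables (R : realType) (n : nat) (M : riemannianManifold R (n + n)).
Local Notation m := (n + n)%N.
Local Notation V := 'rV[R]_m.
Implicit Types (x y z : M) (i j : chart M).

Lemma chart_step_split x y (l t : R) : 0 < t < l -> chart_step x y l ->
  exists2 z, chart_step x z t & chart_step z y (l - t).
Proof.
move=> /andP[t0 tl] [l0 [i [p [w [HU Hq <- <-]]]]].
pose a := t / l; have a0 : 0 < a by rewrite divr_gt0.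
have a1 : a < 1 by rewrite ltr_pdivrMr// mul1r.
have sub (b k : R) : 0 <= b -> 0 <= k -> b + k <= 1 ->
    (forall s : R, 0 <= s <= 1 -> chart_image i (p + b *: w + s *: (k *: w))) /\
    (forall s : R, 0 <= s <= 1 ->
      quad (metric i (p + b *: w + s *: (k *: w))) (k *: w) <= (k * l) ^+ 2).
  move=> b0 k0 bk.
  have E (s : R) : p + b *: w + s *: (k *: w) = p + (b + s * k) *: w.
    by rewrite scalerA -addrA -scalerDl.
  have sk (s : R) : 0 <= s <= 1 -> 0 <= b + s * k <= 1.
    move=> /andP[s0 s1]; rewrite addr_ge0 ?mulr_ge0//=; apply: le_trans bk.
    by rewrite lerD2l ler_piMl.
  split=> s s01; rewrite E; first exact: HU (sk s s01).
  rewrite /quad linearZ /= -!scalemxAl -scalemxAr scalerA mxE exprMn expr2 -expr2.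
  by apply: ler_wpM2l; [exact: sqr_ge0|exact: Hq (sk s s01)].
have kl : a * l = t by rewrite /a mulfVK// gt_eqF.
have [A1 A2] := sub 0 a (lexx _) (ltW a0) ltac:(by rewrite add0r ltW).
have [B1 B2] := sub a (1 - a) (ltW a0) ltac:(by rewrite subr_ge0 ltW) ltac:(by rewrite addrC subrK).
exists (par i (p + a *: w)); split; rewrite ?subr_gt0//.
  exists i, p, (a *: w); split=> // s s01.
    by have := A1 s s01; rewrite scale0r addr0.
  by have := A2 s s01; rewrite scale0r addr0 kl.
exists i, (p + a *: w), ((1 - a) *: w); split=> //.
  by move=> s; have := B2 s; rewrite mulrBl mul1r kl.
by rewrite -addrA -scalerDl (addrC a) subrK scale1r.
Qed.

(** Chains have points at any intermediate length, which is the length-space property behind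
    Hopf-Rinow. *)
Lemma reach_split x y (l t : R) : 0 <= t <= l -> reach x y l ->
  exists2 z, reach x z t & reach z y (l - t).
Proof.
move=> tl H; elim: H t tl => {x y l} [x|x y z l l' S H' IH] t /andP[t0 tl].
  have -> : t = 0 by apply/eqP; rewrite eq_le tl t0.
  by exists x; rewrite ?subr0; exact: reach0.
have [->|tn0] := eqVneq t 0.
  by exists x; [exact: reach0|rewrite subr0; apply: reach_step S H'].
have [tl'|lt] := ltP t l.
  have t_gt0 : 0 < t by rewrite lt_neqAle eq_sym tn0.
  have [|z' A B] := chart_step_split _ S (t := t); first by rewrite t_gt0.
  exists z'; first exact: reach1.
  by rewrite addrAC; apply: reach_step B H'.
have [|z' A B] := IH (t - l); first by rewrite subr_ge0 lt /= lerBlDl.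
exists z'; first by rewrite -[t](subrK l) addrC; apply: reach_step S A.
by have -> : l + l' - t = l' - (t - l) by ring.
Qed.

Lemma precompact_sub (A B : set M) : A `<=` B -> precompact B -> precompact A.
Proof. by move=> AB [K Kc BK]; exists K => //; exact: subset_trans BK. Qed.

Lemma precompact0 : precompact (set0 : set M).
Proof. by exists set0; [exact: compact0|]. Qed.

Lemma precompact_bigU (I : eqType) (A : I -> set M) (s : seq I) :
  (forall x : I, x \in s -> precompact (A x)) -> precompact [set y | exists2 x : I, x \in s & A x y].
Proof.
elim: s => [|x s IH] H.
  by apply: (precompact_sub _ precompact0) => y [].
have [K Kc AK] := IH (fun (y : I) ys => H y (@mem_behead _ (x :: s) y ys)).
have [K' K'c AK'] := H x (mem_head _ _).
exists (K `|` K'); first exact: compactU.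
by move=> y [z]; rewrite inE => /orP[/eqP ->|zs] Ay; [right; exact: AK'|left; apply: AK; exists z].
Qed.

(** The ball of radius r = 8 e is exhausted in eight steps of width e. A point of the next ball lies
    within e of a point u of the current one; u lies in one of finitely many small sets [W z], so
    the new point is within 2 e of [z], inside the ball of radius r/2 around [z]. *)
Lemma ball_precompact_of_half x (r : R) : 0 < r ->
  (forall y l, l < 2 * r -> reach x y l -> precompact (reach_ball y (r / 2))) ->
  precompact (reach_ball x r).
Proof.
move=> r0 H; have [e e0 r8] : exists2 e : R, 0 < e & r = 8 * e.
  by exists (r / 8); [rewrite divr_gt0|field].
have r4 : r / 2 = 4 * e by rewrite r8; field.
suff S k : (k < 8)%N -> precompact (reach_ball x (k.+1%:R * e)).
  by have := S 7%N isT; rewrite -r8.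
elim: k => [|k IH] k8.
  apply: precompact_sub (H x 0 _ (reach0 x)); last by rewrite mulr_gt0.
  move=> y [l le xyl]; exists l => //; apply: lt_le_trans le _.
  by rewrite r4 ler_pM2r// ler1n.
have [K Kc aK] := IH (ltnW k8); pose a := k.+1%:R * e; rewrite -/a in aK.
have a0 : 0 < a by rewrite mulr_gt0.
have aE : k.+2%:R * e = a + e by rewrite -[k.+2%:R]natr1 mulrDl mul1r.
have a7 : a <= 7 * e by rewrite ler_pM2r// ler_nat.
have [W HW] := choice (fun z => local_reach z e0).
have [s _ sK] := compact_seq_cover (W := W) Kc
  (fun z _ => conj (let: And3 o _ _ := HW z in o) (let: And3 _ o _ := HW z in o)).
(* Requiring [W z] to meet the current ball ensures that [z] is within 2 r of [x], where the
   hypothesis applies; for other [z] the set is empty. *)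
pose A z := [set y | (exists2 u, W z u & reach_ball x a u) /\ reach_ball z (r / 2) y].
apply: precompact_sub (precompact_bigU (A := A) (s := s) _).
  move=> y [l]; rewrite aE => la xyl.
  have l0 := reach_ge0 xyl.
  pose t := Num.max 0 (l - e).
  have t0 : 0 <= t by rewrite le_max lexx.
  have tl : t <= l by rewrite ge_max l0 lerBlDr lerDl ltW.
  have ta : t < a by rewrite gt_max a0 ltrBlDr.
  have lt : l - t <= e by rewrite lerBlDr -lerBlDl le_max lexx orbT.
  have [|u xu uy] := reach_split _ xyl (t := t); first by rewrite t0.
  have ua : reach_ball x a u by exists t.
  have [z zs Wu] := sK u (aK u ua); exists z => //; split; first by exists u.
  have [_ _ /(_ u Wu)[l1 l1e zu]] := HW z.
  exists (l1 + (l - t)); last exact: reach_trans zu uy.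
  apply: (@lt_le_trans _ _ (e + e)); first by apply: ltr_leD.
  by rewrite r4; move: e0; clear; lra.
move=> z _; have [[u Wu [l la xu]]|nu] := pselect (exists2 u, W z u & reach_ball x a u); last first.
  by apply: (precompact_sub _ precompact0) => y [].
have [_ _ /(_ u Wu)[l1 l1e zu]] := HW z.
apply: precompact_sub (H z (l + l1) _ (reach_trans xu (reach_sym zu))); first by move=> y [].
by rewrite r8; move: la l1e a7 e0; clear; move: a => a' *; lra.
Qed.

(* A ball that is not precompact yields, at comparable distance, a ball of half the radius
   that is not precompact either; iterating produces a Cauchy sequence whose limit would
   have no precompact ball. *)
Theorem hopf_rinow : complete_manifold M -> forall x (r : R), precompact (reach_ball x r).
Proof.
move=> Mc x r; apply: contrapT => bad.
have r0 : 0 < r.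
  rewrite ltNge; apply/negP => r0; apply: bad; apply: (precompact_sub _ precompact0).
  by move=> y [l lr /reach_ge0 l0]; have := lt_le_trans lr r0; rewrite ltNge l0.
have step (xr : M * R) : exists y, 0 < xr.2 -> ~ precompact (reach_ball xr.1 xr.2) ->
    (exists2 l, l < 2 * xr.2 & reach xr.1 y l) /\ ~ precompact (reach_ball y (xr.2 / 2)).
  have [r1|r1] := ltP 0 xr.2; last by exists x.
  have [pc|npc] := pselect (precompact (reach_ball xr.1 xr.2)); first by exists x.
  apply: contrapT => /forallNP H; apply: npc; apply: ball_precompact_of_half => // y l lr xy.
  by apply: contrapT => np; apply: (H y) => _ _; split=> //; exists l.
have [f fP] := choice step.
pose s := fix s k := if k is k'.+1 then f (s k', r / 2 ^+ k') else x.
have rk k : 0 < r / 2 ^+ k by rewrite divr_gt0// exprn_gt0.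
have hk k : r / 2 ^+ k.+1 = r / 2 ^+ k / 2 by rewrite exprSr invfM mulrA.
have sbad k : ~ precompact (reach_ball (s k) (r / 2 ^+ k)).
  elim: k => [|k IH]; first by rewrite expr0 divr1.
  by rewrite hk; have [] := fP (s k, r / 2 ^+ k) (rk k) IH.
have sreach k : exists2 l, l < 2 * (r / 2 ^+ k) & reach (s k) (s k.+1) l.
  by have [] := fP (s k, r / 2 ^+ k) (rk k) (sbad k).
(* Each step is shorter than 2 r / 2^k, which equals 4 (r / 2^k - r / 2^(k+1)); the bounds
   telescope. *)
have sN (N j : nat) : exists2 l, l <= 4 * (r / 2 ^+ N) - 4 * (r / 2 ^+ (N + j)) & reach (s N) (s (N + j)%N) l.
  elim: j => [|j [l lb H]]; first by rewrite addn0 subrr; exists 0 => //; exact: reach0.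
  have [l' l'b H'] := sreach (N + j)%N.
  exists (l + l'); last by rewrite addnS; apply: reach_trans H H'.
  rewrite addnS hk; move: lb l'b; move: (r / _) (r / _) => u v *; lra.
have sC N p q : (N <= p)%N -> (N <= q)%N -> exists2 l, l <= 8 * (r / 2 ^+ N) & reach (s p) (s q) l.
  move=> /subnKC <- /subnKC <-.
  have [l lb H] := sN N (p - N)%N; have [l' lb' H'] := sN N (q - N)%N.
  exists (l + l'); last by apply: reach_trans H'; exact: reach_sym.
  move: lb lb' (rk (N + (p - N))%N) (rk (N + (q - N))%N).
  by move: (r / _) (r / _) (r / _) => u v w *; lra.
have [B B0 dB] := reach_dist M.
have [e e0|z sz] := Mc s.
  have [|N HN] := @small_pow2 R (B * 8 * r) e _ e0; first by rewrite !mulr_ge0// ltW.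
  exists N => p q pN qN; have [l lb H] := sC N p q pN qN.
  apply: le_lt_trans (dB _ _ _ H) _; rewrite lte_fin; apply: le_lt_trans (HN N (leqnn _)).
  by rewrite -!mulrA ler_pM2l.
have [t t0 pt] := small_ball_precompact z.
have t20 : 0 < t / 2 by rewrite divr_gt0.
have [W [oW Wz HW]] := local_reach z t20.
have [N1 HN1] := small_pow2 (ltW r0) t20.
have /sz [N2 _ HN2] : nbhs z W by exact: open_nbhs_nbhs.
pose N := maxn N1 N2; have NW : W (s N) by apply: HN2; rewrite /= leq_maxr.
apply: (sbad N); apply: precompact_sub pt => y [l lN H].
have [l' l't H'] := HW _ NW; exists (l' + l); last exact: reach_trans H' H.
have := HN1 N (leq_maxl _ _); move: lN l't; move: (r / _) => u *; lra.
Qed.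

(** Both the set of reachable points and its complement are open by [local_reach]; the manifold is
    connected. *)
Lemma all_reachable x y : exists l, reach x y l.
Proof.
pose A := [set z | exists l, reach x z l].
suff : A = setT by move=> E; have : A y by rewrite E.
apply: (@manifold_connected R m M).
- by exists x, 0; exact: reach0.
- exists A; last by rewrite setTI.
  rewrite openE => z [l xz]; have [W [oW Wz HW]] := local_reach z ltr01.
  apply: filterS (open_nbhs_nbhs (conj oW Wz)) => u /HW[l' _ zu].
  by exists (l + l'); exact: reach_trans zu.
exists A; last by rewrite setTI.
rewrite -openC openE => z nz; have [W [oW Wz HW]] := local_reach z ltr01.
apply: filterS (open_nbhs_nbhs (conj oW Wz)) => u /HW[l' _ zu] [l xu]; apply: nz; exists (l + l').
by apply: reach_trans xu _; exact: reach_sym.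
Qed.

End HopfRinow.

(* Terms with b_i >= 1/2 are dominated by twice b_i^(p+2) e_i^(p+2); the others are small
   compared with A^(p+2). *)
Lemma weighted_power_sum (R : realType) (N p : nat) (b e : 'I_N -> R) (A Q : R) :
  (forall i, 0 <= b i <= 1) -> (forall i, 0 <= e i) -> 0 <= A ->
  (forall i, b i != 0 -> e i <= 4 / 3 * A) -> 2 * N%:R * (2 / 3) ^+ p.+2 <= 1 :> R ->
  A ^+ p.+2 <= Q -> \sum_i (b i * e i) ^+ p.+2 <= Q ->
  \sum_i b i ^+ p.+1 * e i ^+ p.+2 <= 3 * Q.
Proof.
move=> b01 e0 A0 eA Np AQ sQ.
have A2 : 0 <= A ^+ p.+2 by rewrite exprn_ge0.
have T0 : 0 <= 2 * (2 / 3) ^+ p.+2 :> R by rewrite mulr_ge0// exprn_ge0// divr_ge0.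
have H i : b i ^+ p.+1 * e i ^+ p.+2 <= 2 * (b i * e i) ^+ p.+2 + 2 * (2 / 3) ^+ p.+2 * A ^+ p.+2.
  have /andP[b0 b1] := b01 i; have ep : 0 <= e i ^+ p.+2 by rewrite exprn_ge0.
  have bp : 0 <= (b i * e i) ^+ p.+2 by rewrite exprn_ge0// mulr_ge0.
  have [->|bn] := eqVneq (b i) 0.
    by rewrite exprS !mul0r exprS mul0r mulr0 add0r mulr_ge0.
  have [h|h] := leP 2^-1 (b i).
    apply: (@le_trans _ _ (2 * (b i * e i) ^+ p.+2)); last by rewrite lerDl mulr_ge0.
    have -> : 2 * (b i * e i) ^+ p.+2 = 2 * b i * b i ^+ p.+1 * e i ^+ p.+2.
      by rewrite exprMn [b i ^+ p.+2]exprS !mulrA.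
    apply: ler_wpM2r => //.
    by rewrite ler_peMl ?exprn_ge0// -(ler_pM2l (_ : 0 < 2^-1)) ?invr_gt0// mulrA mulVf// mul1r mulr1.
  apply: (@le_trans _ _ (2 * (2 / 3) ^+ p.+2 * A ^+ p.+2)); last by rewrite lerDr mulr_ge0.
  apply: (@le_trans _ _ (2^-1 ^+ p.+1 * (4 / 3 * A) ^+ p.+2)).
    apply: ler_pM; rewrite ?exprn_ge0//.
      by apply: lerXn2r; rewrite ?nnegrE ?invr_ge0// ltW.
    by apply: lerXn2r; rewrite ?nnegrE ?mulr_ge0 ?divr_ge0// eA.
  have -> : 2 / 3 = 2^-1 * (4 / 3) :> R by field.
  rewrite (exprMn _ (2^-1)) (exprMn _ (4 / 3)) [2^-1 ^+ p.+2]exprS !mulrA divff// mul1r.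
  by rewrite lexx.
apply: le_trans (ler_sum _ (fun i _ => H i)) _.
rewrite big_split /= -mulr_sumr sumr_const card_ord -[X in _ + X]mulr_natl.
have -> : 3 * Q = 2 * Q + 1 * Q by ring.
apply: lerD; first by rewrite ler_pM2l.
have E : N%:R * (2 * (2 / 3) ^+ p.+2) <= 1 :> R by move: Np; rewrite mulrA [N%:R * 2]mulrC.
by rewrite mulrA mul1r; apply: le_trans (ler_wpM2r A2 E) _; rewrite mul1r.
Qed.

(** Bernoulli's inequality (3/2)^k >= 1 + k/2. The exponent 4 N + 2 gives at least 2 N + 2. *)
Lemma power_two_thirds (R : realType) (N : nat) : 2 * N%:R * (2 / 3) ^+ (4 * N).+2 <= 1 :> R.
Proof.
have H k : 1 + k%:R / 2 <= (3 / 2 : R) ^+ k.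
  elim: k => [|k IH]; first by rewrite mul0r addr0 expr0.
  rewrite exprS; apply: le_trans (ler_wpM2l _ IH); last by rewrite divr_ge0.
  rewrite -natr1; have : 0 <= k%:R :> R by [].
  by move: (k%:R) => x x0; lra.
have -> : 2 / 3 = (3 / 2)^-1 :> R by rewrite invf_div.
rewrite exprVn ler_pdivrMr ?mul1r ?exprn_gt0 ?divr_gt0//.
have E : (4 * N).+2%:R = 4 * N%:R + 2 :> R by rewrite -addn2 natrD natrM.
apply: le_trans (H _); rewrite E.
have : 0 <= N%:R :> R by [].
by move: (N%:R) => x x0; lra.
Qed.

Lemma expR_quarter (R : realType) (t : R) : t <= 4^-1 -> expR t <= 4 / 3.
Proof.
move=> t4; have h : 3 / 4 <= expR (- t).
  by apply: le_trans (expR_ge1Dx (- t)); move: t4; lra.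
rewrite -[t]opprK expRN -[4 / 3]invf_div lef_pV2 ?posrE ?expR_gt0// divr_gt0//.
Qed.

Lemma is_derive_power (R : realType) (e t : R) (p : nat) :
  is_derive t 1 (fun s : R => (s * e) ^+ p.+1) (p.+1%:R * (t * e) ^+ p * e).
Proof.
have d : is_derive t 1 (fun s : R => s * e) e.
  by apply: is_derive_eq; rewrite /GRing.scale /= mulr0 mulr1 add0r.
have -> : (fun s : R => (s * e) ^+ p.+1) = (fun s => s * e) ^+ p.+1.
  by apply/funext => s; rewrite exprfctE.
exact: is_deriveX d.
Qed.

(** * Cutoff functions of small gradient *)

Section Cutoff.
Variables (R : realType) (n : nat) (M : riemannianManifold R (n + n)).
Local Notation m := (n + n)%N.
Local Notation V := 'rV[R]_m.
Local Notation oc i := (@chart_image_open R _ M i).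
Implicit Types (o x y z : M) (i j : chart M).

Definition reach_dist_from o x : R := inf [set l | reach o x l].
Local Notation D := reach_dist_from.

Lemma reach_dist_le o x l : reach o x l -> D o x <= l.
Proof. by move=> H; apply: ge_inf => //; exists 0 => l' /reach_ge0. Qed.

Lemma reach_dist_lt o x (a : R) : D o x < a -> exists2 l, l < a & reach o x l.
Proof.
by move=> /inf_lt[|l H la]; [exact: all_reachable|exists l].
Qed.

Lemma reach_dist_lip o x y l : reach x y l -> D o y <= D o x + l.
Proof.
move=> xy; rewrite -lerBlDr; apply: lb_le_inf; first exact: all_reachable.
by move=> l' ox; rewrite lerBlDr; apply: reach_dist_le; exact: reach_trans ox xy.
Qed.

(* For weights e_a = exp(- D(xs_a) / tau), the function (tau / p) ln (sum_a (b_a e_a)^p) is a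
   smooth substitute for - D whose gradient is bounded independently of tau; the summand
   ebar^p keeps the logarithm finite and makes the cutoff vanish off the supports. *)
Section Construction.
Variables (o : M) (k tau Cb B : R) (K : set M) (N : nat) (xs : 'I_N -> M) (b : 'I_N -> M -> R).
Hypotheses (k1 : 1 <= k) (tau0 : 0 < tau) (tau1 : tau <= 1) (Cb0 : 0 < Cb).
Hypothesis HB : forall t : R, `|dsmooth_step t| <= B.
Hypothesis ballK : reach_ball o (2 * k + 3) `<=` K.
Hypothesis b_smooth : forall a, smooth_on_manifold (b a).
Hypothesis b_supp : forall a, compactly_supported (b a).
Hypothesis b01 : forall a z, 0 <= b a z <= 1.
Hypothesis b_grad : forall a z, gradpair (b a) (b a) z <= (Cb / tau) ^+ 2.
Hypothesis b_reach : forall a z, b a z != 0 -> reach (xs a) z (tau / 8).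
Hypothesis b_cover : forall z, K z -> exists a, b a z = 1.

Let p := (4 * N).+2.
Let e a := expR (- D o (xs a) / tau).
Let ebar := expR (- (2 * k + 2) / tau).
Let Q z := \sum_a (b a z * e a) ^+ p + ebar ^+ p.
(** Up to errors of order tau, [psi] is 2 + (1 - D)/k where D <= 2 k + 2. It is at least 1 where D
    <= k, and off the supports of the bumps ln Q = - p (2 k + 2) / tau gives exactly -1/k, where
    [smooth_step] is 0. *)
Let psi z := 2 + (1 + tau / p%:R * ln (Q z)) / k.
Let phi z := smooth_step (psi z).

Let k0 : 0 < k. Proof. exact: lt_le_trans k1. Qed.
Let p0 : 0 < p%:R :> R. Proof. by rewrite ltr0n. Qed.
Let e0 a : 0 < e a. Proof. exact: expR_gt0. Qed.
Let ebar0 : 0 < ebar. Proof. exact: expR_gt0. Qed.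

Let lnp (t : R) : ln (expR t ^+ p) = p%:R * t.
Proof. by rewrite -expRM_natl expRK. Qed.

Let S0 z : 0 <= \sum_a (b a z * e a) ^+ p.
Proof.
apply: sumr_ge0 => a _; have /andP[h _] := b01 a z.
by rewrite exprn_ge0// mulr_ge0// ltW.
Qed.

Let Q0 z : 0 < Q z.
Proof. by apply: ltr_wpDl => //; rewrite exprn_gt0. Qed.

Let center a z : b a z != 0 -> D o (xs a) <= D o z + tau / 8 /\ D o z <= D o (xs a) + tau / 8.
Proof.
by move=> /b_reach H; split; [apply: reach_dist_lip; exact: reach_sym|exact: reach_dist_lip].
Qed.

(** All weights active at [z] have centres within tau / 8 of [z], so their exponents differ by at
    most 1/4 and the weights by a factor exp(1/4) <= 4/3. If D < 2 k + 3, some bump equals 1 at [z]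
    and its weight serves as A. Farther out, active centres have D >= 2 k + 2, and [ebar]
    dominates. *)
Let scale z : exists A, [/\ 0 <= A, A ^+ p <= Q z & forall a, b a z != 0 -> e a <= 4 / 3 * A].
Proof.
have [Dz|Dz] := ltP (D o z) (2 * k + 3).
  have [a0 ba0] := b_cover (ballK (reach_dist_lt Dz)).
  exists (e a0); split; first exact: ltW.
    rewrite /Q (bigD1 a0) //= ba0 mul1r -addrA lerDl addr_ge0 ?exprn_ge0 ?(ltW ebar0)//.
    apply: sumr_ge0 => a _; have /andP[h _] := b01 a z.
    by rewrite exprn_ge0// mulr_ge0// ltW.
  move=> a baz; have [_ h1] := center baz.
  have [|h2 _] := @center a0 z; first by rewrite ba0 oner_eq0.
  have -> : e a = expR ((D o (xs a0) - D o (xs a)) / tau) * e a0.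
    by rewrite /e -expRD; congr expR; rewrite -mulrDl; congr (_ / _); rewrite addrAC subrr add0r.
  apply: ler_wpM2r; first exact: ltW.
  apply: expR_quarter; rewrite ler_pdivrMr//.
  by move: h1 h2; move: (D o _) (D o _) (D o _) => u v w *; lra.
exists ebar; split; [exact: ltW|by rewrite /Q lerDr|move=> a /center[_ h]].
apply: (@le_trans _ _ ebar); last first.
  by rewrite ler_peMl ?(ltW ebar0)// ler_pdivlMr// mul1r ler_nat.
rewrite ler_expR ler_pM2r ?invr_gt0// lerN2.
by move: h Dz tau1; move: (D o _) (D o _) => u v *; lra.
Qed.

(** The differential of Q contains (b e)^(p-1) e db with |db| <= Cb / tau, one factor b short of the
    terms of Q. The bound 3, whatever the number of bumps, makes the gradient of (tau / p) ln Q at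
    most 3 Cb. *)
Let ratio z : \sum_a b a z ^+ p.-1 * e a ^+ p <= 3 * Q z.
Proof.
have [A [A0 AQ eA]] := scale z.
apply: (weighted_power_sum (p := (4 * N)) _ _ A0 eA (power_two_thirds R N) AQ) => [a|a|].
- exact: b01.
- exact: ltW.
- by rewrite /Q lerDl exprn_ge0// ltW.
Qed.

Lemma cutoff_smooth : smooth_on_manifold phi.
Proof.
move=> l i; have oU := oc i.
have QC : Ck l (chart_image i) (fun y : V => Q (par i y)).
  apply: CkD => //; last exact: Ck_cst.
  apply: Ck_sum => // a _; apply: CkX => //; apply: CkM => //; last exact: Ck_cst.
  exact: b_smooth.
have LC : Ck l (chart_image i) (fun y : V => ln (Q (par i y))) by exact: (Ck_ln oU).
apply: (@Ck_smooth_step _ _ l (chart_image i) (fun y : V => psi (par i y))) => //.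
apply: CkD => //; first exact: Ck_cst.
apply: CkM => //; last exact: Ck_cst.
apply: CkD => //; first exact: Ck_cst.
by apply: CkM => //; exact: Ck_cst.
Qed.

Lemma cutoff_supp : compactly_supported phi.
Proof.
have bK a : precompact (closure [set z | b a z != 0]).
  by exists (closure [set z | b a z != 0]); [exact: b_supp|].
have [K' K'c HK] : precompact [set z | exists a, closure [set z | b a z != 0] z].
  apply: precompact_sub (precompact_bigU (s := enum 'I_N) (fun a _ => bK a)).
  by move=> z [a az]; exists a => //; rewrite mem_enum.
have K'l : closed K' by exact: compact_closed (manifold_hausdorff (r:=M)) K'c.
apply: (compactly_supported_sub K'c K'l) => z nK.
have b0 a : b a z = 0.
  by apply: csupp_off => az; apply: nK; apply: HK; exists a.
have QE : Q z = ebar ^+ p.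
  by rewrite /Q big1 ?add0r// => a _; rewrite b0 mul0r expr0n.
apply: smooth_step0; rewrite /psi QE lnp.
have -> : tau / p%:R * (p%:R * (- (2 * k + 2) / tau)) = - (2 * k + 2).
  by field; rewrite !gt_eqF.
have -> : 2 + (1 + - (2 * k + 2)) / k = - k^-1 by field; rewrite gt_eqF.
by rewrite oppr_le0 invr_ge0 ltW.
Qed.

Lemma cutoff_one z : D o z <= k -> phi z = 1.
Proof.
move=> Dk; have Dz : D o z < 2 * k + 3 by move: Dk k0; lra.
have [a0 ba0] := b_cover (ballK (reach_dist_lt Dz)).
have [|h2 _] := @center a0 z; first by rewrite ba0 oner_eq0.
have eQ : e a0 ^+ p <= Q z.
  rewrite /Q (bigD1 a0) //= ba0 mul1r -addrA lerDl addr_ge0 ?exprn_ge0 ?(ltW ebar0)//.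
  apply: sumr_ge0 => a _; have /andP[h _] := b01 a z.
  by rewrite exprn_ge0// mulr_ge0// ltW.
apply: smooth_step1; rewrite /psi -lerBlDl ler_pdivlMr// -lerBlDl.
apply: (@le_trans _ _ (tau / p%:R * ln (e a0 ^+ p))); last first.
  apply: ler_wpM2l; first by rewrite divr_ge0 ?ltW.
  by rewrite ler_ln ?posrE ?exprn_gt0.
rewrite lnp.
have -> : tau / p%:R * (p%:R * (- D o (xs a0) / tau)) = - D o (xs a0).
  by field; rewrite !gt_eqF.
by move: h2 Dk tau1 tau0; move: (D o _) (D o _) => u v *; lra.
Qed.

Lemma cutoff_grad z : gradpair phi phi z <= (3 * B * Cb / k) ^+ 2.
Proof.
set i := chart_at z; have zi : dom i z := dom_chart_at z.
have Uy := chart_image_coord zi; have zE : par i (coord i z) = z by exact: coordK.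
apply/(grad_dual _ (cutoff_smooth 1%N) zi) => w; set y := coord i z.
set g := quad _ w; have g0 : 0 <= g by apply: quad_ge0; exact: metric_pos.
pose d a := 'D_w (local_repr i (b a)) y.
have db a : is_derive y w (local_repr i (b a)) (d a).
  by have [h _] := derive_partial w (oc i) (b_smooth a 1%N i) Uy; exact: DeriveDef.
have d2 a : `|d a| <= Cb / tau * Num.sqrt g.
  have := (grad_dual (Cb / tau) (b_smooth a 1%N) zi).1 (b_grad a z) w; rewrite -/y -/(d a) -/g => h.
  rewrite -ler_sqr ?nnegrE ?mulr_ge0 ?invr_ge0 ?sqrtr_ge0 ?(ltW Cb0) ?(ltW tau0)//.
  by rewrite real_normK ?num_real// exprMn sqr_sqrtr.
pose dQ := \sum_a p%:R * (b a z * e a) ^+ p.-1 * e a * d a.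
have HQ : is_derive y w (fun y : V => Q (par i y)) dQ.
  have h : forall a, is_derive y w (fun y' : V => (b a (par i y') * e a) ^+ p) (p%:R * (b a z * e a) ^+ p.-1 * e a * d a).
    move=> a.
    have := is_derive_comp1 (db a) (@is_derive_power R (e a) (local_repr i (b a) y) p.-1).
    by rewrite /local_repr /= /y zE.
  have hs := is_derive_sum h.
  have -> : (fun y : V => Q (par i y)) = (\sum_a (fun y : V => (b a (par i y) * e a) ^+ p)) \+ cst (ebar ^+ p).
    by apply/funext => y'; rewrite /Q /= fct_sumE.
  by have := is_deriveD hs (is_derive_cst (ebar ^+ p) y w); rewrite addr0.
have HL : is_derive y w (fun y : V => ln (Q (par i y))) ((Q z)^-1 * dQ).
  have := @is_derive_comp1 _ _ _ (@ln R) y w _ _ HQ (is_derive1_ln (Q0 _)); by rewrite /= /y zE.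
have HP : is_derive y w (fun y : V => psi (par i y)) (tau / p%:R / k * ((Q z)^-1 * dQ)).
  have h (t : R) : is_derive t 1 (fun s : R => 2 + (1 + tau / p%:R * s) / k) (tau / p%:R / k).
    by apply: is_derive_eq; rewrite /GRing.scale /=; ring.
  exact: (is_derive_comp1 HL (h _)).
have HF : is_derive y w (local_repr i phi) (dsmooth_step (psi z) * (tau / p%:R / k * ((Q z)^-1 * dQ))).
  have := is_derive_comp1 HP (is_derive_smooth_step _); by rewrite /y zE.
have [_ ->] := HF.
have B0 : 0 <= B by apply: le_trans (HB 0).
have c0 : 0 <= Cb / tau * Num.sqrt g.
  exact: (mulr_ge0 (divr_ge0 (ltW Cb0) (ltW tau0)) (sqrtr_ge0 g)).
have dQle : `|dQ| <= p%:R * (Cb / tau * Num.sqrt g) * (3 * Q z).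
  apply: le_trans (ler_norm_sum _ _ _) _.
  apply: le_trans (ler_wpM2l _ (ratio z)); last first.
    exact: (mulr_ge0 (ltW p0) c0).
  rewrite mulr_sumr; apply: ler_sum => a _; have /andP[h _] := b01 a z.
  have ea := ltW (e0 a).
  rewrite normrM; have -> : `|p%:R * (b a z * e a) ^+ p.-1 * e a| = p%:R * (b a z * e a) ^+ p.-1 * e a.
    by rewrite ger0_norm// !mulr_ge0// exprn_ge0// mulr_ge0.
  have -> : p%:R * (Cb / tau * Num.sqrt g) * (b a z ^+ p.-1 * e a ^+ p) =
    p%:R * (b a z * e a) ^+ p.-1 * e a * (Cb / tau * Num.sqrt g).
    by rewrite /p /= exprMn [e a ^+ _.+2]exprS; ring.
  by apply: ler_wpM2l; [rewrite !mulr_ge0// exprn_ge0// mulr_ge0|exact: d2].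
have E : `|dsmooth_step (psi z) * (tau / p%:R / k * ((Q z)^-1 * dQ))| <= 3 * B * Cb / k * Num.sqrt g.
  have Qz := Q0 z; rewrite normrM.
  have -> : 3 * B * Cb / k * Num.sqrt g =
    B * (tau / p%:R / k * ((Q z)^-1 * (p%:R * (Cb / tau * Num.sqrt g) * (3 * Q z)))).
    by field; rewrite !gt_eqF.
  apply: ler_pM => //.
  have t0 : 0 <= tau / p%:R / k by exact: (divr_ge0 (divr_ge0 (ltW tau0) (ltW p0)) (ltW k0)).
  rewrite normrM (ger0_norm t0); apply: ler_wpM2l => //.
  by rewrite normrM ger0_norm ?invr_ge0 ?(ltW Qz)//; apply: ler_wpM2l; rewrite ?invr_ge0 ?(ltW Qz).
rewrite -[X in X <= _]real_normK ?num_real// -[g]sqr_sqrtr// -exprMn.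
have r0 : 0 <= 3 * B * Cb / k.
  exact: (divr_ge0 (mulr_ge0 (mulr_ge0 (ler0n _ _) B0) (ltW Cb0)) (ltW k0)).
rewrite ler_sqr ?nnegrE//; exact: (mulr_ge0 r0 (sqrtr_ge0 g)).
Qed.

End Construction.

(** The order of choices matters: k, then the compact set from Hopf-Rinow, then tau, then the finite
    cover and with it the exponent. The constant 3 B Cb precedes all of them. *)
Lemma cutoffs : complete_manifold M -> exists2 C : R, 0 < C & forall o (k : R), 1 <= k ->
  exists phi : M -> R, [/\ smooth_on_manifold phi, compactly_supported phi, (forall x, 0 <= phi x <= 1),
    (forall x, gradpair phi phi x <= (C / k) ^+ 2) & forall x l, l <= k -> reach o x l -> phi x = 1].
Proof.
move=> Mc; have [Cb Cb0 HC] := uniform_bumps M.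
have [B B0 HB] := dsmooth_step_bounded R.
exists (3 * B * Cb) => [|o k k1]; first by rewrite !mulr_gt0.
have [K Kc ballK] := hopf_rinow Mc o (2 * k + 3).
have [tau1 tau10 Htau] := HC K Kc.
pose tau := Num.min tau1 1.
have tau0 : 0 < tau by rewrite lt_min tau10 ltr01.
have /choice[bW HbW] : forall x, exists bW : (M -> R) * set M, K x ->
    [/\ is_bump x tau Cb bW.1, open bW.2, bW.2 x & forall z, bW.2 z -> bW.1 z = 1].
  move=> x; have [xK|nK] := pselect (K x); last by exists (fun=> 0, set0).
  have [|b bP] := Htau tau x _ xK; first by rewrite tau0 ge_min lexx.
  have [_ _ _ _ [_ [W [oW Wx W1]]]] := bP.
  by exists (b, W).
have [|s sK scov] := @compact_seq_cover M K (fun x => (bW x).2) Kc.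
  by move=> x /HbW[].
pose xs := tnth (in_tuple s); pose b a := (bW (xs a)).1.
have xK a : K (xs a) by apply: sK; exact: mem_tnth.
have P a := let: And4 h _ _ _ := HbW _ (xK a) in h.
have bcov z : K z -> exists a, b a z = 1.
  move=> /scov[x xs' Wx]; have /tnthP[a ax] : x \in in_tuple s by [].
  exists a; rewrite /b /xs -ax; have [_ _ _ ->//] := HbW x (sK x xs').
have tau_le1 : tau <= 1 by rewrite ge_min lexx orbT.
have b1 a : smooth_on_manifold (b a) by case: (P a).
have b2 a : compactly_supported (b a) by case: (P a).
have b3 a z : 0 <= b a z <= 1 by have [_ _ h _ _] := P a; exact: h.
have b4 a z : gradpair (b a) (b a) z <= (Cb / tau) ^+ 2 by have [_ _ _ h _] := P a; exact: h.
have b5 a z : b a z != 0 -> reach (xs a) z (tau / 8) by have [_ _ _ _ [h _]] := P a; exact: h.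
have := cutoff_smooth o k tau xs b1 b3.
set phi := (X in smooth_on_manifold X) => phis; exists phi; split=> //.
- exact: (cutoff_supp k1 tau0 b2).
- by move=> x; rewrite /phi smooth_step_ge0 smooth_step_le1.
- by move=> x; exact: (cutoff_grad k1 tau0 tau_le1 Cb0 HB ballK b1 b3 b4 b5 bcov).
move=> x l lk H; apply: (cutoff_one k1 tau0 tau_le1 ballK b3 b5 bcov).
exact: le_trans (reach_dist_le H) lk.
Qed.

End Cutoff.

(** * Pointwise inequalities on the manifold *)

Lemma amgm_sqr (R : realType) (x a b : R) : 0 <= a -> 0 <= b -> x ^+ 2 <= 4 * (a * b) -> `|x| <= a + b.
Proof.
move=> a0 b0 H; rewrite -ler_sqr ?nnegrE ?addr_ge0// real_normK ?num_real//.
apply: le_trans H _; rewrite -subr_ge0.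
have -> : (a + b) ^+ 2 - 4 * (a * b) = (a - b) ^+ 2 by ring.
exact: sqr_ge0.
Qed.

(* Cauchy-Schwarz for the inner product tr(G X G Y^T) on square matrices. *)
Lemma mxtrace_cauchy (R : realType) p (G X Z : 'M[R]_p) : posdefmx G ->
  (\tr (G *m X *m G *m Z^T)) ^+ 2 <= \tr (G *m X *m G *m X^T) * \tr (G *m Z *m G *m Z^T).
Proof.
move=> gp; pose T (A B : 'M[R]_p) := \tr (G *m A *m G *m B^T).
rewrite -/(T X Z) -/(T X X) -/(T Z Z).
have T0 A : 0 <= T A A by case: (mxtrace_psd A gp).
have TC A B : T A B = T B A.
  rewrite /T -mxtrace_tr !trmx_mul trmxK gp.1 !mulmxA mxtrace_mulC.
  by rewrite !mulmxA.
have TD A B C (t : R) : T (A + t *: B) C = T A C + t * T B C.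
  by rewrite /T mulmxDr !mulmxDl -scalemxAr -!scalemxAl mxtraceD mxtraceZ.
have E t : T (X + t *: Z) (X + t *: Z) = T X X + 2 * t * T X Z + t ^+ 2 * T Z Z.
  rewrite TD (TC X) (TC Z) !TD (TC Z X); ring.
have [Tz|Tnz] := eqVneq (T Z Z) 0.
  have [_ /(_ Tz) Z0] := mxtrace_psd Z gp.
  by rewrite /T Z0 trmx0 !mulmx0 raddf0 expr0n /= mulr0.
have Tp : 0 < T Z Z by rewrite lt_neqAle eq_sym Tnz T0.
have := T0 (X + (- (T X Z / T Z Z)) *: Z); rewrite E.
have -> : T X X + 2 * (- (T X Z / T Z Z)) * T X Z + (- (T X Z / T Z Z)) ^+ 2 * T Z Z =
  T X X - T X Z ^+ 2 / T Z Z by field.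
by rewrite subr_ge0 ler_pdivrMr.
Qed.

Lemma neg_part_bound (R : realType) (l s : R) : 0 <= s -> - (l * s) <= `|Num.min 0 l| * s.
Proof.
move=> s0; rewrite -mulNr; apply: ler_wpM2r => //.
by have [h|h] := leP 0 l; [rewrite normr0 oppr_le0|rewrite ltr0_norm].
Qed.

Lemma scalemxE (R : realType) p q (c : R) (A : 'M[R]_(p, q)) a b : (c *: A) a b = c * A a b.
Proof. by rewrite mxE. Qed.

Lemma laplacian_near (R : realType) p (g : 'rV[R]_p -> 'M[R]_p) (f h : 'rV[R]_p -> R) y :
  (\forall z \near y, f z = h z) -> laplacian g f y = laplacian g h y.
Proof.
move=> fh; rewrite /laplacian; apply: (f_equal (GRing.mul _)).
apply: eq_bigr => a _.
apply: partial_near.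
apply: filterS (near_join fh) => z Hz.
apply: (f_equal (GRing.mul _)).
apply: eq_bigr => b _.
by rewrite (partial_near b Hz).
Qed.

Section Pointwise.
Variables (R : realType) (n : nat) (M : riemannianManifold R (n + n)).
Hypothesis M_kahler : kahler M.
Local Notation m := (n + n)%N.
Local Notation V := 'rV[R]_m.
Local Notation I := (mulI_mx R n).
Local Notation oc i := (@chart_image_open R _ M i).
Implicit Types (x : M) (i : chart M) (f h v u : M -> R).

Local Notation cx x := (chart_image_coord (dom_chart_at x)).

Lemma gradient_sqnormE f x : gradient_sqnorm f x = gradpair f f x.
Proof. exact: grad_sqnormE. Qed.

Let Gp x : posdefmx (cometric (metric (chart_at x)) (coord (chart_at x) x)).
Proof. by apply: posdefmx_inv; exact: metric_pos (cx x). Qed.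

Lemma ginner_cs f h x : gradpair f h x ^+ 2 <= gradpair f f x * gradpair h h x.
Proof.
rewrite /gradpair /glob /ginner; have gp := metric_pos (cx x).
have := cauchy_schwarz_metric ((dcol (local_repr (chart_at x) f) (coord (chart_at x) x))^T *m
  cometric (metric (chart_at x)) (coord (chart_at x) x)) (dcol (local_repr (chart_at x) h) (coord (chart_at x) x)) gp.
rewrite /quad trmx_mul trmxK trmx_inv gp.1 !mulmxA mulmxKV ?posdefmx_unit//.
Qed.

Lemma gradpair_sym f h x : gradpair f h x = gradpair h f x.
Proof.
have S (G : 'M[R]_m) (a b : 'cV[R]_m) : G^T = G -> (a^T *m G *m b) 0 0 = (b^T *m G *m a) 0 0.
  by move=> GT; rewrite -[a^T *m G *m b]trmxK [LHS]mxE !trmx_mul trmxK GT mulmxA.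
by apply: S; exact: (Gp x).1.
Qed.

Lemma gradpair_ge0 f x : 0 <= gradpair f f x.
Proof. by rewrite -gradient_sqnormE /gradient_sqnorm; apply: grad_sqnorm_ge0 (cx x); exact: metric_pos. Qed.

Lemma dcol_mul f h x : Ck_on_manifold 1 f -> Ck_on_manifold 1 h -> let i := chart_at x in let y := coord i x in
  dcol (local_repr i (fun z => f z * h z)) y =
  f x *: dcol (local_repr i h) y + h x *: dcol (local_repr i f) y.
Proof.
move=> F H i y; have Uy : chart_image i y := cx x.
have fE : f x = local_repr i f y by rewrite /local_repr /= coordK//; exact: dom_chart_at.
have hE : h x = local_repr i h y by rewrite /local_repr /= coordK//; exact: dom_chart_at.
apply/matrixP => a b; rewrite [LHS]mxE addmxE !scalemxE ![dcol _ _ _ _]mxE fE hE.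
rewrite addrC [X in X + _]mulrC.
exact: (partialM (Ck_derivable (F i) Uy) (Ck_derivable (H i) Uy)).
Qed.

Lemma gradpair_mul f h v x : Ck_on_manifold 1 f -> Ck_on_manifold 1 h ->
  gradpair (fun z => f z * h z) v x = f x * gradpair h v x + h x * gradpair f v x.
Proof.
move=> F H; rewrite /gradpair /glob /ginner (dcol_mul x F H).
have tD (P Q : 'cV[R]_m) (s t : R) : (s *: P + t *: Q)^T = s *: P^T + t *: Q^T by rewrite raddfD /= !linearZ.
by rewrite tD !mulmxDl -!scalemxAl addmxE !scalemxE.
Qed.

Lemma flux_mul u f h x : Ck_on_manifold 1 f -> Ck_on_manifold 1 h ->
  flux u (fun z => f z * h z) x = f x * flux u h x + h x * flux u f x.
Proof.
move=> F H; rewrite /flux /glob /ddc_flux (dcol_mul x F H).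
have tD (P Q : 'cV[R]_m) (s t : R) : (s *: P + t *: Q)^T = s *: P^T + t *: Q^T by rewrite raddfD /= !linearZ.
by rewrite tD !mulmxDl -!scalemxAl addmxE !scalemxE.
Qed.

Lemma ddc_sq_ge0 u x : 0 <= ddc_sq u x.
Proof. by rewrite /ddc_sq /glob /ddc_sqnorm; case: (mxtrace_psd (ddc (local_repr (chart_at x) u) (coord (chart_at x) x)) (Gp x)). Qed.

(** The flux is the trace pairing of ddc u with the rank-one matrix df (I du)^T. The squared norm of
    the latter is |df|^2 |du|^2, as I is an isometry. *)
Lemma flux_bound u f x : flux u f x ^+ 2 <= ddc_sq u x * (gradpair f f x * gradpair u u x).
Proof.
rewrite /flux /ddc_sq /gradpair /glob /ddc_flux /ddc_sqnorm /ginner.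
have gp := Gp x; have GI := cometric_comm (@metric_pos _ _ M (chart_at x)) (@metric_hermitian _ _ _ M_kahler (chart_at x)) (cx x).
move: GI gp; move: (cometric _ _) (ddc _ _) (dcol _ _) (dcol _ _) => G X d a GI gp.
have bb : ((I *m d)^T *m G *m (I *m d)) 0 0 = (d^T *m G *m d) 0 0.
  rewrite trmx_mul -!mulmxA (mulmxA G I) -GI -(mulmxA I G) (mulmxA I^T I) mulI_trVK mul1mx.
  by [].
have tr1 (A : 'M[R]_1) : \tr A = A 0 0 by rewrite /mxtrace big_ord1.
have := mxtrace_cauchy X (a *m (I *m d)^T) gp.
rewrite trmx_mul trmxK.
have -> : \tr (G *m X *m G *m (I *m d *m a^T)) = (a^T *m (G *m X *m G) *m (I *m d)) 0 0.
  by rewrite (mulmxA _ (I *m d)) mxtrace_mulC tr1 !mulmxA.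
have -> : \tr (G *m (a *m (I *m d)^T) *m G *m (I *m d *m a^T)) =
   (a^T *m G *m a) 0 0 * (d^T *m G *m d) 0 0.
  rewrite -bb; move: (I *m d) => b.
  rewrite (mulmxA _ b) mxtrace_mulC tr1 !mulmxA.
  have -> : a^T *m G *m a *m b^T *m G *m b = (a^T *m G *m a) *m (b^T *m G *m b) by rewrite !mulmxA.
  by rewrite mxE big_ord1.
by [].
Qed.

Lemma pluriharmonic_smooth u : Ck_on_manifold 2 u -> (forall x, ddc_sq u x = 0) ->
  smooth_on_manifold u /\
  forall i y, chart_image i y -> I *m hess (local_repr i u) y = hess (local_repr i u) y *m I^T.
Proof.
move=> U2 H.
have C i y : chart_image i y -> I *m hess (local_repr i u) y = hess (local_repr i u) y *m I^T.
  move=> Uy; have [yi yE] := chart_imageP Uy.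
  have := H (par i y); rewrite /ddc_sq (glob_chart (ddc_sq_indep M_kahler U2) yi) yE /ddc_sqnorm.
  have [_ h] := mxtrace_psd (ddc (local_repr i u) y) (posdefmx_inv (metric_pos Uy)).
  by move=> /h/eqP; rewrite /ddc subr_eq0 => /eqP ->.
split=> // k i.
apply: (weyl (oc i) (U2 i)) => y Uy.
(* The identity matrix commutes with I as well, so the trace argument also applies to the flat
   metric of the chart. *)
have := antiinv_trace (G := 1%:M) _ (C i y Uy); rewrite mulmx1 mul1mx => /(_ erefl).
by rewrite mul1mx => T0; rewrite -[RHS]T0; apply: eq_bigr => a _; rewrite [RHS]mxE.
Qed.

Section Regularized.
Variables (u : M -> R) (e : R).
Hypothesis u_smooth : smooth_on_manifold u.
Hypothesis u_pluri : forall i y, chart_image i y ->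
  I *m hess (local_repr i u) y = hess (local_repr i u) y *m I^T.
Hypothesis e_gt0 : 0 < e.

Definition reg_norm x := Num.sqrt (gradpair u u x + e).
Local Notation F := reg_norm.

Let u1 : Ck_on_manifold 1 u. Proof. exact: u_smooth. Qed.

Let FE i y : chart_image i y -> local_repr i F y = reg_grad (metric i) (local_repr i u) e y.
Proof.
move=> /chart_imageP[yi yE]; rewrite /local_repr /F /= /gradpair (glob_chart (gradpair_indep u1 u1) yi) yE.
by rewrite /reg_grad grad_sqnormE.
Qed.

Lemma reg_norm_smooth : smooth_on_manifold F.
Proof.
move=> k i; apply: (Ck_eq (oc i) (f := reg_grad (metric i) (local_repr i u) e)) => [y Uy|].
  by rewrite FE.
apply: reg_grad_smooth => //; [exact: (oc i)|exact: metric_Ckmx|exact: metric_pos|].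
by move=> k'; exact: u_smooth.
Qed.

Lemma reg_norm_sqr x : F x ^+ 2 = gradpair u u x + e.
Proof. by rewrite sqr_sqrtr// addr_ge0 ?gradpair_ge0// ltW. Qed.

Lemma reg_norm_gt0 x : 0 < F x.
Proof. by rewrite sqrtr_gt0 ltr_wpDl ?gradpair_ge0. Qed.

Lemma reg_norm_bochner x : gradpair F F x - F x * lap F x <= `|ricci_min_neg x| * F x ^+ 2.
Proof.
set i := chart_at x; have xi : dom i x := dom_chart_at x; set y := coord i x.
have Uy : chart_image i y := cx x.
pose Fi := reg_grad (metric i) (local_repr i u) e.
have near : \forall z \near y, local_repr i F z = Fi z.
  have : nbhs y (chart_image i) by apply: open_nbhs_nbhs; split=> //; exact: (oc i).
  by apply: filterS => z /FE.
have F2 i' : Ck 2 (chart_image i') (local_repr i' F) by exact: reg_norm_smooth.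
have gE : gradpair F F x = grad_sqnorm (metric i) Fi y.
  by rewrite grad_sqnormE /gradpair /glob /ginner (dcol_near near).
have lE : lap F x = laplacian (metric i) Fi y.
  by rewrite /lap /glob (laplacian_near _ near).
have FxE : F x = Fi y by rewrite -(nbhs_singleton near) /local_repr /= coordK.
rewrite gE lE {1}FxE.
have B := reg_grad_bochner (oc i) (@metric_Ckmx _ _ M i) (@metric_pos _ _ M i) (@metric_hermitian _ _ _ M_kahler i)
  (@metric_closed _ _ _ M_kahler i) (fun k => u_smooth k i) (@u_pluri i) e_gt0 Uy.
apply: le_trans B _.
set v := _^T *m _.
have gp := metric_pos Uy.
have qv : quad (metric i y) v = gradpair u u x.
  rewrite /quad /v trmx_mul trmxK /cometric trmx_inv gp.1 !mulmxA mulmxKV ?posdefmx_unit//.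
have Ry := rayleigh v (ricci_sym (oc i) (@metric_Ckmx _ _ M i) (@metric_pos _ _ M i) Uy) gp.
apply: (@le_trans _ _ (- (ricci_min x * gradpair u u x))).
  by rewrite lerN2 -qv; exact: Ry.
have g0 := gradpair_ge0 u x.
apply: (@le_trans _ _ (`|ricci_min_neg x| * gradpair u u x)).
  exact: neg_part_bound.
have le (s : R) : s <= s + e by rewrite lerDl ltW.
by rewrite reg_norm_sqr; exact: (ler_wpM2l (normr_ge0 _) (le _)).
Qed.

End Regularized.
End Pointwise.

(** * The vanishing theorem *)

Section Integrals.
Variables (R : realType) (n : nat) (M : riemannianManifold R (n + n)).
Variables (vol : {measure set (borelType M) -> \bar R}) (volP : is_riemannian_volume vol).
Local Notation m := (n + n)%N.
Local Notation V := 'rV[R]_m.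
Local Notation oc i := (@chart_image_open R _ M i).
Implicit Types (x : M) (i : chart M) (f h u : M -> R).
Local Notation csupp := compactly_supported.

Lemma integral_volE f : continuous f -> csupp f ->
  (\int[vol]_x (f x)%:E = (integral_vol vol f)%:E)%E.
Proof.
move=> cf sf; rewrite /integral_vol /Rintegral fineK//.
exact: integrable_fin_num (integrable_csupp volP cf sf).
Qed.

Lemma integral_vol_le f h : continuous f -> csupp f -> continuous h -> csupp h ->
  (forall x, f x <= h x) -> integral_vol vol f <= integral_vol vol h.
Proof.
move=> cf sf ch sh fh; apply: le_Rintegral => //.
- exact: integrable_csupp.
- exact: integrable_csupp.
Qed.

Lemma integral_volZ (c : R) f : continuous f -> csupp f ->
  integral_vol vol (fun x => c * f x) = c * integral_vol vol f.
Proof. by move=> cf sf; apply: RintegralZl => //; exact: integrable_csupp. Qed.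

Lemma test_function x0 (W : set M) : open W -> W x0 ->
  exists f0 : M -> R, [/\ continuous f0, csupp f0, forall x, 0 <= f0 x <= 1,
    forall x, f0 x != 0 -> W x & 0 < integral_vol vol f0].
Proof.
move=> oW Wx.
have [i [b [_ [C [C' [xi [sb _] [Cc _] [CC' C'U] [b0 _ b01 _ [W1 [_ Ox b1]]]]]]]]] := chart_bump oW Wx.
have CU : C `<=` chart_image i by move=> y /CC'/C'U[].
have Ccl : closed C by apply: compact_closed => //; exact: norm_hausdorff.
have bM : Ck_on_manifold 0 (chart_ext i b).
  by apply: (Ck_chart_ext Cc CU b0); exact: Ck_sub (@subsetT _ _) (sb 0%N).
have [Kc Kcl] := compact_par Cc CU.
have cb : continuous (chart_ext i b) by exact: Ck_continuous bM.
exists (chart_ext i b); split=> //.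
- by apply: compactly_supported_sub Kc Kcl _ => x; exact: chart_ext_off b0 CU.
- move=> x; rewrite /chart_ext; case: ifP => // _; by rewrite lexx ler01.
- move=> x; have [xj|/chart_ext_out ->] := pselect (dom i x); last by rewrite eqxx.
  rewrite chart_extE// => bx; have /CC'/C'U[_ /=] : C (coord i x).
    by apply: contrapT => /b0 h; move: bx; rewrite h eqxx.
  by rewrite coordK.
pose q y := voldens (metric i) y * b y.
have q0 y : ~ C y -> q y = 0 by move=> nC; rewrite /q b0// mulr0.
have qC : Ck 0 setT q.
  apply: (Ck_extend0 (oc i) Ccl CU q0); apply: (CkM (oc i)).
    by apply: voldens_smooth; [exact: (oc i)|exact: metric_Ckmx|exact: metric_pos].
  exact: Ck_sub (@subsetT _ _) (sb 0%N).
have qc : continuous q by exact: (Ck_setT_continuous qC).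
have Uy : chart_image i (coord i x0) := chart_image_coord xi.
have rho0 y : chart_image i y -> 0 < voldens (metric i) y.
  by move=> Uz; apply: voldens_gt0 Uz; exact: metric_pos.
have [r Cr] : exists r : R, forall y, C y -> `|y| < r.
  have [B [_ HB]] := compact_bounded Cc.
  by exists (B + 1 + 1) => y yC; apply: le_lt_trans (HB (B + 1) _ y yC) _; rewrite ?ltrDl.
have -> : integral_vol vol (chart_ext i b) = irow q.
  rewrite /integral_vol /irow /Rintegral; congr fine.
  apply: (integral_vol_chart volP cb CU b0) => x; first exact: chart_extE.
  exact: chart_ext_out.
apply: (irow_gt0 (r := r) (y0 := coord i x0)) => //.
- move=> y ry; apply: q0 => /Cr; rewrite ltNge => /negP; exact.
- move=> y; have [yC|nC] := pselect (C y); last by rewrite q0.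
  by rewrite /q mulr_ge0//; [exact: ltW (rho0 y (CU y yC))|case/andP: (b01 y)].
by rewrite /q mulr_gt0 ?rho0//; have := b1 x0 Ox; rewrite chart_extE// => ->.
Qed.

Lemma csupp_mul f h : csupp f -> csupp (fun x => f x * h x).
Proof. by move=> sf; apply: (compactly_supported_by sf) => x /csupp_off ->; rewrite mul0r. Qed.

Lemma energy_cutoff phi u (c E : R) : Ck_on_manifold 1 phi -> csupp phi -> Ck_on_manifold 1 u ->
  (forall x, gradpair phi phi x <= c) -> (\int[vol]_x (gradient_sqnorm u x)%:E <= E%:E)%E ->
  csupp (fun x => gradpair phi phi x * gradpair u u x) /\
  integral_vol vol (fun x => gradpair phi phi x * gradpair u u x) <= c * E.
Proof.
move=> F sF U Hc HE.
have c0 : 0 <= c by apply: le_trans (Hc point); exact: gradpair_ge0.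
have cg f : Ck_on_manifold 1 f -> continuous (gradpair f f) by move=> F'; exact: gradpair_continuous.
have sg : csupp (fun x => gradpair phi phi x * gradpair u u x).
  by apply: (compactly_supported_by sF) => x nx; rewrite gradpair_off// mul0r.
have cc : continuous (fun x => gradpair phi phi x * gradpair u u x).
  by move=> x; apply: cvgM; exact: cg.
split=> //; rewrite -lee_fin -(integral_volE cc sg) EFinM.
apply: (@le_trans _ _ (\int[vol]_x (c%:E * (gradpair u u x)%:E))%E).
  apply: ge0_integral_mono => x _; first by rewrite lee_fin mulr_ge0 ?gradpair_ge0.
  by rewrite -EFinM lee_fin; apply: ler_wpM2r; [exact: gradpair_ge0|exact: Hc].
rewrite ge0_integralZl//.
- apply: lee_wpmul2l; first by rewrite lee_fin.
  by under eq_integral do rewrite -gradient_sqnormE.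
- by apply/measurable_EFinP; apply: continuous_measurable_borel; exact: cg.
- by move=> x _; rewrite lee_fin gradpair_ge0.
Qed.

End Integrals.

Lemma inverse_square_small (R : realType) (c K : R) : 0 < c -> 0 <= K ->
  (forall k : R, 1 <= k -> c <= K / k ^+ 2) -> False.
Proof.
move=> c0 K0 H; pose k := 1 + K / c.
have kc : 0 <= K / c by rewrite divr_ge0// ltW.
have k1 : 1 <= k by rewrite lerDl.
have := H k k1; rewrite ler_pdivlMr ?exprn_gt0 ?(lt_le_trans ltr01)//.
apply/negP; rewrite -ltNge; apply: (@lt_le_trans _ _ (c * k)).
  by rewrite /k mulrDr mulr1 mulrC mulfVK ?gt_eqF// ltrDr.
by rewrite ler_pM2l// expr2 ler_peMl// (le_trans ler01).
Qed.

Section Pluriharmonic.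
Variables (R : realType) (n : nat) (M : riemannianManifold R (n + n)).
Hypotheses (M_kahler : kahler M) (M_complete : complete_manifold M).
Variables (vol : {measure set (borelType M) -> \bar R}) (volP : is_riemannian_volume vol).
Variables (u : M -> R) (E : R).
Hypotheses (u2 : Ck_on_manifold 2 u) (u_harmonic : forall x, lap u x = 0).
Hypothesis u_energy : (\int[vol]_x (gradient_sqnorm u x)%:E <= E%:E)%E.

Let u1 : Ck_on_manifold 1 u. Proof. by move=> i; exact: CkW (u2 i). Qed.

Lemma energy_ge0 : 0 <= E.
Proof.
rewrite -lee_fin; apply: le_trans u_energy; apply: integral_ge0 => x _.
by rewrite lee_fin gradient_sqnormE gradpair_ge0.
Qed.

Lemma cutoff_ddc phi (c : R) : Ck_on_manifold 1 phi -> compactly_supported phi ->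
  (forall x, gradpair phi phi x <= c) ->
  integral_vol vol (fun x => phi x * (phi x * ddc_sq u x)) <= 16 * (c * E).
Proof.
move=> F sF Hc; have [sg gE] := energy_cutoff volP F sF u1 Hc u_energy.
have F2 : Ck_on_manifold 1 (fun x => phi x * phi x) by exact: Ck_manifoldM.
have sF2 : compactly_supported (fun x => phi x * phi x) by exact: csupp_mul sF.
have D := ddc_global M_kahler volP u2 u_harmonic F2 sF2.
pose T x := phi x * phi x * (2^-1 * ddc_sq u x) + flux u (fun z => phi z * phi z) x.
pose A x := phi x * (phi x * ddc_sq u x).
pose B x := gradpair phi phi x * gradpair u u x.
have cphi := Ck_continuous F; have cddc := ddc_sq_continuous M_kahler u2.
have cA : continuous A by move=> x; apply: cvgM; [exact: cphi|apply: cvgM; [exact: cphi|exact: cddc]].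
have sA : compactly_supported A by exact: csupp_mul sF.
have cB : continuous B by move=> x; apply: cvgM; exact: gradpair_continuous.
have cT : continuous T.
  move=> x; apply: cvgD; last exact: (flux_continuous M_kahler u2 F2).
  apply: cvgM; first by apply: cvgM; exact: cphi.
  by apply: cvgM; [exact: cvg_cst|exact: cddc].
have fT x : T x = 2^-1 * A x + 2 * phi x * flux u phi x by rewrite /T (flux_mul _ _ F F) /A; ring.
have sT : compactly_supported T.
  by apply: (compactly_supported_by sF) => x /csupp_off p0; rewrite fT /A p0 !(mul0r, mulr0) addr0.
(* T is A / 2 plus a flux term bounded by A / 4 + 4 B, hence T >= A / 4 - 4 B. The integral of T
   vanishes by [ddc_global], which leaves the factor 16. *)
have H x : A x <= 4 * T x + 16 * B x.
  have p2 : phi x * phi x = phi x ^+ 2 by rewrite expr2.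
  have A0 : 0 <= A x by rewrite /A mulrA p2 mulr_ge0 ?sqr_ge0 ?ddc_sq_ge0.
  have B0 : 0 <= B x by rewrite mulr_ge0 ?gradpair_ge0.
  have := @amgm_sqr R (2 * phi x * flux u phi x) (A x / 4) (4 * B x).
  rewrite divr_ge0// mulr_ge0// => /(_ isT isT) am.
  have : `|2 * phi x * flux u phi x| <= A x / 4 + 4 * B x.
    apply: am; rewrite exprMn.
    have -> : 4 * (A x / 4 * (4 * B x)) = (2 * phi x) ^+ 2 * (ddc_sq u x * B x).
      by rewrite /A; field.
    by apply: ler_wpM2l; [exact: sqr_ge0|exact: flux_bound].
  rewrite ler_norml => /andP[h _]; rewrite fT.
  by move: h A0; move: (A x) (B x) (2 * phi x * _) => a b t *; lra.
have cS : continuous (fun x => 4 * T x + 16 * B x).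
  by move=> x; apply: cvgD; (apply: cvgM; first exact: cvg_cst); [exact: cT|exact: cB].
have c4 : continuous (fun x => 4 * T x) by move=> x; apply: cvgM; [exact: cvg_cst|exact: cT].
have c16 : continuous (fun x => 16 * B x) by move=> x; apply: cvgM; [exact: cvg_cst|exact: cB].
have s4 : compactly_supported (fun x => 4 * T x).
  by apply: (compactly_supported_by sT) => x /csupp_off ->; rewrite mulr0.
have s16 : compactly_supported (fun x => 16 * B x).
  by apply: (compactly_supported_by sg) => x /csupp_off h; rewrite /B h mulr0.
have sS : compactly_supported (fun x => 4 * T x + 16 * B x).
  apply: (compactly_supported_by sF) => x nx.
  by rewrite fT /A /B (csupp_off nx) (gradpair_off nx) !(mul0r, mulr0) !addr0 mulr0.
apply: le_trans (integral_vol_le volP cA sA cS sS H) _.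
rewrite (integral_volD volP c4 c16 s4 s16) (integral_volZ volP 4 cT sT) (integral_volZ volP 16 cB sg).
by rewrite [integral_vol vol T]D mulr0 add0r ler_pM2l.
Qed.

Lemma finite_energy_pluriharmonic x : ddc_sq u x = 0.
Proof.
apply/eqP; rewrite eq_le ddc_sq_ge0 andbT leNgt; apply/negP => d0.
have [C C0 HC] := cutoffs M_complete.
set c := ddc_sq u x / 2; have c0 : 0 < c by rewrite divr_gt0.
have cddc := ddc_sq_continuous M_kahler u2.
(* On [W1] chains from [x] are shorter than 1 <= k, so every cutoff centred at [x] equals 1 on the
   support of the test function. The lower bound for the integral then does not depend on k. *)
have [W1 [oW1 W1x HW1]] := local_reach x ltr01.
pose W2 := ddc_sq u @^-1` [set t | c < t].
have oW2 : open W2 by apply: open_comp => [z _|]; [exact: cddc|exact: open_gt].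
have W2x : W2 x by rewrite /W2 /= /c ltr_pdivrMr// mulr_natr mulr2n ltrDl.
have [f0 [cf sf f01 fW f_gt0]] := test_function volP (openI oW1 oW2) (conj W1x W2x).
apply: (@inverse_square_small _ (c * integral_vol vol f0) (16 * (C ^+ 2 * E))).
- by rewrite mulr_gt0.
- exact: (mulr_ge0 (ler0n _ 16) (mulr_ge0 (sqr_ge0 C) energy_ge0)).
move=> k k1; have [phi [sphi cphi phi01 gphi phi1]] := HC x k k1.
have F : Ck_on_manifold 1 phi by exact: sphi.
have := cutoff_ddc F cphi gphi.
have -> : 16 * ((C / k) ^+ 2 * E) = 16 * (C ^+ 2 * E) / k ^+ 2.
  by field; rewrite gt_eqF// (lt_le_trans ltr01).
apply: le_trans; rewrite -(integral_volZ volP c cf sf).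
have ccphi := Ck_continuous F.
apply: integral_vol_le => //.
- by move=> z; apply: cvgM; [exact: cvg_cst|exact: cf].
- by apply: (compactly_supported_by sf) => z /csupp_off ->; rewrite mulr0.
- by move=> z; apply: cvgM; [exact: ccphi|apply: cvgM; [exact: ccphi|exact: cddc]].
- exact: csupp_mul.
move=> z; have [fz|/fW[Wz /= /ltW cz]] := eqVneq (f0 z) 0.
  rewrite fz mulr0 mulrA -expr2 mulr_ge0 ?sqr_ge0 ?ddc_sq_ge0//.
have [l l1 xz] := HW1 z Wz.
rewrite (phi1 z l _ xz); last exact: le_trans (ltW l1) k1.
rewrite !mul1r; apply: le_trans cz; rewrite ler_piMr ?(ltW c0)//.
by case/andP: (f01 z).
Qed.

End Pluriharmonic.

Section Vanishing.
Variables (R : realType) (n : nat) (M : riemannianManifold R (n + n)).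
Variables (vol : {measure set (borelType M) -> \bar R}) (nu C_S : R).
Hypothesis M_kahler : kahler M.
Hypothesis volP : is_riemannian_volume vol.
Hypotheses (nu_gt2 : 2 < nu) (C_S_gt0 : 0 < C_S).
Local Notation csupp := compactly_supported.
Implicit Types (f h w : M -> R) (x : M).

(** [s] is the Hoelder conjugate of nu / 2 and half of the Sobolev exponent, so Hoelder's inequality
    applied to the curvature and w^2 produces exactly the Sobolev norm of w; [r] is 1 / s. *)
Let s := nu / (nu - 2).
Let r := (nu - 2) / nu.

Let nu0 : 0 < nu. Proof. by apply: lt_trans nu_gt2. Qed.
Let nu2 : 0 < nu - 2. Proof. by rewrite subr_gt0. Qed.
Let s0 : 0 < s. Proof. by rewrite divr_gt0. Qed.
Let r0 : 0 < r. Proof. by rewrite divr_gt0. Qed.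

Lemma powR_sqr (t a : R) : `|t| `^ (2 * a) = (t ^+ 2) `^ a.
Proof. by rewrite powRrM -[2]/(2%:R) powR_mulrn// real_normK ?num_real. Qed.

Definition sobolev_norm w : \bar R := ((\int[vol]_x ((w x ^+ 2) `^ s)%:E) `^ r)%E.

Hypothesis sobolev : forall w, smooth_on_manifold w -> csupp w ->
  (sobolev_norm w <= C_S%:E * \int[vol]_x (gradient_sqnorm w x)%:E)%E.
Variable lam : R.
Hypothesis ricci_norm : (((\int[vol]_x (`|ricci_min_neg x| `^ (nu / 2))%:E) `^ (2 / nu)) <= lam%:E)%E.
Hypothesis lam_small : lam * C_S < 2.

Lemma lam_ge0 : 0 <= lam.
Proof. by rewrite -lee_fin; apply: le_trans ricci_norm; exact: poweR_ge0. Qed.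

(** Hoelder's inequality is applied to the continuous function [q]; the passage from [q] to
    [ricci_min_neg] is monotonicity of the integral of nonnegative functions, which asks for no
    measurability. *)
Lemma hoelder_ricci (q g : M -> R) : continuous q -> continuous g -> csupp g ->
  (forall x, 0 <= q x <= `|ricci_min_neg x|) -> (forall x, 0 <= g x) ->
  ((integral_vol vol (fun x => q x * g x))%:E <=
     lam%:E * ((\int[vol]_x ((g x) `^ s)%:E) `^ r))%E.
Proof.
move=> cq cg sg q01 g0.
have mq := continuous_measurable_borel cq; have mg := continuous_measurable_borel cg.
have p0 : 0 < nu / 2 by rewrite divr_gt0.
have pq : (nu / 2)^-1 + s^-1 = 1 by rewrite /s !invf_div; field; rewrite gt_eqF.
have := hoelder vol mq mg p0 s0 pq.
rewrite unlock /Lnorm invr1 poweRe1; last by apply: integral_ge0 => x _; exact: poweR_ge0.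
have cqg : continuous (fun x => q x * g x) by move=> x; apply: cvgM; [exact: cq|exact: cg].
have sqg : csupp (fun x => q x * g x).
  by apply: (compactly_supported_by sg) => x /csupp_off ->; rewrite mulr0.
have -> : (\int[vol]_x `|(EFin \o (q \* g)%R) x| `^ 1 = (integral_vol vol (fun x => q x * g x))%:E)%E.
  rewrite -(integral_volE volP cqg sqg); apply: eq_integral => x _.
  rewrite poweRe1 ?abse_ge0//= ger0_norm// mulr_ge0//; by case/andP: (q01 x).
move=> /le_trans; apply.
have gE : (\int[vol]_x `|(EFin \o g) x| `^ s = \int[vol]_x ((g x) `^ s)%:E)%E.
  by apply: eq_integral => x _; rewrite /= ger0_norm.
have sE : s^-1 = r by rewrite /s invf_div.
rewrite gE sE; apply: lee_wpmul2r; first exact: poweR_ge0.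
apply: le_trans ricci_norm; rewrite invf_div; apply: gt0_ler_poweR.
- by rewrite divr_ge0 ?ltW.
- by rewrite in_itv /= leey andbT; apply: integral_ge0 => x _; rewrite lee_fin powR_ge0.
- by rewrite in_itv /= leey andbT; apply: integral_ge0 => x _; rewrite lee_fin powR_ge0.
apply: ge0_integral_mono => x _; first by rewrite /= lee_fin powR_ge0.
rewrite /= lee_fin; have /andP[q0 q1] := q01 x.
by apply: ge0_ler_powR; rewrite ?nnegrE ?(ltW p0)// ger0_norm.
Qed.

Section Energy.
Variables (u phi : M -> R) (e : R).
Hypothesis u_smooth : smooth_on_manifold u.
Hypothesis u_pluri : forall (i : chart M) y, chart_image i y ->
  mulI_mx R n *m hess (local_repr i u) y = hess (local_repr i u) y *m (mulI_mx R n)^T.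
Hypothesis e_gt0 : 0 < e.
Hypotheses (phi_smooth : smooth_on_manifold phi) (phi_supp : csupp phi).
Local Notation F := (reg_norm u e).
Let w x := phi x * F x.
Let eta := 2 - lam * C_S.

Let eta0 : 0 < eta. Proof. by rewrite subr_gt0. Qed.
Let Fs : smooth_on_manifold F. Proof. exact: reg_norm_smooth. Qed.
Let F1 : Ck_on_manifold 1 F. Proof. exact: Fs. Qed.
Let p1 : Ck_on_manifold 1 phi. Proof. exact: phi_smooth. Qed.
Let ws : smooth_on_manifold w. Proof. by move=> k; apply: Ck_manifoldM; [exact: phi_smooth|exact: Fs]. Qed.
Let wsupp : csupp w. Proof. exact: csupp_mul. Qed.

(** Integrating [H] removes T by Green's formula, and Hoelder with Sobolev bounds the curvature term
    by lam C_S times the energy of w = phi F. What remains on the left is 2 - delta - lam C_S, which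
    equals delta for delta = eta / 2. The constant is thus (1 + 1/delta) / delta. *)
Lemma weighted_energy :
  integral_vol vol (gradpair w w) <=
  (1 + 2 / eta) * (2 / eta) * integral_vol vol (fun x => gradpair phi phi x * F x ^+ 2).
Proof.
have Fp x : 0 < F x by exact: reg_norm_gt0.
have w1 : Ck_on_manifold 1 w by exact: ws.
have F2 : Ck_on_manifold 2 F by exact: Fs.
pose f x := phi x * w x.
have f1 : Ck_on_manifold 1 f by exact: Ck_manifoldM.
have fsupp : csupp f by exact: csupp_mul.
have green := green_global M_kahler volP F2 f1 fsupp.
pose T x := f x * lap F x + gradpair f F x.
pose A x := gradpair F F x; pose B x := gradpair phi phi x.
pose N x := (A x - F x * lap F x) / F x ^+ 2.
(* q, the positive part of N, is continuous, so that Hoelder's inequality applies; it lies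
   below |ricci_min_neg|, which need not be measurable. *)
pose q x := 2^-1 * (N x + `|N x|).
pose delta := eta / 2; have d0 : 0 < delta by rewrite divr_gt0.
have d1 : delta <= 1.
  by rewrite /delta ler_pdivrMr// mul1r /eta gerBl mulr_ge0 ?(ltW C_S_gt0)// lam_ge0.
have cF := Ck_continuous F1; have cphi := Ck_continuous p1; have cw := Ck_continuous w1.
have cA : continuous A by exact: gradpair_continuous.
have cB : continuous B by exact: gradpair_continuous.
have cl : continuous (lap F) by move=> x; exact: (@lap_continuous _ _ _ M_kahler F F2 x).
have cN : continuous N.
  move=> x; apply: cvgM; first by apply: cvgB; [exact: cA|apply: cvgM; [exact: cF|exact: cl]].
  apply: cvgV; first by rewrite expf_neq0// gt_eqF.
  exact: (cvgM (cF x) (cF x)).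
have cq : continuous q.
  move=> x; apply: cvgM; first exact: cvg_cst.
  by apply: cvgD; [exact: cN|apply: cvg_norm; exact: cN].
have q0 x : 0 <= q x.
  by rewrite mulr_ge0// -lerBlDl sub0r; have := ler_norm (- N x); rewrite normrN.
have Nq x : N x <= q x.
  by rewrite /q -ler_pdivrMl// mulrC; have := ler_norm (N x); move: `|N x| (N x) => a b; lra.
have qr x : q x <= `|ricci_min_neg x|.
  have Nr : N x <= `|ricci_min_neg x|.
    by rewrite /N ler_pdivrMr ?exprn_gt0//; exact: reg_norm_bochner.
  rewrite /q; have [h|h] := leP 0 (N x).
    by rewrite ger0_norm//; move: Nr; move: (N x) => a; lra.
  by rewrite ltr0_norm// subrr mulr0.
have cw2 : continuous (fun x => w x ^+ 2) by move=> x; apply: cvgM; exact: cw.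
have sw2 : csupp (fun x => w x ^+ 2) by exact: csupp_mul.
(* With al = phi^2 |dF|^2, be = F^2 |d phi|^2 and X the cross term, |dw|^2 = al + 2 X + be. Bochner
   gives f Lap F >= al - q w^2, hence T + q w^2 >= 2 al + 2 X: this second al is the extra |dF|^2.
   Compared with 2 |dw|^2 one copy of 2 X is in excess, and Young's inequality absorbs it at the
   cost of delta. *)
have H x : (2 - delta) * gradpair w w x <= T x + (q x * w x ^+ 2 + (1 + delta^-1) * (B x * F x ^+ 2)).
  pose al := phi x ^+ 2 * A x; pose be := B x * F x ^+ 2; pose X := phi x * F x * gradpair phi F x.
  have al0 : 0 <= al by rewrite mulr_ge0 ?sqr_ge0 ?gradpair_ge0.
  have be0 : 0 <= be by rewrite mulr_ge0 ?sqr_ge0 ?gradpair_ge0.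
  have wF : gradpair w F x = phi x * A x + F x * gradpair phi F x by exact: gradpair_mul.
  have wphi : gradpair w phi x = phi x * gradpair phi F x + F x * B x.
    by rewrite (gradpair_mul _ _ p1 F1) (gradpair_sym F phi).
  have WE : gradpair w w x = al + 2 * X + be.
    rewrite (gradpair_mul _ _ p1 F1) (gradpair_sym F w) (gradpair_sym phi w) wF wphi /al /be /X /w; ring.
  have fE : gradpair f F x = al + 2 * X.
    rewrite (gradpair_mul _ _ p1 w1) wF /al /X /w; ring.
  have X2 : 2 * X <= delta * al + be / delta.
    apply: le_trans (ler_norm _) _; apply: amgm_sqr; [by rewrite mulr_ge0// ltW|by rewrite divr_ge0// ltW|].
    have -> : 4 * (delta * al * (be / delta)) = (2 * (phi x * F x)) ^+ 2 * (B x * A x).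
      by rewrite /al /be; field; rewrite gt_eqF.
    rewrite /X mulrA exprMn; apply: ler_wpM2l; first exact: sqr_ge0.
    exact: ginner_cs.
  have TE : T x = f x * lap F x + al + 2 * X by rewrite /T fE addrA.
  have qw : al - q x * w x ^+ 2 <= f x * lap F x.
    have -> : al - q x * w x ^+ 2 = phi x ^+ 2 * (A x - q x * F x ^+ 2).
      by rewrite /al /w; ring.
    have -> : f x * lap F x = phi x ^+ 2 * (F x * lap F x) by rewrite /f /w; ring.
    apply: ler_wpM2l; first exact: sqr_ge0.
    by rewrite lerBlDr -lerBlDl -ler_pdivrMr ?exprn_gt0//; exact: Nq.
  have K : (1 - delta) * (2 * X) <= (1 - delta) * (delta * al + be / delta).
    by apply: ler_wpM2l => //; rewrite subr_ge0.
  have L0 : 0 <= delta ^+ 2 * al + delta * be.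
    exact: (addr_ge0 (mulr_ge0 (sqr_ge0 _) al0) (mulr_ge0 (ltW d0) be0)).
  have KE : (1 - delta) * (delta * al + be / delta) = al + be / delta - (1 - delta) * (al + be) - (delta ^+ 2 * al + delta * be).
    by field; rewrite gt_eqF.
  rewrite WE TE -/be.
  have -> : (2 - delta) * (al + 2 * X + be) = (1 - delta) * (2 * X) + ((1 - delta) * (al + be) + (al + 2 * X + be)) by ring.
  rewrite KE in K; rewrite [(1 + delta^-1) * be]mulrDl mul1r [delta^-1 * be]mulrC.
  move: K L0 qw; move: ((1 - delta) * (2 * X)) ((1 - delta) * (al + be)) (be / delta) (delta ^+ 2 * al + delta * be) (2 * X) (q x * _) (f x * _) => *.
  lra.
have sW : csupp (gradpair w w).
  by apply: (compactly_supported_by wsupp) => x nx; exact: gradpair_off.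
have cW : continuous (gradpair w w) by exact: gradpair_continuous.
have cT : continuous T.
  move=> x; apply: cvgD; last exact: gradpair_continuous.
  by apply: cvgM; [exact: (Ck_continuous f1)|exact: cl].
have offphi x : ~ closure [set x | phi x != 0] x -> [/\ phi x = 0, B x = 0 & gradpair w w x = 0].
  move=> nx; split; [exact: csupp_off|exact: gradpair_off|].
  rewrite (gradpair_mul _ _ p1 F1) (csupp_off nx) mul0r add0r.
  have := ginner_cs phi w x; rewrite (gradpair_off nx) mul0r => h.
  have : gradpair phi w x ^+ 2 == 0 by rewrite eq_le h sqr_ge0.
  by rewrite sqrf_eq0 => /eqP ->; rewrite mulr0.
have sT : csupp T.
  apply: (compactly_supported_by phi_supp) => x nx; have [pz _ _] := offphi x nx.
  rewrite /T (gradpair_mul _ _ p1 w1) /f /w pz !(mul0r, mulr0) !add0r; ring.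
pose G1 x := q x * w x ^+ 2; pose G2 x := B x * F x ^+ 2.
have cG1 : continuous G1 by move=> x; apply: cvgM; [exact: cq|exact: cw2].
have cG2 : continuous G2.
  by move=> x; apply: cvgM; [exact: cB|apply: cvgM; exact: cF].
have sG1 : csupp G1 by apply: (compactly_supported_by sw2) => x /csupp_off h; rewrite /G1 h mulr0.
have sG2 : csupp G2 by apply: (compactly_supported_by phi_supp) => x /offphi[_ h _]; rewrite /G2 h mul0r.
have cM (c : R) h : continuous h -> continuous (fun x => c * h x).
  by move=> ch x; apply: cvgM; [exact: cvg_cst|exact: ch].
have sM (c : R) h : csupp h -> csupp (fun x => c * h x).
  by move=> sh; apply: (compactly_supported_by sh) => x /csupp_off ->; rewrite mulr0.
have cD h h' : continuous h -> continuous h' -> continuous (fun x => h x + h' x).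
  by move=> ch ch' x; apply: cvgD; [exact: ch|exact: ch'].
have sG12 : csupp (fun x => G1 x + (1 + delta^-1) * G2 x).
  apply: (compactly_supported_by phi_supp) => x /offphi[pz h _].
  by rewrite /G1 /G2 h /w pz !mul0r expr0n /= !mulr0 addr0.
have sTG : csupp (fun x => T x + (G1 x + (1 + delta^-1) * G2 x)).
  apply: (compactly_supported_by phi_supp) => x nx; have [pz h _] := offphi x nx.
  rewrite /G1 /G2 h /T (gradpair_mul _ _ p1 w1) /f /w pz; ring.
have := integral_vol_le volP (cM (2 - delta) _ cW) (sM _ _ sW) (cD _ _ cT (cD _ _ cG1 (cM (1 + delta^-1) _ cG2))) sTG H.
rewrite (integral_volZ volP _ cW sW).
rewrite (integral_volD volP cT (cD _ _ cG1 (cM _ _ cG2)) sT sG12) [integral_vol vol T]green add0r.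
rewrite (integral_volD volP cG1 (cM _ _ cG2) sG1 (sM _ _ sG2)) (integral_volZ volP _ cG2 sG2).
set a := integral_vol vol (gradpair w w); set I1 := integral_vol vol G2.
have hoel : integral_vol vol G1 <= lam * C_S * a.
  have w20 x : 0 <= w x ^+ 2 by exact: sqr_ge0.
  have q01 x : 0 <= q x <= `|ricci_min_neg x| by rewrite q0 qr.
  rewrite -lee_fin; apply: le_trans (hoelder_ricci cq cw2 sw2 q01 w20) _.
  rewrite -mulrA EFinM; apply: lee_wpmul2l; first by rewrite lee_fin lam_ge0.
  apply: le_trans (sobolev ws wsupp) _; rewrite EFinM.
  under eq_integral do rewrite gradient_sqnormE.
  by rewrite (integral_volE volP cW sW).
have -> : (1 + 2 / eta) * (2 / eta) * I1 = (1 + delta^-1) * I1 / delta.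
  by rewrite /delta; field; rewrite gt_eqF.
rewrite ler_pdivlMr//.
have -> : a * delta = (2 - delta) * a - lam * C_S * a by rewrite /delta /eta; field.
move: hoel; move: (_ * a) (_ * a) (_ * I1) (integral_vol vol G1) => *; lra.
Qed.

End Energy.
End Vanishing.

Section VanishingGradient.
Variables (R : realType) (n : nat) (M : riemannianManifold R (n + n)).
Variables (vol : {measure set (borelType M) -> \bar R}) (nu C_S lam : R).
Hypotheses (M_kahler : kahler M) (M_complete : complete_manifold M).
Hypothesis volP : is_riemannian_volume vol.
Hypotheses (nu_gt2 : 2 < nu) (C_S_gt0 : 0 < C_S).
Hypothesis sobolev : forall w : M -> R, smooth_on_manifold w -> compactly_supported w ->
  (sobolev_norm vol nu w <= C_S%:E * \int[vol]_x (gradient_sqnorm w x)%:E)%E.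
Hypothesis ricci_norm :
  (((\int[vol]_x (`|ricci_min_neg x| `^ (nu / 2))%:E) `^ (2 / nu)) <= lam%:E)%E.
Hypothesis lam_small : lam * C_S < 2.
Variables (u : M -> R) (E : R).
Hypotheses (u2 : Ck_on_manifold 2 u) (u_harmonic : forall x, lap u x = 0).
Hypothesis u_energy : (\int[vol]_x (gradient_sqnorm u x)%:E <= E%:E)%E.

(** If |du|^2 were positive at [x], the Sobolev norms of phi F for cutoffs centred at [x] would be
    bounded below independently of k, whereas the weighted energy bounds them by a multiple of 1 /
    k^2. *)
Lemma gradient_vanishes x : gradpair u u x = 0.
Proof.
have ddc0 := finite_energy_pluriharmonic M_kahler M_complete volP u2 u_harmonic u_energy.
have [us up] := pluriharmonic_smooth M_kahler u2 ddc0.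
have u1 : Ck_on_manifold 1 u by exact: us.
have nu2 : 0 < nu - 2 by rewrite subr_gt0.
have nu0 : 0 < nu by apply: lt_trans nu_gt2.
apply/eqP; rewrite eq_le gradpair_ge0 andbT leNgt; apply/negP => d0.
have [C C0 HC] := cutoffs M_complete.
pose c := gradpair u u x / 2; have c0 : 0 < c by rewrite divr_gt0.
have cg : continuous (gradpair u u) by exact: gradpair_continuous.
have [W1 [oW1 W1x HW1]] := local_reach x ltr01.
pose W2 := gradpair u u @^-1` [set t | c < t].
have oW2 : open W2 by apply: open_comp => [z _|]; [exact: cg|exact: open_gt].
have W2x : W2 x by rewrite /W2 /= /c ltr_pdivrMr// mulr_natr mulr2n ltrDl.
have [f0 [cf sf f01 fW f_gt0]] := test_function volP (openI oW1 oW2) (conj W1x W2x).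
pose s := nu / (nu - 2); pose r := (nu - 2) / nu.
have s0 : 0 < s by rewrite divr_gt0.
have r0 : 0 < r by rewrite divr_gt0.
pose eta := 2 - lam * C_S; have eta0 : 0 < eta by rewrite subr_gt0.
pose C1 := (1 + 2 / eta) * (2 / eta).
have C10 : 0 <= C1 by rewrite mulr_ge0 ?addr_ge0 ?divr_ge0// ltW.
have E0 := energy_ge0 u_energy.
(* The lower bound: on the support of [f0] the cutoff equals 1 and F^2 >= |du|^2 > c, while 0 <= f0
   <= 1, so (phi F)^(2 s) is at least c^s f0. *)
pose K0 := (c `^ s * integral_vol vol f0) `^ r.
apply: (@inverse_square_small _ K0 (C_S * (C1 * (C ^+ 2 * E + 1)))).
- by rewrite powR_gt0// mulr_gt0// powR_gt0.
- exact: (mulr_ge0 (ltW C_S_gt0) (mulr_ge0 C10 (addr_ge0 (mulr_ge0 (sqr_ge0 C) E0) ler01))).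
move=> k k1; have k0 : 0 < k := lt_le_trans ltr01 k1.
have [phi [sphi cphi phi01 gphi phi1]] := HC x k k1.
have p1 : Ck_on_manifold 1 phi by exact: sphi.
pose N := integral_vol vol (gradpair phi phi).
have N0 : 0 <= N by apply: Rintegral_ge0 => z _; exact: gradpair_ge0.
(* The energy of the cutoff weighted by F^2 = |du|^2 + e contains e N, where N may grow with k in
   infinite volume. This e keeps that term below 1 / k^2; the +1 covers N = 0. *)
pose e := (k ^+ 2 * (N + 1))^-1.
have e0 : 0 < e by rewrite invr_gt0 mulr_gt0 ?exprn_gt0// ltr_wpDl.
have WE := weighted_energy M_kahler volP nu_gt2 C_S_gt0 sobolev ricci_norm lam_small us up e0 sphi cphi.
set F := reg_norm u e in WE; set w := (fun z => phi z * F z) in WE.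
have Fs : smooth_on_manifold F by exact: reg_norm_smooth.
have ws : smooth_on_manifold w by move=> j; apply: Ck_manifoldM; [exact: sphi|exact: Fs].
have wc : compactly_supported w by exact: csupp_mul.
have cw : continuous w by exact: Ck_continuous (ws 0%N).
have w1 : Ck_on_manifold 1 w by exact: ws.
pose B z := gradpair phi phi z.
have cB : continuous B by exact: gradpair_continuous.
have sB : compactly_supported B by apply: (compactly_supported_by cphi) => z; exact: gradpair_off.
have [sBu BuE] := energy_cutoff volP p1 cphi u1 gphi u_energy.
have I1le : integral_vol vol (fun z => B z * F z ^+ 2) <= (C ^+ 2 * E + 1) / k ^+ 2.
  have -> : (fun z => B z * F z ^+ 2) = (fun z => B z * gradpair u u z + e * B z).
    by apply/funext => z; rewrite (reg_norm_sqr _ e0) mulrDr [B z * e]mulrC.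
  rewrite (integral_volD volP (f := fun z => B z * gradpair u u z) (h := fun z => e * B z)) //.
  - rewrite (integral_volZ volP e cB sB) mulrDl; apply: lerD.
      apply: le_trans BuE _.
      by have -> : (C / k) ^+ 2 * E = C ^+ 2 * E / k ^+ 2 by field; rewrite gt_eqF.
    have N1 : 0 < N + 1 by rewrite ltr_wpDl.
    have -> : e * integral_vol vol B = N / (N + 1) * (1 / k ^+ 2).
      by rewrite -/N /e; field; rewrite !gt_eqF.
    rewrite -[X in _ <= X]mul1r; apply: ler_wpM2r; first by rewrite divr_ge0// sqr_ge0.
    by rewrite ler_pdivrMr// mul1r lerDl.
  - by move=> z; apply: cvgM; [exact: cB|exact: cg].
  - by move=> z; apply: cvgM; [exact: cvg_cst|exact: cB].
  - by apply: (compactly_supported_by sB) => z /csupp_off ->; rewrite mulr0.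
have cW : continuous (gradpair w w) by exact: gradpair_continuous.
have sW : compactly_supported (gradpair w w).
  by apply: (compactly_supported_by wc) => z nz; exact: gradpair_off.
have SW : (sobolev_norm vol nu w <= (C_S * (C1 * (C ^+ 2 * E + 1)) / k ^+ 2)%:E)%E.
  apply: le_trans (sobolev ws wc) _.
  under eq_integral do rewrite gradient_sqnormE.
  rewrite (integral_volE volP cW sW) -EFinM lee_fin.
  have -> : C_S * (C1 * (C ^+ 2 * E + 1)) / k ^+ 2 = C_S * (C1 * ((C ^+ 2 * E + 1) / k ^+ 2)) by rewrite !mulrA.
  apply: ler_wpM2l; first exact: ltW.
  exact: (le_trans WE (ler_wpM2l C10 I1le)).
rewrite -lee_fin; apply: le_trans SW; rewrite /sobolev_norm -/s -/r /K0 -poweR_EFin.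
have cf0 : continuous (fun z => c `^ s * f0 z) by move=> z; apply: cvgM; [exact: cvg_cst|exact: cf].
have sf0 : compactly_supported (fun z => c `^ s * f0 z).
  by apply: (compactly_supported_by sf) => z /csupp_off ->; rewrite mulr0.
apply: gt0_ler_poweR; first exact: ltW.
- by rewrite in_itv /= leey andbT lee_fin mulr_ge0 ?powR_ge0// ltW.
- by rewrite in_itv /= leey andbT; apply: integral_ge0 => z _; rewrite lee_fin powR_ge0.
rewrite -(integral_volZ volP _ cf sf) -(integral_volE volP cf0 sf0).
apply: ge0_integral_mono => z _.
  by rewrite lee_fin mulr_ge0 ?powR_ge0//; case/andP: (f01 z).
rewrite lee_fin; have [->|/fW[Wz /= cz]] := eqVneq (f0 z) 0; first by rewrite mulr0 powR_ge0.
have [l l1 xz] := HW1 z Wz.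
apply: (@le_trans _ _ (c `^ s)).
  by rewrite ler_piMr ?powR_ge0//; case/andP: (f01 z).
apply: ge0_ler_powR; rewrite ?nnegrE ?(ltW s0) ?(ltW c0) ?sqr_ge0//.
rewrite /w (phi1 z l _ xz) ?mul1r; last exact: le_trans (ltW l1) k1.
by rewrite (reg_norm_sqr _ e0) (le_trans (ltW cz))// lerDl ltW.
Qed.

(** Any two points are joined by a chain, along which [u] is Lipschitz with constant 0. *)
Lemma harmonic_constant : exists c : R, forall x, u x = c.
Proof.
have u1 : Ck_on_manifold 1 u by move=> i; exact: CkW (u2 i).
exists (u point) => x; have [l H] := all_reachable point x.
have G z : gradpair u u z <= 0 ^+ 2 by rewrite gradient_vanishes expr0n.
have := reach_lipschitz u1 (lexx 0) G H; rewrite mul0r normr_le0 subr_eq0 => /eqP; exact.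
Qed.

End VanishingGradient.

Theorem corollary1p8 (R : realType) (n : nat)
    (M : riemannianManifold R (n + n))
    (vol : {measure set (borelType M) -> \bar R})
    (nu C_S : R)
    (M_kahler : kahler M)
    (M_complete : complete_manifold M)
    (volP : is_riemannian_volume vol)
    (nu_gt2 : 2 < nu)
    (C_S_gt0 : 0 < C_S)
    (sobolev : forall phi : M -> R,
        smooth_on_manifold phi -> compactly_supported phi ->
        ((\int[vol]_x (`|phi x| `^ (2 * nu / (nu - 2)))%:E)
            `^ ((nu - 2) / nu)
         <= C_S%:E * \int[vol]_x (gradient_sqnorm phi x)%:E)%E)
    (ricci_small :
        ((\int[vol]_x (`|ricci_min_neg x| `^ (nu / 2))%:E) `^ (2 / nu)
         < (2 / C_S)%:E)%E) :
  forall u : M -> R,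
    harmonic_function u ->
    (\int[vol]_x (gradient_sqnorm u x)%:E < +oo)%E ->
    exists c : R, forall x : M, u x = c.
Proof.
move=> u [u2 uh] uE.
have [E uE'] : exists E : R, (\int[vol]_x (gradient_sqnorm u x)%:E <= E%:E)%E.
  have E0 : (0 <= \int[vol]_x (gradient_sqnorm u x)%:E)%E.
    by apply: integral_ge0 => x _; rewrite lee_fin gradient_sqnormE gradpair_ge0.
  exists (fine (\int[vol]_x (gradient_sqnorm u x)%:E)).
  by rewrite fineK// ge0_fin_numE.
set L := (X in (X < _)%E) in ricci_small.
have L0 : (0 <= L)%E by exact: poweR_ge0.
(* The strict bound excludes the value +oo, so the norm is a real number that can be used as
   [lam]. *)
have LE : L = (fine L)%:E.
  by rewrite fineK// ge0_fin_numE//; apply: lt_trans ricci_small _; exact: ltry.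
apply: (harmonic_constant (lam := fine L) M_kahler M_complete volP nu_gt2 C_S_gt0 _ _ _ u2 _ uE') => //.
- move=> w ws wc; rewrite /sobolev_norm; under eq_integral do rewrite -powR_sqr mulrA.
  exact: sobolev.
- by rewrite -LE.
- by rewrite -ltr_pdivlMr// -lte_fin -LE.
Qed.
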